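(* Let $F,G\in\mathcal{F}(\mathbb{R})$ and let $W$ be a weight function system satisfying $(\alpha)$, $(N)$ and $(\omega)$. Suppose that the Cauchy–Riemann operator $\overline\partial:\mathcal{K}_W(T^{F,G})\to\mathcal{K}_W(T^{F,G})$ is surjective. Let $E$ be a locally complete locally convex Hausdorff space with a fundamental sequence of bounded sets. If $E$ satisfies $(A)$, then the $E$-valued Cauchy–Riemann operator $\overline\partial:\mathcal{K}_W(T^{F,G};E)\to\mathcal{K}_W(T^{F,G};E)$ is surjective as well.
   Context: $\overline\partial=\frac12\left(\frac{\partial}{\partial x}+i\frac{\partial}{\partial y}\right)$. $\mathcal{F}(\mathbb{R})$ is the set of all uniformly continuous $F:\mathbb{R}\to[0,\infty)$ with $0<\inf_{t}F(t)\le\sup_{t}F(t)<\infty$. For $F,G\in\mathcal{F}(\mathbb{R})$, $T^{F,G}=\{z\in\mathbb{C}: -G(\mathrm{Re}\,z)<\mathrm{Im}\,z<F(\mathrm{Re}\,z)\}$. A weight function is a non-decreasing unbounded function $w:[0,\infty)\to[0,\infty)$; a weight function system is a sequence $W=(w_N)_{N\in\mathbb{N}}$ of weight functions with $w_N\le w_{N+1}$ pointwise. Conditions on $W$: - $(\alpha)$: $\forall N\,\exists M\ge N, A>1\,\forall t\ge0:\ w_N(2t)\le w_M(t)+\log A$. - $(N)$: $\forall N\,\exists M\ge N:\ \int_0^\infty e^{w_N(t)-w_M(t)}\,dt<\infty$. - $(\omega)$: $\forall N\,\exists M\ge N\,\forall K\ge M\,\exists\theta\in(0,1),C>1\,\forall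 t\ge0:\ (1-\theta)w_N(t)+\theta w_K(t)\le w_M(t)+\log C$. For a locally convex Hausdorff space $E$, $\mathcal{K}_W(T^{F,G};E)$ is the space of all $\mathbf{f}\in C^\infty(T^{F,G};E)$ such that $\sup_{\xi\in\overline{T^{aF,aG}}}e^{w_N(|\mathrm{Re}\,\xi|)}p(\mathbf{f}^{(\alpha)}(\xi))<\infty$ for all continuous seminorms $p$ on $E$, all $N\in\mathbb{N}$, all multi-indices $\alpha$ (pairs of non-negative integers) and all $a\in(0,1)$. $\mathcal{K}_W(T^{F,G})=\mathcal{K}_W(T^{F,G};\mathbb{C})$. $E$ is locally complete if every bounded subset is contained in a Banach disk, i.e. an absolutely convex bounded set $B$ whose span, normed by the Minkowski functional of $B$, is complete. A space $E$ with a fundamental non-decreasing sequence $(B_n)_n$ of absolutely convex bounded sets (every bounded set is contained in some $B_n$) satisfies $(A)$ if $\exists n\,\forall m\ge n, s>0\,\exists k\ge m, C>0\,\forall r>0:\ B_m\subseteq rB_n+\frac{C}{r^s}B_k$. *)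

(* Defs.v *)
From HB Require Import structures.
From mathcomp Require Import all_boot all_order all_algebra.
From mathcomp Require Import all_classical all_reals all_analysis.
From mathcomp Require Import complex.

Set Implicit Arguments.
Unset Strict Implicit.
Unset Printing Implicit Defensive.

Import Order.TTheory GRing.Theory Num.Theory.
Import numFieldTopology.Exports numFieldNormedType.Exports.

Local Open Scope classical_set_scope.
Local Open Scope ring_scope.

Section Weights.
Variable R : realType.

(* Weight functions live on [0, +oo[; they are represented by functions on R
   whose values at negative arguments are never used. *)
Definition weight_function (w : R -> R) : Prop :=
  [/\ forall t, 0 <= t -> 0 <= w t,
      forall s t, 0 <= s -> s <= t -> w s <= w t
    & forall A : R, exists2 t, 0 <= t & A < w t].

Definition weight_system (w : nat -> R -> R) : Prop :=
  (forall N, weight_function (w N)) /\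
  (forall N t, 0 <= t -> w N t <= w N.+1 t).

Definition weight_alpha (w : nat -> R -> R) : Prop :=
  forall N, exists M (A : R), [/\ (N <= M)%N, 1 < A
    & forall t, 0 <= t -> w N (2 * t) <= w M t + ln A].

Definition weight_N (w : nat -> R -> R) : Prop :=
  forall N, exists2 M, (N <= M)%N &
    (\int[lebesgue_measure]_(t in `[0%R, +oo[) (expR (w N t - w M t))%:E
       < +oo)%E.

Definition weight_omega (w : nat -> R -> R) : Prop :=
  forall N, exists2 M, (N <= M)%N & forall K, (M <= K)%N ->
    exists theta C : R, [/\ 0 < theta < 1, 1 < C
      & forall t, 0 <= t ->
          (1 - theta) * w N t + theta * w K t <= w M t + ln C].

Definition profile (F : R -> R) : Prop :=
  [/\ forall t, 0 <= F t, unif_continuous F,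
      (0 < ereal_inf (range (EFin \o F)))%E
    & (ereal_sup (range (EFin \o F)) < +oo)%E].

(* The canonical topology of the complex numbers is carried by (R[i])^o. *)
Definition strip (F G : R -> R) : set (R[i])^o :=
  [set z | - G (complex.Re z) < complex.Im z < F (complex.Re z)].

End Weights.

Section VectorValuedFunctions.
Variables (R : realType) (E : tvsType R[i]).
Implicit Types (f : (R[i])^o -> E) (z v : R[i]) (T : set (R[i])^o).

Definition diff_quotient f v z (h : R) : E :=
  (h^-1)%:C%C *: (f (z + h%:C%C * v) - f z).

(* The real increment h is what makes this a partial derivative in the sense
   of R^2: v = 1 gives d/dx and v = 'i gives d/dy.  The library's lim needs a pointed type, which a tvsType
   is not; as lim does, partial takes a junk value when there is no limit. *)
Definition partial v f : (R[i])^o -> E :=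
  fun z => xget 0 [set l | diff_quotient f v z h @[h --> (0 : R)^'] --> l].

Definition has_partial v f z : Prop :=
  exists l : E, diff_quotient f v z h @[h --> (0 : R)^'] --> l.

Fixpoint Cn (n : nat) T f : Prop :=
  (forall z, T z -> {for z, continuous f}) /\
  (if n is m.+1 then
     [/\ forall z, T z -> has_partial 1 f z /\ has_partial 'i%C f z,
         Cn m T (partial 1 f) & Cn m T (partial 'i%C f)]
   else True).

(* Meant for an open set T: only the values of f on T matter. *)
Definition Cinfty T f : Prop := forall n, Cn n T f.

Definition multi_partial (i j : nat) f : (R[i])^o -> E :=
  iter i (partial 1) (iter j (partial 'i%C) f).

Definition dbar f : (R[i])^o -> E :=
  fun z => (2%:R^-1 : R[i]) *: (partial 1 f z + 'i%C *: partial 'i%C f z).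

Definition seminorm (p : E -> R) : Prop :=
  (forall x y, p (x + y) <= p x + p y) /\
  (forall (a : R[i]) x, (p (a *: x))%:C%C = `|a| * (p x)%:C%C).

(* Elements are total functions, to be read as their restrictions to the
   strip; see dbar_surjective, where equality is only required there. *)
Definition KW (F G : R -> R) (w : nat -> R -> R) : set ((R[i])^o -> E) :=
  [set f | Cinfty (strip F G) f /\
    forall p : E -> R, seminorm p -> continuous p ->
    forall (N i j : nat) (a : R), 0 < a < 1 ->
      has_ubound [set expR (w N `|complex.Re xi|) * p (multi_partial i j f xi)
        | xi in closure (strip (fun t => a * F t) (fun t => a * G t))]].

Definition dbar_surjective (F G : R -> R) (w : nat -> R -> R) : Prop :=
  forall g, KW F G w g ->
    exists2 f, KW F G w f & forall z, strip F G z -> dbar f z = g z.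

End VectorValuedFunctions.

Section LocallyConvexSpaces.
Variables (R : realType) (E : tvsType R[i]).
Implicit Types B : set E.

Definition absolutely_convex B : Prop :=
  forall (a b : R[i]) x y, `|a| + `|b| <= 1 -> B x -> B y ->
    B (a *: x + b *: y).

(* Absorbed by every neighbourhood of 0 (von Neumann); the library's
   bounded_set needs a norm. *)
Definition tvs_bounded B : Prop :=
  forall U : set E, nbhs (0 : E) U ->
    exists2 r : R, 0 < r & B `<=` [set r%:C%C *: x | x in U].

Definition linear_span B : set E :=
  [set x | exists n (a : 'I_n -> R[i]) (b : 'I_n -> E),
    (forall i, B (b i)) /\ x = \sum_(i < n) a i *: b i].

Definition minkowski B (x : E) : R :=
  inf [set t : R | 0 < t /\ [set t%:C%C *: y | y in B] x].

Definition span_complete B : Prop :=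
  forall u : nat -> E, (forall n, linear_span B (u n)) ->
    (forall e : R, 0 < e -> exists N : nat, forall m n,
       (N <= m)%N -> (N <= n)%N -> minkowski B (u m - u n) < e) ->
    exists2 l, linear_span B l &
      forall e : R, 0 < e -> exists N : nat, forall n,
        (N <= n)%N -> minkowski B (u n - l) < e.

Definition Banach_disk B : Prop :=
  [/\ absolutely_convex B, tvs_bounded B & span_complete B].

Definition locally_complete : Prop :=
  forall B, tvs_bounded B -> exists2 D : set E, Banach_disk D & B `<=` D.

Definition fundamental_sequence (B : nat -> set E) : Prop :=
  [/\ forall n, absolutely_convex (B n) /\ tvs_bounded (B n),
      forall n, B n `<=` B n.+1
    & forall D, tvs_bounded D -> exists n, D `<=` B n].

Definition condition_A (B : nat -> set E) : Prop :=
  exists n : nat, forall (m : nat) (s : R), (n <= m)%N -> 0 < s ->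
    exists (k : nat) (C : R), [/\ (m <= k)%N, 0 < C
      & forall r : R, 0 < r ->
          B m `<=` [set r%:C%C *: x + (C / r `^ s)%:C%C *: y
                     | x in B n & y in B k]].

End LocallyConvexSpaces.

Arguments dbar_surjective {R} E F G w.
Arguments locally_complete {R} E.

(* Main.v *)
(* For g vanishing on a smaller strip T', the point is to solve dbar f = g up to the
   edge of a prescribed strip by a function that is as small as we like, in one
   fixed disk D0, on an interior strip.  Cut g into pieces h_k supported in
   small squares near the boundary, after division by translates P_k of a
   rapidly decaying holomorphic function P; such a P is 1 - z f, with f
   obtained from the scalar operator.  The Cauchy transform u_k of h_k has a
   Laurent expansion sum_i b_i (z - z_k)^(-i-1) about a pole z_k lying outside
   the strip.  Conditions (A) and (omega) split b = x + y with x small in D0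
   and y decaying so fast that sum_i y_i (z - z_k)^(-i-1) converges on the whole
   strip, where it is holomorphic.  Subtracting it from u_k leaves dbar u_k
   unchanged and leaves only the x-part on the interior strip, so
   f = sum_k P_k (u_k - sum_i y_i (z - z_k)^(-i-1)) is the required solution.  A
   Mittag-Leffler argument over an exhaustion by strips then solves dbar f = g. *)

(* For vector-valued data the Mittag-Leffler step is not automatic: the corrections must be small in
   one fixed disk [D0], while each of them is only known to be bounded in disks that get worse with
   the order, the decay and the strip. (A) reconciles the two at the price of an exponent s, and
   (omega) is the matching log-convexity of the weights. Since (A) splits single vectors, it can be
   applied only after each piece has been reduced to countably many vectors, its Laurent
   coefficients. Decay and radius of convergence are then treated as one weight, indexed by pairs of
   a cell and an order. The Cauchy transform decays only like 1/z; the translates of P restore the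
   decay required in K_W, and the construction of P is the only place where surjectivity in the
   scalar case enters. Local completeness is used through limits of series dominated by a disk.
   Integrals, Laurent series, sums over cells and the final gluing are therefore all presented as
   such series. *)
Require Import Defs.
From mathcomp Require Import all_boot all_order all_algebra.
From mathcomp Require Import all_classical all_reals all_analysis.
From mathcomp Require Import complex ring lra.
Set Implicit Arguments.
Unset Strict Implicit.
Unset Printing Implicit Defensive.
Import Order.TTheory GRing.Theory Num.Theory.
Import numFieldTopology.Exports numFieldNormedType.Exports.
Import Normc.
Local Open Scope classical_set_scope.
Local Open Scope ring_scope.

(* [lmod] decides identities in a module over R[i]: it compares the coefficients
   of the atoms with [field]. *)
Section ModuleNormalForm.
Variables (K : pzRingType) (V : lmodType K).

Inductive mexp := MZero | MAtom of nat | MAdd of mexp & mexp | MOpp of mexp | MScale of K & mexp.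

Fixpoint meval (env : seq V) (e : mexp) : V :=
  match e with
  | MZero => 0 | MAtom n => nth 0 env n | MAdd a b => meval env a + meval env b
  | MOpp a => - meval env a | MScale k a => k *: meval env a end.

Fixpoint mcoef (e : mexp) (i : nat) : K :=
  match e with
  | MZero => 0 | MAtom n => if Nat.eqb n i then 1 else 0 | MAdd a b => mcoef a i + mcoef b i
  | MOpp a => - mcoef a i | MScale k a => k * mcoef a i end.

Fixpoint mbounded (N : nat) (e : mexp) : bool :=
  match e with
  | MZero => true | MAtom n => Nat.ltb n N | MAdd a b => mbounded N a && mbounded N b
  | MOpp a => mbounded N a | MScale k a => mbounded N a end.

(** It unfolds by computation, so that [repeat split] leaves one scalar equation per atom. *)
Fixpoint mconj (n : nat) (P : nat -> Prop) : Prop :=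
  match n with 0%N => True | S m => P m /\ mconj m P end.

Lemma mevalE (env : seq V) (e : mexp) : mbounded (size env) e ->
  meval env e = \sum_(i < size env) mcoef e i *: nth 0 env i.
Proof.
elim: e => [|n|a IHa b IHb|a IHa|k a IHa] /=.
- by move=> _; rewrite big1// => i _; rewrite scale0r.
- move=> /PeanoNat.Nat.ltb_lt/ssrnat.ltP hn; rewrite (bigD1 (Ordinal hn))//= PeanoNat.Nat.eqb_refl.
  rewrite scale1r big1 ?addr0// => i /eqP ni.
  case: (PeanoNat.Nat.eqb_spec n i) => [ee|]; last by rewrite scale0r.
  by exfalso; apply: ni; apply: val_inj.
- move=> /andP[/IHa -> /IHb ->]; rewrite -big_split/=.
  by apply: eq_bigr => i _; rewrite scalerDl.
- by move=> /IHa ->; rewrite -sumrN; apply: eq_bigr => i _; rewrite scaleNr.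
- move=> /IHa ->; rewrite scaler_sumr; apply: eq_bigr => i _.
  by rewrite scalerA.
Qed.

Lemma meval_eq (env : seq V) (a b : mexp) : mbounded (size env) a && mbounded (size env) b ->
  mconj (size env) (fun i => mcoef a i = mcoef b i) -> meval env a = meval env b.
Proof.
move=> /andP[ha hb] H; rewrite !mevalE//; apply: eq_bigr => i _; congr (_ *: _).
move: (nat_of_ord i) (ltn_ord i) H => {i} i; elim: (size env) => // n IH ilt /= [h1 h2]; move: ilt.
by rewrite ltnS leq_eqVlt => /orP[/eqP ->//|/IH]; apply.
Qed.

End ModuleNormalForm.

Ltac mem_env x env :=
  lazymatch env with
  | nil => constr:(false)
  | cons x _ => constr:(true)
  | cons _ ?t => mem_env x t
  end.
Ltac add_atoms env e :=
  lazymatch e with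
  | ?a + ?b => let env := add_atoms env a in add_atoms env b
  | - ?a => add_atoms env a
  | ?k *: ?a => add_atoms env a
  | 0 => env
  | _ => let m := mem_env e env in
         lazymatch m with true => env | false => constr:(cons e env) end
  end.
Ltac atom_index x env :=
  lazymatch env with
  | cons x _ => constr:(0%N)
  | cons _ ?t => let n := atom_index x t in constr:(S n)
  end.
Ltac reify_mod K env e :=
  lazymatch e with
  | ?a + ?b => let a' := reify_mod K env a in let b' := reify_mod K env b in
               constr:(@MAdd K a' b')
  | - ?a => let a' := reify_mod K env a in constr:(@MOpp K a')
  | ?k *: ?a => let a' := reify_mod K env a in constr:(@MScale K k a')
  | 0 => constr:(@MZero K)
  | _ => let n := atom_index e env in constr:(@MAtom K n)
  end.
Ltac lmod_in K V :=
  lazymatch goal with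
  | |- ?l = ?r =>
    let env := add_atoms (@nil V) l in
    let env := add_atoms env r in
    let l' := reify_mod K env l in
    let r' := reify_mod K env r in
    apply: (@meval_eq K V env l' r');
      [by [] | cbn [mconj size mcoef Nat.eqb]; repeat split; rewrite ?mulr0 ?mulr1 ?addr0 ?add0r ?oppr0]
  end.
Ltac lmod V := lazymatch type of V with
  | tvsType ?K => lmod_in K V; first [by []|ring|field] end.

(** * Seminorms, disks and local completeness *)

Section Modulus.
Variable R : realType.
Implicit Types (z : R[i]) (r : R).

Lemma normcE z : `|z| = (normc z)%:C%C. Proof. by []. Qed.

Lemma normc_ge0 z : 0 <= normc z.
Proof. by case: z => a b; rewrite /= sqrtr_ge0. Qed.

Lemma normc_triangle (x y : R[i]) : normc (x + y) <= normc x + normc y.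
Proof. exact: (@le_normcD R x y). Qed.

Lemma normcR r : normc (r%:C)%C = `|r|.
Proof. by rewrite /= expr0n addr0 sqrtr_sqr. Qed.

Lemma normcN z : normc (- z) = normc z.
Proof. by case: z => a b /=; rewrite !sqrrN. Qed.

Lemma normc_eq0 z : (normc z == 0) = (z == 0).
Proof. by apply/eqP/eqP => [/eq0_normc //|->]; rewrite normc0. Qed.

Lemma normc_gt0 z : (0 < normc z) = (z != 0).
Proof. by rewrite lt_def normc_ge0 andbT normc_eq0. Qed.

Lemma normc_sub (x y : R[i]) : normc (x - y) = normc (y - x).
Proof. by rewrite -normcN opprB. Qed.

Lemma normc_i : normc ('i%C : R[i]) = 1.
Proof. by rewrite /= expr0n expr1n add0r sqrtr1. Qed.

Lemma normcX z n : normc (z ^+ n) = normc z ^+ n.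
Proof.
by elim: n => [|n IH]; rewrite ?expr0 ?normc1// !exprS normcM IH.
Qed.

Lemma normc_Re z : `|complex.Re z| <= normc z.
Proof.
case: z => a b /=; rewrite -sqrtr_sqr ler_wsqrtr// lerDl; exact: sqr_ge0.
Qed.

Lemma normc_Im z : `|complex.Im z| <= normc z.
Proof.
case: z => a b /=; rewrite -[leLHS]sqrtr_sqr ler_wsqrtr// lerDr; exact: sqr_ge0.
Qed.

Lemma normc_le_ReIm z : normc z <= `|complex.Re z| + `|complex.Im z|.
Proof.
rewrite {1}(complexE z) (le_trans (normc_triangle _ _))// normcM normc_i mul1r.
by rewrite !normcR.
Qed.

End Modulus.

Arguments normc {R} x : simpl never.

Section TvsLimits.
Variables (R : realType) (E : tvsType R[i]).

Lemma cvgD_tvs (T : Type) (F : set_system T) (FF : Filter F) (f g : T -> E) (a b : E) :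
  f @ F --> a -> g @ F --> b -> (fun x => f x + g x) @ F --> a + b.
Proof.
move=> fa gb.
apply: (@cvg_comp _ _ _ (fun x => (f x, g x)) (fun p : E * E => p.1 + p.2) _ (nbhs (a, b))).
  exact: cvg_pair.
exact: (@tvs.add_continuous E (a, b)).
Qed.

Lemma cvgZ_tvs (T : Type) (F : set_system T) (FF : Filter F) (f : T -> E)
    (c : T -> R[i]^o) (a : E) (k : R[i]^o) :
  f @ F --> a -> c @ F --> k -> (fun x => (c x : R[i]) *: f x) @ F --> (k : R[i]) *: a.
Proof.
move=> fa gb.
apply: (@cvg_comp _ _ _ (fun x => (c x, f x)) (fun p : R[i]^o * E => p.1 *: p.2) _ (nbhs (k, a))).
  by apply: (@cvg_pair _ _ _ F (nbhs k) (nbhs a)).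
exact: (@scale_continuous _ E (k, a)).
Qed.

Lemma cvgZc_tvs (T : Type) (F : set_system T) (FF : Filter F) (f : T -> E)
    (k : R[i]) (a : E) :
  f @ F --> a -> (fun x => k *: f x) @ F --> k *: a.
Proof.
move=> fa; apply: (@cvgZ_tvs _ _ _ f (fun=> k) a k) => //; exact: cvg_cst.
Qed.

Lemma cvgN_tvs (T : Type) (F : set_system T) (FF : Filter F) (f : T -> E) (a : E) :
  f @ F --> a -> (fun x => - f x) @ F --> - a.
Proof.
move=> /(@cvgZc_tvs _ _ _ _ (-1)); rewrite scaleN1r.
by under eq_fun do rewrite scaleN1r.
Qed.

Lemma cvgB_tvs (T : Type) (F : set_system T) (FF : Filter F) (f g : T -> E) (a b : E) :
  f @ F --> a -> g @ F --> b -> (fun x => f x - g x) @ F --> a - b.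
Proof. by move=> fa gb; apply: cvgD_tvs => //; exact: cvgN_tvs. Qed.

Lemma cvgRC (T : Type) (F : set_system T) (FF : Filter F) (c : T -> R) (k : R) :
  c @ F --> k -> (fun t => (c t)%:C%C : R[i]^o) @ F --> (k%:C%C : R[i]^o).
Proof.
move=> ck; apply/cvgrPdist_lt => e e0.
have e0' : 0 < complex.Re e by move: e0; rewrite ltcE => /andP[].
have [_ /eqP ei] : 0 < complex.Re e /\ complex.Im e == 0.
  by move: e0; rewrite ltcE => /andP[].
(* The norm of [R[i]^o] takes values in [R[i]], and a positive element there has imaginary part
   0. *)
have ee : e = (complex.Re e)%:C%C by rewrite {1}(complexE e) ei mulr0 addr0.
move/cvgrPdist_lt: ck => /(_ _ e0'); apply: filterS => t kt.
by rewrite ee -rmorphB /= normcE ltcR normcR.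
Qed.

Lemma nbhs0_sub (U : set E) (x : E) : nbhs x U -> nbhs 0 [set y | U (x + y)].
Proof.
move=> xU; have /= := (@tvs.add_continuous E (x, 0)) U; rewrite addr0 => /(_ xU).
case=> /= -[A B] /= [xA B0] AB; apply: filterS B0 => y By /=.
by apply: (AB (x, y)); split => //; exact: nbhs_singleton xA.
Qed.

Lemma nbhs0_add (U : set E) (x : E) : nbhs 0 [set y | U (x + y)] -> nbhs x U.
Proof.
move=> xU; have /= := (@tvs.add_continuous E (- x, x)) [set y | U (x + y)].
rewrite addNr => /(_ xU); case=> /= -[A B] /= [xA Bx] AB; apply: filterS Bx => y By.
have /= := AB (- x, y); rewrite addrA subrr add0r; apply; split => //.
exact: nbhs_singleton xA.
Qed.

Lemma nbhs0_scale (U : set E) (k : R[i]) : nbhs 0 U -> nbhs 0 [set y | U (k *: y)].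
Proof.
move=> U0; have := @cvgZc_tvs _ (nbhs (0:E)) _ id k 0 cvg_id.
by rewrite scaler0; apply.
Qed.

End TvsLimits.

Section Seminorms.
Variables (R : realType) (E : tvsType R[i]).
Implicit Types (p : E -> R) (x y : E).

Definition csn p := seminorm p /\ continuous p.

Lemma seminorm0 p : seminorm p -> p 0 = 0.
Proof.
move=> [_ pZ]; have := pZ 0 0; rewrite scaler0 normr0 mul0r => h.
by apply: (@complexI R).
Qed.

Lemma seminormZ p a x : seminorm p -> p (a *: x) = normc a * p x.
Proof. by move=> [_ pZ]; apply: (@complexI R); rewrite pZ normcE -rmorphM. Qed.

Lemma seminormD p x y : seminorm p -> p (x + y) <= p x + p y.
Proof. by case. Qed.

Lemma seminormN p x : seminorm p -> p (- x) = p x.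
Proof. by move=> sp; rewrite -scaleN1r seminormZ// normcN normc1 mul1r. Qed.

Lemma seminormB p x y : seminorm p -> p (x - y) = p (y - x).
Proof. by move=> sp; rewrite -seminormN// opprB. Qed.

Lemma seminorm_ge0 p x : seminorm p -> 0 <= p x.
Proof.
move=> sp; have := seminormD x (- x) sp; rewrite subrr seminorm0// seminormN//.
by lra.
Qed.

Lemma seminorm_tri p x y z : seminorm p -> p (x - z) <= p (x - y) + p (y - z).
Proof.
by move=> sp; rewrite -[in leLHS](subrK y x) -addrA seminormD.
Qed.

Lemma csn_small p e : csn p -> 0 < e -> nbhs 0 [set x | p x < e].
Proof.
move=> [sp cp] e0; have := cp 0; rewrite /continuous_at seminorm0//.
move=> /cvgrPdist_lt/(_ _ e0); apply: filterS => x; rewrite sub0r normrN.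
by rewrite ger0_norm// seminorm_ge0.
Qed.

(** Local convexity supplies a neighbourhood V that is merely convex. W is its balanced core, the
    points all of whose multiples by scalars of modulus at most 1 stay in V; it is convex along with
    V, and continuity of the scaling at (0, 0) makes it a neighbourhood. *)
Lemma balanced_convex_nbhs (U : set E) : nbhs 0 U ->
  exists W : set E, [/\ nbhs 0 W, W `<=` U,
    (forall (k : R[i]) x, normc k <= 1 -> W x -> W (k *: x)) &
    (forall (s t : R) x y, 0 <= s -> 0 <= t -> s + t = 1 -> W x -> W y ->
       W (s%:C%C *: x + t%:C%C *: y))].
Proof.
move=> U0; have [B Bconv [Bop Bbase]] := @locally_convex _ E.
have [V [BV V0] VU] := Bbase 0 U U0.
have nV : nbhs 0 V by apply: open_nbhs_nbhs; split=> //; exact: Bop.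
exists [set x | forall k : R[i], normc k <= 1 -> V (k *: x)]; split.
- have /= := (@scale_continuous _ E (0, 0)) V; rewrite scaler0 => /(_ nV).
  case=> /= -[A C] /= [A0 C0] AC.
  have [/= e e0 eA] : exists2 e : R, 0 < e & forall k : R[i], normc k < e -> A k.
    move: A0 => /nbhs_ballP[e /= e0 eA].
    move: (e0); rewrite ltcE => /andP[/eqP ei e1].
    exists (complex.Re e) => // k ke; apply: eA.
    rewrite /ball /= sub0r normrN normcE ltcE /= ke andbT.
    by move: ei => /= ->.
  pose k0 := (e / 2)%:C%C : R[i].
  have k0n : k0 != 0 by rewrite -normc_eq0 normcR normr_eq0 gt_eqF// divr_gt0.
  apply: filterS (nbhs0_scale k0^-1 C0) => x /= Cx k k1.
  have /= := AC (k * k0, k0^-1 *: x).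
  rewrite scalerA -mulrA divff// mulr1; apply; split => //=.
  apply: eA; rewrite normcM normcR ger0_norm ?divr_ge0 1?ltW//.
  rewrite (le_lt_trans (ler_wpM2r _ k1)) ?divr_ge0 1?ltW//; lra.
- by move=> x /(_ 1); rewrite normc1 scale1r => /(_ (lexx _)) /VU.
- move=> k x k1 Vx l l1; rewrite scalerA; apply: Vx.
  by rewrite normcM mulr_ile1 ?normc_ge0.
- move=> s t x y s0 t0 st Vx Vy k k1; rewrite scalerDr !scalerA.
  rewrite ![k * _]mulrC -!scalerA.
  have sI0 : (0 : R[i]) <= s%:C%C by rewrite lecR.
  have sI1 : s%:C%C <= (1 : R[i]) by rewrite lecR -st lerDl.
  have := Bconv V; rewrite inE => /(_ BV (k *: x) (k *: y) (Itv01 sI0 sI1)).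
  rewrite !inE => /(_ (Vx _ k1) (Vy _ k1)).
  have -> : t%:C%C = 1 - s%:C%C :> R[i].
    by rewrite -(rmorph1 (real_complex R)) -rmorphB -st addrAC subrr add0r.
  exact.
Qed.

(** The seminorm is the gauge of a balanced convex neighbourhood inside U. This turns the abstract
    topology of E into a family of continuous seminorms, which is the form in which limits are
    estimated below. *)
Lemma gauge_csn (U : set E) : nbhs 0 U ->
  exists p, csn p /\ forall x, p x < 1 -> U x.
Proof.
move=> /balanced_convex_nbhs[W [W0 WU Wbal Wconv]].
have W00 : W 0 := nbhs_singleton W0.
pose S x := [set t : R | 0 < t /\ W ((t^-1)%:C%C *: x)].
have Sup x t t' : S x t -> t <= t' -> S x t'.
  move=> [t0 Wt] tt'; have t'0 : 0 < t' by exact: lt_le_trans tt'.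
  split=> //; have -> : (t'^-1)%:C%C *: x = (t / t')%:C%C *: ((t^-1)%:C%C *: x).
    by rewrite scalerA -rmorphM /= mulrAC divff ?gt_eqF// mul1r.
  apply: Wbal => //; rewrite normcR ger0_norm ?divr_ge0 ?(ltW t0) ?(ltW t'0)//.
  by rewrite ler_pdivrMr// mul1r.
have Sne x : S x !=set0.
  have h : (fun t : R => (t%:C%C : R[i]) *: x) @ nbhs (0:R) --> (0 : E).
    rewrite -[0 in X in _ --> X](scale0r x).
    apply: (@cvgZ_tvs _ _ _ (nbhs (0:R)) _ (fun=> x) (fun t => t%:C%C : R[i]^o) x 0).
      exact: cvg_cst.
    by rewrite -(rmorph0 (real_complex R)); apply: cvgRC; exact: cvg_id.
  have /nbhs_ballP[e /= e0 eW] : nbhs (0:R) [set t | W (t%:C%C *: x)] by exact: h.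
  exists (e / 2)^-1; split; first by rewrite invr_gt0 divr_gt0.
  rewrite invrK; apply: eW; rewrite /ball /= sub0r normrN ger0_norm; last first.
    by rewrite divr_ge0 ?ltW.
  by rewrite ltr_pdivrMr// ltr_pMr// ltr1n.
have Slb x : has_lbound (S x) by exists 0 => t [/ltW].
have Sinf x : has_inf (S x) by split.
pose p x := inf (S x).
have p0 x : 0 <= p x by apply: lb_le_inf => // t [/ltW].
have pS x t : S x t -> p x <= t by move=> h; apply: ge_inf.
have Sp x t : p x < t -> S x t.
  move=> h; have [s Ss st] := @inf_adherent _ (S x) (t - p x) ltac:(by rewrite subr_gt0) (Sinf x).
  by apply: (Sup _ _ _ Ss); apply: ltW; rewrite -(subrK (p x) t) addrC.
clearbody p.
have SD x y s t : S x s -> S y t -> S (x + y) (s + t).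
  move=> [s0 Ws] [t0 Wt]; have st0 : 0 < s + t by exact: addr_gt0.
  split=> //; have -> : ((s + t)^-1)%:C%C *: (x + y) =
    (s / (s + t))%:C%C *: ((s^-1)%:C%C *: x) + (t / (s + t))%:C%C *: ((t^-1)%:C%C *: y).
    rewrite !scalerA -!rmorphM/= ![_ / (s + t) / _]mulrAC !divff ?gt_eqF// !mul1r.
    by rewrite scalerDr.
  apply: Wconv; rewrite ?divr_ge0 ?ltW//.
  by rewrite -mulrDl divff// gt_eqF.
have SZ x t (a : R[i]) : a != 0 -> S x t -> S (a *: x) (normc a * t).
  move=> a0 [t0 Wt]; have na : 0 < normc a by rewrite normc_gt0.
  split; first exact: mulr_gt0.
  have -> : ((normc a * t)^-1)%:C%C *: (a *: x) =
     (a * ((normc a)^-1)%:C%C) *: ((t^-1)%:C%C *: x).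
    by rewrite !scalerA invfM rmorphM /=; congr (_ *: _); ring.
  apply: Wbal => //.
  by rewrite normcM normcR ger0_norm ?invr_ge0 ?normc_ge0// divff ?gt_eqF.
have sp : seminorm p.
  split=> [x y|a x].
    apply/ler_addgt0Pr => e e0.
    have hx : p x < p x + e / 2 by rewrite ltrDl divr_gt0.
    have hy : p y < p y + e / 2 by rewrite ltrDl divr_gt0.
    by have /pS := SD _ _ _ _ (Sp _ _ hx) (Sp _ _ hy); rewrite addrACA -splitr.
  rewrite normcE -rmorphM/=; congr (_%:C%C).
  have [->|a0] := eqVneq a 0.
    rewrite scale0r normc0 mul0r; apply/eqP; rewrite eq_le p0 andbT.
    apply/ler_addgt0Pr => e e0; rewrite add0r; apply: pS; split=> //.
    by rewrite scaler0.
  have na : 0 < normc a by rewrite normc_gt0.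
  have key b y : b != 0 -> p (b *: y) <= normc b * p y.
    move=> b0; have nb : 0 < normc b by rewrite normc_gt0.
    apply/ler_addgt0Pr => e e0.
    have hy : p y < p y + e / normc b by rewrite ltrDl divr_gt0.
    have := SZ y (p y + e / normc b) b b0 (Sp _ _ hy).
    by move/pS; rewrite mulrDr mulrCA divff ?mulr1// gt_eqF.
  apply/eqP; rewrite eq_le key//=.
  have := key a^-1 (a *: x); rewrite scalerA mulVf// scale1r invr_eq0 => /(_ a0).
  by rewrite normcV ler_pdivlMl// mulrC.
exists p; split; last first.
  move=> x /Sp[_]; rewrite invr1 scale1r => Wx; exact: WU.
split=> // x; apply/cvgrPdist_lt => e e0.
apply: nbhs0_add.
apply: filterS (nbhs0_scale (((e / 2)^-1)%:C%C) W0) => y /= Wy.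
have py : p y <= e / 2 by apply: pS; split=> //; rewrite divr_gt0.
apply: (@le_lt_trans _ _ (p y)); last by lra.
have h1 := seminormD x y sp; have h2 := seminormD (x + y) (- y) sp.
move: h2; rewrite addrK (seminormN _ sp) => h2.
by rewrite ler_norml; apply/andP; split; lra.
Qed.

Lemma csn_nbhs x (U : set E) : nbhs x U ->
  exists2 p, csn p & forall y, p (y - x) < 1 -> U y.
Proof.
move=> /nbhs0_sub/gauge_csn[p [cp h]]; exists p => // y /h /=.
by rewrite addrC subrK.
Qed.

Lemma cvg_csn (T : Type) (F : set_system T) (FF : Filter F) (f : T -> E) (l : E) :
  f @ F --> l <-> forall p, csn p -> forall e, 0 < e -> \forall t \near F, p (f t - l) < e.
Proof.
split=> [fl p cp e e0|H U /csn_nbhs[p cp pU]].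
  have : (fun t => f t - l) @ F --> (0 : E).
    by rewrite -(subrr l); apply: cvgB_tvs => //; exact: cvg_cst.
  by move/(_ _ (csn_small cp e0)).
by apply: filterS (H p cp 1 ltr01) => t /= /pU.
Qed.

(** Under the hypothesis the neighbourhood filter of x converges to y as well as to x. *)
Lemma csn_eq (hE : hausdorff_space E) x y :
  (forall p, csn p -> p (x - y) = 0) -> x = y.
Proof.
move=> H; apply: (@cvg_unique _ hE (nbhs x)); first exact: cvg_id.
apply/cvg_csn => p cp e e0.
have : (id : E -> E) @ nbhs x --> x by exact: cvg_id.
move/cvg_csn => /(_ p cp e e0); apply: filterS => t pt.
by rewrite (le_lt_trans (seminorm_tri t x y cp.1))// H// addr0.
Qed.

Lemma csn_closed (D : set E) x : closed D ->
  (forall p, csn p -> forall e, 0 < e -> exists2 d, D d & p (d - x) < e) -> D x.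
Proof.
move=> cD H; apply: cD => U /csn_nbhs[p cp pU].
by have [d Dd pd] := H p cp 1 ltr01; exists d; split=> //; exact: pU.
Qed.

Lemma bounded_csn (D : set E) p : tvs_bounded D -> csn p ->
  exists2 M, 0 < M & forall x, D x -> p x <= M.
Proof.
move=> bD cp; have [r r0 h] := bD _ (csn_small cp ltr01).
exists r => // x /h[y /= py <-].
by rewrite (seminormZ _ _ cp.1) normcR gtr0_norm// -[leRHS]mulr1 ler_wpM2l ?ltW.
Qed.

Lemma csn_bounded (D : set E) :
  (forall p, csn p -> exists M, forall x, D x -> p x <= M) -> tvs_bounded D.
Proof.
move=> H U /gauge_csn[p [cp pU]]; have [M hM] := H p cp.
exists (`|M| + 1) => // x Dx; exists (((`|M| + 1)^-1)%:C%C *: x).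
  apply: pU; rewrite (seminormZ _ _ cp.1) normcR gtr0_norm ?invr_gt0//.
  rewrite mulrC ltr_pdivrMr// mul1r (le_lt_trans (hM _ Dx))//.
  by rewrite (le_lt_trans (ler_norm _))// ltrDl.
by rewrite scalerA -rmorphM/= divff ?gt_eqF// scale1r.
Qed.

End Seminorms.

Section Disks.
Variables (R : realType) (E : tvsType R[i]).
Implicit Types (D : set E) (x y : E).

(** [scaled D r x] plays the part of an inequality between the norm of x and r, for the gauge of D.
    Being a membership, it avoids infima and makes sense for vectors outside the span of D. *)
Definition scaled D (r : R) : set E := [set r%:C%C *: x | x in D].

(** Closedness is included so that bounds pass to limits, see [scaled_lim]; boundedness converts
    bounds in D into bounds of every continuous seminorm. *)
Definition bdisk D := [/\ absolutely_convex D, D 0, closed D & tvs_bounded D].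

Lemma scaled0 D r : D 0 -> scaled D r 0.
Proof. by move=> D0; exists 0 => //; rewrite scaler0. Qed.

Lemma scaled1 D x : scaled D 1 x <-> D x.
Proof.
split=> [[y Dy <-]|Dx]; first by rewrite scale1r.
by exists x => //; rewrite scale1r.
Qed.

Lemma scaledZ D (r s : R) (a : R[i]) x : absolutely_convex D -> D 0 -> 0 <= r ->
  normc a * r <= s -> scaled D r x -> scaled D s (a *: x).
Proof.
move=> Dc D0 r0 ars [y Dy <-].
have s0 : 0 <= s by apply: le_trans ars; rewrite mulr_ge0 ?normc_ge0.
(* One cannot divide by s = 0, but then the hypotheses force a r = 0. *)
have [s00|sn0] := eqVneq s 0.
  have : a * r%:C%C == 0.
    rewrite -normc_eq0 normcM normcR (ger0_norm r0) eq_le -{1}s00 ars.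
    by rewrite mulr_ge0 ?normc_ge0.
  by rewrite scalerA => /eqP ->; rewrite scale0r; exact: scaled0.
exists ((a * (r / s)%:C%C) *: y).
  have := Dc (a * (r / s)%:C%C) 0 y y; rewrite scale0r addr0; apply=> //.
  rewrite normr0 addr0 normcE -(rmorph1 (real_complex R)) lecR.
  rewrite normcM normcR ger0_norm ?divr_ge0// mulrA ler_pdivrMr ?mul1r//.
  by rewrite lt_def sn0.
rewrite !scalerA mulrCA -rmorphM/= mulrCA divff// mulr1 //.
Qed.

Lemma scaled_le D (r s : R) : absolutely_convex D -> D 0 -> 0 <= r -> r <= s ->
  scaled D r `<=` scaled D s.
Proof.
move=> Dc D0 r0 rs x Dx; rewrite -[x]scale1r; apply: scaledZ Dx => //.
by rewrite normc1 mul1r.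
Qed.

Lemma scaledN D (r : R) x : absolutely_convex D -> D 0 -> 0 <= r ->
  scaled D r x -> scaled D r (- x).
Proof.
by move=> Dc D0 r0 Dx; rewrite -scaleN1r; apply: scaledZ Dx; rewrite // normcN normc1 mul1r.
Qed.

Lemma scaledD D (r s : R) x y : absolutely_convex D -> D 0 -> 0 <= r -> 0 <= s ->
  scaled D r x -> scaled D s y -> scaled D (r + s) (x + y).
Proof.
move=> Dc D0 r0 s0 Dx Dy; have [rs0|rs0] := eqVneq (r + s) 0.
  move: rs0 => /eqP; rewrite paddr_eq0// => /andP[/eqP r00 /eqP s00].
  move: Dx Dy; rewrite r00 s00 addr0 => -[x' _ <-] [y' _ <-].
  by rewrite !scale0r addr0; apply: scaled0.
move: Dx Dy => [x' Dx <-] [y' Dy <-].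
exists ((r / (r + s))%:C%C *: x' + (s / (r + s))%:C%C *: y').
  apply: Dc => //; rewrite !normcE -rmorphD/= -(rmorph1 (real_complex R)) lecR.
  rewrite !normcR !ger0_norm ?divr_ge0 ?addr_ge0// -mulrDl divff//.
by rewrite scalerDr !scalerA -!rmorphM/= ![(r + s) * _]mulrC !divfK.
Qed.

Lemma scaledB D (r s : R) x y : absolutely_convex D -> D 0 -> 0 <= r -> 0 <= s ->
  scaled D r x -> scaled D s y -> scaled D (r + s) (x - y).
Proof. by move=> Dc D0 r0 s0 Dx Dy; apply: scaledD => //; apply: scaledN. Qed.

Lemma scaled_sum D (I : Type) (r : seq I) (P : pred I) (c : I -> R) (x : I -> E) :
  absolutely_convex D -> D 0 ->
  (forall k, P k -> 0 <= c k) -> (forall k, P k -> scaled D (c k) (x k)) ->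
  scaled D (\sum_(k <- r | P k) c k) (\sum_(k <- r | P k) x k).
Proof.
move=> Dc D0 c0 Dx.
(* The induction carries the sign of the partial sums of c, which [scaledD] requires. *)
apply: (@proj2 (0 <= \sum_(k <- r | P k) c k)).
apply: (big_ind2 (fun (c : R) (x : E) => 0 <= c /\ scaled D c x)).
- by split=> //; exact: scaled0.
- by move=> ? ? ? ? [? ?] [? ?]; split; [exact: addr_ge0|exact: scaledD].
- by move=> k Pk; split; [exact: c0|exact: Dx].
Qed.

Lemma scaled_mul D (r s : R) : scaled (scaled D r) s = scaled D (s * r).
Proof.
apply/seteqP; split=> x [y].
  by move=> [z Dz <-] <-; exists z => //; rewrite scalerA rmorphM.
by move=> Dy <-; exists (r%:C%C *: y); [exists y|rewrite scalerA rmorphM].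
Qed.

(** For r > 0 divide by r and use that D is closed. For r = 0 the values are eventually 0, and the
    Hausdorff property identifies the limit. *)
Lemma scaled_lim (hE : hausdorff_space E) D (r : R) (T : Type) (F : set_system T)
    (FF : ProperFilter F) (f : T -> E) l : closed D -> 0 <= r ->
  f @ F --> l -> (\forall t \near F, scaled D r (f t)) -> D 0 -> scaled D r l.
Proof.
move=> cD; rewrite le_eqVlt => /orP[/eqP <-|r0] fl Df D0.
  have -> : l = 0.
    apply: (@cvg_unique _ hE (f @ F)) => //.
    have /cvg_trans : f @ F --> (fun=> (0 : E)) @ F.
      apply: near_eq_cvg; apply: filterS Df => t [y _ <-].
      by rewrite scale0r.
    by apply; exact: cvg_cst.
  exact: scaled0.
exists ((r^-1)%:C%C *: l); last by rewrite scalerA -rmorphM/= divff ?gt_eqF// scale1r.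
have := @cvgZc_tvs _ _ _ F (@filter_filter _ _ FF) f ((r^-1)%:C%C) l fl.
apply: (closed_cvg D cD); apply: filterS Df => t [y Dy <-].
by rewrite scalerA -rmorphM/= mulVf ?gt_eqF// scale1r.
Qed.

Lemma bdisk_scaled D (r : R) : bdisk D -> 0 < r -> bdisk (scaled D r).
Proof.
move=> [Dc D0 cD bD] r0; split.
- move=> a b _ _ ab [x Dx <-] [y Dy <-]; exists (a *: x + b *: y); first exact: Dc.
  by rewrite scalerDr !scalerA ![_ * r%:C%C]mulrC.
- exact: scaled0.
- have -> : scaled D r = (fun x => (r^-1)%:C%C *: x) @^-1` D.
    apply/seteqP; split => x /= => [[y Dy <-]|Dx].
      by rewrite scalerA -rmorphM/= mulVf ?gt_eqF// scale1r.
    by exists ((r^-1)%:C%C *: x) => //; rewrite scalerA -rmorphM/= divff ?gt_eqF// scale1r.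
  apply: closed_comp => // x _; apply: cvgZc_tvs; exact: cvg_id.
- apply: csn_bounded => p cp; have [M M0 hM] := bounded_csn bD cp.
  exists (r * M) => _ [x Dx <-]; rewrite (seminormZ _ _ cp.1) normcR gtr0_norm//.
  by rewrite ler_pM2l// hM.
Qed.

Lemma bdisk_closure D : absolutely_convex D -> D !=set0 -> tvs_bounded D ->
  bdisk (closure D).
Proof.
move=> Dc [d0 Dd0] bD.
have D0 : D 0.
  by have := Dc 0 0 d0 d0; rewrite !scale0r addr0; apply=> //; rewrite normr0 addr0 ler01.
split.
- move=> a b x y ab Dx Dy U /csn_nbhs[p cp pU].
  have sm z : closure D z -> exists2 w, D w & p (w - z) < 1 / 2.
    have Nz : nbhs z [set w | p (w - z) < 1 / 2].
      have : (id : E -> E) @ nbhs z --> z by exact: cvg_id.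
      by move/cvg_csn => /(_ p cp (1/2)); apply; lra.
    by move=> /(_ _ Nz)[w [Dw pw]]; exists w.
  have [x' Dx' px] := sm x Dx; have [y' Dy' py] := sm y Dy.
  exists (a *: x' + b *: y'); split; first exact: Dc.
  apply: pU; have -> : a *: x' + b *: y' - (a *: x + b *: y) = a *: (x' - x) + b *: (y' - y).
    by rewrite !scalerBr opprD addrACA.
  apply: (le_lt_trans (seminormD _ _ cp.1)); rewrite !(seminormZ _ _ cp.1).
  have ab' : normc a + normc b <= 1.
    by move: ab; rewrite !normcE -rmorphD/= -(rmorph1 (real_complex R)) lecR.
  have := normc_ge0 a; have := normc_ge0 b; move: px py => /ltW px /ltW py a0 b0.
  have := ler_wpM2l b0 px; have := ler_wpM2l a0 py; lra.
- exact: subset_closure.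
- exact: closed_closure.
- apply: csn_bounded => p cp; have [M M0 hM] := bounded_csn bD cp.
  exists (M + 1) => x Dx.
  have Nz : nbhs x [set w | p (w - x) < 1].
    have : (id : E -> E) @ nbhs x --> x by exact: cvg_id.
    by move/cvg_csn => /(_ p cp 1); apply; lra.
  have [w [/hM Dw /= pw]] := Dx _ Nz.
  have := seminormD w (x - w) cp.1; rewrite (seminormB _ _ cp.1).
  by rewrite [w + _]addrC subrK; lra.
Qed.

End Disks.

Section Completeness.
Variables (R : realType) (E : tvsType R[i]).

(* The only consequence of local completeness that is used. *)
Definition series_complete := forall (D : set E), bdisk D ->
  forall (x : nat -> E) (c : nat -> R) (M : R), (forall k, 0 <= c k) ->
    (forall n, \sum_(k < n) c k <= M) -> (forall k, scaled D (c k) (x k)) ->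
  exists l : E, (fun n => \sum_(k < n) x k) @ \oo --> l.

Lemma psum_cvg (c : nat -> R) (M : R) : (forall k, 0 <= c k) ->
  (forall n, \sum_(k < n) c k <= M) ->
  exists2 s : R, (fun n => \sum_(k < n) c k) @ \oo --> s &
    forall n, \sum_(k < n) c k <= s.
Proof.
move=> c0 cM.
have ndc : nondecreasing_seq (fun n => \sum_(k < n) c k).
  by apply/nondecreasing_seqP => n; rewrite big_ord_recr/= lerDl.
have bc : has_ubound (range (fun n => \sum_(k < n) c k)).
  by exists M => _ [n _ <-].
exists (sup (range (fun n => \sum_(k < n) c k))).
  exact: nondecreasing_cvgn.
by move=> n; apply: ub_le_sup => //; exists n.
Qed.

Lemma psum_split (V : zmodType) (x : nat -> V) m n : (m <= n)%N ->
  \sum_(k < n) x k = \sum_(k < m) x k + \sum_(m <= k < n) x k.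
Proof. by move=> mn; rewrite -!(big_mkord xpredT x) (big_cat_nat (leq0n m) mn). Qed.

Lemma scaled_psum_sub (D : set E) (x : nat -> E) (c : nat -> R) (s : R) m n :
  absolutely_convex D -> D 0 -> (forall k, 0 <= c k) ->
  (forall k, scaled D (c k) (x k)) -> (forall n, \sum_(k < n) c k <= s) -> (m <= n)%N ->
  scaled D (s - \sum_(k < m) c k) (\sum_(k < n) x k - \sum_(k < m) x k).
Proof.
move=> Dc D0 c0 Dx cs mn; rewrite (psum_split x mn) addrAC subrr add0r.
have := cs n; rewrite (psum_split c mn) => csn.
apply: (@scaled_le _ _ D (\sum_(m <= k < n) c k)) => //.
- by apply: sumr_ge0.
- by lra.
- exact: scaled_sum.
Qed.

(** The remainder of a dominated series is controlled by the remainder of its numerical majorant,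
    uniformly over all series with that majorant. This replaces uniform convergence in what
    follows. *)
Lemma scaled_psum_lim (hE : hausdorff_space E) (D : set E) (x : nat -> E) (c : nat -> R) (s : R) l m :
  bdisk D -> (forall k, 0 <= c k) ->
  (forall k, scaled D (c k) (x k)) -> (forall n, \sum_(k < n) c k <= s) ->
  (fun n => \sum_(k < n) x k) @ \oo --> l ->
  scaled D (s - \sum_(k < m) c k) (l - \sum_(k < m) x k).
Proof.
move=> [Dc D0 cD _] c0 Dx cs xl.
apply: (@scaled_lim _ _ hE D _ _ \oo _ (fun n => \sum_(k < n) x k - \sum_(k < m) x k)) => //.
- by have := cs m; lra.
- by apply: cvgB_tvs => //; exact: cvg_cst.
- by exists m => // n /= mn; apply: scaled_psum_sub.
Qed.

Lemma scaled_psum_lim0 (hE : hausdorff_space E) (D : set E) (x : nat -> E) (c : nat -> R) (s : R) l :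
  bdisk D -> (forall k, 0 <= c k) ->
  (forall k, scaled D (c k) (x k)) -> (forall n, \sum_(k < n) c k <= s) ->
  (fun n => \sum_(k < n) x k) @ \oo --> l -> scaled D s l.
Proof.
move=> bD c0 Dx cs xl; have := scaled_psum_lim hE 0 bD c0 Dx cs xl.
by rewrite !big_ord0 !subr0.
Qed.

Lemma span_absorbed (K : set E) x : absolutely_convex K -> K 0 -> linear_span K x ->
  exists2 t : R, 0 < t & scaled K t x.
Proof.
move=> Kc K0 [n [a [b [Kb ->]]]].
have s0 : 0 <= \sum_(i < n) normc (a i) by apply: sumr_ge0 => i _; exact: normc_ge0.
exists (1 + \sum_(i < n) normc (a i)); first by lra.
apply: (@scaled_le _ _ K (\sum_(i < n) normc (a i))) => //; first by lra.
apply: scaled_sum => // i _; first exact: normc_ge0.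
apply: (@scaledZ _ _ K 1) => //; first by rewrite mulr1.
exact/scaled1.
Qed.

Lemma minkowski_lt (K : set E) x (t e : R) : absolutely_convex K -> K 0 -> 0 <= t -> t < e ->
  scaled K t x -> Defs.minkowski K x < e.
Proof.
move=> Kc K0 t0 te Kx; apply: (@le_lt_trans _ _ ((t + e) / 2)); last by lra.
apply: ge_inf; first by exists 0 => s [/ltW].
by split; [lra|apply: (@scaled_le _ _ K t) => //; lra].
Qed.

Lemma minkowski_scaled (K : set E) x (e : R) : absolutely_convex K -> K 0 -> linear_span K x ->
  Defs.minkowski K x < e -> scaled K e x.
Proof.
move=> Kc K0 sx xe.
have hi : has_inf [set t : R | 0 < t /\ [set t%:C%C *: y | y in K] x].
  split; first by have [t t0 Kt] := span_absorbed Kc K0 sx; exists t.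
  by exists 0 => s [/ltW].
have e0 : 0 < e - Defs.minkowski K x by rewrite subr_gt0.
have [t [t0 Kt] te] := inf_adherent e0 hi.
apply: (@scaled_le _ _ K t) => //; first exact: ltW.
by move: te; rewrite /Defs.minkowski; lra.
Qed.

Lemma linear_spanB (K : set E) x y : linear_span K x -> linear_span K y ->
  linear_span K (x - y).
Proof.
move=> [n [a [b [Kb ->]]]] [m [a' [b' [Kb' ->]]]].
exists (n + m)%N, (fun i => match fintype.split i with inl j => a j | inr j => - a' j end),
  (fun i => match fintype.split i with inl j => b j | inr j => b' j end); split.
  by move=> i; case: (fintype.split i).
rewrite big_split_ord/=; congr (_ + _).
  by apply: eq_bigr => i _; rewrite (unsplitK (inl i)).
rewrite -sumrN; apply: eq_bigr => i _; rewrite (unsplitK (inr i)).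
by rewrite scaleNr.
Qed.

(** In the gauge of a Banach disk K containing D, the tails of c show that the partial sums form a
    Cauchy sequence. Its limit in the span of K is also a limit in E because K is bounded. *)
Lemma locally_complete_series : locally_complete E -> series_complete.
Proof.
move=> lcE D [Dc D0 cD bD] x c M c0 cM Dx.
have [K [Kc bK Kcomp] DK] := lcE D bD.
have K0 : K 0 by exact: DK.
have [s cs cles] := psum_cvg c0 cM.
pose S n := \sum_(k < n) x k.
have KS m n : (m <= n)%N -> scaled K (s - \sum_(k < m) c k) (S n - S m).
  move=> mn; have := scaled_psum_sub Dc D0 c0 Dx cles mn.
  by move=> [y /DK Ky <-]; exists y.
have spS n : linear_span K (S n).
  have /choice[y hy] : forall k, exists y, D y /\ (c k)%:C%C *: y = x k.
    by move=> k; have [y Dy e] := Dx k; exists y.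
  exists n, (fun i => (c i)%:C%C), (fun i => y i); split.
    by move=> i; apply: DK; exact: (hy i).1.
  by apply: eq_bigr => i _; rewrite (hy i).2.
have tail e : 0 < e -> exists N, forall n, (N <= n)%N -> s - \sum_(k < n) c k < e.
  move=> e0; move/cvgrPdist_lt: cs => /(_ _ e0)[N _ hN]; exists N => n /hN /=.
  by apply: le_lt_trans; exact: ler_norm.
have sub0 n : 0 <= s - \sum_(k < n) c k by rewrite subr_ge0.
have cau e : 0 < e -> exists N, forall m n, (N <= m)%N -> (N <= n)%N ->
    Defs.minkowski K (S m - S n) < e.
  move=> e0; have [N hN] := tail e e0; exists N.
  move=> m n Nm Nn; have [mn|/ltnW nm] := leqP m n.
    apply: (minkowski_lt Kc K0 (sub0 m) (hN _ Nm)).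
    by rewrite -[S m - S n]opprB; apply: (scaledN Kc K0 (sub0 m)); exact: KS.
  by apply: (minkowski_lt Kc K0 (sub0 n) (hN _ Nn)); exact: KS.
have [l spl hl] := Kcomp S spS cau.
exists l; apply/cvg_csn => p cp e e0.
have [r r0 hr] := bounded_csn bK cp.
have [N hN] := hl (e / (2 * r)) ltac:(by rewrite divr_gt0 ?mulr_gt0).
exists N => // n /= /hN /(minkowski_scaled Kc K0 (linear_spanB (spS n) spl)) [y Ky <-].
rewrite (seminormZ _ _ cp.1) normcR ger0_norm; last by rewrite divr_ge0 ?mulr_ge0 ?ltW.
apply: (@le_lt_trans _ _ (e / (2 * r) * r)).
  by rewrite ler_wpM2l ?hr// divr_ge0 ?mulr_ge0 ?ltW.
by rewrite invfM mulrA divfK ?gt_eqF//; lra.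
Qed.

End Completeness.

(** * Partial derivatives and bounds in disks *)

Section PlaneTopology.
Variable R : realType.

Lemma nbhs_planeP (z : R[i]^o) (U : set R[i]^o) : nbhs z U <->
  exists2 d : R, 0 < d & forall w : R[i], normc (w - z) < d -> U w.
Proof.
split=> [/nbhs_ballP[e /= e0 eA]|[d d0 dU]].
  move: (e0); rewrite ltcE => /andP[/eqP ei e1].
  exists (complex.Re e) => // k ke; apply: eA.
  rewrite /ball /= distrC normcE ltcE /= ke andbT.
  by move: ei => /= ->.
apply/nbhs_ballP; exists (d%:C%C); first by rewrite /= ltcR.
move=> w; rewrite /ball /= distrC normcE ltcR; exact: dU.
Qed.

Lemma dnbhs0P (P : R -> Prop) : (\forall h \near (0 : R)^', P h) <->
  exists2 d, 0 < d & forall h, `|h| < d -> h != 0 -> P h.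
Proof.
rewrite /dnbhs /within /=; split=> [/nbhs_ballP[d /= d0 h]|[d d0 h]].
  by exists d => // x xd x0; apply: h => //; rewrite /ball /= sub0r normrN.
apply/nbhs_ballP; exists d => // x; rewrite /ball /= sub0r normrN => xd x0.
exact: h.
Qed.

End PlaneTopology.

Section Derivatives.
Variables (R : realType) (E : tvsType R[i]).
Implicit Types (f : R[i]^o -> E) (u : R -> E) (D : set E).

Definition is_rd u (t : R) (l : E) := forall p, csn p -> forall e, 0 < e ->
  exists2 d : R, 0 < d & forall h : R, `|h| < d ->
    p (u (t + h) - u t - h%:C%C *: l) <= e * `|h|.

Definition is_pd v f (z : R[i]^o) (l : E) := diff_quotient f v z h @[h --> (0 : R)^'] --> l.

Lemma is_pdP v f z l : is_pd v f z l <->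
  forall p, csn p -> forall e, 0 < e ->
  exists2 d : R, 0 < d & forall h : R, `|h| < d ->
    p (f (z + h%:C%C * v) - f z - h%:C%C *: l) <= e * `|h|.
Proof.
have key (p : E -> R) (h : R) : csn p -> h != 0 ->
    p (f (z + h%:C%C * v) - f z - h%:C%C *: l) = `|h| * p (diff_quotient f v z h - l).
  move=> cp h0; rewrite -normcR -(seminormZ _ _ cp.1) scalerBr /diff_quotient.
  by rewrite scalerA -rmorphM/= divff// scale1r.
split=> [/cvg_csn H p cp e e0|H].
  have /dnbhs0P[d d0 hd] := H p cp e e0; exists d => // h hhd.
  have [->|h0] := eqVneq h 0.
    by rewrite mul0r addr0 subrr scale0r subrr (seminorm0 cp.1) normr0 mulr0.
  by rewrite key// mulrC ler_wpM2r// ltW// hd.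
apply/cvg_csn => p cp e e0; apply/dnbhs0P.
have [d d0 hd] := H p cp (e / 2) ltac:(lra); exists d => // h hhd h0.
have := hd h hhd; rewrite key// mulrC ler_pM2r ?normr_gt0// => hh.
by apply: (le_lt_trans hh); lra.
Qed.

Lemma is_pd_rd v f z t l : is_pd v f (z + t%:C%C * v) l ->
  is_rd (fun t : R => f (z + t%:C%C * v)) t l.
Proof.
move=> /is_pdP H p cp e e0; have [d d0 hd] := H p cp e e0; exists d => // h hh.
by rewrite rmorphD/= mulrDl addrA; exact: hd.
Qed.

(** Continuous induction: with an error e t measured by a single seminorm, the property [Q e] holds
    up to the supremum s of its validity, at s, and beyond s. Closedness of the scaled disk removes
    the error at the end. D is not assumed bounded, so that it may be a seminorm ball. *)
Lemma mean_value D u (a : R) (l : R -> E) : absolutely_convex D -> D 0 -> closed D -> 0 < a ->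
  (forall t : R, 0 <= t <= a -> is_rd u t (l t)) ->
  (forall t : R, 0 <= t <= a -> D (l t)) -> scaled D a (u a - u 0).
Proof.
move=> Dc D0 cD a0 ud Dl.
have cDa : closed (scaled D a).
  have -> : scaled D a = (fun x => (a^-1)%:C%C *: x) @^-1` D.
    apply/seteqP; split => x /= => [[y Dy <-]|Dx].
      by rewrite scalerA -rmorphM/= mulVf ?gt_eqF// scale1r.
    by exists ((a^-1)%:C%C *: x) => //; rewrite scalerA -rmorphM/= divff ?gt_eqF// scale1r.
  apply: closed_comp => // x _; apply: cvgZc_tvs; exact: cvg_id.
apply: csn_closed cDa _ => p cp e e0.
pose Q (e : R) t := exists2 d, scaled D t d & p (u t - u 0 - d) <= e * t.
suff [d Dd pd] : Q (e / (2 * a)) a.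
  exists d => //; rewrite (seminormB _ _ cp.1) (le_lt_trans pd)//.
  by rewrite invfM mulrA divfK ?gt_eqF//; lra.
have : 0 < e / (2 * a) by rewrite divr_gt0 ?mulr_gt0.
move: (e / (2 * a)) => {}e {}e0.
pose A := [set t | 0 <= t <= a /\ Q e t].
have A0 : A 0.
  split; first by rewrite lexx ltW.
  by exists 0; [exact: scaled0|rewrite !subr0 subrr (seminorm0 cp.1) mulr0].
have hA : has_sup A by split; [exists 0|exists a => t [/andP[]]].
pose s := sup A.
have s0 : 0 <= s by apply: ub_le_sup => //; exact: hA.2.
have sa : s <= a by apply: ge_sup; [exists 0|move=> t [/andP[]]].
have [d d0 hd] := ud s (introT andP (conj s0 sa)) p cp e e0.
(* Used twice, to reach s from a t just below it and to go on from s; in both cases only the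
   derivative at s enters, with an increment of either sign. *)
have ext (t t' : R) : 0 <= t -> t <= t' -> Q e t -> t' <= a -> 
    (t = s \/ t' = s) -> t' - t < d -> Q e t'.
  move=> t0 tt' [x Dx px] t'a ts ttd.
  have h0 : 0 <= t' - t by lra.
  exists (x + (t' - t)%:C%C *: l s).
    have hl : scaled D (t' - t) ((t' - t)%:C%C *: l s).
      by exists (l s) => //; apply: Dl; rewrite s0.
    by have := scaledD Dc D0 t0 h0 Dx hl; rewrite [t + _]addrC subrK.
  have -> : u t' - u 0 - (x + (t' - t)%:C%C *: l s) =
    (u t - u 0 - x) + (u t' - u t - (t' - t)%:C%C *: l s).
    by lmod E.
  apply: (le_trans (seminormD _ _ cp.1)).
  suff : p (u t' - u t - (t' - t)%:C%C *: l s) <= e * (t' - t).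
    by move: px; rewrite mulrBr; lra.
  case: ts => ts.
    by have := hd (t' - t); rewrite -ts [t + _]addrC subrK (ger0_norm h0) => ->.
  have := hd (t - t'); rewrite -ts [t' + _]addrC subrK distrC (ger0_norm h0) => /(_ ttd).
  rewrite (seminormB _ _ cp.1); congr (p _ <= _).
  by lmod E.
have Qs : Q e s.
  have [t [/andP[t0 ta] Qt] st] := sup_adherent d0 hA.
  have ts : t <= s by apply: ub_le_sup; [exact: hA.2|split=> //; rewrite t0].
  by apply: (ext t s) => //; [right|move: st; rewrite -/s; lra].
have [<-//|sna] := eqVneq s a.
have [e' [e'0 e'd e'a]] : exists e', [/\ 0 < e', e' < d & s + e' <= a].
  exists (Num.min (d / 2) (a - s)); split.
  - by rewrite lt_min; apply/andP; split; lra.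
  - by rewrite gt_min; apply/orP; left; lra.
  - by rewrite -lerBrDl ge_min lexx orbT.
have : A (s + e').
  split; first by apply/andP; split; lra.
  apply: (ext s (s + e')) => //; [lra|by left|lra].
by move=> /(ub_le_sup hA.2); rewrite -/s; lra.
Qed.

(** [mean_value] for u t - t c and the closed absolutely convex set where p is at most M. *)
Lemma mean_value_csn p u (a : R) (l : R -> E) (c : E) (M : R) : csn p -> 0 < a ->
  (forall t : R, 0 <= t <= a -> is_rd u t (l t)) ->
  (forall t : R, 0 <= t <= a -> p (l t - c) <= M) -> p (u a - u 0 - a%:C%C *: c) <= M * a.
Proof.
move=> cp a0 ud Ml.
have M0 : 0 <= M by apply: le_trans (Ml 0 _); rewrite ?seminorm_ge0 ?cp.1 ?lexx ?ltW//; exact: cp.1.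
pose D := [set x : E | p x <= M].
have := @mean_value D (fun t => u t - t%:C%C *: c) a (fun t => l t - c).
case.
- move=> k m x y km px py; rewrite /D /=.
  have km' : normc k + normc m <= 1.
    by move: km; rewrite !normcE -rmorphD/= -(rmorph1 (real_complex R)) lecR.
  apply: (le_trans (seminormD _ _ cp.1)); rewrite !(seminormZ _ _ cp.1).
  have k0 := normc_ge0 k; have m0 := normc_ge0 m.
  have := ler_wpM2l k0 px; have := ler_wpM2l m0 py; have := ler_wpM2r M0 km'; lra.
- by rewrite /D /= (seminorm0 cp.1).
- have -> : D = p @^-1` [set x | x <= M] by [].
  by apply: closed_comp => [x _|]; [exact: cp.2|exact: closed_le].
- exact: a0.
- move=> t ta q cq e e0; have [d d0 hd] := ud t ta q cq e e0; exists d => // h hh.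
  have := hd h hh; congr (q _ <= _); lmod E.
- by move=> t /Ml.
move=> x px /eqP; rewrite eq_sym subr_eq => /eqP h.
have -> : u a - u 0 - a%:C%C *: c = a%:C%C *: x by rewrite addrAC h rmorph0; lmod E.
rewrite (seminormZ _ _ cp.1) normcR gtr0_norm// mulrC.
exact: (ler_wpM2r (ltW a0) px).
Qed.

End Derivatives.

Section Rules.
Variables (R : realType) (E : tvsType R[i]).
Implicit Types (f g : R[i]^o -> E) (v z : R[i]).

Lemma is_pd_cst v (c : E) z : is_pd v (fun=> c) z 0.
Proof.
apply/is_pdP => p cp e e0; exists 1 => // h _.
by rewrite subrr scaler0 subrr (seminorm0 cp.1) mulr_ge0 ?(ltW e0).
Qed.

Lemma is_pdD v f g z l m : is_pd v f z l -> is_pd v g z m ->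
  is_pd v (fun z => f z + g z) z (l + m).
Proof.
move=> fl gm; rewrite /is_pd.
have -> : diff_quotient (fun z => f z + g z) v z =
    (fun h => diff_quotient f v z h + diff_quotient g v z h).
  by apply/funext => h; rewrite /diff_quotient; lmod E.
exact: cvgD_tvs.
Qed.

Lemma is_pdZ v (k : R[i]) f z l : is_pd v f z l -> is_pd v (fun z => k *: f z) z (k *: l).
Proof.
move=> fl; rewrite /is_pd.
have -> : diff_quotient (fun z => k *: f z) v z = (fun h => k *: diff_quotient f v z h).
  by apply/funext => h; rewrite /diff_quotient; lmod E.
exact: cvgZc_tvs.
Qed.

Lemma is_pdB v f g z l m : is_pd v f z l -> is_pd v g z m ->
  is_pd v (fun z => f z - g z) z (l - m).
Proof.
move=> fl gm; rewrite /is_pd.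
have -> : diff_quotient (fun z => f z - g z) v z =
    (fun h => diff_quotient f v z h - diff_quotient g v z h).
  by apply/funext => h; rewrite /diff_quotient; lmod E.
exact: cvgB_tvs.
Qed.

Lemma is_pd_uniq (hE : hausdorff_space E) v f z l m : is_pd v f z l -> is_pd v f z m -> l = m.
Proof. by move=> fl fm; apply: (cvg_unique _ fl fm). Qed.

Lemma is_pd_partial (hE : hausdorff_space E) v f z l : is_pd v f z l -> partial v f z = l.
Proof.
move=> fl; apply: xget_unique => // m fm; exact: (is_pd_uniq hE fm fl).
Qed.

Lemma has_partialP v f z : has_partial v f z -> is_pd v f z (partial v f z).
Proof.
move=> [l fl].
exact: (@xgetPex _ (0 : E) [set m : E | diff_quotient f v z h @[h --> (0:R)^'] --> m] (ex_intro _ l fl)).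
Qed.

Lemma is_pd_near v f g z l : (\forall w \near (z : R[i]^o), f w = g w) ->
  is_pd v f z l -> is_pd v g z l.
Proof.
move=> /nbhs_planeP[d d0 fg] fl; apply/is_pdP => p cp e e0.
move/is_pdP: fl => /(_ p cp e e0)[d' d'0 hd'].
have v0 : 0 < normc v + 1 by rewrite ltr_wpDl ?normc_ge0.
exists (Num.min d' (d / (normc v + 1))); first by rewrite lt_min d'0 divr_gt0.
move=> h; rewrite lt_min => /andP[hd hv].
rewrite -!fg; [exact: hd'|by rewrite subrr normc0|].
rewrite addrAC subrr add0r normcM normcR.
move: hv; rewrite ltr_pdivlMr//; apply: le_lt_trans.
by rewrite ler_wpM2l// lerDl.
Qed.

Lemma partial_near v f g z : (\forall w \near (z : R[i]^o), f w = g w) ->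
  partial v f z = partial v g z.
Proof.
move=> fg; rewrite /partial; congr (xget 0 _); apply/seteqP; split=> l.
  exact: is_pd_near.
by apply: is_pd_near; apply: filterS fg.
Qed.

Lemma is_pd_line v f z l : is_pd v f z l ->
  f (z + h%:C%C * v) @[h --> (0 : R)^'] --> f z.
Proof.
move=> /is_pdP fl; apply/cvg_csn => p cp e e0; apply/dnbhs0P.
have [d d0 hd] := fl p cp 1 ltr01.
have pl := seminorm_ge0 l cp.1.
exists (Num.min d (e / (2 + p l))); first by rewrite lt_min d0 divr_gt0//; lra.
move=> h; rewrite lt_min => /andP[/hd]; rewrite mul1r => h1 h2 _.
have -> : f (z + h%:C%C * v) - f z =
  (f (z + h%:C%C * v) - f z - h%:C%C *: l) + h%:C%C *: l by lmod E.
apply: (le_lt_trans (seminormD _ _ cp.1)); rewrite (seminormZ _ _ cp.1) normcR.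
move: h2; rewrite ltr_pdivlMr; last by lra.
have := normr_ge0 h; nra.
Qed.

(** Only continuity of f along the line in direction v is available, from [is_pd_line], and it is
    enough for the difference quotient of the product. *)
Lemma is_pdM v (phi : R[i]^o -> R[i]^o) f z a l : is_pd v phi z a -> is_pd v f z l ->
  is_pd v (fun w => (phi w : R[i]) *: f w) z ((a : R[i]) *: f z + (phi z : R[i]) *: l).
Proof.
move=> pa fl; rewrite /is_pd.
have -> : diff_quotient (fun w => (phi w : R[i]) *: f w) v z =
    (fun h => (diff_quotient phi v z h : R[i]) *: f (z + h%:C%C * v) +
              (phi z : R[i]) *: diff_quotient f v z h).
  apply/funext => h; rewrite /diff_quotient.
  have -> : (h^-1)%:C%C *: (phi (z + h%:C%C * v) - phi z) =
     (h^-1)%:C%C * ((phi (z + h%:C%C * v) : R[i]) - phi z) by [].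
  by lmod E.
apply: cvgD_tvs; last exact: cvgZc_tvs.
by apply: cvgZ_tvs; [exact: is_pd_line fl|exact: pa].
Qed.

(** The factor k is real, so that the direction v is preserved. *)
Lemma is_pd_aff v (k : R) (b : R[i]) f z l : is_pd v f (k%:C%C * z + b) l ->
  is_pd v (fun w => f (k%:C%C * w + b)) z (k%:C%C *: l).
Proof.
move=> /is_pdP fl; apply/is_pdP => p cp e e0.
have [d d0 hd] := fl p cp (e / (`|k| + 1)) ltac:(by rewrite divr_gt0).
exists (d / (`|k| + 1)) => [|h]; first by rewrite divr_gt0.
rewrite ltr_pdivlMr// => hh.
have := hd (k * h); rewrite normrM => hd'.
have -> : k%:C%C * (z + h%:C%C * v) + b = k%:C%C * z + b + (k * h)%:C%C * v.
  by rewrite rmorphM/=; ring.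
have -> : h%:C%C *: (k%:C%C *: l) = (k * h)%:C%C *: l.
  by rewrite scalerA -rmorphM mulrC.
apply: (le_trans (hd' _)).
  by apply: le_lt_trans hh; rewrite mulrC ler_wpM2l// lerDl.
rewrite mulrA ler_wpM2r// mulrAC ler_pdivrMr// ler_pM2l// lerDl//.
Qed.

Lemma pd_mean (hE : hausdorff_space E) D v f z (a M : R) (l : R -> E) : bdisk D ->
  0 <= M -> 0 <= a -> (forall t : R, 0 <= t <= a -> is_pd v f (z + t%:C%C * v) (l t)) ->
  (forall t : R, 0 <= t <= a -> scaled D M (l t)) ->
  scaled D (M * a) (f (z + a%:C%C * v) - f z).
Proof.
move=> bD M0 a0 fl Dl.
have rd t : 0 <= t <= a -> is_rd (fun t : R => f (z + t%:C%C * v)) t (l t).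
  by move=> /fl/is_pd_rd.
move: a0; rewrite le_eqVlt => /orP[/eqP a0|a0].
  rewrite -a0 rmorph0 mul0r addr0 subrr; apply: scaled0; by case: bD.
(* For M = 0 the set [scaled D M] is not handled by [bdisk_scaled]; there the increment is shown to
   vanish seminorm by seminorm. *)
move: M0; rewrite le_eqVlt => /orP[/eqP M0|M0].
  suff -> : f (z + a%:C%C * v) - f z = 0 by apply: scaled0; case: bD.
  apply: (csn_eq hE) => p cp; rewrite subr0; apply/eqP.
  rewrite eq_le (seminorm_ge0 _ cp.1) andbT.
  have := @mean_value_csn _ _ p _ a l 0 0 cp a0 rd; rewrite rmorph0 mul0r addr0 mul0r.
  rewrite scaler0 subr0; apply=> t /Dl [x _ <-].
  by rewrite -M0 rmorph0 scale0r subr0 (seminorm0 cp.1).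
have [Dc D0 cD _] := bdisk_scaled bD M0.
have := @mean_value _ _ _ _ a l Dc D0 cD a0 rd Dl.
by rewrite rmorph0 mul0r addr0 scaled_mul mulrC.
Qed.

End Rules.

Section UnitDisk.
Variable R : realType.

(** The complex plane is treated as a special case of E, with this disk in place of its norm, so
    that the calculus of bounded derivatives serves scalar and vector functions alike. *)
Definition unit_disk : set R[i]^o := [set x | normc x <= 1].

Lemma unit_diskP (r : R) (x : R[i]^o) : 0 <= r -> scaled unit_disk r x <-> normc x <= r.
Proof.
move=> r0; split=> [[y /= ny <-]|xr].
  by rewrite [_ *: _]/(_ * _) normcM normcR ger0_norm// ler_piMr.
have [r00|rn0] := eqVneq r 0.
  move: xr; rewrite r00 => x0; have -> : x = 0.
    by apply/eqP; rewrite -normc_eq0 eq_le x0 normc_ge0.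
  by apply: scaled0; rewrite /unit_disk /= normc0 ler01.
have rp : 0 < r by rewrite lt_def rn0.
exists ((r^-1)%:C%C *: x); last by rewrite scalerA -rmorphM/= divff ?scale1r.
rewrite /unit_disk /= [_ *: _]/(_ * _) normcM normcR gtr0_norm ?invr_gt0//.
by rewrite mulrC ler_pdivrMr// mul1r.
Qed.

Lemma plane_hausdorff : hausdorff_space R[i]^o.
Proof. exact: norm_hausdorff. Qed.

Lemma normc_csn : csn (normc : R[i]^o -> R).
Proof.
split; first by split=> [x y|a x]; [exact: normc_triangle|rewrite normcE -rmorphM normcM].
move=> x; apply/(@cvgrPdist_lt _ _ _ (nbhs (x : R[i]^o)) (nbhs_filter _)) => e e0; apply/nbhs_planeP; exists e => // w.
apply: le_lt_trans; rewrite ler_norml.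
have := normc_triangle (w - x) x; have := normc_triangle (x - w) w.
by rewrite !subrK [normc (x - w)]normc_sub => h1 h2; apply/andP; split; lra.
Qed.

Lemma unit_disk_bdisk : bdisk unit_disk.
Proof.
split.
- move=> a b x y ab x1 y1.
  have ab' : normc a + normc b <= 1.
    by move: ab; rewrite !normcE -rmorphD/= -(rmorph1 (real_complex R)) lecR.
  rewrite /unit_disk /= in x1 y1 *; apply: (le_trans (normc_triangle _ _)).
  rewrite ![_ *: _]/(_ * _) !normcM; apply: le_trans ab'.
  by rewrite lerD// ler_piMr// normc_ge0.
- by rewrite /unit_disk /= normc0 ler01.
- have -> : unit_disk = normc @^-1` [set x | x <= 1] by [].
  by apply: closed_comp => [x _|]; [exact: normc_csn.2|exact: closed_le].
- move=> U /nbhs_planeP[d d0 dU]; exists (2 / d); first by rewrite divr_gt0.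
  move=> x; rewrite /unit_disk /= => x1; exists ((d / 2)%:C%C *: x).
    apply: dU; rewrite subr0 [_ *: _]/(_ * _) normcM normcR ger0_norm ?divr_ge0 ?ltW//.
    by apply: (@le_lt_trans _ _ (d / 2)); [rewrite ler_piMr// divr_ge0 ?ltW|lra].
  by rewrite scalerA -rmorphM/=; have -> : 2 / d * (d / 2) = 1; [field; rewrite gt_eqF|rewrite scale1r].
Qed.

Lemma plane_bounded (D : set R[i]^o) : tvs_bounded D ->
  exists2 M : R, 0 < M & forall x, D x -> normc x <= M.
Proof. by move=> bD; exact: bounded_csn bD normc_csn. Qed.

Lemma Re_continuous : continuous (fun z : R[i]^o => complex.Re z).
Proof.
move=> x; apply/(@cvgrPdist_lt _ _ _ (nbhs (x : R[i]^o)) (nbhs_filter _)) => e e0; apply/nbhs_planeP; exists e => // w.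
apply: le_lt_trans; rewrite distrC.
have -> : complex.Re w - complex.Re x = complex.Re (w - x) by case: w x => ? ? [? ?].
exact: normc_Re.
Qed.

Lemma Im_continuous : continuous (fun z : R[i]^o => complex.Im z).
Proof.
move=> x; apply/(@cvgrPdist_lt _ _ _ (nbhs (x : R[i]^o)) (nbhs_filter _)) => e e0; apply/nbhs_planeP; exists e => // w.
apply: le_lt_trans; rewrite distrC.
have -> : complex.Im w - complex.Im x = complex.Im (w - x) by case: w x => ? ? [? ?].
exact: normc_Im.
Qed.

End UnitDisk.

Section BoundedDerivatives.
Variables (R : realType) (E : tvsType R[i]).
Implicit Types (f g : R[i]^o -> E) (z : R[i]^o) (S : set R[i]^o) (D : set E) (c : R[i]^o -> R).

Definition dir (b : bool) : R[i] := if b then 'i%C else 1.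

Lemma normc_dir b : normc (dir b) = 1.
Proof. by case: b; rewrite /dir ?normc_i ?normc1. Qed.

(* Only existence and bounds of partial derivatives are recorded: by the mean value
   inequality BD n.+1 already makes the derivatives up to order n Lipschitz. *)
Fixpoint BD (n : nat) S c D f : Prop :=
  (forall z, S z -> scaled D (c z) (f z)) /\
  (if n is m.+1 then
     (forall b z, S z -> has_partial (dir b) f z) /\
     (forall b, BD m S c D (partial (dir b) f))
   else True).

Lemma BD_val n S c D f : BD n S c D f -> forall z, S z -> scaled D (c z) (f z).
Proof. by case: n => [|n] []. Qed.

Lemma BD_pd n S c D f b z : BD n.+1 S c D f -> S z ->
  is_pd (dir b) f z (partial (dir b) f z).
Proof. by move=> [_ [H _]] Sz; apply: has_partialP; exact: H. Qed.

Lemma BD_partial n S c D f b : BD n.+1 S c D f -> BD n S c D (partial (dir b) f).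
Proof. by move=> [_ [_ H]]; exact: H. Qed.

Lemma BD_ext n S c D f g : open S -> (forall z, S z -> f z = g z) ->
  BD n S c D f -> BD n S c D g.
Proof.
move=> oS; elim: n f g => [|n IH] f g fg.
  by move=> [H _]; split=> // z Sz; rewrite -fg//; exact: H.
have nfg z : S z -> \forall w \near z, f w = g w.
  by move=> Sz; move: (open_nbhs_nbhs (conj oS Sz)); apply: filterS.
move=> H; split; first by move=> z Sz; rewrite -fg//; exact: (BD_val H).
split=> b.
  move=> z Sz; exists (partial (dir b) f z).
  have h : is_pd (dir b) f z _ := BD_pd H Sz; exact: (is_pd_near (nfg z Sz) h).
apply: IH (BD_partial b H) => z Sz; exact: partial_near (nfg z Sz).
Qed.

Lemma BD_intro (hE : hausdorff_space E) n S c D f (f' : bool -> R[i]^o -> E) : open S ->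
  (forall z, S z -> scaled D (c z) (f z)) ->
  (forall b z, S z -> is_pd (dir b) f z (f' b z)) ->
  (forall b, BD n S c D (f' b)) -> BD n.+1 S c D f.
Proof.
move=> oS Df pf Df'; split=> //; split=> b.
  by move=> z Sz; exists (f' b z); exact: pf.
apply: BD_ext (Df' b) => // z Sz; apply/esym/is_pd_partial => //; exact: pf.
Qed.

Lemma BD_le n m S S' c c' D D' f : absolutely_convex D -> D 0 -> (m <= n)%N -> S' `<=` S ->
  D `<=` D' -> (forall z, S' z -> c z <= c' z) -> (forall z, S' z -> 0 <= c z) -> BD n S c D f -> BD m S' c' D' f.
Proof.
move=> Dc D0 + SS DD cc c0.
have val k g : BD k S c D g -> forall z, S' z -> scaled D' (c' z) (g z).
  move=> H z Sz; have z1 := cc z Sz.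
  by have [y /DD Dy <-] := scaled_le Dc D0 (c0 z Sz) z1 (BD_val H (SS _ Sz)); exists y.
elim: n m f => [|n IH] [|m] f //.
- by move=> _ H; split=> //; exact: (val _ _ H).
- by move=> _ H; split=> //; exact: (val _ _ H).
- move=> mn H; split; first exact: (val _ _ H).
  split=> b; first by move=> z /SS; exact: H.2.1.
  by apply: IH => //; exact: BD_partial.
Qed.

Lemma BD_lt n m S c D f : absolutely_convex D -> D 0 -> (m <= n)%N ->
  BD n S c D f -> BD m S c D f.
Proof.
move=> _ _; elim: n m f => [|n IH] [|m] f // mn H.
- by split=> //; exact: (BD_val H).
- split; first exact: (BD_val H).
  by split; [exact: H.2.1|move=> b; apply: IH => //; exact: BD_partial].
Qed.

Lemma BD_union n S S' c D f : BD n S c D f -> BD n S' c D f -> BD n (S `|` S') c D f.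
Proof.
elim: n f => [|n IH] f H H'.
  by split=> // z [] Sz; [exact: (BD_val H)|exact: (BD_val H')].
split; first by move=> z [] Sz; [exact: (BD_val H)|exact: (BD_val H')].
split; first by move=> b z [] Sz; [exact: (H.2.1)|exact: (H'.2.1)].
by move=> b; apply: IH; exact: BD_partial.
Qed.

Lemma BD_cst0 (hE : hausdorff_space E) n S c D : open S -> D 0 -> BD n S c D (fun=> 0).
Proof.
move=> oS D0; elim: n => [|n IH]; first by split=> // z _; exact: scaled0.
apply: (BD_intro hE (f' := fun _ _ => 0)) => // [z _|b z _]; first exact: scaled0.
exact: is_pd_cst.
Qed.

Lemma BD_cst (hE : hausdorff_space E) n S c D x : open S -> D 0 ->
  (forall z, S z -> scaled D (c z) x) -> BD n S c D (fun=> x).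
Proof.
move=> oS D0 Dx; case: n => [|n]; first by split.
apply: (BD_intro hE (f' := fun _ _ => 0)) => // [b z _|b]; first exact: is_pd_cst.
exact: BD_cst0.
Qed.

Lemma BD_add (hE : hausdorff_space E) n S c c' D f g : open S -> absolutely_convex D -> D 0 ->
  (forall z, S z -> 0 <= c z) -> (forall z, S z -> 0 <= c' z) ->
  BD n S c D f -> BD n S c' D g ->
  BD n S (fun z => c z + c' z) D (fun z => f z + g z).
Proof.
move=> oS Dc D0 c0 c'0; elim: n f g => [|n IH] f g Hf Hg.
  split=> // z Sz; apply: scaledD => //; first exact: c0.
  - exact: c'0.
  - exact: (BD_val Hf).
  - exact: (BD_val Hg).
apply: (BD_intro hE (f' := fun b z => partial (dir b) f z + partial (dir b) g z)) => //.
- move=> z Sz; apply: scaledD => //; first exact: c0.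
  - exact: c'0.
  - exact: (BD_val Hf).
  - exact: (BD_val Hg).
- by move=> b z Sz; apply: is_pdD; [exact: BD_pd Hf Sz|exact: BD_pd Hg Sz].
- by move=> b; apply: IH; exact: BD_partial.
Qed.

Lemma BD_scale (hE : hausdorff_space E) n S c D f (k : R[i]) : open S -> absolutely_convex D -> D 0 ->
  (forall z, S z -> 0 <= c z) -> BD n S c D f ->
  BD n S (fun z => normc k * c z) D (fun z => k *: f z).
Proof.
move=> oS Dc D0 c0; elim: n f => [|n IH] f H.
  by split=> // z Sz; apply: (scaledZ Dc D0 (c0 z Sz)) => //; exact: (BD_val H).
apply: (BD_intro hE (f' := fun b z => k *: partial (dir b) f z)) => //.
- by move=> z Sz; apply: (scaledZ Dc D0 (c0 z Sz)) => //; exact: (BD_val H).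
- by move=> b z Sz; apply: is_pdZ; exact: BD_pd H Sz.
- by move=> b; apply: IH; exact: BD_partial.
Qed.

Lemma BD_eqc n S c c' D f : (forall z, S z -> c z = c' z) -> BD n S c D f -> BD n S c' D f.
Proof.
move=> cc; elim: n f => [|n IH] f H.
  by split=> // z Sz; rewrite -cc//; exact: (BD_val H).
split; first by move=> z Sz; rewrite -cc//; exact: (BD_val H).
split; first exact: H.2.1.
by move=> b; apply: IH; exact: BD_partial.
Qed.

Lemma BD_sum (hE : hausdorff_space E) n S (c : nat -> R[i]^o -> R) D (f : nat -> R[i]^o -> E) (K : nat) :
  open S -> absolutely_convex D -> D 0 ->
  (forall k z, S z -> 0 <= c k z) -> (forall k, (k < K)%N -> BD n S (c k) D (f k)) ->
  BD n S (fun z => \sum_(k < K) c k z) D (fun z => \sum_(k < K) f k z).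
Proof.
move=> oS Dc D0 c0; elim: K => [|K IH] H.
  have -> : (fun z => \sum_(k < 0) f k z) = (fun=> 0) by apply/funext => z; rewrite big_ord0.
  exact: BD_cst0.
have -> : (fun z => \sum_(k < K.+1) f k z) = (fun z => \sum_(k < K) f k z + f K z).
  by apply/funext => z; rewrite big_ord_recr.
have -> : (fun z => \sum_(k < K.+1) c k z) = (fun z => \sum_(k < K) c k z + c K z).
  by apply/funext => z; rewrite big_ord_recr.
apply: BD_add => //; first by move=> z Sz; apply: sumr_ge0 => k _; exact: c0.
- by move=> z Sz; exact: c0.
- by apply: IH => k kK; apply: H; exact: ltnW.
- exact: H.
Qed.

Lemma BD_aff (hE : hausdorff_space E) n S c D f (k : R) (b : R[i]) : open S ->
  absolutely_convex D -> D 0 -> (forall z, S z -> 0 <= c z) ->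
  BD n S c D f ->
  BD n [set z | S (k%:C%C * z + b)] (fun z => Num.max 1 `|k| ^+ n * c (k%:C%C * z + b)) D
     (fun z => f (k%:C%C * z + b)).
Proof.
move=> oS Dc D0 c0.
have oS' : open [set z : R[i]^o | S (k%:C%C * z + b)].
  apply: open_comp oS => z _.
  apply: (@cvgD_tvs _ R[i]^o _ (nbhs z) _ (fun z => k%:C%C * z) (fun=> b)).
    apply: (@cvgZc_tvs _ R[i]^o _ (nbhs z) _ id); exact: cvg_id.
  exact: cvg_cst.
(* Each derivative brings out a factor k; the maximum with 1 keeps the bound increasing in the
   order, since [BD] uses one bound for all orders up to n. *)
set m := Num.max 1 _.
have m1 : 1 <= m by rewrite le_max lexx.
have kn : `|k| <= m by rewrite le_max lexx orbT.
have mn j : 1 <= m ^+ j by rewrite exprn_ege1.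
move: n f; elim=> [|n IH] {}f H.
  split=> // z Sz; rewrite expr0 mul1r; exact: (BD_val H).
have val z : S (k%:C%C * z + b) -> 0 <= c (k%:C%C * z + b) <= m ^+ n.+1 * c (k%:C%C * z + b).
  move=> Sz; rewrite c0//= ler_peMl// c0//.
apply: (BD_intro hE (f' := fun d z => k%:C%C *: partial (dir d) f (k%:C%C * z + b))) => //.
- move=> z Sz; have /andP[h1 h2] := val z Sz.
  by apply: scaled_le h2 _ _ => //; exact: (BD_val H).
- by move=> d z Sz; apply: is_pd_aff; exact: BD_pd H Sz.
- move=> d; have := IH _ (BD_partial d H).
  move=> /(BD_scale hE k%:C%C oS' Dc D0) h.
  have p0 z : S (k%:C%C * z + b) -> 0 <= m ^+ n * c (k%:C%C * z + b).
    by move=> Sz; rewrite mulr_ge0 ?c0// (le_trans ler01).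
  apply: (BD_le Dc D0 (leqnn n) _ _ _ _ (h p0)) => // z Sz; last first.
    by rewrite mulr_ge0 ?normc_ge0 ?p0.
  rewrite normcR.
  by rewrite mulrA exprS ler_wpM2r ?c0// ler_wpM2r// (le_trans ler01).
Qed.

End BoundedDerivatives.

Arguments dir {R} b.

Section BoundedProducts.
Variables (R : realType) (E : tvsType R[i]) (hE : hausdorff_space E).
Let U := @unit_disk R.

(** By the Leibniz rule every derivative doubles the number of products, whence the factor 2 ^ n. *)
Lemma BD_mul n (S : set R[i]^o) (a c : R[i]^o -> R) (D : set E) (phi : R[i]^o -> R[i]^o)
    (f : R[i]^o -> E) : open S -> absolutely_convex D -> D 0 ->
  (forall z, S z -> 0 <= a z) -> (forall z, S z -> 0 <= c z) ->
  BD n S a U phi -> BD n S c D f ->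
  BD n S (fun z => 2 ^+ n * (a z * c z)) D (fun z => (phi z : R[i]) *: f z).
Proof.
move=> oS Dc D0 a0 c0; elim: n phi f => [|n IH] phi f Hp Hf.
  split=> // z Sz; rewrite expr0 mul1r; apply: (scaledZ Dc D0 (c0 z Sz)).
    by rewrite ler_wpM2r ?c0//; apply/unit_diskP; [exact: a0|exact: (BD_val Hp)].
  exact: (BD_val Hf).
have [Uc U0 _ _] := unit_disk_bdisk R.
apply: (BD_intro hE (f' := fun b z =>
  (partial (dir b) phi z : R[i]) *: f z + (phi z : R[i]) *: partial (dir b) f z)) => //.
- move=> z Sz; apply: (scaledZ Dc D0 (c0 z Sz)) (BD_val Hf Sz).
  have /(unit_diskP _ (a0 z Sz)) h := BD_val Hp Sz.
  apply: (le_trans (ler_wpM2r (c0 z Sz) h)); rewrite ler_peMl ?mulr_ge0 ?a0 ?c0//.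
  by rewrite exprn_ege1// ler1n.
- by move=> b z Sz; apply: is_pdM; [exact: BD_pd Hp Sz|exact: BD_pd Hf Sz].
- move=> b; have h1 := IH _ _ (BD_partial b Hp) (BD_lt Dc D0 (leqnSn n) Hf).
  have h2 := IH _ _ (BD_lt Uc U0 (leqnSn n) Hp) (BD_partial b Hf).
  have pos z : S z -> 0 <= 2 ^+ n * (a z * c z) :> R.
    by move=> Sz; rewrite !mulr_ge0 ?a0 ?c0// exprn_ge0.
  have := BD_add hE oS Dc D0 pos pos h1 h2.
  apply: BD_eqc => z Sz; rewrite exprS; ring.
Qed.

End BoundedProducts.

(** * Mean value inequalities in the plane, differentiation of series, symmetry of second
    derivatives *)

Section LipschitzSeries.
Variables (R : realType) (E : tvsType R[i]) (hE : hausdorff_space E).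
Implicit Types (f g : R[i]^o -> E) (S : set R[i]^o) (D : set E).

Lemma pd_mean2 D f v (z : R[i]) (a M : R) (l : R -> E) : bdisk D -> 0 <= M ->
  (forall t : R, `|t| <= `|a| -> is_pd v f (z + t%:C%C * v) (l t)) ->
  (forall t : R, `|t| <= `|a| -> scaled D M (l t)) ->
  scaled D (M * `|a|) (f (z + a%:C%C * v) - f z).
Proof.
move=> bD M0 fl Dl; have [a0|a0] := leP 0 a.
  rewrite ger0_norm//; apply: (pd_mean hE (l := l)) => // t /andP[t0 ta].
    by apply: fl; rewrite !ger0_norm.
  by apply: Dl; rewrite !ger0_norm.
have na0 : 0 <= - a by lra.
have := @pd_mean _ _ hE D v f (z + a%:C%C * v) (- a) M (fun t => l (a + t)) bD M0 na0.
rewrite ltr0_norm// -addrA -mulrDl -rmorphD subrr rmorph0 mul0r addr0 => h.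
rewrite -opprB; case: bD => Dc D0 _ _; apply: scaledN => //; first by rewrite mulr_ge0.
apply: h => t /andP[t0 ta].
  rewrite -addrA -mulrDl -rmorphD; apply: fl.
  by rewrite ler0_norm ?(ltr0_norm a0); lra.
by apply: Dl; rewrite ler0_norm ?(ltr0_norm a0); lra.
Qed.

Lemma BD_lip S D f (z : R[i]) (M s t : R) : bdisk D -> 0 <= M -> BD 1 S (fun=> M) D f ->
  (forall x y : R, `|x| <= `|s| -> `|y| <= `|t| -> S (z + x%:C%C * 1 + y%:C%C * 'i%C)) ->
  scaled D (M * (`|s| + `|t|)) (f (z + s%:C%C * 1 + t%:C%C * 'i%C) - f z).
Proof.
move=> bD M0 H HS; case: (bD) => Dc D0 _ _.
have -> : f (z + s%:C%C * 1 + t%:C%C * 'i%C) - f z =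
  (f (z + s%:C%C * 1 + t%:C%C * 'i%C) - f (z + s%:C%C * 1)) + (f (z + s%:C%C * 1) - f z).
  by lmod E.
rewrite mulrDr addrC; apply: scaledD; rewrite ?mulr_ge0//.
  apply: (@pd_mean2 _ _ _ _ _ _ (fun y => partial 'i%C f (z + s%:C%C * 1 + y%:C%C * 'i%C))) => // y yt.
    by apply: (BD_pd (b := true) H); exact: HS.
  by apply: (BD_val (BD_partial true H)); exact: HS.
have HS' x : `|x| <= `|s| -> S (z + x%:C%C * 1).
  by move=> xs; have := HS x 0 xs; rewrite rmorph0 mul0r addr0; apply; rewrite normr0.
apply: (@pd_mean2 _ _ _ _ _ _ (fun x => partial 1 f (z + x%:C%C * 1))) => // x xs.
  by apply: (BD_pd (b := false) H); exact: HS'.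
by apply: (BD_val (BD_partial false H)); exact: HS'.
Qed.

Lemma plane_split (w z : R[i]) :
  w = z + (complex.Re (w - z))%:C%C * 1 + (complex.Im (w - z))%:C%C * 'i%C.
Proof.
by rewrite mulr1 -addrA [_ * 'i%C]mulrC -complexE addrC subrK.
Qed.

Lemma BD_lip_plane D f (z w : R[i]) (M : R) : bdisk D -> 0 <= M -> BD 1 setT (fun=> M) D f ->
  scaled D (M * (2 * normc (w - z))) (f w - f z).
Proof.
move=> bD M0 H; have := @BD_lip setT D f z M _ (complex.Im (w - z)) bD M0 H.
move=> /(_ (complex.Re (w - z)) (fun _ _ _ _ => I)); rewrite -plane_split.
case: (bD) => Dc D0 _ _; apply: scaled_le => //.
  by rewrite mulr_ge0// addr_ge0.
rewrite ler_wpM2l//; have := normc_Re (w - z); have := normc_Im (w - z); lra.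
Qed.

Lemma open_ball_box S (z : R[i]^o) : open S -> S z -> exists2 d : R, 0 < d &
  forall x y : R, `|x| + `|y| < d -> S (z + x%:C%C * 1 + y%:C%C * 'i%C).
Proof.
move=> oS Sz; have /nbhs_planeP[d d0 dS] := open_nbhs_nbhs (conj oS Sz).
exists d => // x y xy; apply: dS; rewrite -[z + _ + _]addrA addrAC subrr add0r.
rewrite (le_lt_trans (normc_triangle _ _))// !normcM !normcR ?normc1 ?normr1 normc_i !mulr1.
exact: xy.
Qed.

Lemma BD_cont S D f (z : R[i]^o) (M : R) : bdisk D -> open S -> S z -> 0 <= M ->
  BD 1 S (fun=> M) D f -> {for z, continuous f}.
Proof.
move=> bD oS Sz M0 H; have [d d0 dS] := open_ball_box oS Sz.
apply/(@cvg_csn _ _ _ (nbhs z) (nbhs_filter z)) => p cp e e0.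
case: (bD) => _ _ _ boD; have [r r0 hr] := bounded_csn boD cp.
have q0 : 0 < r * M * 2 + 1 by have := mulr_ge0 (ltW r0) M0; lra.
apply/nbhs_planeP; exists (Num.min (d / 2) (e / (r * M * 2 + 1))).
  by rewrite lt_min !divr_gt0.
move=> w; rewrite lt_min => /andP[w1 w2].
have a1 := normc_Re (w - z); have a2 := normc_Im (w - z).
have := @BD_lip S D f z M (complex.Re (w - z)) (complex.Im (w - z)) bD M0 H.
rewrite -plane_split => h.
have {h}[|y Dy <-] := h; first by move=> x y xs yt; apply: dS; lra.
rewrite (seminormZ _ _ cp.1) normcR ger0_norm; last by rewrite mulr_ge0// addr_ge0.
apply: (le_lt_trans (ler_wpM2l _ (hr _ Dy))); first by rewrite mulr_ge0// addr_ge0.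
move: w2; rewrite ltr_pdivlMr//.
have := normc_ge0 (w - z); have := mulr_ge0 (ltW r0) M0 => rM n0.
apply: le_lt_trans.
have : (`|complex.Re (w - z)| + `|complex.Im (w - z)|) * (r * M) <= 2 * normc (w - z) * (r * M).
  by rewrite ler_wpM2r//; lra.
nra.
Qed.

Section Series.
Variables (S : set R[i]^o) (D : set E) (e : nat -> R) (s M0 : R) (M : R[i]^o -> R).
Hypotheses (oS : open S) (bD : bdisk D) (e0 : forall k, 0 <= e k)
  (es : forall n, \sum_(k < n) e k <= s)
  (M_ge0 : forall z, S z -> 0 <= M z) (M_le : forall z, S z -> M z <= M0).

(** The mean value inequality bounds the increments of every finite tail beyond K by the same small
    multiple of |h|. In the limit, so are those of the whole tail, and the first K terms are
    differentiated directly. *)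
Lemma is_pd_series (u : nat -> R[i]^o -> E) f b z l :
  (forall k, BD 1 S (fun z => e k * M z) D (u k)) ->
  (forall z, S z -> (fun n => \sum_(k < n) u k z) @ \oo --> f z) -> S z ->
  (fun n => \sum_(k < n) partial (dir b) (u k) z) @ \oo --> l ->
  is_pd (dir b) f z l.
Proof.
move=> Hu Hf Sz Hl; case: (bD) => Dc D0 cD boD.
have M00 : 0 <= M0 := le_trans (M_ge0 Sz) (M_le Sz).
have [s' s'cv s'le] := psum_cvg e0 es.
apply/is_pdP => p cp eps eps0; have [r r0 hr] := bounded_csn boD cp.
have pscaled t x : 0 <= t -> scaled D t x -> p x <= t * r.
  move=> t0 [y Dy <-]; rewrite (seminormZ _ _ cp.1) normcR ger0_norm//.
  by rewrite ler_wpM2l// hr.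
have q0 : 0 < r * M0 + 1 by have := mulr_ge0 (ltW r0) M00; lra.
(* One third of eps each goes to the increment of the tail, to the tail of the derivatives and to
   the differentiated partial sum. *)
have [K hK] : exists K, (s' - \sum_(k < K) e k) * (r * M0) <= eps / 3.
  move/cvgrPdist_lt: s'cv => /(_ (eps / 3 / (r * M0 + 1)))[|N _ hN].
    by rewrite !divr_gt0.
  exists N; have /ltW := hN N (leqnn N); rewrite /= ger0_norm ?subr_ge0 ?s'le//.
  rewrite ler_pdivlMr// => h.
  apply: le_trans h; apply: ler_wpM2l; [by rewrite subr_ge0 s'le|lra].
set tK := s' - \sum_(k < K) e k in hK; have tK0 : 0 <= tK by rewrite subr_ge0 s'le.
have /nbhs_planeP[d d0 dS] := open_nbhs_nbhs (conj oS Sz).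
pose fK w := \sum_(k < K) u k w; pose lK := \sum_(k < K) partial (dir b) (u k) z.
have pdK n w : S w -> is_pd (dir b) (fun w => \sum_(k < n) u k w) w
    (\sum_(k < n) partial (dir b) (u k) w).
  move=> Sw; elim: n => [|n IH].
    rewrite big_ord0; have -> : (fun w => \sum_(k < 0) u k w) = fun=> 0.
      by apply/funext => ?; rewrite big_ord0.
    exact: is_pd_cst.
  rewrite big_ord_recr/=; have -> : (fun w => \sum_(k < n.+1) u k w) =
      (fun w => \sum_(k < n) u k w + u n w) by apply/funext => ?; rewrite big_ord_recr.
  by apply: is_pdD => //; exact: BD_pd (Hu n) Sw.
have /is_pdP/(_ p cp (eps / 3))[|d' d'0 hd'] := pdK K z Sz; first by lra.
exists (Num.min d d') => [|h]; first by rewrite lt_min d0.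
rewrite lt_min => /andP[hd hdd'].
have Sh t : `|t| <= `|h| -> S (z + t%:C%C * dir b).
  move=> th; apply: dS; rewrite addrAC subrr add0r normcM normcR normc_dir mulr1.
  exact: le_lt_trans hd.
(* The mean value inequality runs along a segment, so the pointwise bound M is replaced here by its
   uniform bound M0. *)
have incr : scaled D (tK * M0 * `|h|)
   ((f (z + h%:C%C * dir b) - f z) - (fK (z + h%:C%C * dir b) - fK z)).
  apply: (@scaled_lim _ _ hE D _ _ \oo _ (fun n =>
     (\sum_(k < n) u k (z + h%:C%C * dir b) - \sum_(k < n) u k z)
       - (fK (z + h%:C%C * dir b) - fK z))) => //.
  - by rewrite !mulr_ge0.
  - apply: cvgB_tvs; last exact: cvg_cst.
    by apply: cvgB_tvs; apply: Hf => //; exact: Sh.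
  - exists K => // n /= Kn.
    have -> : \sum_(k < n) u k (z + h%:C%C * dir b) - \sum_(k < n) u k z -
        (fK (z + h%:C%C * dir b) - fK z) =
      (\sum_(k < n) u k (z + h%:C%C * dir b) - fK (z + h%:C%C * dir b))
        - (\sum_(k < n) u k z - fK z) by lmod E.
    apply: (@pd_mean2 D (fun w => \sum_(k < n) u k w - fK w) (dir b) z h (tK * M0)
      (fun t => \sum_(k < n) partial (dir b) (u k) (z + t%:C%C * dir b)
          - \sum_(k < K) partial (dir b) (u k) (z + t%:C%C * dir b))) => //.
    + by rewrite mulr_ge0.
    + move=> t th; have St := Sh t th.
      by apply: is_pdB; [exact: pdK n _ St|exact: pdK K _ St].
    + move=> t th; have St := Sh t th.
      apply: (@scaled_le _ _ D (tK * M (z + t%:C%C * dir b))) => //.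
      * by rewrite mulr_ge0 ?M_ge0.
      * by rewrite ler_wpM2l ?M_le.
      have := @scaled_psum_sub _ _ D (fun k => partial (dir b) (u k) (z + t%:C%C * dir b))
         (fun k => e k * M (z + t%:C%C * dir b)) (s' * M (z + t%:C%C * dir b)) K n Dc D0.
      rewrite -mulr_suml -mulrBl; apply=> //.
      * by move=> k; rewrite mulr_ge0 ?M_ge0.
      * by move=> k; exact: (BD_val (BD_partial b (Hu k)) St).
      * by move=> m; rewrite -mulr_suml ler_wpM2r ?M_ge0.
have ltail : scaled D (tK * M0) (l - lK).
  apply: (@scaled_le _ _ D (tK * M z)) => //.
  - by rewrite mulr_ge0 ?M_ge0.
  - by rewrite ler_wpM2l ?M_le.
  have := @scaled_psum_lim _ _ hE D (fun k => partial (dir b) (u k) z)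
     (fun k => e k * M z) (s' * M z) l K bD.
  rewrite -mulr_suml -mulrBl; apply=> //.
  - by move=> k; rewrite mulr_ge0 ?M_ge0.
  - by move=> k; exact: (BD_val (BD_partial b (Hu k)) Sz).
  - by move=> m; rewrite -mulr_suml ler_wpM2r ?M_ge0.
have -> : f (z + h%:C%C * dir b) - f z - h%:C%C *: l =
  ((f (z + h%:C%C * dir b) - f z) - (fK (z + h%:C%C * dir b) - fK z))
  + ((fK (z + h%:C%C * dir b) - fK z - h%:C%C *: lK) - h%:C%C *: (l - lK)) by lmod E.
apply: (le_trans (seminormD _ _ cp.1)).
have q1 : 0 <= tK * M0 * `|h| by rewrite !mulr_ge0.
have h1 := pscaled _ _ q1 incr.
have h2 := hd' h hdd'.
have q2 : 0 <= tK * M0 by rewrite mulr_ge0.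
have h3 := pscaled _ _ q2 ltail.
have h4 := seminormD (fK (z + h%:C%C * dir b) - fK z - h%:C%C *: lK) (- (h%:C%C *: (l - lK))) cp.1.
move: h4; rewrite (seminormN _ cp.1) (seminormZ _ _ cp.1) normcR => h4.
have h0 := normr_ge0 h.
have h5 : tK * M0 * r <= eps / 3 by apply: le_trans hK; rewrite -mulrA [M0 * r]mulrC.
have h6 : p (l - lK) <= eps / 3 by exact: le_trans h3 h5.
have h7 := ler_wpM2l h0 h6.
have h8 := ler_wpM2l h0 h5.
have h9 : tK * M0 * `|h| * r = `|h| * (tK * M0 * r) by ring.
rewrite h9 in h1; rewrite -/fK -/lK in h2; move: h1 h2 h4 h7 h8.
move: (`|h| * (tK * M0 * r)) => q; lra.
Qed.

(** The series of derivatives has the same majorant, hence converges by completeness; [is_pd_series]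
    identifies its sum, and the induction on n continues with it. *)
Lemma BD_series n (u : nat -> R[i]^o -> E) f : series_complete E ->
  (forall k, BD n S (fun z => e k * M z) D (u k)) ->
  (forall z, S z -> (fun n => \sum_(k < n) u k z) @ \oo --> f z) ->
  BD n S (fun z => s * M z) D f.
Proof.
move=> sc; case: (bD) => Dc D0 _ _.
have lim (v : nat -> R[i]^o -> E) g z m : (forall k, BD m S (fun z => e k * M z) D (v k)) ->
    S z -> (fun n => \sum_(k < n) v k z) @ \oo --> (g z : E) -> scaled D (s * M z) (g z).
  move=> Hv Sz Hg; apply: (scaled_psum_lim0 hE (c := fun k => e k * M z) bD _ _ _ Hg).
  - by move=> k; rewrite mulr_ge0 ?M_ge0.
  - by move=> k; exact: (BD_val (Hv k)).
  - by move=> m'; rewrite -mulr_suml ler_wpM2r ?M_ge0.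
elim: n u f => [|n IH] u f Hu Hf.
  by split=> // z Sz; apply: (lim _ _ _ _ Hu Sz); exact: Hf.
have ex b z : exists l, S z -> (fun n => \sum_(k < n) partial (dir b) (u k) z) @ \oo --> (l : E).
  have [Sz|nSz] := pselect (S z); last by exists 0.
  have [l hl] := sc D bD (fun k => partial (dir b) (u k) z) (fun k => e k * M z) (s * M z)
     ltac:(by move=> k; rewrite mulr_ge0 ?M_ge0)
     ltac:(by move=> m; rewrite -mulr_suml ler_wpM2r ?M_ge0)
     ltac:(by move=> k; exact: (BD_val (BD_partial b (Hu k)))).
  by exists l.
have [f' hf'] : exists f' : bool -> R[i]^o -> E, forall b z, S z ->
    (fun n => \sum_(k < n) partial (dir b) (u k) z) @ \oo --> f' b z.
  exists (fun b z => projT1 (cid (ex b z))) => b z; exact: (projT2 (cid (ex b z))).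
apply: (BD_intro hE (f' := f')) => //.
- by move=> z Sz; apply: (lim _ _ _ _ Hu Sz); exact: Hf.
- move=> b z Sz; apply: (is_pd_series (u := u)) => //; last exact: hf'.
  by move=> k; apply: BD_lt (Hu k).
- by move=> b; apply: (IH (fun k => partial (dir b) (u k))) => [k|z Sz]; [exact: BD_partial|exact: hf'].
Qed.

End Series.

Lemma is_rdB (u v : R -> E) t l m : is_rd u t l -> is_rd v t m ->
  is_rd (fun t => u t - v t) t (l - m).
Proof.
move=> ul vm p cp e e0.
have [d d0 hd] := ul p cp (e / 2) ltac:(lra).
have [d' d'0 hd'] := vm p cp (e / 2) ltac:(lra).
exists (Num.min d d') => [|h]; first by rewrite lt_min d0.
rewrite lt_min => /andP[/hd h1 /hd' h2].
have -> : u (t + h) - v (t + h) - (u t - v t) - h%:C%C *: (l - m) =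
  (u (t + h) - u t - h%:C%C *: l) - (v (t + h) - v t - h%:C%C *: m) by lmod E.
by apply: (le_trans (seminormD _ _ cp.1)); rewrite (seminormN _ cp.1); lra.
Qed.

(** Two mean value estimates: one in direction v for the difference of f between two parallel
    segments, and one in direction v' for its derivative. *)
Lemma second_difference p S f f1 f12 (v v' z : R[i]) (A : E) (e h : R) : csn p -> 0 < h ->
  (forall z, S z -> is_pd v f z (f1 z)) -> (forall z, S z -> is_pd v' f1 z (f12 z)) ->
  (forall s t : R, 0 <= s <= h -> 0 <= t <= h -> S (z + s%:C%C * v + t%:C%C * v')) ->
  (forall s t : R, 0 <= s <= h -> 0 <= t <= h ->
     p (f12 (z + s%:C%C * v + t%:C%C * v') - A) <= e) ->
  p (f (z + h%:C%C * v + h%:C%C * v') - f (z + h%:C%C * v) - (f (z + h%:C%C * v') - f z)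
     - (h ^+ 2)%:C%C *: A) <= e * h ^+ 2.
Proof.
move=> cp h0 pf pf1 HS Hp.
have hh : 0 <= h <= h by rewrite lexx ltW.
have h00 : (0:R) <= 0 <= h by rewrite lexx ltW.
pose u s := f (z + h%:C%C * v' + s%:C%C * v) - f (z + s%:C%C * v).
have := @mean_value_csn _ _ p u h
  (fun s => f1 (z + h%:C%C * v' + s%:C%C * v) - f1 (z + s%:C%C * v)) (h%:C%C *: A) (e * h) cp h0.
rewrite /u rmorph0 mul0r !addr0 scalerA -rmorphM -expr2 -mulrA -expr2.
rewrite [z + h%:C%C * v' + _]addrAC; apply.
- move=> s sh; apply: is_rdB; apply: is_pd_rd; apply: pf.
    by rewrite addrAC; apply: HS.
  by have := HS s 0 sh h00; rewrite rmorph0 mul0r addr0.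
- move=> s sh.
  have := @mean_value_csn _ _ p (fun t => f1 (z + s%:C%C * v + t%:C%C * v')) h
    (fun t => f12 (z + s%:C%C * v + t%:C%C * v')) A e cp h0.
  rewrite rmorph0 mul0r !addr0 [z + h%:C%C * v' + _]addrAC; apply.
  + by move=> t th; apply: is_pd_rd; apply: pf1; exact: HS.
  + by move=> t th; exact: Hp.
Qed.

(** The same second difference, divided by h ^ 2, is close to both mixed derivatives. *)
Lemma schwarz S f f1 f2 f12 f21 (v v' : R[i]) (z : R[i]^o) : normc v <= 1 -> normc v' <= 1 -> open S -> S z ->
  (forall z, S z -> is_pd v f z (f1 z)) -> (forall z, S z -> is_pd v' f z (f2 z)) ->
  (forall z, S z -> is_pd v' f1 z (f12 z)) -> (forall z, S z -> is_pd v f2 z (f21 z)) ->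
  {for z, continuous f12} -> {for z, continuous f21} -> f12 z = f21 z.
Proof.
move=> v1 v'1 oS Sz pf1 pf2 pf12 pf21 c12 c21; apply: (csn_eq hE) => p cp.
apply/eqP; rewrite eq_le (seminorm_ge0 _ cp.1) andbT; apply/ler_addgt0Pr => e e0.
rewrite add0r.
have e2 : 0 < e / 2 by lra.
have N1 : \forall w \near z, p (f12 w - f12 z) < e / 2.
  by move/cvg_csn: c12; apply.
have N2 : \forall w \near z, p (f21 w - f21 z) < e / 2.
  by move/cvg_csn: c21; apply.
have /nbhs_planeP : nbhs z (S `&` ([set w | p (f12 w - f12 z) < e / 2] `&`
    [set w | p (f21 w - f21 z) < e / 2])).
  by apply: filterI; [exact: open_nbhs_nbhs|exact: filterI].
case=> d d0 hd; pose h := d / 4; have h0 : 0 < h by rewrite /h; lra.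
have inb s t : 0 <= s <= h -> 0 <= t <= h -> normc (z + s%:C%C * v + t%:C%C * v' - z) < d.
  move=> /andP[s0 sh] /andP[t0 th].
  rewrite -[z + _ + _]addrA addrAC subrr add0r (le_lt_trans (normc_triangle _ _))// !normcM !normcR.
  rewrite !ger0_norm//; have := ler_wpM2l s0 v1; have := ler_wpM2l t0 v'1.
  by rewrite /h in sh th; lra.
have A1 := @second_difference p S f f1 f12 v v' z (f12 z) (e / 2) h cp h0 pf1 pf12
  (fun s t sh th => (hd _ (inb s t sh th)).1)
  (fun s t sh th => ltW (hd _ (inb s t sh th)).2.1).
have inb' s t : 0 <= s <= h -> 0 <= t <= h -> normc (z + s%:C%C * v' + t%:C%C * v - z) < d.
  by move=> sh th; rewrite [z + _ + _]addrAC; exact: inb.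
have A2 := @second_difference p S f f2 f21 v' v z (f21 z) (e / 2) h cp h0 pf2 pf21
  (fun s t sh th => (hd _ (inb' s t sh th)).1)
  (fun s t sh th => ltW (hd _ (inb' s t sh th)).2.2).
rewrite [z + h%:C%C * v' + _]addrAC in A2.
have h20 : 0 < h ^+ 2 by rewrite exprn_gt0.
rewrite -(ler_pM2l h20) -{1}(ger0_norm (ltW h20)) -normcR -(seminormZ _ _ cp.1).
set X := f _ in A1 A2; set Y := f _ in A1 A2; set Z := f _ in A1 A2.
have -> : (h ^+ 2)%:C%C *: (f12 z - f21 z) =
  (X - Z - (Y - f z) - (h ^+ 2)%:C%C *: f21 z) - (X - Y - (Z - f z) - (h ^+ 2)%:C%C *: f12 z).
  by lmod E.
by apply: (le_trans (seminormD _ _ cp.1)); rewrite (seminormN _ cp.1); lra.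
Qed.

End LipschitzSeries.

(** * Profiles, strips and their exhaustion *)

Section Profiles.
Variable R : realType.
Implicit Types (F G : R -> R) (a b : R).

Lemma profileP F : profile F -> exists c H : R, [/\ 0 < c, forall t, c <= F t <= H &
  forall e : R, 0 < e -> exists2 d : R, 0 < d & forall s t, `|s - t| < d -> `|F s - F t| < e].
Proof.
move=> [F0 uF infF supF].
have lb t : (ereal_inf (range (EFin \o F)) <= (F t)%:E)%E.
  by apply: ereal_inf_lbound; exists t.
have ub t : ((F t)%:E <= ereal_sup (range (EFin \o F)))%E.
  by apply: ereal_sup_ubound; exists t.
have fi : ereal_inf (range (EFin \o F)) \is a fin_num.
  rewrite fin_numElt (lt_trans _ infF) ?ltNyr//=.
  by rewrite (le_lt_trans (lb 0)) ?ltry.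
have fs : ereal_sup (range (EFin \o F)) \is a fin_num.
  rewrite fin_numElt supF andbT (lt_le_trans _ (ub 0))//.
  exact: ltNyr.
exists (fine (ereal_inf (range (EFin \o F)))), (fine (ereal_sup (range (EFin \o F)))); split.
- by rewrite -lte_fin fineK.
- by move=> t; rewrite -!lee_fin !fineK// lb ub.
- move/unif_continuousP: uF => uF e e0.
  have [d d0 hd] := uF e e0.
  by exists d => // s t st; have := hd (s, t); apply.
Qed.

Lemma profile_cont F : profile F -> continuous F.
Proof.
move=> /profileP[c [H [_ _ uF]]] x; apply/cvgrPdist_lt => e e0.
have [d d0 hd] := uF e e0; apply/nbhs_ballP; exists d => // y; exact: hd.
Qed.

Definition sub_strip F G a := strip (fun t => a * F t) (fun t => a * G t).

Lemma Re_comp_cont (H : R -> R) (z : R[i]^o) : continuous H ->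
  (fun z : R[i]^o => H (complex.Re z)) @ nbhs z --> H (complex.Re z).
Proof.
move=> cH; apply: (@cvg_comp _ _ _ (fun z : R[i]^o => complex.Re z) H _ (nbhs (complex.Re z))).
  exact: Re_continuous.
exact: cH.
Qed.

Lemma open_strip F G : continuous F -> continuous G -> open (strip F G).
Proof.
move=> cF cG.
have -> : strip F G =
  (fun z : R[i]^o => F (complex.Re z) - complex.Im z) @^-1` [set x | 0 < x] `&`
  (fun z : R[i]^o => complex.Im z + G (complex.Re z)) @^-1` [set x | 0 < x].
  apply/seteqP; split => z /=.
    by move=> /andP[h1 h2]; split; lra.
  by move=> [h1 h2]; apply/andP; split; lra.
apply: openI; apply: open_comp; try exact: open_gt.
  by move=> z _; apply: (@cvgB R R _ (nbhs (z : R[i]^o)) _ (fun z : R[i]^o => F (complex.Re z)));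
    [exact: Re_comp_cont|exact: Im_continuous].
by move=> z _; apply: (@cvgD R R _ (nbhs (z : R[i]^o)) _ _ (fun z : R[i]^o => G (complex.Re z)));
    [exact: Im_continuous|exact: Re_comp_cont].
Qed.

Lemma open_sub_strip F G a : profile F -> profile G -> open (sub_strip F G a).
Proof.
move=> /profile_cont cF /profile_cont cG; apply: open_strip => x.
  by apply: cvgM; [exact: cvg_cst|exact: cF].
by apply: cvgM; [exact: cvg_cst|exact: cG].
Qed.

(** The closure satisfies the weak inequalities, and these imply the strict ones for b because F and
    G are bounded below by positive constants. *)
Lemma closure_sub_strip F G a b : profile F -> profile G -> a < b ->
  closure (sub_strip F G a) `<=` sub_strip F G b.
Proof.
move=> pF pG ab.
have [cF [HF [cF0 bF _]]] := profileP pF; have [cG [HG [cG0 bG _]]] := profileP pG.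
suff h : closure (sub_strip F G a) `<=`
    [set z : R[i]^o | - (a * G (complex.Re z)) <= complex.Im z <= a * F (complex.Re z)].
  move=> z /h /=/andP[h1 h2]; have /andP[f1 f2] := bF (complex.Re z).
  have /andP[g1 g2] := bG (complex.Re z); rewrite /sub_strip /strip /=.
  apply/andP; split; nra.
have cl : closed [set z : R[i]^o | - (a * G (complex.Re z)) <= complex.Im z <= a * F (complex.Re z)].
  have -> : [set z : R[i]^o | - (a * G (complex.Re z)) <= complex.Im z <= a * F (complex.Re z)] =
   (fun z : R[i]^o => a * F (complex.Re z) - complex.Im z) @^-1` [set x | 0 <= x] `&`
  (fun z : R[i]^o => complex.Im z + a * G (complex.Re z)) @^-1` [set x | 0 <= x].
    apply/seteqP; split => z /=.
      by move=> /andP[h1 h2]; split; lra.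
    by move=> [h1 h2]; apply/andP; split; lra.
  have cRe (H : R -> R) : profile H -> continuous (fun t => a * H t).
    by move=> /profile_cont cH t; apply: cvgM; [exact: cvg_cst|exact: cH].
  apply: closedI; apply: closed_comp; try exact: closed_ge.
    by move=> z _; apply: (@cvgB R R _ (nbhs (z : R[i]^o)) _ (fun z : R[i]^o => a * F (complex.Re z)));
    [exact: (@Re_comp_cont (fun t => a * F t) z (cRe F pF))|exact: Im_continuous].
  by move=> z _; apply: (@cvgD R R _ (nbhs (z : R[i]^o)) _ _ (fun z : R[i]^o => a * G (complex.Re z)));
    [exact: Im_continuous|exact: (@Re_comp_cont (fun t => a * G t) z (cRe G pG))].
move=> z cz; apply: cl; move: z cz; apply: closureS => z.
by rewrite /sub_strip /strip /= => /andP[h1 h2]; apply/andP; split; exact: ltW.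
Qed.

Lemma sub_strip1 F G : sub_strip F G 1 = strip F G.
Proof. by congr strip; apply/funext => t; rewrite mul1r. Qed.

Lemma sub_strip_mono F G a b : profile F -> profile G -> a <= b ->
  sub_strip F G a `<=` sub_strip F G b.
Proof.
move=> [F0 _ _ _] [G0 _ _ _] ab z; rewrite /sub_strip /strip /= => /andP[h1 h2].
have := F0 (complex.Re z); have := G0 (complex.Re z); move=> g f.
by apply/andP; split; nra.
Qed.

Lemma strip_exhaust F G z : profile F -> profile G -> strip F G z ->
  exists2 a, 0 < a < 1 & sub_strip F G a z.
Proof.
move=> pF pG; have [cF [HF [cF0 bF _]]] := profileP pF; have [cG [HG [cG0 bG _]]] := profileP pG.
rewrite /strip /sub_strip /= => /andP[h1 h2].
have /andP[f1 f2] := bF (complex.Re z); have /andP[g1 g2] := bG (complex.Re z).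
set y := complex.Im z in h1 h2 *; set f := F _ in h2 f1 f2 *; set g := G _ in h1 g1 g2 *.
have f0 : 0 < f by lra. have g0 : 0 < g by lra.
(* The last two entries are the midpoints between 1 and the relative heights y / f and - y / g of
   the point; 1 / 2 makes the factor positive. *)
exists (Num.max (1 / 2) (Num.max ((1 + y / f) / 2) ((1 - y / g) / 2))).
  rewrite lt_max; apply/andP; split; first by apply/orP; left; lra.
  rewrite !gt_max; apply/and3P; split; first lra.
    have : y / f < 1 by rewrite ltr_pdivrMr// mul1r. 
    lra.
  have : - (y / g) < 1 by rewrite -mulNr ltr_pdivrMr// mul1r; lra.
  lra.
set m := Num.max _ _.
have m1 : (1 + y / f) / 2 <= m by rewrite /m !le_max lexx !orbT.
have m2 : (1 - y / g) / 2 <= m by rewrite /m !le_max lexx !orbT.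
have e1 : y / f * f = y by rewrite divfK ?gt_eqF.
have e2 : y / g * g = y by rewrite divfK ?gt_eqF.
have := ler_wpM2r (ltW f0) m1; have := ler_wpM2r (ltW g0) m2.
have -> : (1 - y / g) / 2 * g = (g - y / g * g) / 2 by lra.
have -> : (1 + y / f) / 2 * f = (f + y / f * f) / 2 by lra.
rewrite e1 e2 => k1 k2.
by rewrite /strip /= -/y -/f -/g; apply/andP; split; lra.
Qed.

End Profiles.

(** * The spaces K_W in terms of disks *)

Definition bounded_in_disks (R : realType) (E : tvsType R[i]) :=
  forall B : set E, tvs_bounded B -> exists2 D : set E, bdisk D & B `<=` D.

Section KWBounds.
Variables (R : realType) (E : tvsType R[i]) (hE : hausdorff_space E).
Variables (F G : R -> R) (w : nat -> R -> R).
Hypotheses (pF : profile F) (pG : profile G).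
Implicit Types f : R[i]^o -> E.

Definition decay N (z : R[i]^o) : R := expR (- w N `|complex.Re z|).

(* KW with the family of seminorms replaced by one disk for each (n, N, a), which is
   what a fundamental sequence of bounded sets allows. *)
Definition KWB f := forall (n N : nat) (a : R), a < 1 -> exists2 D : set E, bdisk D &
  BD n (sub_strip F G a) (decay N) D f.

Lemma bounded_in_disks_dir (hB : bounded_in_disks E) (D1 D2 : set E) : bdisk D1 -> bdisk D2 ->
  exists2 D : set E, bdisk D & D1 `<=` D /\ D2 `<=` D.
Proof.
move=> [_ _ _ b1] [_ _ _ b2].
have [D bD h] : exists2 D : set E, bdisk D & D1 `|` D2 `<=` D.
  apply: hB; apply: csn_bounded => p cp.
  have [M1 _ h1] := bounded_csn b1 cp; have [M2 _ h2] := bounded_csn b2 cp.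
  by exists (Num.max M1 M2) => x [/h1|/h2]; rewrite le_max => ->; rewrite ?orbT.
by exists D => //; split=> x ?; apply: h; [left|right].
Qed.

Fixpoint word (s : seq bool) f := if s is b :: s' then partial (dir b) (word s' f) else f.

Lemma Cn_step n (T : set R[i]^o) f b : Cn n.+1 T f -> Cn n T (partial (dir b) f).
Proof. by case: b => -[_ []]. Qed.

Lemma Cinfty_word (T : set R[i]^o) f s : Cinfty T f -> Cinfty T (word s f).
Proof. by move=> H; elim: s => //= b s IH n; apply: Cn_step; exact: IH. Qed.

Lemma Cinfty_pd (T : set R[i]^o) f b z : Cinfty T f -> T z -> is_pd (dir b) f z (partial (dir b) f z).
Proof.
move=> /(_ 1%N) [_ [H _ _]] /H[h1 h2]; apply: has_partialP; by case: b.
Qed.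

Lemma Cinfty_cont (T : set R[i]^o) f z : Cinfty T f -> T z -> {for z, continuous f}.
Proof. by move=> /(_ 0%N)[H _] Tz; exact: H. Qed.

Lemma partial_comm (T : set R[i]^o) f z : open T -> Cinfty T f -> T z ->
  partial 'i%C (partial 1 f) z = partial 1 (partial 'i%C f) z.
Proof.
move=> oT Cf Tz.
have C1 := Cinfty_word [:: false] Cf; have C2 := Cinfty_word [:: true] Cf.
apply: (@schwarz _ _ hE T f (partial 1 f) (partial 'i%C f) _ _ 1 'i%C) => //.
- by rewrite normc1.
- by rewrite normc_i.
- by move=> y Ty; exact: (Cinfty_pd (b := false) Cf Ty).
- by move=> y Ty; exact: (Cinfty_pd (b := true) Cf Ty).
- by move=> y Ty; exact: (Cinfty_pd (b := true) C1 Ty).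
- by move=> y Ty; exact: (Cinfty_pd (b := false) C2 Ty).
- exact: (Cinfty_cont (Cinfty_word [:: true; false] Cf) Tz).
- exact: (Cinfty_cont (Cinfty_word [:: false; true] Cf) Tz).
Qed.

Lemma partial_eq_on (T : set R[i]^o) f g b z : open T -> (forall y, T y -> f y = g y) -> T z ->
  partial (dir b) f z = partial (dir b) g z.
Proof.
move=> oT fg Tz; apply: partial_near; move: (open_nbhs_nbhs (conj oT Tz)).
by apply: filterS => y /fg.
Qed.

Lemma multi_partial_word i j f :
  multi_partial i j f = word (nseq i false ++ nseq j true) f.
Proof.
rewrite /multi_partial; elim: i => [|i IH] /=; last by rewrite IH.
by elim: j => //= j ->.
Qed.

(** [BD] differentiates in any order while [KW] bounds only the sorted derivatives. A new vertical
    derivative is moved past the horizontal ones by [partial_comm], one at a time. *)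
Lemma word_multi (T : set R[i]^o) f s z : open T -> Cinfty T f -> T z ->
  word s f z = multi_partial (count_mem false s) (count_mem true s) f z.
Proof.
move=> oT Cf; elim: s z => [|b s IH] z Tz //=.
rewrite (partial_eq_on b oT IH Tz); case: b => //=; rewrite /= add0n add1n.
have := Cinfty_word (nseq (count_mem true s) true) Cf.
have -> : word (nseq (count_mem true s) true) f = iter (count_mem true s) (partial 'i%C) f.
  by elim: (count_mem true s) => //= j ->.
rewrite /multi_partial iterS.
move: (iter (count_mem true s) (partial 'i%C) f) => g Cg.
elim: (count_mem false s) z Tz => //= i IHi z Tz.
have Ci : Cinfty T (iter i (partial 1) g).
  have -> : iter i (partial 1) g = word (nseq i false) g by elim: (i) => //= k ->.
  exact: Cinfty_word.
rewrite (partial_comm oT Ci Tz).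
exact: (partial_eq_on false oT IHi Tz).
Qed.

Lemma BD_of_bounds n (S T : set R[i]^o) (c : R[i]^o -> R) (D : set E) f : open T -> S `<=` T -> Cinfty T f ->
  (forall i j, (i + j <= n)%N -> forall z, S z -> scaled D (c z) (multi_partial i j f z)) ->
  BD n S c D f.
Proof.
move=> oT ST Cf H.
suff : forall m s, (m + size s <= n)%N -> BD m S c D (word s f).
  by move=> /(_ n [::]); rewrite addn0; apply.
elim=> [|m IH] s ms.
  split=> // z Sz; rewrite (word_multi s oT Cf (ST _ Sz)); apply: H => //.
  by rewrite -size_filter -size_filter -size_cat (@perm_size _ _ s)// perm_catC perm_sym -(perm_filterC (pred1 true)) perm_cat2l (@eq_filter _ _ (predC (pred1 true)))// => -[].
split; first by exact: (BD_val (IH s (ltnW ms))).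
split=> b.
  by move=> z /ST Tz; exists (partial (dir b) (word s f) z); exact: (Cinfty_pd (Cinfty_word s Cf) Tz).
by apply: (IH (b :: s)); rewrite /= addnS -addSn.
Qed.

(** The weighted values of finitely many derivatives on a smaller strip form one set, bounded
    because each seminorm is bounded on it; a disk containing this set is the one required. *)
Lemma KW_KWB f : bounded_in_disks E -> KW F G w f -> KWB f.
Proof.
move=> hB [Cf Hf] n N a a1.
(* [KW] speaks of 0 < a < 1 only, whereas [KWB] admits every real a < 1. *)
pose a' := Num.max a (1 / 2); have a'1 : 0 < a' < 1.
  by rewrite lt_max gt_max a1; apply/andP; split; [apply/orP; right|]; lra.
have oT : open (strip F G) by rewrite -sub_strip1; exact: open_sub_strip.
have aT : sub_strip F G a `<=` strip F G by rewrite -sub_strip1; apply: sub_strip_mono => //; exact: ltW.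
pose B := [set y | exists i j xi, [/\ (i <= n)%N, (j <= n)%N, sub_strip F G a xi &
    y = (expR (w N `|complex.Re xi|))%:C%C *: multi_partial i j f xi]].
have bB : tvs_bounded B.
  apply: csn_bounded => p cp.
  have /choice[M hM] : forall ij : nat * nat, exists M : R, forall xi, sub_strip F G a xi ->
      expR (w N `|complex.Re xi|) * p (multi_partial ij.1 ij.2 f xi) <= M.
    move=> [i j]; have [M hM] := Hf p cp.1 cp.2 N i j a' a'1; exists M => xi axi.
    apply: hM; exists xi => //; apply: subset_closure.
    by apply: (sub_strip_mono pF pG _ axi); rewrite le_max lexx.
  exists (\sum_(i < n.+1) \sum_(j < n.+1) `|M (val i, val j)|) => _ [i [j [xi [ilt jlt axi ->]]]].
  rewrite (seminormZ _ _ cp.1) normcR ger0_norm ?expR_ge0//.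
  apply: (le_trans (hM (i, j) xi axi)); apply: (le_trans (ler_norm _)).
  rewrite (bigD1 (Ordinal (ilt : (i < n.+1)%N)))//= (bigD1 (Ordinal (jlt : (j < n.+1)%N)))//=.
  by rewrite -addrA lerDl addr_ge0// sumr_ge0// => k _; apply: sumr_ge0.
have [D bD BDs] := hB B bB; exists D => //.
apply: (BD_of_bounds oT aT Cf) => i j ij z Sz.
exists ((expR (w N `|complex.Re z|))%:C%C *: multi_partial i j f z).
  apply: BDs; exists i, j, z; split=> //.
    by apply: leq_trans ij; exact: leq_addr.
  by apply: leq_trans ij; exact: leq_addl.
by rewrite scalerA -rmorphM/= /decay -expRD addNr expR0 scale1r.
Qed.

(** Bounds on one more derivative give continuity, so bounds of all orders give smoothness; the
    seminorm estimates follow because disks are bounded. *)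
Lemma KWB_KW f : (forall N t, 0 <= t -> 0 <= w N t) -> KWB f -> KW F G w f.
Proof.
move=> w0 H.
(* The property without weights, stable under partial derivatives, on which the induction for [Cn]
   runs. *)
pose L f := forall n a, a < 1 -> exists2 D : set E, bdisk D & BD n (sub_strip F G a) (fun=> 1) D f.
have decay1 N z : 0 < decay N z <= 1.
  by rewrite expR_gt0 -expR0 ler_expR oppr_le0 w0.
have L0 : L f.
  move=> n a a1; have [D bD h] := H n 0%N a a1; exists D => //.
  case: (bD) => Dc D0 _ _; apply: (BD_le Dc D0 (leqnn n) _ _ _ _ h) => // z _.
    by have /andP[] := decay1 0%N z.
  by have /andP[/ltW] := decay1 0%N z.
have Lp g b : L g -> L (partial (dir b) g).
  by move=> Lg n a a1; have [D bD h] := Lg n.+1 a a1; exists D => //; exact: BD_partial.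
have LC n g : L g -> Cn n (strip F G) g.
  elim: n g => [|n IH] g Lg.
    split=> // z /(strip_exhaust pF pG)[a /andP[a0 a1] az].
    have [D bD h] := Lg 1%N a a1; apply: (BD_cont hE bD _ az ler01 h).
    exact: open_sub_strip.
  split; first by case: (n) (IH g Lg) => [|k] [].
  split; [|exact: IH (Lp g false Lg)|exact: IH (Lp g true Lg)].
  move=> z /(strip_exhaust pF pG)[a /andP[a0 a1] az].
  have [D bD h] := Lg 1%N a a1; split.
    by exists (partial 1 g z); exact: (BD_pd (b := false) h az).
  by exists (partial 'i%C g z); exact: (BD_pd (b := true) h az).
split; first by move=> n; exact: LC.
move=> p sp cp N i j a /andP[a0 a1].
(* The strip for (1 + a) / 2 contains the closure of the strip for a. *)
have [D bD h] := H (i + j)%N N ((1 + a) / 2) ltac:(lra).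
case: (bD) => _ _ _ boD; have [M M0 hM] := bounded_csn boD (conj sp cp).
exists M => _ [xi cxi <-].
have Sxi : sub_strip F G ((1 + a) / 2) xi.
  by apply: closure_sub_strip cxi => //; lra.
have h' : BD 0 (sub_strip F G ((1 + a) / 2)) (decay N) D (multi_partial i j f).
  rewrite multi_partial_word.
  have : (i + j = 0 + size (nseq i false ++ nseq j true))%N by rewrite size_cat !size_nseq.
  move: h; set S := sub_strip _ _ _; clearbody S; clear.
  move: (i + j)%N => n h en; rewrite en in h; move: h {en n}.
  move: (nseq i false ++ nseq j true) (0%N); elim => [|b s IH] m; first by rewrite addn0.
  by rewrite /= addnS -addSn => /IH; exact: BD_partial.
have [y Dy <-] := BD_val h' Sxi.
rewrite (seminormZ _ _ sp) normcR (ger0_norm (expR_ge0 _)) mulrA /decay -expRD subrr.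
by rewrite expR0 mul1r hM.
Qed.

End KWBounds.

(** * Smooth cutoff functions *)

Section SmoothStep.
Variable R : realType.
Implicit Types (x t : R) (k n : nat).

(* This family is closed under differentiation: flat k' = flat (k + 2) - k flat (k + 1). *)
Definition flat k x : R := if 0 < x then x ^- k * expR (- x^-1) else 0.

Lemma flat_le0 k x : x <= 0 -> flat k x = 0.
Proof. by rewrite /flat leNgt => /negbTE ->. Qed.

Lemma flat_ge0 k x : 0 <= flat k x.
Proof.
rewrite /flat; case: ifP => // x0.
by rewrite mulr_ge0 ?expR_ge0// invr_ge0 exprn_ge0// ltW.
Qed.

Lemma flat_gt0 k x : 0 < x -> 0 < flat k x.
Proof.
by move=> x0; rewrite /flat x0 mulr_gt0 ?expR_gt0// invr_gt0 exprn_gt0.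
Qed.

(** With y = 1 / x this is y ^ k / k! <= exp y, a term of the exponential series. *)
Lemma flat_bounded k x : flat k x <= k`!%:R.
Proof.
rewrite /flat; case: ifP => x0; last exact: ler0n.
rewrite expRN ler_pdivrMr ?expR_gt0// -exprVn.
have y0 : 0 <= x^-1 by rewrite invr_ge0 ltW.
case: k => [|k]; first by rewrite expr0 fact0 mul1r -expR0 ler_expR.
have := expR_ge1Dxn k y0; rewrite -ler_pdivrMl ?ltr0n ?fact_gt0// mulrC.
by apply: le_trans; rewrite lerDr.
Qed.

(** Together with [flat_bounded] this shows that [flat k] is of order x ^ 2 at 0, hence has
    derivative 0 there. *)
Lemma flatS k x : flat k x = x ^+ 2 * flat k.+2 x.
Proof.
rewrite /flat; case: ifP => x0; last by rewrite mulr0.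
rewrite mulrA; congr (_ * _).
by rewrite -[k.+2]addn2 exprD invfM mulrCA divff ?mulr1// expf_neq0// gt_eqF.
Qed.

Lemma is_derive_cvg (f : R -> R) x (d : R) : is_derive x 1 f d <->
  forall e, 0 < e -> exists2 r : R, 0 < r & forall h, `|h| < r ->
    `|f (x + h) - f x - h * d| <= e * `|h|.
Proof.
have key (h : R) : h != 0 -> f (x + h) - f x - h * d = h * (h^-1 *: (f (h *: (1:R) + x) - f x) - d).
  move=> h0; have -> : h^-1 *: (f (h *: (1:R) + x) - f x) = h^-1 * (f (x + h) - f x).
    by rewrite [h *: _]mulr1 [h + x]addrC.
  by rewrite mulrBr mulrA divff// mul1r.
split=> [fd e e0|H].
  have hd : h^-1 *: (f (h *: (1:R) + x) - f x) @[h --> 0^'] --> d.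
    have <- : 'D_1 f x = d by exact: derive_val.
    exact: ex_derive.
  move/cvgrPdist_lt: hd => /(_ e e0)/dnbhs0P[r r0 hr]; exists r => // h hh.
  have [->|h0] := eqVneq h 0; first by rewrite addr0 subrr mul0r subr0 normr0 mulr0.
  by rewrite key// normrM mulrC ler_wpM2r// distrC ltW// hr.
have hd : h^-1 *: (f (h *: (1:R) + x) - f x) @[h --> 0^'] --> d.
  apply/cvgrPdist_lt => e e0; have [r r0 hr] := H (e / 2) ltac:(lra).
  apply/dnbhs0P; exists r => // h hh h0; have := hr h hh.
  rewrite key// normrM mulrC ler_pM2r ?normr_gt0// distrC => h1.
  by apply: (le_lt_trans h1); lra.
by apply: DeriveDef; [apply/cvg_ex; exists d|exact: cvg_lim hd].
Qed.

Lemma flat_derive k x : is_derive x 1 (flat k) (flat k.+2 x - k%:R * flat k.+1 x).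
Proof.
have [x0|x0|x0] := ltgtP x 0.
- rewrite !flat_le0 ?ltW// mulr0 subr0; apply/is_derive_cvg => e e0.
  exists (- x) => [|h]; first by rewrite oppr_gt0.
  rewrite ltr_norml => /andP[_ hx].
  by rewrite !flat_le0 ?mulr0 ?subr0 ?subrr ?normr0 ?mulr_ge0 ?(ltW e0)//; lra.
- have xn0 : x != 0 by rewrite gt_eqF.
  pose f y := (y^-1) ^+ k * expR (- y^-1) : R.
  have fd : is_derive x 1 f (flat k.+2 x - k%:R * flat k.+1 x).
    have dV : is_derive x 1 (fun y : R => y^-1) (- x ^- 2 *: (1 : R)).
      exact: is_deriveV.
    have h1 : is_derive x (1:R) (fun y : R => y^-1 ^+ k) (k%:R * x^-1 ^+ k.-1 * - x ^- 2).
      have -> : (fun y : R => y^-1 ^+ k) = (fun y : R => y^-1) ^+ k.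
        by apply/funext => y; elim: (k) => // j; rewrite !exprS => ->.
      by apply: (is_derive_eq (is_deriveX k dV)); congr (_ * _); exact: mulr1.
    have h2 : is_derive x (1:R) (fun y : R => expR (- y^-1)) _ :=
      is_derive1_comp (is_derive_expR _) (is_deriveN dV).
    have hm : is_derive x (1:R) f _ := is_deriveM h1 h2.
    apply: (is_derive_eq hm); rewrite /flat x0.
    transitivity (x^-1 ^+ k * (expR (- x^-1) * - (- x ^- 2 * 1)) +
      expR (- x^-1) * (k%:R * x^-1 ^+ k.-1 * - x ^- 2)); first by [].
    rewrite -!exprVn; move: (x^-1) (expR _) => y E.
    by case: (k) => [|j] /=; rewrite ?exprS; ring.
  apply/is_derive_cvg => e e0; move/is_derive_cvg: fd => /(_ e e0)[r r0 hr].
  exists (Num.min r x) => [|h]; first by rewrite lt_min r0.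
  rewrite lt_min => /andP[/hr h1 hx].
  have xh : 0 < x + h by move: hx; rewrite ltr_norml => /andP[]; lra.
  by have := h1; rewrite /f /flat x0 xh !exprVn.
- rewrite x0 !flat_le0// mulr0 subr0; apply/is_derive_cvg => e e0.
  exists (e / k.+2`!%:R) => [|h]; first by rewrite divr_gt0// ltr0n fact_gt0.
  rewrite add0r mulr0 !subr0 (flat_le0 k (lexx 0)) subr0 flatS normrM normrX.
  rewrite ltr_pdivlMr ?ltr0n ?fact_gt0// => hh.
  rewrite (ger0_norm (flat_ge0 _ _)) expr2 mulrAC; apply: ler_wpM2r => //.
  by apply: le_trans (ltW hh); rewrite ler_wpM2l// flat_bounded.
Qed.

Definition step x : R := flat 0 x / (flat 0 x + flat 0 (1 - x)).

(** One of x and 1 - x is at least 1 / 2. A uniform lower bound is what bounds all derivatives of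
    the reciprocal. *)
Lemma step_den x : expR (- 2) <= flat 0 x + flat 0 (1 - x).
Proof.
have h y : 1 / 2 <= y -> expR (-2) <= flat 0 y.
  move=> y2; have y0 : 0 < y by lra.
  rewrite /flat y0 expr0 invr1 mul1r ler_expR lerN2.
  by rewrite -[leRHS]invrK lef_pV2 ?posrE//; lra.
have [x2|x2] := leP (1 / 2) x.
  by have := h x x2; have := flat_ge0 0 (1 - x); lra.
by have := h (1 - x) ltac:(lra); have := flat_ge0 0 x; lra.
Qed.

Lemma step_den_gt0 x : 0 < flat 0 x + flat 0 (1 - x).
Proof. exact: lt_le_trans (expR_gt0 _) (step_den x). Qed.

Lemma step_le0 x : x <= 0 -> step x = 0.
Proof. by move=> x0; rewrite /step flat_le0// mul0r. Qed.

Lemma step_ge1 x : 1 <= x -> step x = 1.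
Proof.
move=> x1; rewrite /step (flat_le0 0 (_ : 1 - x <= 0)) ?subr_le0// addr0.
by rewrite divff// gt_eqF// flat_gt0//; lra.
Qed.

Lemma step_01 x : 0 <= step x <= 1.
Proof.
rewrite /step divr_ge0 ?flat_ge0 ?addr_ge0 ?flat_ge0//=.
by rewrite ler_pdivrMr ?step_den_gt0// mul1r lerDl flat_ge0.
Qed.

Definition step' x : R := (flat 2 x * flat 0 (1 - x) + flat 0 x * flat 2 (1 - x)) /
  (flat 0 x + flat 0 (1 - x)) ^+ 2.

Lemma step_derive x : is_derive x 1 step (step' x).
Proof.
have dn0 : flat 0 x + flat 0 (1 - x) != 0 by rewrite gt_eqF// step_den_gt0.
have d1 := flat_derive 0 x; have d2 : is_derive (1 - x) 1 (flat 0) _ := flat_derive 0 (1 - x).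
have d3 : is_derive x 1 (fun y => flat 0 (1 - y)) (- flat 2 (1 - x)).
  apply: is_derive_eq => /=.
  by rewrite mul0r subr0 add0r mul1r mulrN1.
have -> : step = (fun x => flat 0 x * (flat 0 x + flat 0 (1 - x))^-1) by [].
have h1 : is_derive x (1:R) (fun y => flat 0 y + flat 0 (1 - y)) _ := is_deriveD d1 d3.
have hm : is_derive x (1:R) (fun y => flat 0 y * (flat 0 y + flat 0 (1 - y))^-1) _ :=
  is_deriveM d1 (@is_deriveV R (fun y => flat 0 y + flat 0 (1 - y)) x _ 1 dn0 h1).
apply: (is_derive_eq hm).
transitivity (flat 0 x * (- (flat 0 x + flat 0 (1 - x)) ^- 2 * (flat 2 x - 0 * flat 1 x - flat 2 (1 - x)))
  + (flat 0 x + flat 0 (1 - x))^-1 * (flat 2 x - 0 * flat 1 x)); first by [].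
by rewrite /step'; field.
Qed.

Lemma step'_ge0 x : 0 <= step' x.
Proof.
by rewrite /step' divr_ge0 ?sqr_ge0// addr_ge0// mulr_ge0// flat_ge0.
Qed.

Lemma step'_gt0 x : 0 < x < 1 -> 0 < step' x.
Proof.
move=> /andP[x0 x1]; rewrite /step' divr_gt0 ?exprn_gt0 ?step_den_gt0//.
by rewrite addr_gt0// mulr_gt0// flat_gt0//; lra.
Qed.

Lemma step'_ge1 x : 1 <= x -> step' x = 0.
Proof. by move=> x1; rewrite /step' !(@flat_le0 _ (1 - x)) ?subr_le0// !mulr0 addr0 mul0r. Qed.

Lemma step'_le0 x : x <= 0 -> step' x = 0.
Proof. by move=> x1; rewrite /step' !(@flat_le0 _ x)// !mul0r addr0 mul0r. Qed.

End SmoothStep.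

Section SmoothScalars.
Variable R : realType.
Implicit Types (phi psi : R[i]^o -> R[i]^o) (S : set R[i]^o) (z v : R[i]).
Let U := @unit_disk R.
Let hC := @plane_hausdorff R.

Definition coord (b : bool) (z : R[i]) : R := if b then complex.Im z else complex.Re z.

Lemma coordD b z w : coord b (z + w) = coord b z + coord b w.
Proof. by case: z w b => ? ? [? ?] []. Qed.

Lemma coordM b (t : R) z : coord b (t%:C%C * z) = t * coord b z.
Proof. by case: z b => ? ? []; rewrite /coord /=; ring. Qed.

Lemma coord_dir b b' : coord b (dir b') = (b == b')%:R.
Proof. by case: b b' => -[]. Qed.

Lemma is_pd_scalarP v phi z (a : R[i]) : is_pd v phi z a <->
  forall e, 0 < e -> exists2 d : R, 0 < d & forall h : R, `|h| < d ->
   normc (phi (z + h%:C%C * v) - phi z - h%:C%C * a) <= e * `|h|.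
Proof.
split=> [/is_pdP H e e0|H]; first exact: (H _ (@normc_csn R) e e0).
apply/is_pdP => p cp e e0; have p1 := seminorm_ge0 (1 : R[i]^o) cp.1.
have p2 : 0 < p 1 + 1 by lra.
have [d d0 hd] := H (e / (p 1 + 1)) ltac:(by rewrite divr_gt0); exists d => // h hh.
set x := _ - _; have -> : x = (x : R[i]) *: (1 : R[i]^o) by rewrite [RHS]mulr1.
rewrite (seminormZ _ _ cp.1); have := ler_wpM2r p1 (hd h hh).
move=> /le_trans; apply; rewrite mulrAC ler_wpM2r// mulrAC ler_pdivrMr//.
by rewrite ler_pM2l//; lra.
Qed.

Lemma is_pd_coord (f : R -> R) b b' z (d : R) : is_derive (coord b z) 1 f d ->
  is_pd (dir b') (fun z => (f (coord b z))%:C%C : R[i]^o) z ((b == b')%:R * d)%:C%C.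
Proof.
move=> /is_derive_cvg fd; apply/is_pd_scalarP => e e0; have [r r0 hr] := fd e e0.
exists r => // h hh; rewrite coordD coordM coord_dir -rmorphM -!rmorphB normcR.
case: eqP => _; first by rewrite mulr1 mul1r; exact: hr.
by rewrite mulr0 addr0 subrr mul0r mulr0 subr0 normr0 mulr_ge0 ?(ltW e0).
Qed.

Lemma is_pdV S v phi z a (m : R) : open S -> S z -> normc v <= 1 -> 0 < m ->
  (forall w, S w -> m <= normc (phi w)) -> is_pd v phi z a ->
  is_pd v (fun w => ((phi w : R[i])^-1 : R[i]^o)) z (- (a : R[i]) / (phi z : R[i]) ^+ 2).
Proof.
move=> oS Sz v1 m0 hm pa.
apply/is_pd_scalarP => e e0.
pose A := normc a + 1; have A0 : 0 < A by rewrite /A ltr_wpDl ?normc_ge0.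
have [d d0 hd] := (is_pd_scalarP _ _ _ _).1 pa (Num.min 1 (e / 2 * m ^+ 2)) ltac:(by rewrite lt_min ltr01 mulr_gt0 ?exprn_gt0//; lra).
have /nbhs_planeP[d' d'0 hd'] := open_nbhs_nbhs (conj oS Sz).
(* Chosen so that the quadratic remainder, at most |h| ^ 2 A (A + 1) / m ^ 3, stays below e |h| /
   2. *)
pose d2 := e / 2 * m ^+ 3 / (A * (A + 1)).
have d20 : 0 < d2 by rewrite !(divr_gt0, mulr_gt0, exprn_gt0)//; lra.
exists (Num.min d (Num.min d' d2)) => [|h]; first by rewrite !lt_min d0 d'0.
rewrite !lt_min => /and3P[hh1 hh2 hh3].
have Sw : S (z + h%:C%C * v).
  apply: hd'; rewrite addrAC subrr add0r normcM normcR.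
  by apply: le_lt_trans hh2; rewrite ler_piMr.
have H1 := hd h hh1; have mw := hm _ Sw; have mz := hm _ Sz.
set w := z + _ in H1 Sw mw *.
have pw0 : (phi w : R[i]) != 0 by rewrite -normc_gt0; lra.
have pz0 : (phi z : R[i]) != 0 by rewrite -normc_gt0; lra.
set X := phi w - phi z - h%:C%C * a in H1.
(* The remainder splits into a term proportional to the remainder X of phi and a term quadratic in
   h. *)
have -> : (phi w)^-1 - (phi z)^-1 - h%:C%C * (- a / phi z ^+ 2) =
  - X * ((phi z)^-1 * (phi w)^-1) + (h%:C%C * a) * ((h%:C%C * a + X) * ((phi z)^-1 * (phi z)^-1 * (phi w)^-1)) :> R[i].
  by rewrite /X; field; rewrite pz0 pw0.
apply: (le_trans (normc_triangle _ _)).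
have iz : normc ((phi z)^-1) <= m^-1 by rewrite normcV lef_pV2 ?posrE//; lra.
have iw : normc ((phi w)^-1) <= m^-1 by rewrite normcV lef_pV2 ?posrE//; lra.
have n0 x : 0 <= normc (x : R[i]) := normc_ge0 x.
have aA : normc a <= A by rewrite /A lerDl.
have Xe : normc X <= e / 2 * m ^+ 2 * `|h|.
  by apply: (le_trans H1); rewrite ler_wpM2r// ge_min lexx orbT.
have X1 : normc X <= `|h| by apply: (le_trans H1); rewrite ler_piMl// ge_min lexx.
have T1 : normc (- X * ((phi z)^-1 * (phi w)^-1)) <= e / 2 * `|h|.
  rewrite !normcM normcN; apply: (@le_trans _ _ (e / 2 * m ^+ 2 * `|h| * (m^-1 * m^-1))).
    by apply: ler_pM => //; rewrite ?mulr_ge0//; apply: ler_pM.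
  by rewrite le_eqVlt; apply/orP; left; apply/eqP; field; rewrite gt_eqF.
have T2 : normc ((h%:C%C * a) * ((h%:C%C * a + X) * ((phi z)^-1 * (phi z)^-1 * (phi w)^-1))) <= e / 2 * `|h|.
  rewrite !normcM normcR.
  apply: (@le_trans _ _ ((`|h| * A) * ((`|h| * (A + 1)) * (m^-1 * m^-1 * m^-1)))).
    apply: ler_pM => //; rewrite ?mulr_ge0 ?exprn_ge0//; first by apply: ler_pM.
    apply: ler_pM => //; rewrite ?mulr_ge0 ?exprn_ge0//.
      apply: (le_trans (normc_triangle _ _)); rewrite normcM normcR mulrDr mulr1.
      by apply: lerD => //; apply: ler_pM.
    by apply: ler_pM => //; rewrite ?mulr_ge0//; apply: ler_pM.
  have e3 : `|h| * A * (`|h| * (A + 1) * (m^-1 * m^-1 * m^-1)) =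
     `|h| * (A * (A + 1) / m ^+ 3) * `|h| by field; rewrite gt_eqF.
  rewrite e3 ler_wpM2r//.
  have q0 : 0 < A * (A + 1) / m ^+ 3 by rewrite divr_gt0 ?mulr_gt0 ?exprn_gt0//; lra.
  apply: (le_trans (ler_wpM2r (ltW q0) (ltW hh3))).
  by rewrite le_eqVlt; apply/orP; left; apply/eqP; rewrite /d2; field; rewrite !gt_eqF//; lra.
lra.
Qed.

Definition SB S phi := forall n, exists2 C : R, 0 <= C & BD n S (fun=> C) U phi.

Let Uc := let: And4 h _ _ _ := unit_disk_bdisk R in h.
Let U0 := let: And4 _ h _ _ := unit_disk_bdisk R in h.

Lemma SB_le S S' phi : S' `<=` S -> SB S phi -> SB S' phi.
Proof.
by move=> SS H n; have [C C0 h] := H n; exists C => //; apply: BD_le h => // [||z _]; rewrite //.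
Qed.

Lemma SB_ext S phi psi : open S -> (forall z, S z -> phi z = psi z) -> SB S phi -> SB S psi.
Proof.
by move=> oS e H n; have [C C0 h] := H n; exists C => //; exact: (BD_ext oS e).
Qed.

Lemma SB_union S S' phi : SB S phi -> SB S' phi -> SB (S `|` S') phi.
Proof.
move=> H H' n; have [C C0 h] := H n; have [C' C'0 h'] := H' n.
exists (Num.max C C'); first by rewrite le_max C0.
by apply: BD_union; [apply: BD_le h|apply: BD_le h'] => // z _; rewrite le_max lexx ?orbT.
Qed.

Lemma SB_cst S (c : R[i]) : open S -> SB S (fun=> c).
Proof.
move=> oS n; exists (normc c); first exact: normc_ge0.
by apply: (BD_cst hC) => // z _; apply/unit_diskP => //; exact: normc_ge0.
Qed.

Lemma SB_add S phi psi : open S -> SB S phi -> SB S psi -> SB S (fun z => phi z + psi z).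
Proof.
move=> oS H H' n; have [C C0 h] := H n; have [C' C'0 h'] := H' n.
by exists (C + C'); [rewrite addr_ge0|apply: (BD_add hC oS Uc U0 _ _ h h')].
Qed.

Lemma SB_mul S phi psi : open S -> SB S phi -> SB S psi -> SB S (fun z => (phi z : R[i]) * psi z).
Proof.
move=> oS H H' n; have [C C0 h] := H n; have [C' C'0 h'] := H' n.
exists (2 ^+ n * (C * C')); first by rewrite !mulr_ge0// exprn_ge0.
by apply: (BD_mul hC oS Uc U0 _ _ h h').
Qed.

Lemma SB_opp S phi : open S -> SB S phi -> SB S (fun z => - phi z).
Proof.
move=> oS H; have := SB_mul oS (SB_cst (-1) oS) H.
by apply: SB_ext => // z _; rewrite mulN1r.
Qed.

Lemma SB_sub S phi psi : open S -> SB S phi -> SB S psi -> SB S (fun z => phi z - psi z).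
Proof. by move=> oS H H'; apply: SB_add => //; exact: SB_opp. Qed.

Lemma SB_partial S phi b : SB S phi -> SB S (partial (dir b) phi).
Proof. by move=> H n; have [C C0 h] := H n.+1; exists C => //; exact: BD_partial. Qed.

Lemma SB_aff S phi (k : R) (b : R[i]) : open S -> SB S phi ->
  SB [set z | S (k%:C%C * z + b)] (fun z => phi (k%:C%C * z + b)).
Proof.
move=> oS H n; have [C C0 h] := H n; exists (Num.max 1 `|k| ^+ n * C).
  by rewrite mulr_ge0// exprn_ge0// le_max ler01.
exact: (@BD_aff _ _ hC n S (fun=> C) U phi k b oS Uc U0 (fun _ _ => C0) h).
Qed.

Lemma SB_intro S phi (phi' : bool -> R[i]^o -> R[i]^o) (C : R) : open S -> 0 <= C ->
  (forall z, S z -> normc (phi z) <= C) ->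
  (forall b z, S z -> is_pd (dir b) phi z (phi' b z)) ->
  (forall n b, exists2 C : R, 0 <= C & BD n S (fun=> C) U (phi' b)) ->
  forall n, exists2 C : R, 0 <= C & BD n.+1 S (fun=> C) U phi.
Proof.
move=> oS C0 hphi pphi H n.
have [C1 C10 h1] := H n false; have [C2 C20 h2] := H n true.
exists (C + C1 + C2); first by rewrite !addr_ge0.
apply: (BD_intro hC (f' := phi')) => //.
  by move=> z Sz; apply/unit_diskP; rewrite ?addr_ge0//; apply: (le_trans (hphi z Sz)); lra.
by case; [apply: BD_le h2|apply: BD_le h1] => // z _; lra.
Qed.

(** The derivative of 1 / phi is - phi' (1 / phi) ^ 2, a product of functions already controlled to
    order n. Only the derivatives of phi are assumed bounded, since phi will be the identity in
    [SB_invz]. *)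
Lemma SB_inv_gen S phi (phi' : bool -> R[i]^o -> R[i]^o) (m : R) : open S -> 0 < m ->
  (forall w, S w -> m <= normc (phi w)) ->
  (forall b z, S z -> is_pd (dir b) phi z (phi' b z)) -> (forall b, SB S (phi' b)) ->
  SB S (fun z => (phi z : R[i])^-1 : R[i]^o).
Proof.
move=> oS m0 hm pphi H.
have val z : S z -> normc ((phi z : R[i])^-1) <= m^-1.
  move=> Sz; rewrite normcV lef_pV2 ?posrE ?hm//; exact: lt_le_trans (hm z Sz).
have m1 : 0 <= m^-1 by rewrite invr_ge0 ltW.
have dr b z : S z -> is_pd (dir b) (fun z => (phi z : R[i])^-1 : R[i]^o) z
   (- (phi' b z : R[i]) * ((phi z : R[i])^-1 * (phi z : R[i])^-1)).
  move=> Sz; have := pphi b z Sz.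
  move=> /(is_pdV oS Sz _ m0 hm); rewrite normc_dir lexx => /(_ isT).
  by rewrite expr2 invfM.
elim=> [|n [C C0 h]].
  by exists m^-1 => //; split=> // z Sz; apply/unit_diskP => //; exact: val.
have [C' C'0 h'] : exists2 C' : R, 0 <= C' & forall b, BD n S (fun=> C') U (phi' b).
  have [C1 C10 h1] := H false n; have [C2 C20 h2] := H true n.
  by exists (C1 + C2) => [|[]]; rewrite ?addr_ge0//; [apply: BD_le h2|apply: BD_le h1] => // z _; lra.
have h2 b : BD n S (fun=> 2 ^+ n * (C' * (2 ^+ n * (C * C)))) U (fun z =>
    - (phi' b z : R[i]) * ((phi z : R[i])^-1 * (phi z : R[i])^-1)).
  have k1 := BD_mul hC oS Uc U0 (fun _ _ => C0) (fun _ _ => C0) h h.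
  have k0 : 0 <= 2 ^+ n * (C * C) by rewrite !mulr_ge0// exprn_ge0.
  have k2 := BD_scale hC (-1) oS Uc U0 (fun _ _ => C'0) (h' b).
  rewrite normcN normc1 mul1r in k2.
  have := BD_mul hC oS Uc U0 (fun _ _ => C'0) (fun _ _ => k0) k2 k1.
  by apply: BD_ext => // z _; rewrite scaleN1r.
exists (m^-1 + 2 ^+ n * (C' * (2 ^+ n * (C * C)))).
  by rewrite addr_ge0// !mulr_ge0// exprn_ge0.
have k0 : 0 <= 2 ^+ n * (C' * (2 ^+ n * (C * C))) by rewrite !mulr_ge0// exprn_ge0.
apply: (BD_intro hC oS _ dr).
  by move=> z Sz; apply/unit_diskP; rewrite ?addr_ge0//; apply: (le_trans (val z Sz)); rewrite lerDl.
by move=> b; apply: BD_le (h2 b) => // z _; rewrite lerDr.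
Qed.

Lemma SB_inv S phi (m : R) : open S -> 0 < m -> (forall w, S w -> m <= normc (phi w)) ->
  SB S phi -> SB S (fun z => (phi z : R[i])^-1 : R[i]^o).
Proof.
move=> oS m0 hm H; apply: (SB_inv_gen (phi' := fun b => partial (dir b) phi) oS m0 hm).
  by move=> b z Sz; have [C C0 h] := H 1%N; exact: BD_pd h Sz.
by move=> b; exact: SB_partial.
Qed.

Lemma is_pd_id v z : is_pd v (id : R[i]^o -> R[i]^o) z v.
Proof.
apply/is_pd_scalarP => e e0; exists 1 => // h _.
by rewrite /= [z + _]addrC addrK subrr normc0 mulr_ge0 ?(ltW e0).
Qed.

(** The induction is on the order for all k at once, because differentiation raises k. *)
Lemma SB_flat k b : SB setT (fun z => (flat k (coord b z))%:C%C : R[i]^o).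
Proof.
move=> n; elim: n k => [|n IH] k.
  exists k`!%:R => //; split=> // z _; apply/unit_diskP => //.
  by rewrite normcR ger0_norm ?flat_ge0// flat_bounded.
have [C2 C20 h2] := IH k.+2; have [C1 C10 h1] := IH k.+1.
pose phi' b' (z : R[i]^o) : R[i]^o := (b == b')%:R%:C%C *:
   (((flat k.+2 (coord b z))%:C%C : R[i]^o) + (- k%:R : R)%:C%C *: ((flat k.+1 (coord b z))%:C%C : R[i]^o)).
exists (k`!%:R + (C2 + k%:R * C1)); first by rewrite !addr_ge0// mulr_ge0.
apply: (BD_intro hC (f' := phi')); first exact: openT.
- move=> z _; apply/unit_diskP; first by rewrite !addr_ge0// mulr_ge0.
  rewrite normcR ger0_norm ?flat_ge0//; apply: (le_trans (flat_bounded _ _)).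
  by rewrite lerDl addr_ge0// mulr_ge0.
- move=> b' z _; have := @is_pd_coord _ b b' z _ (flat_derive k (coord b z)).
  congr (is_pd _ _ _ _); rewrite /phi'; apply/esym.
  transitivity (((b == b')%:R:R)%:C%C * ((flat k.+2 (coord b z))%:C%C +
    (- (k%:R):R)%:C%C * (flat k.+1 (coord b z))%:C%C) : R[i]); first by [].
  by rewrite -!rmorphM -rmorphD -rmorphM mulNr.
- move=> b'.
  have q0 : 0 <= C2 + k%:R * C1 by rewrite addr_ge0// mulr_ge0.
  have k1 := BD_scale hC ((- k%:R : R)%:C%C) (@openT _) Uc U0 (fun _ _ => C10) h1.
  rewrite normcR normrN ger0_norm// in k1.
  have kC : 0 <= k%:R * C1 by rewrite mulr_ge0.
  have k2 := BD_add hC (@openT _) Uc U0 (fun _ _ => C20) (fun _ _ => kC) h2 k1.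
  have := BD_scale hC (((b == b')%:R : R)%:C%C) (@openT _) Uc U0 (fun _ _ => q0) k2.
  apply: BD_le => // z _; last by rewrite mulr_ge0 ?normc_ge0.
  rewrite normcR ger0_norm// ; apply: (@le_trans _ _ (C2 + k%:R * C1)); last by rewrite lerDr.
  by rewrite ler_piMl//; case: (b == b').
Qed.

Lemma SB_step b : SB setT (fun z => (step (coord b z))%:C%C : R[i]^o).
Proof.
pose e z : R[i]^o := (flat 0 (coord b z))%:C%C.
have he : SB setT e := SB_flat 0 b.
(* The affine map - z + dir b replaces the coordinate b by 1 minus it. *)
have h1 : SB setT (fun z => e ((-1 : R)%:C%C * z + dir b)) := SB_aff (-1) (dir b) (@openT _) he.
have h2 := SB_add (@openT _) he h1.
have dd (z : R[i]) : coord b ((-1 : R)%:C%C * z + dir b) = 1 - coord b z.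
  by rewrite coordD coordM coord_dir eqxx mulN1r addrC.
have h3 : SB setT (fun z => (e z + e ((-1 : R)%:C%C * z + dir b))^-1).
  apply: (SB_inv (@openT _) (expR_gt0 (-2)) _ h2) => z _.
  rewrite /e dd -rmorphD normcR ger0_norm; first exact: step_den.
  exact: ltW (step_den_gt0 _).
have := SB_mul (@openT _) he h3; apply: SB_ext; first exact: openT.
by move=> z _; rewrite /e dd /step -rmorphD -fmorphV -rmorphM.
Qed.

End SmoothScalars.

(** * The integral of a compactly supported function *)

Section GridCounting.
Variable R : realType.

(** Truncating the interval at N gives a bound that can be proved by induction on N and that is at
    most b + 1 - a. *)
Lemma count_between_le (a b : R) N : a <= b + 1 ->
  \sum_(i < N) (if a < (val i)%:R < b then 1 else 0) <= b + 1 - a :> R.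
Proof.
move=> ab; suff : \sum_(i < N) (if a < (val i)%:R < b then 1 else 0 : R) <=
    Num.max 0 (Num.min N%:R (b + 1) - a).
  move=> /le_trans; apply; rewrite ge_max subr_ge0 ab/= lerD2r ge_min lexx orbT//.
elim: N => [|N IH]; first by rewrite big_ord0 le_max lexx.
rewrite big_ord_recr/=; case: ifP => [/andP[h1 h2]|_].
  move: IH; rewrite /Num.min; case: ifP => [_|]; last by rewrite ltNge; lra.
  rewrite -natr1 ltrD2r h2 /Num.max; case: ifP => //; case: ifP => //; lra.
rewrite addr0; apply: (le_trans IH); rewrite ge_max le_max lexx/= le_max lerD2r.
by apply/orP; right; rewrite le_min !ge_min lexx orbT andbT -natr1 lerDl ler01.
Qed.

Lemma count_between_ge (a b : R) N : 0 <= a -> b <= N%:R ->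
  b - a - 1 <= \sum_(i < N) (if a < (val i)%:R < b then 1 else 0) :> R.
Proof.
move=> a0 bN; suff : Num.min N%:R b - a - 1 <= \sum_(i < N) (if a < (val i)%:R < b then 1 else 0 : R).
  by rewrite /Num.min; case: ifP => //; rewrite ltNge bN.
elim: N {bN} => [|N IH].
  rewrite big_ord0; have : Num.min 0%:R b <= 0%:R by rewrite ge_min lexx. lra.
rewrite big_ord_recr/=; case: ifP => [/andP[h1 h2]|h].
  move: IH; rewrite /Num.min h2 -natr1; case: ifP; lra.
rewrite addr0; have s0 : 0 <= \sum_(i < N) (if a < (val i)%:R < b then 1 else 0 : R).
  by apply: sumr_ge0 => i _; case: ifP.
have [Na|Na] := leP N%:R a.
  have : Num.min N.+1%:R b <= N.+1%:R by rewrite ge_min lexx.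
  rewrite -natr1; lra.
move: h; rewrite Na/= => /negbT; rewrite -leNgt => bN.
have e1 : Num.min N%:R b = b by apply/min_idPr.
have e2 : Num.min N.+1%:R b = b by apply/min_idPr; rewrite -natr1; lra.
by rewrite e2; rewrite e1 in IH.
Qed.

Lemma sum_double (V : nmodType) (f : nat -> V) N :
  \sum_(i < N.*2) f i = \sum_(i < N) (f (val i).*2 + f (val i).*2.+1).
Proof.
elim: N => [|N IH]; first by rewrite !big_ord0.
by rewrite doubleS !big_ord_recr/= IH addrA.
Qed.

End GridCounting.

Section Integral.
Variables (R : realType) (E : tvsType R[i]) (hE : hausdorff_space E).
Implicit Types (u v g : R[i]^o -> E) (D : set E) (z : R[i]).

(* Locked, like gridN, to keep unification from computing powers of 2. *)
Definition mesh (q : nat) : R := locked (2 ^+ q)^-1.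

Lemma meshE q : mesh q = (2 ^+ q)^-1.
Proof. by rewrite /mesh -lock. Qed.

Lemma mesh_gt0 q : 0 < mesh q.
Proof. by rewrite meshE invr_gt0 exprn_gt0. Qed.

Lemma meshS q : mesh q = 2 * mesh q.+1.
Proof. by rewrite !meshE exprS invfM mulrA divff ?mul1r ?pnatr_eq0. Qed.

Lemma mesh_le1 q : mesh q <= 1.
Proof. by rewrite meshE invf_le1 ?exprn_gt0// exprn_ege1// ler1n. Qed.

Lemma mesh_small (e : R) : 0 < e -> exists q0, forall q, (q0 <= q)%N -> mesh q < e.
Proof.
move=> e0; exists (Num.truncn e^-1).+1 => q hq.
rewrite meshE -[ltRHS]invrK ltf_pV2 ?posrE ?invr_gt0 ?exprn_gt0//.
apply: (@lt_le_trans _ _ q%:R).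
  apply: (lt_le_trans (truncnS_gt _)); by rewrite ler_nat.
by rewrite -natrX ler_nat ltnW// ltn_expl.
Qed.

(** 2 ^ (q + 2) steps of length 2 ^ -q make up the side 4 of the square. *)
Definition gridN (q : nat) : nat := locked (2 ^ q.+2)%N.

Lemma meshN q : mesh q * (gridN q)%:R = 4.
Proof.
rewrite meshE /gridN -lock natrX -[q.+2]addn2 exprD mulrA mulVf ?mul1r ?expf_neq0 ?pnatr_eq0//.
by ring.
Qed.

Definition gpt (q i j : nat) : R[i] :=
  (- 2 + i%:R * mesh q)%:C%C * 1 + (- 2 + j%:R * mesh q)%:C%C * 'i%C.

Lemma gpt_coord q i j b : coord b (gpt q i j) = - 2 + (if b then j else i)%:R * mesh q.
Proof.
by case: b; rewrite /gpt mulr1 coordD /coord /=; ring.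
Qed.

Lemma gpt_double q i j a b : gpt q.+1 (i.*2 + a) (j.*2 + b) =
  gpt q i j + (a%:R * mesh q.+1)%:C%C * 1 + (b%:R * mesh q.+1)%:C%C * 'i%C.
Proof.
by rewrite /gpt (meshS q) -!muln2 !natrD !natrM; ring.
Qed.

(* Riemann sums over the dyadic points of [-2, 2[ ^ 2; all integrands below are
   supported in this square. *)
Definition rsum q u : E := ((mesh q ^+ 2)%:C)%C *: \sum_(i < gridN q) \sum_(j < gridN q) u (gpt q i j).

Lemma rsum_scaled q D u (c : R[i]^o -> R) : absolutely_convex D -> D 0 ->
  (forall z, 0 <= c z) -> (forall z, scaled D (c z) (u z)) ->
  scaled D (mesh q ^+ 2 * \sum_(i < gridN q) \sum_(j < gridN q) c (gpt q i j)) (rsum q u).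
Proof.
move=> Dc D0 c0 Du.
have s0 i : 0 <= \sum_(j < gridN q) c (gpt q i j) by exact: sumr_ge0.
apply: (@scaledZ _ _ D (\sum_(i < gridN q) \sum_(j < gridN q) c (gpt q i j))) => //.
- exact: sumr_ge0.
- by rewrite normcR ger0_norm// exprn_ge0// ltW// mesh_gt0.
- by apply: scaled_sum => // i _; apply: scaled_sum.
Qed.

Lemma sum_cst2 (n : nat) (c : R) : \sum_(i < n) \sum_(j < n) c = c * n%:R * n%:R.
Proof.
have h (d : R) : \sum_(i < n) d = d * n%:R by rewrite big_const_ord iter_addr addr0 mulr_natr.
by rewrite (eq_bigr (fun=> c * n%:R)) ?h.
Qed.

Lemma rsum_bound q D u (c : R) : absolutely_convex D -> D 0 -> 0 <= c ->
  (forall z, scaled D c (u z)) -> scaled D (16 * c) (rsum q u).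
Proof.
move=> Dc D0 c0 Du; have := @rsum_scaled q D u (fun=> c) Dc D0 (fun=> c0) Du.
suff -> : mesh q ^+ 2 * (\sum_(i < gridN q) \sum_(j < gridN q) c) = 16 * c by [].
rewrite sum_cst2; transitivity ((mesh q * (gridN q)%:R) * (mesh q * (gridN q)%:R) * c).
  by ring.
by rewrite meshN; ring.
Qed.

Lemma rsum_supp q D u (c r : R) z : absolutely_convex D -> D 0 -> 0 <= c -> 0 < r ->
  mesh q <= r -> (forall w, scaled D c (u w)) ->
  (forall w, u w != 0 -> forall b, `|coord b w - coord b z| < r) ->
  scaled D (9 * r ^+ 2 * c) (rsum q u).
Proof.
move=> Dc D0 c0 r0 mr Du hu.
pose ind b (w : R[i]) : R := if `|coord b w - coord b z| < r then 1 else 0.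
have i0 b w : 0 <= ind b w by rewrite /ind; case: ifP.
have cw w : scaled D (c * (ind false w * ind true w)) (u w).
  have [->|/hu h] := eqVneq (u w) 0; first exact: scaled0.
  by rewrite /ind (h false) (h true) !mulr1.
have := @rsum_scaled q D u (fun w => c * (ind false w * ind true w)) Dc D0 _ cw.
move=> /(_ (fun w => mulr_ge0 c0 (mulr_ge0 (i0 _ _) (i0 _ _)))).
have m0 := mesh_gt0 q.
pose cnt b : R := \sum_(i < gridN q) (if `|(- 2 + (val i)%:R * mesh q) - coord b z| < r then 1 else 0).
have -> : \sum_(i < gridN q) \sum_(j < gridN q)
   c * (ind false (gpt q i j) * ind true (gpt q i j)) = c * (cnt false * cnt true).
  rewrite /cnt mulr_suml mulr_sumr; apply: eq_bigr => i _.
  rewrite mulr_sumr mulr_sumr; apply: eq_bigr => j _.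
  by rewrite /ind !gpt_coord.
have cb b : cnt b <= 2 * r / mesh q + 1.
  rewrite /cnt; pose a := (coord b z - r + 2) / mesh q.
  have -> : 2 * r / mesh q + 1 = (coord b z + r + 2) / mesh q + 1 - a.
    by rewrite /a; field; rewrite gt_eqF.
  apply: le_trans (@count_between_le _ a ((coord b z + r + 2) / mesh q) (gridN q) _); last first.
    rewrite /a ler_wpDr// ler_wpM2r ?invr_ge0 ?ltW//; lra.
  apply: ler_sum => i _; case: ifP => [h|_]; last by case: ifP.
  suff -> : a < (val i)%:R < (coord b z + r + 2) / mesh q by [].
  move: h; rewrite /a; move: ((val i)%:R : R) => t; rewrite ltr_norml => /andP[h1 h2].
  rewrite ltr_pdivrMr// ltr_pdivlMr//; move: h1 h2; move: (t * mesh q) (coord b z) => x y h1 h2.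
  by apply/andP; split; lra.
have c0' b : 0 <= cnt b by apply: sumr_ge0 => i _; case: ifP.
apply: scaled_le => //; first by rewrite !mulr_ge0// ltW.
have k1 : mesh q * cnt false <= 3 * r.
  apply: (le_trans (ler_wpM2l (ltW m0) (cb false))).
  by rewrite mulrDr mulr1 mulrCA divff ?gt_eqF// mulr1; lra.
have k2 : mesh q * cnt true <= 3 * r.
  apply: (le_trans (ler_wpM2l (ltW m0) (cb true))).
  by rewrite mulrDr mulr1 mulrCA divff ?gt_eqF// mulr1; lra.
have -> : mesh q ^+ 2 * (c * (cnt false * cnt true)) = c * ((mesh q * cnt false) * (mesh q * cnt true)) by ring.
have -> : 9 * r ^+ 2 * c = c * ((3 * r) * (3 * r)) by ring.
rewrite ler_wpM2l//; apply: ler_pM => //; by rewrite mulr_ge0// ltW.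
Qed.

Lemma rsumD q u v : rsum q (fun z => u z + v z) = rsum q u + rsum q v.
Proof.
rewrite /rsum -scalerDr -big_split/=; congr (_ *: _); apply: eq_bigr => i _.
by rewrite -big_split.
Qed.

Lemma rsumZ q (k : R[i]) u : rsum q (fun z => k *: u z) = k *: rsum q u.
Proof.
rewrite /rsum [RHS]scalerA [k * _]mulrC -scalerA; congr (_ *: _).
rewrite scaler_sumr; apply: eq_bigr => i _; by rewrite scaler_sumr.
Qed.

Lemma rsumB q u v : rsum q (fun z => u z - v z) = rsum q u - rsum q v.
Proof.
have -> : (fun z => u z - v z) = (fun z => u z + (-1) *: v z).
  by apply/funext => z; rewrite scaleN1r.
by rewrite rsumD rsumZ scaleN1r.
Qed.

Definition is_int u (l : E) := (fun q => rsum q u) @ \oo --> l.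

Definition integral u : E := xget 0 [set l : E | is_int u l].

Lemma is_int_uniq u l : is_int u l -> integral u = l.
Proof.
move=> h; apply: xget_unique => // m hm; exact: (cvg_unique _ hm h).
Qed.

Lemma is_intD u v l m : is_int u l -> is_int v m -> is_int (fun z => u z + v z) (l + m).
Proof.
move=> hu hv; rewrite /is_int; under eq_fun do rewrite rsumD.
exact: cvgD_tvs.
Qed.

Lemma is_intB u v l m : is_int u l -> is_int v m -> is_int (fun z => u z - v z) (l - m).
Proof.
move=> hu hv; rewrite /is_int; under eq_fun do rewrite rsumB.
exact: cvgB_tvs.
Qed.

Lemma is_intZ (k : R[i]) u l : is_int u l -> is_int (fun z => k *: u z) (k *: l).
Proof.
move=> hu; rewrite /is_int; under eq_fun do rewrite rsumZ.
exact: cvgZc_tvs.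
Qed.

Lemma is_int_ext u v l : (forall z, u z = v z) -> is_int u l -> is_int v l.
Proof. by move=> /funext ->. Qed.

Lemma is_int_bound D u (c : R) l : bdisk D -> 0 <= c ->
  (forall z, scaled D c (u z)) -> is_int u l -> scaled D (16 * c) l.
Proof.
move=> [Dc D0 cD _] c0 Du hl; apply: (@scaled_lim _ _ hE D (16 * c) _ \oo _ (fun q => rsum q u) l cD) => //; first by rewrite mulr_ge0.
by near=> q; exact: rsum_bound.
Unshelve. all: by end_near. Qed.

Lemma is_int_supp D u (c r : R) z l : bdisk D -> 0 <= c -> 0 < r ->
  (forall w, scaled D c (u w)) -> (forall w, u w != 0 -> forall b, `|coord b w - coord b z| < r) ->
  is_int u l -> scaled D (9 * r ^+ 2 * c) l.
Proof.
move=> [Dc D0 cD _] c0 r0 Du hu hl; apply: (@scaled_lim _ _ hE D (9 * r ^+ 2 * c) _ \oo _ (fun q => rsum q u) l cD) => //.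
  by rewrite !mulr_ge0// ltW.
have [q0 hq] := mesh_small r0; exists q0 => // q /= /hq /ltW mq.
exact: (rsum_supp Dc D0 c0 r0 mq Du hu).
Qed.

(** A refinement replaces each grid point by four points at distance at most 2 mesh, so consecutive
    Riemann sums differ by at most 16 times 2 M mesh, 16 being the area of the square. The
    telescoping series of differences is thus dominated by a geometric one. *)
Lemma lipschitz_int D u (M : R) : series_complete E -> bdisk D -> 0 <= M ->
  (forall z w, scaled D (M * normc (z - w)) (u z - u w)) -> exists l, is_int u l.
Proof.
move=> sc bD M0 Lu; case: (bD) => Dc D0 _ _.
have m0 q := mesh_gt0 q.
have step q : scaled D (32 * M * mesh q) (rsum q.+1 u - rsum q u).
  have -> : rsum q.+1 u - rsum q u = ((mesh q.+1 ^+ 2)%:C)%C *: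
    \sum_(i < gridN q) \sum_(j < gridN q)
      ((u (gpt q.+1 (i.*2) (j.*2)) - u (gpt q i j)) + (u (gpt q.+1 (i.*2) (j.*2.+1)) - u (gpt q i j)) +
       ((u (gpt q.+1 (i.*2.+1) (j.*2)) - u (gpt q i j)) + (u (gpt q.+1 (i.*2.+1) (j.*2.+1)) - u (gpt q i j)))).
    have -> : \sum_(i < gridN q) \sum_(j < gridN q)
      ((u (gpt q.+1 (i.*2) (j.*2)) - u (gpt q i j)) + (u (gpt q.+1 (i.*2) (j.*2.+1)) - u (gpt q i j)) +
       ((u (gpt q.+1 (i.*2.+1) (j.*2)) - u (gpt q i j)) + (u (gpt q.+1 (i.*2.+1) (j.*2.+1)) - u (gpt q i j))))
     = \sum_(i < gridN q.+1) \sum_(j < gridN q.+1) u (gpt q.+1 i j) -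
       (4%:C%C : R[i]) *: \sum_(i < gridN q) \sum_(j < gridN q) u (gpt q i j).
      have -> : gridN q.+1 = (gridN q).*2 by rewrite /gridN -!lock expnS mul2n.
      rewrite (sum_double (fun i => \sum_(j < (gridN q).*2) u (gpt q.+1 i j))).
      rewrite scaler_sumr -sumrB; apply: eq_bigr => i _.
      rewrite (sum_double (fun j => u (gpt q.+1 (val i).*2 j))) (sum_double (fun j => u (gpt q.+1 (val i).*2.+1 j))) -big_split/= scaler_sumr -sumrB; apply: eq_bigr => j _.
      by lmod E.
    rewrite scalerBr scalerA -rmorphM/=; congr (_ - _ *: _); congr (_%:C)%C.
    by rewrite meshS; ring.
  have dist q' i j a b : (a <= 1)%N -> (b <= 1)%N ->
      scaled D (2 * M * mesh q') (u (gpt q'.+1 (i.*2 + a) (j.*2 + b)) - u (gpt q' i j)).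
    move=> a1 b1; apply: scaled_le (Lu _ _) => //; first by rewrite mulr_ge0 ?normc_ge0.
    rewrite gpt_double -[gpt q' i j + _ + _]addrA addrAC subrr add0r.
    have h : normc ((a%:R * mesh q'.+1)%:C%C * 1 + (b%:R * mesh q'.+1)%:C%C * 'i%C) <= 2 * mesh q'.
      apply: (le_trans (normc_triangle _ _)); rewrite mulr1 normcM normc_i mulr1 !normcR.
      rewrite !ger0_norm ?mulr_ge0 ?(ltW (m0 _))//.
      have ha : a%:R <= 1 :> R by move: a1; rewrite -(ler_nat R). 
      have hb : b%:R <= 1 :> R by move: b1; rewrite -(ler_nat R).
      have := m0 q'.+1; rewrite (meshS q') => mq.
      have := ler_wpM2r (ltW mq) ha; have := ler_wpM2r (ltW mq) hb; lra.
    have := ler_wpM2l M0 h; lra.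
  have c0 : 0 <= 2 * M * mesh q by rewrite !mulr_ge0// ltW.
  pose c4 := 4 * (2 * M * mesh q).
  have c40 : 0 <= c4 by rewrite mulr_ge0.
  apply: (@scaledZ _ _ D (\sum_(i < gridN q) \sum_(j < gridN q) c4)) => //.
  - by apply: sumr_ge0 => i _; apply: sumr_ge0.
  - rewrite normcR ger0_norm ?exprn_ge0 ?(ltW (m0 _))// sum_cst2.
    have -> : mesh q.+1 ^+ 2 * (c4 * (gridN q)%:R * (gridN q)%:R) =
       (mesh q * (gridN q)%:R) * (mesh q * (gridN q)%:R) * (c4 / 4) by rewrite (meshS q); field.
    rewrite meshN /c4; lra.
  - apply: scaled_sum => // i _; first by apply: sumr_ge0.
    apply: scaled_sum => // j _; rewrite /c4.
    have -> : 4 * (2 * M * mesh q) = (2 * M * mesh q + 2 * M * mesh q) + (2 * M * mesh q + 2 * M * mesh q) by ring.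
    have d00 := @dist q i j 0 0 isT isT; have d01 := @dist q i j 0 1 isT isT.
    have d10 := @dist q i j 1 0 isT isT; have d11 := @dist q i j 1 1 isT isT.
    rewrite !addn0 !addn1 in d00 d01 d10 d11.
    by apply: scaledD => //; rewrite ?addr_ge0//; apply: scaledD.
have geo n : \sum_(k < n) 32 * M * mesh k <= 64 * M.
  rewrite -mulr_sumr; have : \sum_(k < n) mesh k <= 2 - mesh n * 2.
    elim: n => [|n IH]; first by rewrite big_ord0 meshE expr0 invr1 mul1r subrr.
    by rewrite big_ord_recr/=; move: IH; rewrite (meshS n); lra.
  have := m0 n; nra.
have [l hl] := sc D bD (fun k => rsum k.+1 u - rsum k u) _ _
   (fun k => mulr_ge0 (mulr_ge0 (ler0n _ 32) M0) (ltW (m0 k))) geo step.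
exists (l + rsum 0 u).
have : (fun n => \sum_(k < n) (rsum k.+1 u - rsum k u) + rsum 0 u) @ \oo --> l + rsum 0 u.
  by apply: cvgD_tvs => //; exact: cvg_cst.
have -> : (fun n => \sum_(k < n) (rsum k.+1 u - rsum k u) + rsum 0 u) = (fun q => rsum q u).
  apply/funext => n; elim: n => [|n IH]; first by rewrite big_ord0 add0r.
  by rewrite big_ord_recr/= addrAC IH addrCA subrr addr0.
by [].
Qed.

Lemma BD_int D u (M : R) : series_complete E -> bdisk D -> 0 <= M -> BD 1 setT (fun=> M) D u ->
  is_int u (integral u).
Proof.
move=> sc bD M0 H.
have [l hl] : exists l, is_int u l.
  apply: (@lipschitz_int D u (2 * M)) => //; first by rewrite mulr_ge0.
  move=> z w; have := BD_lip_plane hE w z bD M0 H; congr (scaled D _ _); ring.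
by rewrite (is_int_uniq hl).
Qed.

(** The mean value inequality is applied to u minus its linear part in direction b, whose derivative
    is small by the mean value inequality for the first derivative of u. *)
Lemma taylor1 D u (M : R) b z (h : R) : bdisk D -> 0 <= M -> BD 2 setT (fun=> M) D u ->
  scaled D (M * `|h| ^+ 2) (u (z + h%:C%C * dir b) - u z - h%:C%C *: partial (dir b) u z).
Proof.
move=> bD M0 H; case: (bD) => Dc D0 _ _.
pose phi w := u w - (coord b (w - z))%:C%C *: partial (dir b) u z.
have := @pd_mean2 _ _ hE D phi (dir b) z h (M * `|h|)
  (fun t => partial (dir b) u (z + t%:C%C * dir b) - partial (dir b) u z) bD (mulr_ge0 M0 (normr_ge0 h)).
have -> : phi (z + h%:C%C * dir b) - phi z = u (z + h%:C%C * dir b) - u z - h%:C%C *: partial (dir b) u z.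
  rewrite /phi [z + _]addrC addrK coordM coord_dir eqxx mulr1 subrr.
  have -> : coord b (0 : R[i]) = 0 by case: (b).
  by lmod E.
rewrite expr2 mulrA; apply.
  move=> t th; apply: is_pdB; first exact: (BD_pd H I).
  apply/is_pdP => p cp e e0; exists 1 => // k _.
  have -> : coord b (z + t%:C%C * dir b + k%:C%C * dir b - z) = coord b (z + t%:C%C * dir b - z) + k.
    by rewrite !coordD !coordM coord_dir eqxx /=; ring.
  set A := coord b _; have -> : (A + k)%:C%C *: partial (dir b) u z - A%:C%C *: partial (dir b) u z -
     k%:C%C *: partial (dir b) u z = 0 by lmod E.
  by rewrite (seminorm0 cp.1) mulr_ge0 ?(ltW e0).
move=> t th; have H1 := BD_partial b H.
apply: (@scaled_le _ _ D (M * `|t|)) => //; rewrite ?mulr_ge0// ?ler_wpM2l//.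
apply: (pd_mean2 hE (l := fun t => partial (dir b) (partial (dir b) u) (z + t%:C%C * dir b))) => // s st.
  exact: (BD_pd H1 I).
exact: (BD_val (BD_partial b H1) I).
Qed.

(** On the grid the derivative is replaced by forward differences divided by the mesh. These
    telescope to 0, and by [taylor1] the total error is of the order of the mesh. *)
Lemma int_partial D u (M : R) b : bdisk D -> 0 <= M -> BD 2 setT (fun=> M) D u ->
  (forall z, 2 <= `|coord b z| -> u z = 0) -> is_int (partial (dir b) u) 0.
Proof.
move=> bD M0 H hu; case: (bD) => Dc D0 _ boD.
have m0 q := mesh_gt0 q.
have key q : scaled D (16 * M * mesh q) (rsum q (partial (dir b) u)).
  pose r (z : R[i]) := u (z + (mesh q)%:C%C * dir b) - u z - (mesh q)%:C%C *: partial (dir b) u z.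
  (* What remains after telescoping are values at coordinate -2 or 2, where u vanishes. *)
  have tel : \sum_(i < gridN q) \sum_(j < gridN q) (u (gpt q i j + (mesh q)%:C%C * dir b) - u (gpt q i j)) = 0.
    have z0 i j : u (gpt q (if b then i else gridN q) (if b then gridN q else j)) = 0.
      apply: hu; rewrite gpt_coord; case: (b); rewrite mulrC meshN ger0_norm; lra.
    have z1 i j : u (gpt q (if b then i else 0%N) (if b then 0%N else j)) = 0.
      by apply: hu; rewrite gpt_coord; case: (b); rewrite mul0r addr0 normrN ger0_norm.
    have tels (f : nat -> E) n : \sum_(i < n) (f i.+1 - f i) = f n - f 0%N.
      elim: n => [|n IH]; first by rewrite big_ord0 subrr.
      by rewrite big_ord_recr/= IH addrC addrA subrK.
    move: z0 z1; rewrite /dir; case: (b) => /= z0 z1.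
      apply: big1 => i _.
      have e j : gpt q i j + (mesh q)%:C%C * 'i%C = gpt q i j.+1 by rewrite /gpt -natr1; ring.
      under eq_bigr do rewrite e; rewrite (tels (fun j => u (gpt q i j))).
      by rewrite (z0 i 0%N) (z1 i 0%N) subrr.
    rewrite exchange_big/=; apply: big1 => j _.
    have e i : gpt q i j + (mesh q)%:C%C * 1 = gpt q i.+1 j by rewrite /gpt -natr1; ring.
    under eq_bigr do rewrite e; rewrite (tels (fun i => u (gpt q i j))).
    by rewrite (z0 0%N j) (z1 0%N j) subrr.
  have -> : rsum q (partial (dir b) u) = (- (mesh q)^-1)%:C%C *: rsum q r.
    rewrite /rsum /r scalerA mulrC -scalerA; congr (_ *: _).
    have -> : \sum_(i < gridN q) \sum_(j < gridN q) (u (gpt q i j + (mesh q)%:C%C * dir b) - u (gpt q i j) -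
      (mesh q)%:C%C *: partial (dir b) u (gpt q i j)) =
      \sum_(i < gridN q) \sum_(j < gridN q) (u (gpt q i j + (mesh q)%:C%C * dir b) - u (gpt q i j)) -
      (mesh q)%:C%C *: \sum_(i < gridN q) \sum_(j < gridN q) partial (dir b) u (gpt q i j).
      rewrite scaler_sumr -sumrB; apply: eq_bigr => i _.
      by rewrite scaler_sumr -sumrB.
    rewrite tel sub0r scalerN scalerA -rmorphM/= mulNr mulVf ?gt_eqF//.
    by rewrite rmorphN scaleNr opprK scale1r.
  have hr z : scaled D (M * mesh q ^+ 2) (r z).
    by have := taylor1 b z (mesh q) bD M0 H; rewrite gtr0_norm.
  have c0 : 0 <= M * mesh q ^+ 2 by rewrite mulr_ge0// exprn_ge0// ltW.
  apply: scaledZ (rsum_bound q Dc D0 c0 hr) => //; first by rewrite mulr_ge0.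
  rewrite normcR normrN gtr0_norm ?invr_gt0//.
  by rewrite le_eqVlt; apply/orP; left; apply/eqP; field; rewrite gt_eqF.
apply/cvg_csn => p cp e e0; have [s s0 hs] := bounded_csn boD cp.
have q1 : 0 < 16 * M * s + 1 by have := mulr_ge0 M0 (ltW s0); lra.
have [q0 hq] := @mesh_small (e / (16 * M * s + 1)) ltac:(by rewrite divr_gt0).
exists q0 => // q /= /hq; rewrite ltr_pdivlMr// => hq'.
rewrite subr0; have [y Dy <-] := key q.
have k0 : 0 <= 16 * M * mesh q by rewrite !mulr_ge0// ltW.
rewrite (seminormZ _ _ cp.1) normcR ger0_norm//.
apply: (le_lt_trans (ler_wpM2l k0 (hs _ Dy))); apply: le_lt_trans hq'.
have := m0 q; have := mulr_ge0 M0 (ltW s0); nra.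
Qed.

End Integral.

(** * The Cauchy transform *)

Section Kernel.
Variable R : realType.
Implicit Types (x t : R) (z w : R[i]).
Let hC := @plane_hausdorff R.
Let U := @unit_disk R.

Definition bump t : R := step (2 - 2 * t) * step (2 + 2 * t).
Definition bump' t : R := - 2 * step' (2 - 2 * t) * step (2 + 2 * t) + 2 * step (2 - 2 * t) * step' (2 + 2 * t).

Lemma bump_derive t : is_derive t 1 bump (bump' t).
Proof.
have aff (k : R) : is_derive t (1 : R) (fun t => 2 + k * t) k.
  apply/is_derive_cvg => e e0; exists 1 => // h _.
  have -> : 2 + k * (t + h) - (2 + k * t) - h * k = 0 by ring.
  by rewrite normr0 mulr_ge0 ?(ltW e0).
have a2 := aff 2.
have a1 : is_derive t (1 : R) (fun t => 2 - 2 * t) (- 2).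
  by have := aff (-2); congr is_derive; apply/funext => x; rewrite mulNr.
have e1 : is_derive t (1 : R) (fun t => step (2 - 2 * t)) _ := is_derive1_comp (step_derive _) a1.
have e2 : is_derive t (1 : R) (fun t => step (2 + 2 * t)) _ := is_derive1_comp (step_derive _) a2.
have hm : is_derive t (1 : R) bump _ := is_deriveM e1 e2.
apply: (is_derive_eq hm).
transitivity (step (2 - 2 * t) * (step' (2 + 2 * t) * 2) + step (2 + 2 * t) * (step' (2 - 2 * t) * - 2)).
  by [].
by rewrite /bump'; ring.
Qed.

Lemma bump1 t : `|t| <= 1 / 2 -> bump t = 1.
Proof.
by rewrite ler_norml => /andP[h1 h2]; rewrite /bump !step_ge1 ?mulr1//; lra.
Qed.

Lemma bump0 t : 1 <= `|t| -> bump t = 0 /\ bump' t = 0.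
Proof.
rewrite ler_normr /bump /bump' => /orP[h|h].
  by rewrite (@step_le0 _ (2 - 2 * t)) ?(@step'_le0 _ (2 - 2 * t))//; try lra; split; ring.
by rewrite (@step_le0 _ (2 + 2 * t)) ?(@step'_le0 _ (2 + 2 * t))//; try lra; split; ring.
Qed.

Lemma bump_ge0 t : 0 <= bump t.
Proof. by rewrite mulr_ge0//; have /andP[] := @step_01 R (2 - 2 * t); have /andP[] := @step_01 R (2 + 2 * t). Qed.

(** This sign makes the real part of [smear] nonnegative, and so its integral nonzero. *)
Lemma bump'_sign t : t * bump' t <= 0.
Proof.
have /andP[a1 a2] := @step_01 R (2 - 2 * t); have /andP[b1 b2] := @step_01 R (2 + 2 * t).
have c1 := @step'_ge0 R (2 - 2 * t); have c2 := @step'_ge0 R (2 + 2 * t).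
rewrite /bump'; have [t0|t0] := leP 0 t.
  rewrite (@step'_ge1 _ (2 + 2 * t)); last lra.
  have := mulr_ge0 t0 (mulr_ge0 c1 b1); lra.
rewrite (@step'_ge1 _ (2 - 2 * t)); last lra.
have nt : 0 <= - t by lra.
have := mulr_ge0 nt (mulr_ge0 a1 c2); lra.
Qed.

Lemma bump'_neg : bump' (3 / 4) < 0.
Proof.
rewrite /bump' (@step'_ge1 _ (2 + 2 * (3 / 4))); last lra.
rewrite (@step_ge1 _ (2 + 2 * (3 / 4))); last lra.
have := @step'_gt0 R (2 - 2 * (3 / 4)) ltac:(by apply/andP; split; lra); lra.
Qed.

Definition cutoff (z : R[i]^o) : R[i]^o := (bump (coord false z) * bump (coord true z))%:C%C.

Lemma SB_cutoff : SB setT cutoff.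
Proof.
have h (b : bool) (k : R) : SB setT (fun z : R[i]^o => (step (2 + k * coord b z))%:C%C : R[i]^o).
  have := SB_aff k (2%:C%C * dir b) (@openT _) (SB_step R b).
  apply: SB_ext; first exact: openT.
  by move=> z _; rewrite coordD !coordM coord_dir eqxx mulr1 addrC.
have hb (b : bool) : SB setT (fun z : R[i]^o => (bump (coord b z))%:C%C : R[i]^o).
  have := SB_mul (@openT _) (h b (-2)) (h b 2); apply: SB_ext; first exact: openT.
  by move=> z _; rewrite -rmorphM /bump mulNr.
have := SB_mul (@openT _) (hb false) (hb true); apply: SB_ext; first exact: openT.
by move=> z _; rewrite -rmorphM.
Qed.

Lemma is_pd_cutoff b z : is_pd (dir b) cutoff z
  (if b then bump (coord false z) * bump' (coord true z) else bump' (coord false z) * bump (coord true z))%:C%C.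
Proof.
have h0 := @is_pd_coord R _ false b z _ (bump_derive (coord false z)).
have h1 := @is_pd_coord R _ true b z _ (bump_derive (coord true z)).
have := is_pdM h0 h1.
have -> : (fun w => ((bump (coord false w))%:C%C : R[i]) *: ((bump (coord true w))%:C%C : R[i]^o)) = cutoff.
  by apply/funext => w; rewrite /cutoff; symmetry; exact: rmorphM.
congr (is_pd _ _ _ _).
transitivity (((false == b)%:R * bump' (coord false z))%:C%C * (bump (coord true z))%:C%C +
  (bump (coord false z))%:C%C * ((true == b)%:R * bump' (coord true z))%:C%C : R[i]); first by [].
by rewrite -!rmorphM -rmorphD; case: b {h0 h1} => /=; congr (_%:C)%C; ring.
Qed.

(* 1/z with its singularity cut off, so that only smooth kernels have to be
   integrated; the rescaled kernels [kern n] converge to 1/z. *)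
Definition ckernel (z : R[i]^o) : R[i]^o := (1 - cutoff z : R[i]) / z.

Lemma open_normc_gt (r : R) : open [set z : R[i]^o | r < normc z].
Proof.
have -> : [set z : R[i]^o | r < normc z] = normc @^-1` [set x | r < x] by [].
by apply: open_comp; [move=> x _; exact: (normc_csn R).2|exact: open_gt].
Qed.

Lemma open_normc_lt (r : R) : open [set z : R[i]^o | normc z < r].
Proof.
have -> : [set z : R[i]^o | normc z < r] = normc @^-1` [set x | x < r] by [].
by apply: open_comp; [move=> x _; exact: (normc_csn R).2|exact: open_lt].
Qed.

Lemma SB_invz (r : R) : 0 < r -> SB [set z : R[i]^o | r < normc z] (fun z : R[i]^o => (z : R[i])^-1 : R[i]^o).
Proof.
move=> r0; apply: (@SB_inv_gen R _ id (fun b _ => dir b) r (@open_normc_gt r) r0).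
- by move=> w /= /ltW.
- by move=> b z _; exact: is_pd_id.
- by move=> b; apply: SB_cst; exact: (@open_normc_gt).
Qed.

Lemma coord_le_normc b z : `|coord b z| <= normc z.
Proof. by case: b; [exact: normc_Im|exact: normc_Re]. Qed.

Lemma ckernel_near0 z : normc z <= 1 / 2 -> ckernel z = 0.
Proof.
move=> z2; rewrite /ckernel /cutoff !bump1 ?mulr1 ?subrr ?mul0r//.
  exact: le_trans (coord_le_normc _ _) z2.
exact: le_trans (coord_le_normc _ _) z2.
Qed.

Lemma ckernel_far b z : 1 <= `|coord b z| -> ckernel z = z^-1.
Proof.
move=> /bump0[h _]; rewrite /ckernel /cutoff.
have -> : bump (coord false z) * bump (coord true z) = 0.
  by case: b h => ->; rewrite ?mul0r ?mulr0.
by rewrite subr0 mul1r.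
Qed.

Lemma SB_ckernel : SB setT ckernel.
Proof.
have -> : @setT R[i]^o = [set z : R[i]^o | 1 / 4 < normc z] `|` [set z : R[i]^o | normc z < 1 / 2].
  apply/seteqP; split=> // z _ /=; have [h|h] := ltP (1 / 4) (normc z); [left|right] => //; lra.
apply: SB_union.
  have o : open [set z : R[i]^o | (1 / 4 : R) < normc z] := @open_normc_gt _.
  have h1 : SB [set z : R[i]^o | 1 / 4 < normc z] cutoff by apply: SB_le SB_cutoff.
  have h2 := SB_sub o (SB_cst 1 o) h1.
  by have := SB_mul o h2 (SB_invz (_ : 0 < 1 / 4)); apply; lra.
apply: (SB_ext (@open_normc_lt _) _ (SB_cst 0 (@open_normc_lt _))) => z /= /ltW z2.
by rewrite ckernel_near0.
Qed.

(** Since 1 / z is holomorphic off 0, this lives only where the cutoff varies. Its rescalings, the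
    functions [dbar (kern n)], form an approximate identity up to the factor [smear_mass]. *)
Definition smear : R[i]^o -> R[i]^o := dbar ckernel.

Lemma dbarE (E : tvsType R[i]) (hE : hausdorff_space E) (f : R[i]^o -> E) (z : R[i]) (l : bool -> E) :
  (forall b, is_pd (dir b) f z (l b)) ->
  dbar f z = (2%:R^-1 : R[i]) *: (l false + 'i%C *: l true).
Proof.
move=> h; rewrite /dbar; have := is_pd_partial hE (h false); have := is_pd_partial hE (h true).
by rewrite /dir => -> ->.
Qed.

Lemma is_pd_invz b z : z != 0 ->
  is_pd (dir b) (fun z : R[i]^o => (z : R[i])^-1 : R[i]^o) z (- dir b / z ^+ 2).
Proof.
move=> z0; have nz : 0 < normc z by rewrite normc_gt0.
apply: (@is_pdV R [set w : R[i]^o | normc z / 2 < normc w] (dir b) id z (dir b) (normc z / 2)).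
- exact: (@open_normc_gt).
- by rewrite /=; lra.
- by rewrite normc_dir.
- lra.
- by move=> w /= /ltW.
- exact: is_pd_id.
Qed.

Lemma smearE z : z != 0 -> smear z = - (2%:R^-1 : R[i]) *
  ((bump' (coord false z) * bump (coord true z))%:C%C + 'i%C * (bump (coord false z) * bump' (coord true z))%:C%C) / z.
Proof.
move=> z0.
have h b := is_pdM (is_pdB (is_pd_cst (dir b) (1 : R[i]^o) z) (@is_pd_cutoff b z)) (@is_pd_invz b z z0).
have -> : smear z = dbar (fun w : R[i]^o => (1 - cutoff w : R[i]) *: ((w : R[i])^-1 : R[i]^o)) z by [].
rewrite (dbarE hC h) /=.
set A := (bump' _ * _)%:C%C; set B := (bump _ * bump' _)%:C%C; set X := cutoff z.
transitivity ((2%:R^-1 : R[i]) * (((0 - A) * z^-1 + (1 - X) * (- 1 / z ^+ 2)) +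
   'i%C * ((0 - B) * z^-1 + (1 - X) * (- 'i%C / z ^+ 2)))); first by [].
have i2 : 'i%C * 'i%C = -1 :> R[i] by rewrite -expr2 sqr_i.
transitivity ((2%:R^-1 : R[i]) * (- A * z^-1 - 'i%C * B * z^-1 - (1 - X) / z ^+ 2 * (1 + 'i%C * 'i%C))).
  by field.
by rewrite i2; field.
Qed.

Lemma smear0 : smear 0 = 0.
Proof.
have h b : is_pd (dir b) ckernel (0 : R[i]) 0.
  apply: (@is_pd_near _ _ _ (fun=> 0)); last exact: is_pd_cst.
  apply/nbhs_planeP; exists (1 / 2); first lra.
  by move=> w; rewrite subr0 => /ltW/ckernel_near0 ->.
by rewrite /smear (dbarE hC h) scaler0 addr0 scaler0.
Qed.

Lemma smear_supp z b : 1 <= `|coord b z| -> smear z = 0.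
Proof.
move=> h; have z0 : z != 0.
  apply/eqP => z0; move: h; have -> : coord b z = 0 by rewrite z0; case: (b).
  by rewrite normr0 ler10.
have [h1 h2] := bump0 h; rewrite smearE//.
by case: b h1 h2 {h} => -> ->; rewrite ?mulr0 ?mul0r rmorph0 ?mulr0 ?addr0 ?mulr0 ?mul0r.
Qed.

(** The numerator contains the derivative of the cutoff along rays, x d/dx + y d/dy, which appears
    when 1 / z is written as the conjugate of z over |z| ^ 2. *)
Lemma Re_smear z : z != 0 -> complex.Re (smear z) =
  - (coord false z * bump' (coord false z) * bump (coord true z) +
     coord true z * bump' (coord true z) * bump (coord false z)) / (2 * normc z ^+ 2).
Proof.
move=> z0; rewrite smearE//.
have nz : normc z ^+ 2 != 0 by rewrite expf_neq0// normc_eq0.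
have n2 : normc z ^+ 2 = coord false z ^+ 2 + coord true z ^+ 2.
  by case: z {z0 nz} => a b; rewrite /normc /coord /= sqr_sqrtr// addr_ge0 ?sqr_ge0.
rewrite n2 in nz *.
set A := (bump' _ * _)%:C%C; set B := (bump _ * bump' _)%:C%C.
have -> : - (2%:R^-1 : R[i]) * (A + 'i%C * B) / z =
  (- (2 * (coord false z ^+ 2 + coord true z ^+ 2))^-1)%:C%C * ((A + 'i%C * B) * (conjc z)).
  have -> : z^-1 = ((coord false z ^+ 2 + coord true z ^+ 2)^-1)%:C%C * conjc z.
    apply: (mulfI z0); rewrite divff// mulrCA.
    have -> : z * conjc z = (coord false z ^+ 2 + coord true z ^+ 2)%:C%C.
      by rewrite /coord; case: (z) => a b; apply/eqP; rewrite eq_complex /=; apply/andP; split; apply/eqP; ring.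
    by rewrite -rmorphM mulVf.
  have -> : (- (2 * (coord false z ^+ 2 + coord true z ^+ 2))^-1)%:C%C =
    - (2%:R^-1 : R[i]) * ((coord false z ^+ 2 + coord true z ^+ 2)^-1)%:C%C.
    by rewrite invfM rmorphN rmorphM fmorphV rmorph_nat mulNr.
  ring.
rewrite /A /B; case: z {z0 n2 nz A B} => x y; rewrite /coord /=; simpc; rewrite /=; ring.
Qed.

Lemma Re_smear_ge0 z : 0 <= complex.Re (smear z).
Proof.
have [->|z0] := eqVneq z 0; first by rewrite smear0.
rewrite Re_smear//; apply: divr_ge0; last by rewrite mulr_ge0 ?exprn_ge0 ?normc_ge0.
rewrite oppr_ge0; have := bump'_sign (coord false z); have := bump'_sign (coord true z).
have := bump_ge0 (coord false z); have := bump_ge0 (coord true z) => b1 b2 s1 s2.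
have := ler_wpM2r b1 s2; have := ler_wpM2r b2 s1; rewrite !mul0r; lra.
Qed.

Lemma Re_smear_gt0 : 0 < complex.Re (smear ((3 / 4)%:C%C)).
Proof.
have z0 : ((3 / 4)%:C%C : R[i]) != 0 by rewrite -normc_gt0 normcR normr_gt0 lt0r_neq0//; lra.
rewrite Re_smear// /coord /= mul0r mul0r addr0.
rewrite divr_gt0// ?mulr_gt0 ?exprn_gt0 ?normc_gt0//.
rewrite (bump1 (_ : `|0| <= 1 / 2)) ?normr0; last lra.
have := bump'_neg; lra.
Qed.

Lemma SB_smear : SB setT smear.
Proof.
have h b := SB_partial b SB_ckernel; have o := @openT R[i]^o.
have := SB_mul o (SB_cst (2%:R^-1) o) (SB_add o (h false) (SB_mul o (SB_cst 'i%C o) (h true))).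
exact.
Qed.

Definition kern (n : nat) (z : R[i]^o) : R[i]^o := (2 ^+ n)%:C%C *: ckernel ((2 ^+ n)%:C%C * z).

Lemma SB_kern n : SB setT (kern n).
Proof.
have o := @openT R[i]^o.
have h := SB_aff (2 ^+ n) 0 o SB_ckernel.
have := SB_mul o (SB_cst ((2 ^+ n)%:C%C) o) h; apply: SB_ext => // z _.
by rewrite addr0.
Qed.

Lemma kern_far n b z : mesh R n <= `|coord b z| -> kern n z = z^-1.
Proof.
rewrite meshE => h; rewrite /kern (@ckernel_far b).
  transitivity (((2 ^+ n)%:C%C : R[i]) * ((2 ^+ n)%:C%C * z)^-1); first by [].
  rewrite invfM mulrA divff ?mul1r//.
  by rewrite -normc_gt0 normcR normr_gt0 expf_neq0.
rewrite coordM normrM ger0_norm ?exprn_ge0// -ler_pdivrMl ?exprn_gt0// mulr1//.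
Qed.

Lemma dbar_kern n z : dbar (kern n) z = (4 ^+ n)%:C%C * smear ((2 ^+ n)%:C%C * z).
Proof.
have h b : is_pd (dir b) (kern n) z ((2 ^+ n)%:C%C *: ((2 ^+ n)%:C%C *: partial (dir b) ckernel ((2 ^+ n)%:C%C * z))).
  apply: is_pdZ.
  have := @is_pd_aff _ _ (dir b) (2 ^+ n) 0 ckernel z (partial (dir b) ckernel ((2 ^+ n)%:C%C * z)).
  have -> : (fun w : R[i]^o => ckernel ((2 ^+ n)%:C%C * w + 0)) = (fun w => ckernel ((2 ^+ n)%:C%C * w)).
    by apply/funext => w; rewrite addr0.
  apply; rewrite addr0; have [C C0 hC'] := SB_ckernel 1; exact: (BD_pd hC' I).
rewrite (dbarE hC h) /smear /dbar.
have -> : (4 ^+ n)%:C%C = (2 ^+ n)%:C%C * (2 ^+ n)%:C%C :> R[i].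
  by rewrite -rmorphM -exprMn; congr ((_ ^+ n)%:C)%C; ring.
move: (partial _ _ _) (partial _ _ _) => B A.
transitivity ((2%:R^-1 : R[i]) * ((2 ^+ n)%:C%C * ((2 ^+ n)%:C%C * A) + 'i%C * ((2 ^+ n)%:C%C * ((2 ^+ n)%:C%C * B)))).
  by [].
transitivity ((2 ^+ n)%:C%C * (2 ^+ n)%:C%C * ((2%:R^-1 : R[i]) * (A + 'i%C * B))); last by [].
ring.
Qed.

Lemma dbar_kern_supp n z b : mesh R n <= `|coord b z| -> dbar (kern n) z = 0.
Proof.
rewrite meshE => h; rewrite dbar_kern (@smear_supp _ b) ?mulr0//.
by rewrite coordM normrM ger0_norm ?exprn_ge0// -ler_pdivrMl ?exprn_gt0// mulr1.
Qed.

(** Real and imaginary parts are absolutely convergent: adding the majorant makes the terms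
    nonnegative, and monotone convergence applies. *)
Lemma plane_series_complete : series_complete R[i]^o.
Proof.
move=> D bD x c M c0 cM Dx; case: (bD) => _ _ _ boD.
have [r r0 hr] := plane_bounded boD.
have bx k : normc (x k) <= c k * r.
  have [y Dy <-] := Dx k; rewrite [_ *: _]/(_ * _) normcM normcR ger0_norm//.
  by rewrite ler_wpM2l// hr.
have real (y : nat -> R) : (forall k, `|y k| <= c k * r) ->
    exists l : R, (fun n => \sum_(k < n) y k) @ \oo --> l.
  move=> hy.
  have cr0 k : 0 <= c k * r by rewrite mulr_ge0// ltW.
  have crM n : \sum_(k < n) c k * r <= M * r by rewrite -mulr_suml ler_wpM2r// ltW.
  have [l1 h1 _] := psum_cvg cr0 crM.
  have y0 k : 0 <= y k + c k * r by have := hy k; rewrite ler_norml; lra.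
  have yM n : \sum_(k < n) (y k + c k * r) <= M * r + M * r.
    rewrite big_split/=; apply: lerD (crM n).
    by apply: le_trans (crM n); apply: ler_sum => k _; apply: le_trans (hy k); exact: ler_norm.
  have [l2 h2 _] := psum_cvg y0 yM; exists (l2 - l1).
  have -> : (fun n => \sum_(k < n) y k) = (fun n => \sum_(k < n) (y k + c k * r)) - (fun n => \sum_(k < n) c k * r).
    by apply/funext => n; rewrite fctE -sumrB; apply: eq_bigr => k _; rewrite addrK.
  exact: cvgB.
have [a ha] := real (fun k => complex.Re (x k)) (fun k => le_trans (normc_Re _) (bx k)).
have [b hb] := real (fun k => complex.Im (x k)) (fun k => le_trans (normc_Im _) (bx k)).
exists ((a%:C%C : R[i]^o) + 'i%C *: (b%:C%C : R[i]^o)).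
have h1 : (fun n => (\sum_(k < n) complex.Re (x k))%:C%C : R[i]^o) @ \oo --> (a%:C%C : R[i]^o) by exact: cvgRC.
have h2 : (fun n => 'i%C *: ((\sum_(k < n) complex.Im (x k))%:C%C : R[i]^o)) @ \oo --> 'i%C *: (b%:C%C : R[i]^o).
  by apply: cvgZc_tvs; exact: cvgRC.
have -> : (fun n => \sum_(k < n) x k) = (fun n => ((\sum_(k < n) complex.Re (x k))%:C%C : R[i]^o) +
   'i%C *: ((\sum_(k < n) complex.Im (x k))%:C%C : R[i]^o)).
  apply/funext => n; rewrite /= !rmorph_sum scaler_sumr -big_split/=.
  by apply: eq_bigr => k _; rewrite [LHS]complexE.
exact: (@cvgD_tvs _ _ _ _ _ _ _ _ _ h1 h2).
Qed.

End Kernel.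

Section Convolution.
Variables (R : realType) (E : tvsType R[i]) (hE : hausdorff_space E) (sc : series_complete E).
Implicit Types (k : R[i]^o -> R[i]^o) (g : R[i]^o -> E) (z w : R[i]) (D : set E).
Let hC := @plane_hausdorff R.
Let U := @unit_disk R.

Definition conv k g z : E := integral (fun w => (k (z - w) : R[i]) *: g w).

Definition supported g := forall z b, 1 < `|coord b z| -> g z = 0.

Lemma coord_continuous b : continuous (fun z : R[i]^o => coord b z).
Proof. by case: b; [exact: Im_continuous|exact: Re_continuous]. Qed.

Lemma open_coord_gt b (r : R) : open [set z : R[i]^o | r < `|coord b z|].
Proof.
have -> : [set z : R[i]^o | r < `|coord b z|] = (fun z : R[i]^o => coord b z) @^-1` [set x | r < `|x|] by [].
apply: open_comp; first by move=> x _; exact: coord_continuous.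
have -> : [set x : R | r < `|x|] = (fun x : R => `|x|) @^-1` [set x | r < x] by [].
by apply: open_comp; [move=> x _; exact: norm_continuous|exact: open_gt].
Qed.

Lemma supported_partial b g : supported g -> supported (partial (dir b) g).
Proof.
move=> sg z b' zb; rewrite (@partial_near _ _ _ _ (fun=> 0)).
  exact: (is_pd_partial hE (is_pd_cst _ _ _)).
have : nbhs (z : R[i]^o) [set w : R[i]^o | 1 < `|coord b' w|].
  by apply: open_nbhs_nbhs; split=> //; exact: (@open_coord_gt b' 1).
by apply: filterS => w; exact: sg.
Qed.

Lemma conv_BD k g n D : SB setT k -> bdisk D -> BD n setT (fun=> 1) D g ->
  exists2 M : R, 0 <= M & forall z, BD n setT (fun=> M) D (fun w => (k (z - w) : R[i]) *: g w).
Proof.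
move=> sk [Dc D0 _ _] Hg; have [C C0 hk] := sk n; have o := @openT R[i]^o.
have [Uc U0 _ _] := unit_disk_bdisk R.
exists (2 ^+ n * (Num.max 1 `|-1| ^+ n * C * 1)).
  by rewrite !mulr_ge0 ?exprn_ge0// le_max ler01.
move=> z; have ha := @BD_aff _ _ hC n setT (fun=> C) U k (-1) z o Uc U0 (fun _ _ => C0) hk.
have ha' : BD n setT (fun=> Num.max 1 `|-1| ^+ n * C) U (fun w => k (z - w)).
  apply: BD_ext ha => // w _; congr k; rewrite rmorphN rmorph1 mulN1r addrC//.
apply: (BD_mul hE o Dc D0 _ _ ha' Hg) => // y _.
by rewrite mulr_ge0 ?exprn_ge0// le_max ler01.
Qed.

Lemma conv_int k g D z : SB setT k -> bdisk D -> BD 1 setT (fun=> 1) D g ->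
  is_int (fun w => (k (z - w) : R[i]) *: g w) (conv k g z).
Proof.
move=> sk bD Hg; have [M M0 hM] := conv_BD sk bD Hg.
exact: (BD_int hE sc bD M0 (hM z)).
Qed.

Arguments conv_int {k g D} z _ _ _.

Lemma conv_bound k g D z (c : R) : SB setT k -> bdisk D -> BD 1 setT (fun=> 1) D g -> 0 <= c ->
  (forall w, normc (k w) <= c) -> scaled D (16 * c) (conv k g z).
Proof.
move=> sk bD Hg c0 kc; apply: (is_int_bound hE bD c0 _ (conv_int z sk bD Hg)) => w.
case: bD => Dc D0 _ _; apply: scaledZ (BD_val Hg I) => //; by rewrite mulr1.
Qed.

Lemma conv_bound_supp k g D z (c r : R) : SB setT k -> bdisk D -> BD 1 setT (fun=> 1) D g -> 0 <= c ->
  0 < r -> (forall w, normc (k w) <= c) -> (forall w b, r <= `|coord b w| -> k w = 0) ->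
  scaled D (9 * r ^+ 2 * c) (conv k g z).
Proof.
move=> sk bD Hg c0 r0 kc kr.
apply: (is_int_supp (z := z) hE bD c0 r0 _ _ (conv_int z sk bD Hg)) => w.
  case: bD => Dc D0 _ _; apply: scaledZ (BD_val Hg I) => //; by rewrite mulr1.
move=> nz b; rewrite ltNge; apply: contraNN nz => h.
rewrite (kr _ b) ?scale0r//; move: h; rewrite -normrN opprB.
suff -> : coord b (z - w) = coord b z - coord b w by [].
by rewrite -[- w]mulN1r -[-1 in LHS](rmorphN1 (real_complex R)) coordD coordM mulN1r.
Qed.

Lemma conv_lin k1 k2 g D z (a b : R[i]) : SB setT k1 -> SB setT k2 -> bdisk D -> BD 1 setT (fun=> 1) D g ->
  conv (fun w => (a * k1 w + b * k2 w : R[i])) g z = a *: conv k1 g z + b *: conv k2 g z.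
Proof.
move=> s1 s2 bD Hg; apply: (is_int_uniq hE).
have := is_intD (@is_intZ _ _ a _ _ (conv_int z s1 bD Hg)) (@is_intZ _ _ b _ _ (conv_int z s2 bD Hg)).
by apply: is_int_ext => w; rewrite scalerDl !scalerA.
Qed.

(** Differentiation under the integral: the Taylor remainder of the smooth kernel is of order h ^ 2
    uniformly, so no limit has to be exchanged with the integral. *)
Lemma conv_pd k g D b z : SB setT k -> bdisk D -> BD 1 setT (fun=> 1) D g ->
  is_pd (dir b) (conv k g) z (conv (partial (dir b) k) g z).
Proof.
move=> sk bD Hg; case: (bD) => Dc D0 _ boD.
have [M M0 hk] := sk 2%N.
apply/is_pdP => p cp e e0; have [s s0 hs] := bounded_csn boD cp.
have q0 : 0 < 16 * M * s + 1 by have := mulr_ge0 M0 (ltW s0); lra.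
exists (e / (16 * M * s + 1)) => [|h]; first by rewrite divr_gt0.
rewrite ltr_pdivlMr// => hh.
set x := _ - _ - _.
have xi : is_int (fun w => ((k (z + h%:C%C * dir b - w) - k (z - w) - h%:C%C * partial (dir b) k (z - w)) : R[i]) *: g w) x.
  have := is_intB (is_intB (conv_int (z + h%:C%C * dir b) sk bD Hg) (conv_int z sk bD Hg))
    (@is_intZ _ _ h%:C%C _ _ (conv_int z (SB_partial b sk) bD Hg)).
  by apply: is_int_ext => w; rewrite !scalerBl scalerA.
have c0 : 0 <= M * `|h| ^+ 2 by rewrite mulr_ge0 ?exprn_ge0.
have /(_ _)[|y Dy <-] := is_int_bound hE bD c0 _ xi.
  move=> w; apply: scaledZ (BD_val Hg I) => //; rewrite mulr1 //.
  apply/(unit_diskP _ c0).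
  have := taylor1 hC b (z - w) h (unit_disk_bdisk R) M0 hk.
  by rewrite [z - w + _]addrAC.
rewrite (seminormZ _ _ cp.1) normcR ger0_norm; last by rewrite !mulr_ge0.
apply: (@le_trans _ _ (16 * (M * `|h| ^+ 2) * s)).
  by rewrite ler_wpM2l ?hs// !mulr_ge0.
have -> : 16 * (M * `|h| ^+ 2) * s = (`|h| * (16 * M * s)) * `|h| by ring.
rewrite ler_wpM2r//; apply: le_trans (ltW hh); rewrite ler_wpM2l//; lra.
Qed.

Arguments conv_pd {k g D} b z _ _ _.

Lemma is_pd_reflect k b z w : SB setT k ->
  is_pd (dir b) (fun w : R[i]^o => k (z - w)) w (- partial (dir b) k (z - w)).
Proof.
move=> sk; have [C C0 hk] := sk 1%N.
have := @is_pd_aff _ _ (dir b) (-1) z k w (partial (dir b) k (z - w)).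
have e (y : R[i]) : (-1)%:C%C * y + z = z - y by rewrite rmorphN rmorph1 mulN1r addrC.
rewrite e => /(_ (BD_pd hk I)); rewrite rmorphN rmorph1 scaleN1r.
by have -> : (fun w : R[i]^o => k (-1 * w + z)) = (fun w => k (z - w)) by apply/funext => y; rewrite mulN1r addrC.
Qed.

Arguments is_pd_reflect {k} b z w _.

(** Integration by parts: the derivative of w -> k (z - w) g w has integral 0 by [int_partial]. *)
Lemma conv_partial k g D b z : SB setT k -> bdisk D -> BD 2 setT (fun=> 1) D g -> supported g ->
  conv k (partial (dir b) g) z = conv (partial (dir b) k) g z.
Proof.
move=> sk bD Hg sg; case: (bD) => Dc D0 _ _.
have Hg1 : BD 1 setT (fun=> 1) D g by apply: BD_lt Hg.
have [M M0 hM] := conv_BD sk bD Hg.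
have H0 : is_int (partial (dir b) (fun w => (k (z - w) : R[i]) *: g w)) 0.
  apply: (int_partial hE bD M0 (hM z)) => w wb; rewrite (sg _ b) ?scaler0//; lra.
have H1 := is_intB (conv_int z sk bD (BD_partial b Hg)) (conv_int z (SB_partial b sk) bD Hg1).
have : is_int (partial (dir b) (fun w => (k (z - w) : R[i]) *: g w))
  (conv k (partial (dir b) g) z - conv (partial (dir b) k) g z).
  apply: is_int_ext H1 => w; symmetry; apply: (is_pd_partial hE).
  have := is_pdM (is_pd_reflect b z w sk) (BD_pd (b := b) (z := w) Hg1 I).
  by congr is_pd; rewrite scaleNr addrC.
move=> /(is_int_uniq hE); rewrite (is_int_uniq hE H0) => /esym/eqP.
by rewrite subr_eq0 => /eqP.
Qed.

(** All derivatives are put on g, so that one bound c serves every order. Derivatives of the kernels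
    would grow with the rescaling. *)
Lemma conv_BDn n k g D (c : R) : SB setT k -> bdisk D -> supported g ->
  (forall g, supported g -> BD 1 setT (fun=> 1) D g -> forall z, scaled D c (conv k g z)) ->
  BD n.+1 setT (fun=> 1) D g -> BD n setT (fun=> c) D (conv k g).
Proof.
move=> sk bD + hc; case: (bD) => Dc D0 _ _; elim: n g => [|n IH] g sg Hg.
  by split=> // z _; exact: hc.
have Hg1 : BD 1 setT (fun=> 1) D g by apply: BD_lt Hg.
have Hg2 : BD 2 setT (fun=> 1) D g by apply: BD_lt Hg.
apply: (BD_intro hE (f' := fun b => conv k (partial (dir b) g))) => //; first exact: openT.
- by move=> z _; exact: hc.
- by move=> b z _; rewrite (conv_partial b z sk bD Hg2 sg); exact: (conv_pd b z sk bD Hg1).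
- move=> b; apply: IH; first exact: supported_partial.
  exact: BD_partial.
Qed.

End Convolution.

Arguments conv_int {R E} hE sc {k g D} z _ _ _.
Arguments conv_pd {R E} hE sc {k g D} b z _ _ _.
Arguments is_pd_reflect {R k} b z w _.

(** * The total mass of the smeared kernel *)

Section MeanOfSmear.
Variable R : realType.
Implicit Types (z w : R[i]).
Let hC := @plane_hausdorff R.
Let scC := @plane_series_complete R.
Let U := @unit_disk R.

Lemma coordN b z : coord b (- z) = - coord b z.
Proof. by case: z b => x y []. Qed.

Lemma coordB b z w : coord b (z - w) = coord b z - coord b w.
Proof. by rewrite coordD coordN. Qed.

Lemma coord_sum b n (u : nat -> R[i]) : coord b (\sum_(k < n) u k) = \sum_(k < n) coord b (u k).
Proof.
elim: n => [|n IH]; first by rewrite !big_ord0; case: b.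
by rewrite !big_ord_recr/= coordD IH.
Qed.

Lemma normc_le_coord z (r : R) : (forall b, `|coord b z| <= r) -> normc z <= 2 * r.
Proof.
move=> h; apply: le_trans (normc_le_ReIm z) _.
by have := h false; have := h true; rewrite /coord; lra.
Qed.

Definition one_fun : R[i]^o -> R[i]^o := fun=> 1.

Lemma one_BD n : BD n setT (fun=> 1) U one_fun.
Proof.
apply: (BD_cst hC); [exact: openT| |move=> z _].
  by case: (unit_disk_bdisk R).
by apply/(unit_diskP _ ler01); rewrite normc1.
Qed.

(* The value is pi, but it is enough to know that it is not 0. *)
Definition smear_mass : R[i] := conv (@smear R) one_fun 0.

(** The constant function 1 has no compact support, but w -> k (z - w) vanishes for |coord b w| >=
    2, so [int_partial] still applies. *)
Lemma conv_one_flat (k : R[i]^o -> R[i]^o) b z : SB setT k -> `|coord b z| <= 1 ->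
  (forall w b, 1 <= `|coord b w| -> k w = 0) -> conv (partial (dir b) k) one_fun z = 0.
Proof.
move=> sk zb kb; have bU := unit_disk_bdisk R.
have [M M0 hM] := conv_BD hC sk bU (one_BD 2).
have H0 : is_int (partial (dir b) (fun w => (k (z - w) : R[i]) *: one_fun w)) 0.
  apply: (int_partial hC bU M0 (hM z)) => w wb; rewrite (kb _ b) ?scale0r//.
  rewrite coordB; have := lerB_dist (coord b w) (coord b z); rewrite distrC; lra.
have := conv_int hC scC z (SB_partial b sk) bU (one_BD 1).
move=> /(is_intZ (k := -1)) H1.
have : is_int (partial (dir b) (fun w => (k (z - w) : R[i]) *: one_fun w))
   (-1 *: conv (partial (dir b) k) one_fun z).
  apply: is_int_ext H1 => w; symmetry; apply: (is_pd_partial hC).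
  have := is_pdM (is_pd_reflect b z w sk) (is_pd_cst (dir b) (1 : R[i]^o) w).
  by rewrite scaler0 addr0 scaleN1r scaleNr.
move=> /(is_int_uniq hC); rewrite (is_int_uniq hC H0) scaleN1r => /eqP.
by rewrite eq_sym oppr_eq0 => /eqP.
Qed.

(** Both partial derivatives vanish on the square by [conv_one_flat]; z is joined to 0 by a vertical
    and a horizontal segment. *)
Lemma conv_smear_const z : (forall b, `|coord b z| <= 1) -> conv (@smear R) one_fun z = smear_mass.
Proof.
move=> z1; have bU := unit_disk_bdisk R; have [Uc U0 _ _] := bU.
have sm := SB_smear R.
have flat0 b w : (forall b, `|coord b w| <= 1) -> is_pd (dir b) (conv (@smear R) one_fun) w 0.
  move=> w1; rewrite -(@conv_one_flat _ b w sm (w1 b)); last by move=> y b' h; exact: (@smear_supp _ _ b').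
  exact: (conv_pd hC scC b w sm bU (one_BD 1)).
have s0 : scaled U 0 0 by exact: scaled0.
rewrite (plane_split z 0) subr0 add0r.
set x := complex.Re z; set y := complex.Im z.
have hx : `|x| <= 1 := z1 false; have hy : `|y| <= 1 := z1 true.
have zero (t : R[i]^o) r : scaled U (0 * r) t -> t = 0.
  by rewrite mul0r => -[v _ <-]; rewrite scale0r.
have e1 := @pd_mean2 _ _ hC U (conv (@smear R) one_fun) 'i%C (x%:C%C * 1) y 0 (fun=> 0) bU (lexx 0).
have e2 := @pd_mean2 _ _ hC U (conv (@smear R) one_fun) 1 0 x 0 (fun=> 0) bU (lexx 0).
rewrite add0r in e2.
have /zero/eqP : scaled U (0 * `|y|) (conv (@smear R) one_fun (x%:C%C * 1 + y%:C%C * 'i%C) - conv (@smear R) one_fun (x%:C%C * 1)).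
  apply: e1 => // t ty; apply: (flat0 true) => b; rewrite coordD !coordM.
  case: b; rewrite /coord /= ?mulr0 ?mulr1 ?addr0 ?add0r//; exact: le_trans ty hy.
rewrite subr_eq0 => /eqP ->.
have /zero/eqP : scaled U (0 * `|x|) (conv (@smear R) one_fun (x%:C%C * 1) - conv (@smear R) one_fun 0).
  apply: e2 => // t ty; rewrite add0r; apply: (flat0 false) => b; rewrite !coordM.
  case: b; rewrite /coord /= ?mulr0 ?mulr1 ?normr0//; exact: le_trans ty hx.
by rewrite subr_eq0 => /eqP ->.
Qed.

Lemma dbar_kern0 : dbar (kern 0) = @smear R.
Proof. by apply/funext => z; rewrite dbar_kern !expr0 !mul1r. Qed.

Lemma SB_dbar (k : R[i]^o -> R[i]^o) : SB setT k -> SB setT (dbar k).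
Proof.
move=> sk; have h b := SB_partial b sk; have o := @openT R[i]^o.
have := SB_mul o (SB_cst (2%:R^-1) o) (SB_add o (h false) (SB_mul o (SB_cst 'i%C o) (h true))).
exact.
Qed.

Lemma SB_comb (k1 k2 : R[i]^o -> R[i]^o) (a b : R[i]) : SB setT k1 -> SB setT k2 ->
  SB setT (fun w => (a * k1 w + b * k2 w : R[i])).
Proof.
move=> s1 s2; have o := @openT R[i]^o.
exact: (SB_add o (SB_mul o (SB_cst a o) s1) (SB_mul o (SB_cst b o) s2)).
Qed.

(** Both kernels equal 1 / w away from 0, so their difference has small compact support. The linear
    combination is in the form of [conv_lin]. *)
Definition dkern n (w : R[i]^o) : R[i]^o := 1 * kern n.+1 w + (-1) * kern n w.

Lemma SB_dkern n : SB setT (dkern n).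
Proof. apply: SB_comb; exact: SB_kern. Qed.

Lemma dkern_supp n w b : mesh R n <= `|coord b w| -> dkern n w = 0.
Proof.
move=> h; rewrite /dkern (kern_far h) (@kern_far _ n.+1 b) ?mulN1r ?mul1r ?subrr//.
apply: le_trans h; rewrite (meshS R n) ler_peMl ?ler1n// ltW// mesh_gt0//.
Qed.

Lemma conv_dbar (E : tvsType R[i]) (hE : hausdorff_space E) (sc : series_complete E) (k : R[i]^o -> R[i]^o)
    (g : R[i]^o -> E) D z :
  SB setT k -> bdisk D -> BD 1 setT (fun=> 1) D g ->
  conv (dbar k) g z = (2%:R^-1 : R[i]) *: (conv (partial 1 k) g z + 'i%C *: conv (partial 'i%C k) g z).
Proof.
move=> sk bD Hg; apply: (is_int_uniq hE).
have h1 := conv_int hE sc z (SB_partial false sk) bD Hg.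
have h2 := conv_int hE sc z (SB_partial true sk) bD Hg.
have := is_intZ (k := 2%:R^-1) (is_intD h1 (is_intZ (k := 'i%C) h2)).
by apply: is_int_ext => w; rewrite /dbar scalerA -scalerDl scalerA.
Qed.

Lemma conv_dbar_eq (k1 k2 : R[i]^o -> R[i]^o) z : SB setT k1 -> SB setT k2 ->
  (forall b, conv (partial (dir b) k1) one_fun z = conv (partial (dir b) k2) one_fun z) ->
  conv (dbar k1) one_fun z = conv (dbar k2) one_fun z.
Proof.
move=> s1 s2 h; have bU := unit_disk_bdisk R.
apply: (etrans (conv_dbar hC scC z s1 bU (one_BD 1))).
apply: (etrans _ (esym (conv_dbar hC scC z s2 bU (one_BD 1)))).
exact: (f_equal2 (fun a b : R[i]^o => (2%:R^-1 : R[i]) *: (a + 'i%C *: b)) (h false) (h true)).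
Qed.

(** Passing from n to n + 1 adds derivatives of the compactly supported [dkern n], whose integrals
    are 0. *)
Lemma conv_dbar_kern n z : (forall b, `|coord b z| <= 1) -> conv (dbar (kern n)) one_fun z = smear_mass.
Proof.
move=> z1; have bU := unit_disk_bdisk R.
elim: n => [|n IH]; first by rewrite dbar_kern0 conv_smear_const.
rewrite -IH; apply/eqP; rewrite -subr_eq0; apply/eqP.
have sk := SB_kern R.
have pk b : conv (partial (dir b) (dkern n)) one_fun z = 0.
  apply: (@conv_one_flat (dkern n) b z (SB_dkern n) (z1 b)).
  by move=> w b' h; apply: (@dkern_supp _ _ b'); apply: le_trans h; exact: mesh_le1.
have pE b w : partial (dir b) (dkern n) w = 1 * partial (dir b) (kern n.+1) w + (-1) * partial (dir b) (kern n) w.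
  apply: (is_pd_partial hC); have [C1 _ h1] := sk n.+1 1%N; have [C2 _ h2] := sk n 1%N.
  exact: (is_pdD (@is_pdZ _ _ (dir b) 1 _ w _ (BD_pd (b := b) h1 I)) (@is_pdZ _ _ (dir b) (-1) _ w _ (BD_pd (b := b) h2 I))).
have cE b : conv (partial (dir b) (kern n.+1)) one_fun z = conv (partial (dir b) (kern n)) one_fun z.
  have := pk b; have -> : partial (dir b) (dkern n) = fun w => 1 * partial (dir b) (kern n.+1) w + (-1) * partial (dir b) (kern n) w.
    by apply/funext => w; rewrite pE.
  rewrite (conv_lin hC scC z 1 (-1) (SB_partial b (sk n.+1)) (SB_partial b (sk n)) bU (one_BD 1)).
  by rewrite scale1r scaleN1r => /eqP; rewrite subr_eq0 => /eqP.
apply/eqP; rewrite subr_eq0; apply/eqP.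
exact: (conv_dbar_eq (sk n.+1) (sk n) cE).
Qed.

(** Near the point 3 / 4 the real part is at least half its value there, by the Lipschitz estimate.
    The grid points in this small square bound all fine Riemann sums from below by m rho ^ 2. *)
Lemma conv_one_gt0 (k : R[i]^o -> R[i]^o) : SB setT k -> (forall w, 0 <= complex.Re (k w)) ->
  0 < complex.Re (k (3 / 4)%:C%C) -> 0 < complex.Re (conv k one_fun 0 : R[i]).
Proof.
move=> sk k_ge0; pose w0 : R[i] := (3 / 4)%:C%C; rewrite -/w0 => k_gt0.
pose m := complex.Re (k w0) / 2; have m0 : 0 < m by rewrite divr_gt0// k_gt0.
have mE : complex.Re (k w0) = 2 * m.
  by rewrite /m mulrCA divff ?mulr1// pnatr_eq0.
clearbody m; have bU := unit_disk_bdisk R; have [M M0 hM] := sk 1%N.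
(* The first bound keeps the small square inside the grid, the second keeps the variation 4 M rho of
   k below m. *)
pose rho := Num.min (1 / 4) (m / (4 * M + 1)).
have M1 : 0 < 4 * M + 1 by lra.
have r0 : 0 < rho by rewrite lt_min; apply/andP; split; [lra|exact: divr_gt0].
have near w : (forall b, `|coord b (w - w0)| < rho) -> m <= complex.Re (k w).
  move=> hw; have : normc (w - w0) <= 2 * rho by apply: normc_le_coord => b; apply: ltW.
  have := BD_lip_plane hC w0 w bU M0 hM => + h.
  have c0 : 0 <= M * (2 * normc (w - w0)) by rewrite !mulr_ge0 ?normc_ge0.
  move=> /(unit_diskP _ c0) h1.
  have h2 := le_trans (normc_Re _) h1; rewrite raddfB/= in h2.
  have h3 : M * (2 * normc (w - w0)) <= m.
    have : rho * (4 * M + 1) <= m by rewrite -ler_pdivlMr// ge_min lexx orbT.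
    have := ler_wpM2l M0 h; lra.
  have : `|complex.Re (k w) - complex.Re (k w0)| <= m by apply: le_trans h2 h3.
  rewrite mE; move: (complex.Re (k w)) => t; rewrite ler_norml => /andP[h4 _]; lra.
pose u w : R[i]^o := (k (0 - w) : R[i]) *: one_fun w.
have uE w : u w = k (0 - w) by exact: mulr1.
have [q0 hq] := mesh_small r0.
have lb q : (q0 <= q)%N -> m * rho ^+ 2 <= complex.Re (rsum q u).
  move=> /hq mr; have mq := mesh_gt0 R q; have gN := meshN R q.
  pose ind b (i : nat) : R := if `|(- 2 + i%:R * mesh R q) + (if b then 0 else 3 / 4)| < rho then 1 else 0.
  have ind01 b i : 0 <= ind b i <= 1 by rewrite /ind; case: ifP; rewrite ?lexx ?ler01.
  pose cnt b := \sum_(i < gridN q) ind b i.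
  have cb b : rho <= mesh R q * cnt b.
    pose cen : R := if b then 0 else 3 / 4.
    have cen01 : 0 <= cen <= 3 / 4 by rewrite /cen; case: (b); apply/andP; split; lra.
    have r4 : rho <= 1 / 4 by rewrite ge_min lexx.
    have a0 : 0 <= (2 - cen - rho) / mesh R q by rewrite divr_ge0 ?(ltW mq)//; lra.
    have bN : (2 - cen + rho) / mesh R q <= (gridN q)%:R by rewrite ler_pdivrMr// mulrC gN; lra.
    have := count_between_ge a0 bN.
    have -> : (2 - cen + rho) / mesh R q - (2 - cen - rho) / mesh R q - 1 = (2 * rho - mesh R q) / mesh R q.
      by field; rewrite gt_eqF.
    rewrite ler_pdivrMr// => h; apply: le_trans (_ : 2 * rho - mesh R q <= _); first lra.
    apply: (le_trans h); rewrite [leRHS]mulrC ler_wpM2r ?(ltW mq)//; apply: ler_sum => i _.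
    case: ifP => [|_]; last by have /andP[] := ind01 b i.
    rewrite ltr_pdivrMr// ltr_pdivlMr// => /andP[h1 h2]; rewrite /ind -/cen.
    suff -> : `|-2 + i%:R * mesh R q + cen| < rho by [].
    rewrite ltr_norml; move: h1 h2; move: (_ * mesh R q) => x h1 h2; apply/andP; split; lra.
  have -> : complex.Re (rsum q u) = mesh R q ^+ 2 * (\sum_(i < gridN q) \sum_(j < gridN q) complex.Re (k (- gpt R q i j))).
    rewrite -[complex.Re _]/(coord false _) /rsum [_ *: _]/(_ * _) coordM; congr (_ * _).
    rewrite (@coord_sum false _ (fun i => \sum_(j < gridN q) u (gpt R q i j))); apply: eq_bigr => i _.
    rewrite (@coord_sum false _ (fun j => u (gpt R q i j))); apply: eq_bigr => j _.
    by rewrite uE sub0r.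
  apply: (@le_trans _ _ (mesh R q ^+ 2 * (\sum_(i < gridN q) \sum_(j < gridN q) m * (ind false i * ind true j)))); last first.
    rewrite ler_wpM2l ?exprn_ge0 ?(ltW mq)//; apply: ler_sum => i _; apply: ler_sum => j _.
    rewrite /ind; case: ifP => h1; last by rewrite mul0r mulr0 k_ge0.
    case: ifP => h2; last by rewrite mulr0 mulr0 k_ge0.
    rewrite !mulr1; apply: near => b; rewrite coordB coordN gpt_coord -normrN; case: b.
      by rewrite /coord /=; move: h2; rewrite addr0 subr0 opprK.
    by move: h1; rewrite /coord /= opprB opprK addrC.
  have -> : mesh R q ^+ 2 * (\sum_(i < gridN q) \sum_(j < gridN q) m * (ind false i * ind true j)) =
     m * ((mesh R q * cnt false) * (mesh R q * cnt true)).
    transitivity (mesh R q ^+ 2 * (m * (cnt false * cnt true))); last ring.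
    congr (_ * _); rewrite /cnt mulr_suml mulr_sumr; apply: eq_bigr => i _.
    by rewrite mulr_sumr mulr_sumr.
  rewrite ler_pM2l// expr2; apply: ler_pM => //; exact: ltW.
have mr0 : 0 < m * rho ^+ 2 by rewrite mulr_gt0 ?exprn_gt0.
have := conv_int hC scC 0 sk bU (one_BD 1).
rewrite -/u => /cvg_csn/(_ _ (normc_csn R) _ mr0)[q1 _ h].
have := h (maxn q0 q1) (leq_maxr _ _); have := lb (maxn q0 q1) (leq_maxl _ _).
move: (rsum _ u) ((conv k one_fun 0)) => x y h1 h2; have := le_lt_trans (normc_Re _) h2.
rewrite raddfB /= ltr_norml => /andP[h3 h4]; move: h1 h4; move: (complex.Re x) (complex.Re y) => *; lra.
Qed.

Lemma smear_mass_gt0 : 0 < complex.Re smear_mass.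
Proof.
apply: conv_one_gt0; [exact: SB_smear|exact: Re_smear_ge0|exact: Re_smear_gt0].
Qed.

End MeanOfSmear.

(** * Solution of the Cauchy-Riemann equation for compactly supported data *)

Section Potential.
Variables (R : realType) (E : tvsType R[i]) (hE : hausdorff_space E) (sc : series_complete E).
Variables (k : nat -> R[i]^o -> R[i]^o) (C0 S0 : R) (mu : R[i]).
Implicit Types (g : R[i]^o -> E) (z w : R[i]) (D : set E).
Let hC := @plane_hausdorff R.
Let scC := @plane_series_complete R.
Hypotheses (C0_ge0 : 0 <= C0) (S0_ge0 : 0 <= S0) (sk : forall n, SB setT (k n)).
Hypothesis k_le : forall n w, normc (k n w) <= 2 ^+ n * C0.
Hypothesis k_far : forall n b w, mesh R n <= `|coord b w| -> k n w = w^-1.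
Hypothesis dk_le : forall n w, normc (dbar (k n) w) <= 4 ^+ n * S0.
Hypothesis dk_far : forall n b w, mesh R n <= `|coord b w| -> dbar (k n) w = 0.
Hypothesis dk_mass : forall n z, (forall b, `|coord b z| <= 1) -> conv (dbar (k n)) (@one_fun R) z = mu.

Let kdiff n w : R[i]^o := 1 * k n.+1 w + (-1) * k n w.
(* Summing the differences of consecutive kernels turns the limit of the
   transforms into a series to which [series_complete] applies. *)
Let kseq n := if n is m.+1 then kdiff m else k 0.
(** 16 C0 is area times size for the first kernel. The difference number m has size at most 3 C0 2 ^
    m on a square of half-side mesh m, and 9 mesh ^ 2 times this is 27 C0 mesh m. *)
Let e n : R := if n is m.+1 then 27 * C0 * mesh R m else 16 * C0.

Let mesh_pow n : mesh R n * 2 ^+ n = 1.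
Proof. by rewrite meshE mulVf// expf_neq0// pnatr_eq0. Qed.

Let e_ge0 n : 0 <= e n.
Proof. by case: n => [|n] /=; rewrite !mulr_ge0// ltW// mesh_gt0. Qed.

(** The meshes sum to at most 2, so the total is at most 16 C0 + 54 C0. *)
Let e_sum n : \sum_(j < n) e j <= 70 * C0.
Proof.
suff h m : \sum_(j < m.+1) e j <= 70 * C0 - 54 * C0 * mesh R m.
  case: n => [|n]; first by rewrite big_ord0 mulr_ge0.
  apply: (le_trans (h n)); rewrite gerBl !mulr_ge0// ltW// mesh_gt0//.
elim: m => [|m IH]; first by rewrite big_ord_recr big_ord0/= add0r meshE expr0 invr1; lra.
rewrite big_ord_recr/=; apply: (le_trans (lerD IH (lexx _))).
by rewrite (meshS R m); move: (mesh_gt0 R m.+1) => h; nra.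
Qed.

Let SB_kseq n : SB setT (kseq n).
Proof. by case: n => [|n]; [exact: sk|apply: SB_comb; exact: sk]. Qed.

Let kseq_bound n g D z : bdisk D -> BD 1 setT (fun=> 1) D g -> scaled D (e n) (conv (kseq n) g z).
Proof.
move=> bD Hg; case: n => [|n].
  apply: (conv_bound hE sc z (sk 0) bD Hg C0_ge0) => w.
  by have := k_le 0 w; rewrite expr0 mul1r.
have c0 : 0 <= 3 * 2 ^+ n * C0 by rewrite !mulr_ge0 ?exprn_ge0.
have -> : e n.+1 = 9 * mesh R n ^+ 2 * (3 * 2 ^+ n * C0).
  transitivity (27 * C0 * mesh R n * (mesh R n * 2 ^+ n)); first by rewrite mesh_pow mulr1.
  by rewrite /e; ring.
apply: (conv_bound_supp hE sc z (SB_kseq n.+1) bD Hg c0 (mesh_gt0 R n)) => [w|w b h].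
  rewrite /kseq /kdiff mul1r mulN1r; apply: (le_trans (normc_triangle _ _)); rewrite normcN.
  have := k_le n w; have := k_le n.+1 w; rewrite exprS; lra.
rewrite /kseq /kdiff (k_far h) (@k_far n.+1 b w) ?mul1r ?mulN1r ?subrr//.
by apply: le_trans h; have := mesh_gt0 R n.+1; rewrite (meshS R n); lra.
Qed.

Let conv_tele n g D z : bdisk D -> BD 1 setT (fun=> 1) D g ->
  \sum_(j < n.+1) conv (kseq j) g z = conv (k n) g z.
Proof.
move=> bD Hg; elim: n => [|n IH]; first by rewrite big_ord_recr big_ord0/= add0r.
rewrite big_ord_recr/= IH /kseq /kdiff (conv_lin hE sc z 1 (-1) (sk n.+1) (sk n) bD Hg).
by rewrite scale1r scaleN1r addrC subrK.
Qed.

Let BD_kseq j n g D : bdisk D -> supported g -> BD n.+1 setT (fun=> 1) D g ->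
  BD n setT (fun=> e j) D (conv (kseq j) g).
Proof.
move=> bD sg Hg; apply: (conv_BDn hE sc (SB_kseq j) bD sg) Hg => g' _ Hg' z.
exact: kseq_bound.
Qed.

Let pot g z : E := xget 0 [set l : E | (fun n => \sum_(j < n) conv (kseq j) g z) @ \oo --> l].

Let pot_cvg g D z : bdisk D -> BD 1 setT (fun=> 1) D g ->
  (fun n => \sum_(j < n) conv (kseq j) g z) @ \oo --> pot g z.
Proof.
move=> bD Hg; have [l hl] := sc bD e_ge0 e_sum (fun j => kseq_bound j z bD Hg).
exact: (@xgetPex _ (0 : E) [set l : E | (fun n => \sum_(j < n) conv (kseq j) g z) @ \oo --> l] (ex_intro _ l hl)).
Qed.

Arguments pot_cvg {g D} z _ _.

Let conv_cvg g D z : bdisk D -> BD 1 setT (fun=> 1) D g -> (fun n => conv (k n) g z) @ \oo --> pot g z.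
Proof.
move=> bD Hg; apply/cvg_csn => p cp r r0; have /cvg_csn/(_ p cp r r0)[N _ h] := pot_cvg z bD Hg.
exists N => // n /= Nn; have := h n.+1 (leqW Nn).
by rewrite /= (conv_tele n z bD Hg).
Qed.

Arguments conv_cvg {g D} z _ _.

Let pot_BD n g D : bdisk D -> supported g -> BD n.+1 setT (fun=> 1) D g -> BD n setT (fun=> 70 * C0) D (pot g).
Proof.
move=> bD sg Hg; case: (bD) => Dc D0 _ _.
have Hg1 : BD 1 setT (fun=> 1) D g by apply: BD_lt Hg.
have := @BD_series _ _ hE setT D e (70 * C0) 1 (fun=> 1) (@openT _) bD e_ge0 e_sum
  (fun _ _ => ler01) (fun _ _ => lexx _) n (fun j => conv (kseq j) g) (pot g) sc.
have BDe j : BD n setT (fun=> e j * 1) D (conv (kseq j) g) by rewrite mulr1; exact: BD_kseq.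
move=> /(_ BDe (fun z _ => pot_cvg z bD Hg1)).
by apply: BD_eqc => z _; rewrite mulr1.
Qed.

Let pot_pd b g D z : bdisk D -> supported g -> BD 2 setT (fun=> 1) D g ->
  is_pd (dir b) (pot g) z (pot (partial (dir b) g) z).
Proof.
move=> bD sg Hg; case: (bD) => Dc D0 _ _.
have Hg1 : BD 1 setT (fun=> 1) D g by apply: BD_lt Hg.
have BDe j : BD 1 setT (fun=> e j * 1) D (conv (kseq j) g) by rewrite mulr1; exact: BD_kseq.
apply: (@is_pd_series _ _ hE setT D e (70 * C0) 1 (fun=> 1) (@openT _) bD e_ge0 e_sum
  (fun _ _ => ler01) (fun _ _ => lexx _) (fun j => conv (kseq j) g) (pot g) b z _ BDe _ I) => [y _|].
  exact: (pot_cvg y bD Hg1).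
have -> : (fun n => \sum_(j < n) partial (dir b) (conv (kseq j) g) z) =
          (fun n => \sum_(j < n) conv (kseq j) (partial (dir b) g) z).
  apply/funext => n; apply: eq_bigr => j _; apply: (is_pd_partial hE).
  by rewrite (conv_partial hE sc b z (SB_kseq j) bD Hg sg); exact: (conv_pd hE sc b z (SB_kseq j) bD Hg1).
exact: (pot_cvg z bD (BD_partial b Hg)).
Qed.

Arguments pot_pd b {g D} z _ _ _.

Let conv_one_scale n z (x : E) : is_int (fun w => (dbar (k n) (z - w) : R[i]) *: x) ((conv (dbar (k n)) (@one_fun R) z : R[i]) *: x).
Proof.
have h := conv_int hC scC z (SB_dbar (sk n)) (unit_disk_bdisk R) (one_BD R 1).
pose u w : R[i]^o := (dbar (k n) (z - w) : R[i]) *: @one_fun R w.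
have uE q : rsum q (fun w => (dbar (k n) (z - w) : R[i]) *: x) = (rsum q u : R[i]) *: x.
  have -> : rsum q u = ((mesh R q ^+ 2)%:C%C : R[i]) * \sum_(i < gridN q) \sum_(j < gridN q) (u (gpt R q i j) : R[i]) by [].
  rewrite -scalerA /rsum; congr (_ *: _).
  rewrite scaler_suml; apply: eq_bigr => i _; rewrite scaler_suml; apply: eq_bigr => j _.
  by rewrite /u; congr (_ *: _); symmetry; exact: mulr1.
rewrite /is_int; under eq_fun do rewrite uE.
apply: (@cvgZ_tvs _ _ _ _ _ (fun=> x) (fun q => rsum q u)) h; exact: cvg_cst.
Qed.

Arguments conv_one_scale n z x : clear implicits.

(** Approximate identity: g w is replaced by g z on a square of half-side mesh n, with error at most
    4 mesh n. Together with the size 4 ^ n S0 of the kernel and the factor 9 mesh ^ 2 this leaves 36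
    S0 mesh n. *)
Let conv_dbar_cvg g D z : bdisk D -> supported g -> BD 1 setT (fun=> 1) D g ->
  (fun n => conv (dbar (k n)) g z) @ \oo --> mu *: g z.
Proof.
move=> bD sg Hg; case: (bD) => Dc D0 _ boD.
(* The mass is known only on the square that carries g; elsewhere both sides are 0. *)
have muE n : (conv (dbar (k n)) (@one_fun R) z : R[i]) *: g z = mu *: g z.
  have [h|] := pselect (forall b, `|coord b z| <= 1); first by rewrite dk_mass.
  move=> /existsNP[b /negP]; rewrite -ltNge => /sg ->; by rewrite !scaler0.
have key n : scaled D (36 * S0 * mesh R n) (conv (dbar (k n)) g z - mu *: g z).
  have m0 := mesh_gt0 R n.
  rewrite -(muE n).
  have hi := is_intB (conv_int hE sc z (SB_dbar (sk n)) bD Hg) (conv_one_scale n z (g z)).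
  have c0 : 0 <= 4 ^+ n * S0 * (4 * mesh R n) by rewrite !mulr_ge0 ?exprn_ge0// ltW.
  have -> : 36 * S0 * mesh R n = 9 * mesh R n ^+ 2 * (4 ^+ n * S0 * (4 * mesh R n)).
    have -> : 4 ^+ n = 2 ^+ n * 2 ^+ n :> R by rewrite -exprMn; congr (_ ^+ _); ring.
    transitivity (36 * S0 * mesh R n * (mesh R n * 2 ^+ n) * (mesh R n * 2 ^+ n)).
      by rewrite mesh_pow !mulr1.
    ring.
  apply: (is_int_supp (z := z) hE bD c0 m0 _ _ hi) => [w|w nz b].
    rewrite -scalerBr; have [[b hb]|h] := pselect (exists b, mesh R n <= `|coord b (z - w)|).
      by rewrite (dk_far hb) scale0r; exact: scaled0.
    have hw b : `|coord b (z - w)| <= mesh R n.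
      by rewrite leNgt; apply/negP => hb; apply: h; exists b; exact: ltW.
    have n2 := normc_le_coord hw.
    apply: scaledZ (BD_lip_plane hE z w bD ler01 Hg) => //; first by rewrite !mulr_ge0 ?normc_ge0.
    rewrite mul1r normc_sub; apply: ler_pM => //; rewrite ?mulr_ge0 ?normc_ge0//; lra.
  rewrite ltNge; apply: contraNN nz => h.
  rewrite (@dk_far n b (z - w)) ?scale0r ?subrr//; by rewrite coordB distrC -coordB coordB.
apply/cvg_csn => p cp r r0; have [s s0 hs] := bounded_csn boD cp.
have q1 : 0 < 36 * S0 * s + 1 by have := mulr_ge0 S0_ge0 (ltW s0); lra.
have [|q0 hq] := @mesh_small R (r / (36 * S0 * s + 1)); first by rewrite divr_gt0.
exists q0 => // q /= /hq; rewrite ltr_pdivlMr// => hq'.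
have [y Dy <-] := key q.
have m0 := mesh_gt0 R q; have k0 : 0 <= 36 * S0 * mesh R q by rewrite !mulr_ge0// ltW.
rewrite (seminormZ _ _ cp.1) normcR ger0_norm//.
apply: (le_lt_trans (ler_wpM2l k0 (hs _ Dy))); apply: le_lt_trans hq'.
have := mulr_ge0 S0_ge0 (ltW s0); nra.
Qed.

Arguments conv_dbar_cvg {g D} z _ _ _.

(** The derivatives of [pot g] are limits of convolutions with derivatives of g; moving these back
    to the kernels produces [conv (dbar (k n)) g], whose limit is known. *)
Let dbar_pot g D z : bdisk D -> supported g -> BD 2 setT (fun=> 1) D g -> dbar (pot g) z = mu *: g z.
Proof.
move=> bD sg Hg; case: (bD) => Dc D0 _ boD.
have Hg1 : BD 1 setT (fun=> 1) D g by apply: BD_lt Hg.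
rewrite (dbarE hE (fun b => pot_pd b z bD sg Hg)).
apply: (cvg_unique hE) (conv_dbar_cvg z bD sg Hg1).
have h b := conv_cvg z bD (BD_partial b Hg).
have := @cvgZc_tvs _ _ _ _ _ _ 2%:R^-1 _ (@cvgD_tvs _ _ _ _ _ _ _ _ _ (h false) (@cvgZc_tvs _ _ _ _ _ _ 'i%C _ (h true))).
have e1 b n : conv (k n) (partial (dir b) g) z = conv (partial (dir b) (k n)) g z.
  exact: (conv_partial hE sc b z (sk n) bD Hg sg).
under eq_fun do rewrite (e1 false) (e1 true).
have e2 n : (2%:R^-1 : R[i]) *: (conv (partial (dir false) (k n)) g z + 'i%C *: conv (partial (dir true) (k n)) g z)
  = conv (dbar (k n)) g z by symmetry; exact: (conv_dbar hE sc z (sk n) bD Hg1).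
by under eq_fun do rewrite e2; move=> h3; exact: h3.
Qed.

(** An open set around the square carrying g on which the powers of z - z' are bounded; off the
    square the integrand of a moment vanishes. *)
Let disk3 : set R[i]^o := [set z | normc z < 3].

Let SB_centered (z' : R[i]) i : SB disk3 (fun z : R[i]^o => ((z - z') ^+ i : R[i])).
Proof.
have o : open disk3 := @open_normc_lt R 3.
have h1 : SB disk3 (fun z : R[i]^o => (z - z' : R[i])).
  apply: SB_sub => //; last exact: SB_cst.
  case=> [|n].
    exists 3 => //; split=> // z /ltW zn; apply/unit_diskP => //.
  have := @SB_intro R disk3 id (fun b _ => dir b) 3 o (ler0n _ 3) (fun z zn => ltW zn)
    (fun b z _ => is_pd_id z) (fun n b => SB_cst (dir b) o n) n.
  by [].
elim: i => [|i IH]; first exact: SB_cst.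
have := SB_mul o h1 IH; apply: SB_ext => // z _; by rewrite exprS.
Qed.

Let moment_int g D (z' : R[i]) i : bdisk D -> supported g -> BD 1 setT (fun=> 1) D g ->
  is_int (fun w => ((w - z') ^+ i : R[i]) *: g w) (integral (fun w => ((w - z') ^+ i : R[i]) *: g w)).
Proof.
move=> bD sg Hg; case: (bD) => Dc D0 _ _; have [C C0' hC'] := @SB_centered z' i 1%N.
have o : open disk3 := @open_normc_lt R 3.
apply: (BD_int (M := 2 ^+ 1 * (C * 1)) hE sc bD).
  by rewrite !mulr_ge0.
have B1 : BD 1 disk3 (fun=> 2 ^+ 1 * (C * 1)) D (fun w => ((w - z') ^+ i : R[i]) *: g w).
  apply: (BD_mul hE o Dc D0) => //.
  exact: BD_le Hg.
have B2 b : BD 1 [set z : R[i]^o | 1 < `|coord b z|] (fun=> 2 ^+ 1 * (C * 1)) D (fun w => ((w - z') ^+ i : R[i]) *: g w).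
  have ob := @open_coord_gt R b 1.
  apply: (BD_ext ob _ (BD_cst0 hE 1 _ ob D0)) => z /= /sg ->; by rewrite scaler0.
have := BD_union B1 (BD_union (B2 false) (B2 true)).
suff -> : disk3 `|` ([set z : R[i]^o | 1 < `|coord false z|] `|` [set z : R[i]^o | 1 < `|coord true z|]) = setT by [].
apply/seteqP; split=> // z _; have [h1|h1] := ltP (normc z) 3; first by left.
right; have := normc_le_ReIm z; have [h2|h2] := ltP 1 `|coord false z|; first by left.
move=> h3; right; move: h2; rewrite /= /coord; lra.
Qed.

Arguments moment_int {g D} z' i _ _ _.

Let geometric (x y : R[i]) m : y != 0 -> y - x != 0 ->
  (y - x)^-1 - \sum_(i < m) y^-1 ^+ i.+1 * x ^+ i = (x / y) ^+ m * (y - x)^-1.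
Proof.
move=> y0 yx; elim: m => [|m IH]; first by rewrite big_ord0 subr0 mul1r.
rewrite big_ord_recr/= opprD addrA IH.
have -> : y^-1 ^+ m.+1 * x ^+ m = y^-1 * (x / y) ^+ m by rewrite exprS exprMn -mulrA [_ * x ^+ m]mulrC.
by rewrite exprS; move: ((x / y) ^+ m) => A; field; rewrite yx y0.
Qed.

(** For w in the support, |w - z'| / |z - z'| is at most 1 / 2, so the geometric expansion of 1 / (z
    - w) can be integrated term by term with an error of order 2 ^ -m. *)
Let pot_laurent g D (z z' : R[i]) (d : R) : bdisk D -> supported g -> BD 1 setT (fun=> 1) D g -> 0 < d ->
  (forall w, g w != 0 -> normc (w - z') <= d) -> 2 * d <= normc (z - z') ->
  (fun m => \sum_(i < m) ((z - z')^-1 ^+ i.+1 : R[i]) *: integral (fun w => ((w - z') ^+ i : R[i]) *: g w)) @ \oo --> pot g z.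
Proof.
move=> bD sg Hg d0 hg zz; case: (bD) => Dc D0 cD boD.
have d2 : 0 < d / 2 by lra.
have far w : g w != 0 -> d <= normc (z - w).
  move=> /hg h; have := normc_triangle (z - w) (w - z').
  have -> : z - w + (w - z') = z - z' by rewrite addrA subrK.
  by move: h zz; move: (normc _) (normc _) (normc _) => *; lra.
(* If both coordinates of z - w were at most mesh n < d / 2, then |z - w| would be below d. Hence
   for n >= n0 the kernel equals 1 / (z - w) on the support, and the sequence defining [pot] is
   constant. *)
have [n0 hn0] := mesh_small d2.
have kE n w : (n0 <= n)%N -> (k n (z - w) : R[i]) *: g w = ((z - w)^-1 : R[i]) *: g w.
  move=> /hn0 hn; have [->|/far nz] := eqVneq (g w) 0; first by rewrite !scaler0.
  have [[b hb]|h] := pselect (exists b, mesh R n <= `|coord b (z - w)|); first by rewrite (k_far hb).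
  have hw b : `|coord b (z - w)| <= mesh R n.
    by rewrite leNgt; apply/negP => hb; apply: h; exists b; exact: ltW.
  by exfalso; have := normc_le_coord hw; move: (normc _) nz hn d0 => *; lra.
have potE : pot g z = conv (k n0) g z.
  apply: (cvg_unique hE (conv_cvg z bD Hg)).
  apply/cvg_csn => p cp r r0; exists n0 => // n /= hn.
  have -> : conv (k n) g z = conv (k n0) g z.
    apply: (is_int_uniq hE); have := conv_int hE sc z (sk n0) bD Hg.
    by apply: is_int_ext => w; rewrite !kE.
  by rewrite subrr (seminorm0 cp.1).
have y0 : z - z' != 0 by rewrite -normc_gt0; lra.
have key m : scaled D (16 * (2^-1 ^+ m / d)) (pot g z - \sum_(i < m) ((z - z')^-1 ^+ i.+1 : R[i]) *: integral (fun w => ((w - z') ^+ i : R[i]) *: g w)).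
  have int_sum : is_int (fun w => \sum_(i < m) ((z - z')^-1 ^+ i.+1 * (w - z') ^+ i) *: g w)
     (\sum_(i < m) ((z - z')^-1 ^+ i.+1 : R[i]) *: integral (fun w => ((w - z') ^+ i : R[i]) *: g w)).
    elim: (m) => [|m' IH].
      rewrite big_ord0; have := @is_intZ _ _ 0 _ _ (moment_int z' 0 bD sg Hg).
      by rewrite scale0r; apply: is_int_ext => w; rewrite big_ord0 scale0r.
    rewrite big_ord_recr/=.
    have := is_intD IH (@is_intZ _ _ ((z - z')^-1 ^+ m'.+1) _ _ (moment_int z' m' bD sg Hg)).
    by apply: is_int_ext => w; rewrite big_ord_recr/= scalerA.
  have c0 : 0 <= 2^-1 ^+ m / d :> R by rewrite divr_ge0 ?exprn_ge0 ?invr_ge0// ltW.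
  apply: (is_int_bound hE bD c0 _ (is_intB _ int_sum)); last first.
    rewrite potE; have := conv_int hE sc z (sk n0) bD Hg.
    by apply: is_int_ext => w; exact: (kE n0 w (leqnn _)).
  move=> w /=; have [->|nz] := eqVneq (g w) 0.
    rewrite scaler0 big1 ?subrr; last by move=> i _; rewrite scaler0.
    exact: scaled0.
  have hf := far w nz; have hz := hg w nz.
  rewrite -scaler_suml -scalerBl.
  have e1 : z - w = (z - z') - (w - z') by rewrite opprB addrA subrK.
  have zw : z - w != 0 by rewrite -normc_gt0; lra.
  rewrite {1}e1 geometric//; last by rewrite -e1.
  apply: scaledZ (BD_val Hg I) => //; rewrite mulr1 normcM normcX -e1 normcV normcM normcV.
  apply: ler_pM; rewrite ?exprn_ge0 ?invr_ge0 ?mulr_ge0 ?invr_ge0 ?normc_ge0//; last first.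
    by rewrite lef_pV2 ?posrE//; lra.
  apply: lerXn2r; rewrite ?nnegrE ?mulr_ge0 ?invr_ge0 ?normc_ge0//.
  rewrite ler_pdivrMr; last lra.
  lra.
apply/cvg_csn => p cp r r0; have [s s0 hs] := bounded_csn boD cp.
have q1 : 0 < 16 / d * s by rewrite mulr_gt0 ?divr_gt0.
have [|q0 hq] := @mesh_small R (r / (16 / d * s)); first by rewrite divr_gt0.
exists q0 => // q /= /hq; rewrite ltr_pdivlMr// => hq'.
have [y Dy yE] := key q; rewrite (seminormB _ _ cp.1) -yE.
have c0 : 0 <= 2^-1 ^+ q / d :> R by rewrite divr_ge0 ?exprn_ge0 ?invr_ge0// ltW.
rewrite (seminormZ _ _ cp.1) normcR ger0_norm; last by rewrite mulr_ge0.
have c16 : 0 <= 16 * (2^-1 ^+ q / d) by rewrite mulr_ge0.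
apply: (le_lt_trans (ler_wpM2l c16 (hs _ Dy))).
apply: le_lt_trans hq'; rewrite meshE exprVn.
by rewrite le_eqVlt; apply/orP; left; apply/eqP; ring.
Qed.

(** Division by mu normalises the potential. The bounds 70 C0 for the potential and 16 for the
    moments are added, so that one constant serves both. *)
Lemma potential_solution g : mu != 0 -> supported g ->
  (forall n, exists2 D : set E, bdisk D & BD n setT (fun=> 1) D g) ->
  exists u : R[i]^o -> E, [/\
    forall n D, bdisk D -> BD n.+1 setT (fun=> 1) D g -> BD n setT (fun=> (70 * C0 + 16) / normc mu) D u,
    forall z, dbar u z = g z &
    forall D (z' : R[i]) (d : R), bdisk D -> BD 1 setT (fun=> 1) D g -> 0 < d ->
      (forall w, g w != 0 -> normc (w - z') <= d) ->
      exists2 b : nat -> E, forall i, scaled D ((70 * C0 + 16) / normc mu * d ^+ i) (b i) &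
        forall z, 2 * d <= normc (z - z') ->
          (fun m => \sum_(i < m) ((z - z')^-1 ^+ i.+1 : R[i]) *: b i) @ \oo --> u z].
Proof.
move=> mu0 sg hg; exists (fun z => mu^-1 *: pot g z).
have n0 : 0 < normc mu by rewrite normc_gt0.
have i0 : 0 < (normc mu)^-1 by rewrite invr_gt0.
split.
- move=> n D bD Hg; case: (bD) => Dc D0 _ _.
  have c0 : 0 <= 70 * C0 by rewrite mulr_ge0.
  have := BD_scale hE mu^-1 (@openT _) Dc D0 (fun _ _ => c0) (pot_BD bD sg Hg).
  apply: BD_le => // z _; last by rewrite mulr_ge0 ?normc_ge0.
  by rewrite normcV mulrC ler_wpM2r ?(ltW i0)//; lra.
- move=> z; have [D bD Hg] := hg 2%N.
  rewrite (dbarE hE (fun b => @is_pdZ _ _ (dir b) mu^-1 _ _ _ (pot_pd b z bD sg Hg))).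
  have := dbar_pot z bD sg Hg; rewrite (dbarE hE (fun b => pot_pd b z bD sg Hg)) => h.
  have -> : g z = mu^-1 *: (mu *: g z) by rewrite scalerA mulVf// scale1r.
  rewrite -h; move: (pot _ z) (pot _ z) => A B; by lmod E.
- move=> D z' d bD Hg d0 hd; case: (bD) => Dc D0 _ _.
  exists (fun i => mu^-1 *: integral (fun w => ((w - z') ^+ i : R[i]) *: g w)) => [i|z zz].
    have c0 : 0 <= d ^+ i by rewrite exprn_ge0// ltW.
    have : scaled D (16 * d ^+ i) (integral (fun w => ((w - z') ^+ i : R[i]) *: g w)).
      apply: (is_int_bound hE bD c0 _ (moment_int z' i bD sg Hg)) => w.
      have [->|/hd h] := eqVneq (g w) 0; first by rewrite scaler0; exact: scaled0.
      apply: scaledZ (BD_val Hg I) => //; rewrite mulr1 normcX.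
      by apply: lerXn2r; rewrite ?nnegrE ?normc_ge0// ltW.
    apply: scaledZ => //; first by rewrite mulr_ge0.
    rewrite normcV mulrA; apply: ler_wpM2r => //; rewrite [leLHS]mulrC.
    by apply: (ler_wpM2r (ltW i0)); rewrite lerDr mulr_ge0.
  have := @cvgZc_tvs _ _ _ _ _ _ mu^-1 _ (pot_laurent bD sg Hg d0 hd zz).
  have eS m : mu^-1 *: (\sum_(i < m) ((z - z')^-1 ^+ i.+1 : R[i]) *: integral (fun w => ((w - z') ^+ i : R[i]) *: g w))
   = \sum_(i < m) ((z - z')^-1 ^+ i.+1 : R[i]) *: (mu^-1 *: integral (fun w => ((w - z') ^+ i : R[i]) *: g w)).
    by rewrite scaler_sumr; apply: eq_bigr => i _; rewrite !scalerA mulrC.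
  under eq_fun do rewrite eS; move=> h; exact: h.
Qed.

End Potential.

Section CauchySolution.
Variable R : realType.

(** K comes from the kernels alone. Its independence of g and of the disks is essential, as the
    lemma is applied to infinitely many cells at once. *)
Lemma cauchy_solution : exists2 K : R, 0 < K &
  forall (E : tvsType R[i]), hausdorff_space E -> series_complete E ->
  forall g : R[i]^o -> E, supported g ->
  (forall n, exists2 D : set E, bdisk D & BD n setT (fun=> 1) D g) ->
  exists u : R[i]^o -> E, [/\
    forall n D, bdisk D -> BD n.+1 setT (fun=> 1) D g -> BD n setT (fun=> K) D u,
    forall z, dbar u z = g z &
    forall D (z' : R[i]) (d : R), bdisk D -> BD 1 setT (fun=> 1) D g -> 0 < d ->
      (forall w, g w != 0 -> normc (w - z') <= d) ->
      exists2 b : nat -> E, forall i, scaled D (K * d ^+ i) (b i) &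
        forall z, 2 * d <= normc (z - z') ->
          (fun m => \sum_(i < m) ((z - z')^-1 ^+ i.+1 : R[i]) *: b i) @ \oo --> u z].
Proof.
have [C0 C0_ge0 hC0] := SB_ckernel R 0%N; have [S0 S0_ge0 hS0] := SB_smear R 0%N.
have mu0 : smear_mass R != 0.
  by apply/eqP => h; have := smear_mass_gt0 R; rewrite h /= ltxx.
have k_le n w : normc (@kern R n w) <= 2 ^+ n * C0.
  rewrite /kern [_ *: _]/(_ * _) normcM normcR ger0_norm ?exprn_ge0//.
  by rewrite ler_wpM2l ?exprn_ge0//; apply/(unit_diskP _ C0_ge0)/(BD_val hC0).
have dk_le n w : normc (dbar (@kern R n) w) <= 4 ^+ n * S0.
  rewrite dbar_kern normcM normcR ger0_norm ?exprn_ge0//.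
  by rewrite ler_wpM2l ?exprn_ge0//; apply/(unit_diskP _ S0_ge0)/(BD_val hS0).
exists ((70 * C0 + 16) / normc (smear_mass R)).
  by rewrite divr_gt0 ?normc_gt0//; lra.
move=> E hE sc g sg hg.
apply: (@potential_solution R E hE sc (@kern R) C0 S0 (smear_mass R) C0_ge0 S0_ge0 (SB_kern R) k_le _ dk_le _ _ g mu0 sg hg).
- by move=> n b w; exact: kern_far.
- by move=> n b w; exact: dbar_kern_supp.
- by move=> n z; exact: conv_dbar_kern.
Qed.

End CauchySolution.

(** * Weights and Laurent series *)

Section Weights.
Variable R : realType.
Implicit Types (w : nat -> R -> R) (t : R).

(** f is not known to be measurable, so monotonicity is taken from the integral as a supremum over
    simple functions. *)
Lemma integral_lower_bound (f : R -> R) (a b c : R) : 0 <= a -> a <= b -> 0 <= c ->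
  (forall t, 0 <= t -> 0 <= f t) -> (forall t, a <= t <= b -> c <= f t) ->
  ((c * (b - a))%:E <= \int[lebesgue_measure]_(t in `[0%R, +oo[) (f t)%:E)%E.
Proof.
move=> a0 ab c0 f0 cf.
have mA : measurable (`[a, b]%classic : set R) by exact: measurable_itv.
have mD : measurable (`[0%R, +oo[%classic : set R) by exact: measurable_itv.
have -> : ((c * (b - a))%:E = \int[lebesgue_measure]_(t in `[0%R, +oo[) (c * \1_`[a, b] t)%:E)%E.
  have cn : c < 0 -> `[a, b]%classic = set0 :> set R by rewrite ltNge c0.
  rewrite (@integralZl_indic _ _ R lebesgue_measure _ mD (fun=> `[a, b]%classic) c cn mA).
  rewrite integral_indic// (_ : _ `&` _ = `[a, b]%classic).
    have e : lebesgue_measure (`[a, b]%classic : set R) = (b - a)%:E.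
      rewrite lebesgue_measure_itv/= lte_fin; case: ltP => [_|ba]; first by rewrite -EFinB.
      by have -> : b = a; [apply/le_anti; rewrite ab ba|rewrite subrr].
    by rewrite EFinM -e.
  apply/seteqP; split=> [x [] //|x xab]; split=> //.
  by move: xab; rewrite /= !in_itv/= => /andP[xa _]; rewrite (le_trans a0 xa).
rewrite integral_mkcond [leRHS]integral_mkcond ge0_integralTE; last first.
  by move=> x; rewrite patchE; case: ifP => // _; rewrite lee_fin mulr_ge0.
rewrite ge0_integralTE; last first.
  by move=> x; rewrite patchE; case: ifP => //; rewrite inE /= in_itv/= andbT lee_fin => /f0.
apply: le_ereal_sup => _ [h /= hf <-]; exists h => // x; apply: (le_trans (hf x)).
rewrite !patchE; case: ifP => //; rewrite inE /= in_itv/= andbT lee_fin => x0.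
rewrite indicE; case: (boolP (x \in _)) => [|_]; last by rewrite mulr0 f0.
by rewrite inE /= in_itv/= mulr1 => /cf.
Qed.

Section WeightSystem.
Variable w : nat -> R -> R.
Hypotheses (hw : weight_system w) (hwalpha : weight_alpha w) (hwN : weight_N w) (hwomega : weight_omega w).

Lemma weight_ge0 N t : 0 <= t -> 0 <= w N t.
Proof. by have [h _ _] := hw.1 N; exact: h. Qed.

Lemma weight_mono N s t : 0 <= s -> s <= t -> w N s <= w N t.
Proof. by have [_ h _] := hw.1 N; exact: h. Qed.

Lemma weight_le N M t : (N <= M)%N -> 0 <= t -> w N t <= w M t.
Proof.
move=> /subnK <- t0; elim: (M - N)%N => [|k IH]; first by rewrite add0n.
by rewrite addSn (le_trans IH)// hw.2.
Qed.

(** (alpha) is iterated until 2 ^ k exceeds D. The second alternative covers negative arguments,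
    where the weights carry no information. *)
Lemma weight_dilation N (D : R) : exists M (C : R), (N <= M)%N /\
  forall t, 0 <= t -> w N (D * t) <= w M t + C \/ D * t < 0.
Proof.
have key k : exists M (C : R), (N <= M)%N /\ forall t, 0 <= t -> w N (2 ^+ k * t) <= w M t + C.
  elim: k => [|k [M [C [NM h]]]]; first by exists N, 0; split=> // t t0; rewrite mul1r addr0.
  have [M' [A [MM' A1 hA]]] := hwalpha M; exists M', (ln A + C); split; first exact: leq_trans MM'.
  move=> t t0; rewrite exprSr -mulrA; have t2 : 0 <= 2 * t by rewrite mulr_ge0.
  by have := h _ t2; have := hA _ t0; lra.
have [k hk] : exists k, D <= 2 ^+ k.
  exists (Num.truncn D).+1; apply: le_trans (ltW (truncnS_gt _)) _.
  by rewrite -natrX ler_nat ltnW// ltn_expl.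
have [M [C [NM h]]] := key k; exists M, C; split=> // t t0.
have [Dt|] := leP 0 (D * t); [left|by right].
by apply: le_trans (h t t0); apply: weight_mono => //; rewrite ler_wpM2r.
Qed.

(** The sum is at most twice the larger of |x| and |y|, and (alpha) absorbs the factor 2. *)
Lemma weight_shift N : exists M (C : R), (N <= M)%N /\
  forall x y : R, w N `|x + y| <= w M `|x| + w M `|y| + C.
Proof.
have [M [A [NM A1 hA]]] := hwalpha N; exists M, (ln A); split=> // x y.
have key (s t : R) : 0 <= s -> s <= t -> w N (s + t) <= w M s + w M t + ln A.
  move=> s0 st; have t0 := le_trans s0 st.
  have := hA t t0; have := weight_ge0 M s0.
  have := @weight_mono N (s + t) (2 * t) ltac:(lra) ltac:(lra); lra.
apply: (@le_trans _ _ (w N (`|x| + `|y|))); first by apply: weight_mono => //; exact: ler_normD.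
have [xy|/ltW yx] := leP `|x| `|y|; first exact: key.
by rewrite addrC [w M _ + _]addrC; exact: key.
Qed.

(** For s between t / 2 and t, (alpha) and monotonicity bound the integrand of (N) below by exp (w_N
    t - w_M t) / A. The interval has length t / 2, so the finite integral bounds t exp (w_N t - w_M
    t). *)
Lemma weight_poly1 N : exists M (C : R), [/\ (N <= M)%N, 0 <= C &
  forall t, 0 <= t -> (1 + t) * expR (- w M t) <= C * expR (- w N t)].
Proof.
have [M1 [A [NM1 A1 hA]]] := hwalpha N; have [M M1M hI] := hwN M1.
have NM : (N <= M)%N := leq_trans NM1 M1M.
have [J hJ] : exists J : R, forall t, 0 <= t -> expR (w N t - ln A - w M t) * (t - t / 2) <= J.
  have lb t : 0 <= t -> ((expR (w N t - ln A - w M t) * (t - t / 2))%:E <=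
      \int[lebesgue_measure]_(t in `[0%R, +oo[) (expR (w M1 t - w M t))%:E)%E.
    move=> t0; apply: integral_lower_bound; rewrite ?expR_ge0//; try lra.
    move=> s /andP[s1 s2]; rewrite ler_expR.
    have s0 : 0 <= s by lra.
    have := hA s s0; have := weight_mono M s0 s2.
    have := @weight_mono N t (2 * s) t0 ltac:(lra); lra.
  move: hI lb; case: (\int[_]_(_ in _) _)%E => [r _ h|//|_ h].
    by exists r => t /h; rewrite lee_fin.
  by have := h 0 (lexx _).
have A0 : 0 < A by lra.
have J0 : 0 <= J by apply: le_trans (hJ 0 (lexx _)); rewrite mul0r subrr mulr0.
exists M, (1 + 2 * A * J); split=> //; first by have := mulr_ge0 (ltW A0) J0; lra.
move=> t t0; have := hJ t t0; rewrite !expRD !expRN lnK ?posrE// => h.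
rewrite mulrDl mul1r [leRHS]mulrDl mul1r; apply: lerD.
  by rewrite lef_pV2 ?posrE ?expR_gt0// ler_expR weight_le.
have e1 := expR_gt0 (w N t); have e2 := expR_gt0 (w M t).
rewrite [leRHS](_ : _ = (A * J * 2) / expR (w N t)); last by ring.
rewrite ler_pdivlMr// mulrAC ler_pdivrMr//.
have := ler_wpM2l (ltW (mulr_gt0 A0 e2)) h.
rewrite (_ : A * expR (w M t) * (expR (w N t) / A / expR (w M t) * (t - t / 2)) = expR (w N t) * (t / 2)); last first.
  by field; rewrite !gt_eqF.
lra.
Qed.

Lemma weight_poly k N : exists M (C : R), [/\ (N <= M)%N, 0 <= C &
  forall t, 0 <= t -> (1 + t) ^+ k * expR (- w M t) <= C * expR (- w N t)].
Proof.
elim: k => [|k [M [C [NM C0 h]]]].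
  by exists N, 1; split=> // t _; rewrite expr0.
have [M' [C' [MM' C'0 h']]] := weight_poly1 M; exists M', (C' * C); split.
- exact: leq_trans MM'.
- exact: mulr_ge0.
move=> t t0; rewrite exprSr -mulrA.
have t1 : 0 <= (1 + t) ^+ k by rewrite exprn_ge0//; lra.
apply: (le_trans (ler_wpM2l t1 (h' t t0))).
by rewrite mulrCA -mulrA; apply: ler_wpM2l => //; exact: h.
Qed.

(** Dividing (omega) by theta gives the exponent (1 - theta) / theta; rounding it up to an integer s
    only costs w_N <= w_M. Integer exponents match [disk_splitting]. *)
Lemma weight_convexity N : exists2 M, (N <= M)%N & forall K, (M <= K)%N ->
  exists (s : nat) (C : R), (0 < s)%N /\
    forall t, 0 <= t -> w K t + s%:R * w N t <= (1 + s%:R) * w M t + C.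
Proof.
have [M NM hM] := hwomega N; exists M => // K MK.
have [th [A [/andP[th0 th1] A1 h]]] := hM K MK.
pose q := (1 - th) / th; have q0 : 0 <= q by rewrite divr_ge0//; lra.
exists (Num.truncn q).+1, (ln A / th); split=> // t t0.
have sq : q <= (Num.truncn q).+1%:R := ltW (truncnS_gt _).
move: sq; move: (_.+1%:R) => s sq.
have NMt := weight_le NM t0.
have := ler_wpM2r (_ : 0 <= th^-1) (h t t0); rewrite invr_ge0 => /(_ (ltW th0)).
rewrite (_ : ((1 - th) * w N t + th * w K t) / th = q * w N t + w K t); last first.
  by rewrite /q; field; rewrite gt_eqF.
rewrite (_ : (w M t + ln A) / th = (1 + q) * w M t + ln A / th); last first.
  by rewrite /q; field; rewrite gt_eqF.
have sq0 : 0 <= s - q by lra.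
have := ler_wpM2l sq0 NMt; move: (ln A / th) => *; lra.
Qed.

(** Iterating the choice of M makes any three consecutive weights satisfy the convexity inequality;
    the maximum with p makes the chain cofinal in the system. *)
Lemma weight_chain N : exists (Ns s : nat -> nat) (C : nat -> R), [/\ Ns 0%N = N,
  forall p, (Ns p <= Ns p.+1)%N, forall p, (p <= Ns p)%N &
  forall p, (0 < s p)%N /\ forall t, 0 <= t ->
     w (Ns p.+2) t + (s p)%:R * w (Ns p) t <= (1 + (s p)%:R) * w (Ns p.+1) t + C p].
Proof.
have /choice[mf hmf] : forall N, exists M, (N <= M)%N /\ forall K, (M <= K)%N ->
  exists (s : nat) (C : R), (0 < s)%N /\
    forall t, 0 <= t -> w K t + s%:R * w N t <= (1 + s%:R) * w M t + C.
  by move=> K; have [M h1 h2] := weight_convexity K; exists M.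
pose Ns := fix Ns p := if p is q.+1 then maxn (mf (Ns q)) p else N.
have NsS p : Ns p.+1 = maxn (mf (Ns p)) p.+1 by [].
have mono p : (Ns p <= Ns p.+1)%N by rewrite NsS (leq_trans (hmf _).1)// leq_maxl.
have key p : exists sC : nat * R, (0 < sC.1)%N /\ forall t, 0 <= t ->
     w (Ns p.+2) t + sC.1%:R * w (Ns p) t <= (1 + sC.1%:R) * w (Ns p.+1) t + sC.2.
  have [|s [C [s0 h]]] := (hmf (Ns p)).2 (Ns p.+2).
    by apply: leq_trans (mono p.+1); rewrite NsS leq_maxl.
  exists (s, C); split=> //= t t0; apply: (le_trans (h t t0)); rewrite lerD2r.
  rewrite ler_wpM2l ?addr_ge0//; apply: weight_le => //; exact: leq_maxl.
have [sC hsC] := choice key; exists Ns, (fun p => (sC p).1), (fun p => (sC p).2); split=> //.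
by case=> // p; rewrite NsS leq_maxr.
Qed.

End WeightSystem.

End Weights.

(** * Laurent series with coefficients in E *)

Section LaurentTails.
Variable R : realType.
Implicit Types (z w : R[i]).
Let hC := @plane_hausdorff R.
Let U := @unit_disk R.

Definition outside (z' : R[i]) (r : R) : set R[i]^o := [set z | r < normc (z - z')].

Lemma open_outside z' r : open (outside z' r).
Proof.
rewrite openE => z /= zr; apply/nbhs_planeP; exists (normc (z - z') - r) => [|w h].
  by rewrite subr_gt0.
rewrite /outside /=; have h2 : normc (z - z') <= normc (w - z) + normc (w - z').
  by have := normc_triangle (z - w) (w - z'); rewrite addrA subrK [normc (z - w)]normc_sub.
by move: h h2; move: (normc (w - z)) (normc (z - z')) (normc (w - z')) => *; lra.
Qed.

Lemma is_pd_invpow z' b i z : z != z' -> is_pd (dir b) (fun z : R[i]^o => ((z - z')^-1 ^+ i.+1 : R[i]) : R[i]^o) z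
  (- (i.+1%:R * dir b) * (z - z')^-1 ^+ i.+2).
Proof.
rewrite -subr_eq0 => zz.
have base : is_pd (dir b) (fun z : R[i]^o => ((z - z')^-1 : R[i]) : R[i]^o) z (- dir b * (z - z')^-1 ^+ 2).
  have h : is_pd (dir b) (fun z : R[i]^o => (z : R[i])^-1 : R[i]^o) (1%:C%C * z - z') (- dir b / (z - z') ^+ 2).
    by rewrite rmorph1 mul1r; exact: is_pd_invz.
  have := is_pd_aff h; rewrite rmorph1 scale1r -exprVn.
  by have -> : (fun w : R[i]^o => (1 * w - z' : R[i])^-1 : R[i]^o) = (fun w => (w - z')^-1) by apply/funext => w; rewrite mul1r.
elim: i => [|i IH]; first by rewrite mul1r.
have := is_pdM base IH.
have -> : (fun w : R[i]^o => ((w - z')^-1 : R[i]) *: ((w - z')^-1 ^+ i.+1 : R[i]^o)) = (fun w => (w - z')^-1 ^+ i.+2).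
  by apply/funext => w; rewrite [RHS]exprS.
congr is_pd; move: (z - z')^-1 => y.
transitivity ((- dir b * y ^+ 2) * y ^+ i.+1 + y * (- (i.+1%:R * dir b) * y ^+ i.+2) : R[i]); first by [].
by rewrite -[i.+2%:R]natr1 !exprS expr0; ring.
Qed.

(** Each derivative of a power of 1 / (z - z') brings out the exponent, at most i + n + 1, and one
    more factor 1 / r; the maximum with 1 covers the lower orders. *)
Definition pole_bound (r : R) n i : R := (i + n.+1)%:R ^+ n * (Num.max 1 r^-1) ^+ n * r^-1 ^+ i.+1.

Lemma pole_bound_ge0 r n i : 0 < r -> 0 <= pole_bound r n i.
Proof. by move=> r0; rewrite !mulr_ge0 ?exprn_ge0 ?invr_ge0 ?le_max ?ler01// ltW. Qed.

Lemma pole_BD z' r n i : 0 < r -> BD n (outside z' r) (fun=> pole_bound r n i) U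
  (fun z => ((z - z')^-1 ^+ i.+1 : R[i])).
Proof.
move=> r0; have o := @open_outside z' r; have [Uc U0 _ _] := unit_disk_bdisk R.
have ri0 : 0 <= r^-1 by rewrite invr_ge0 ltW.
have m1 : 1 <= Num.max 1 r^-1 :> R by rewrite le_max lexx.
have mr : r^-1 <= Num.max 1 r^-1 :> R by rewrite le_max lexx orbT.
have m0 : 0 <= Num.max 1 r^-1 :> R by exact: le_trans ler01 m1.
have val n' i' z : outside z' r z -> scaled U (pole_bound r n' i') ((z - z')^-1 ^+ i'.+1 : R[i]).
  move=> zr; apply/unit_diskP; first exact: pole_bound_ge0.
  rewrite normcX normcV; have zn : 0 <= normc (z - z') := normc_ge0 _.
  apply: (@le_trans _ _ (r^-1 ^+ i'.+1)).
    apply: lerXn2r; rewrite ?nnegrE ?invr_ge0 ?(ltW r0)//.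
    by rewrite lef_pV2 ?posrE//; [exact: ltW|exact: lt_trans zr].
  rewrite /pole_bound ler_peMl ?exprn_ge0//.
  by rewrite mulr_ege1// exprn_ege1// ler1n addnS.
elim: n i => [|n IH] i; first by split=> // z; exact: val.
apply: (BD_intro hC (f' := fun b z => (- (i.+1%:R * dir b) : R[i]) *: ((z - z')^-1 ^+ i.+2 : R[i]^o))) => //.
- by move=> z; exact: val.
- move=> b z zr; apply: is_pd_invpow; rewrite -subr_eq0 -normc_gt0; exact: lt_trans zr.
- move=> b.
  have := BD_scale hC (- (i.+1%:R * dir b)) o Uc U0 (fun _ _ => pole_bound_ge0 n i.+1 r0) (IH i.+1).
  apply: BD_le => // z _; last by rewrite mulr_ge0 ?normc_ge0 ?pole_bound_ge0.
  rewrite normcN normcM normc_dir mulr1 -(rmorph_nat (real_complex R)) normcR ger0_norm//.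
  rewrite /pole_bound addSnnS [(i + n.+2)%:R ^+ n.+1]exprS [Num.max _ _ ^+ n.+1]exprS [r^-1 ^+ i.+2]exprS.
  set a := (i + n.+2)%:R; set m := Num.max _ _; set q := r^-1 ^+ i.+1.
  have ia : i.+1%:R <= a :> R by rewrite ler_nat addnS ltnS leq_addr.
  rewrite [leLHS](_ : _ = (i.+1%:R * a ^+ n * m ^+ n * q) * r^-1); last by ring.
  rewrite [leRHS](_ : _ = (a * a ^+ n * m ^+ n * q) * m); last by ring.
  apply: ler_pM => //; rewrite ?mulr_ge0 ?exprn_ge0//.
  by do 3 (apply: ler_wpM2r; rewrite ?exprn_ge0//).
Qed.

(** The polynomial factor is dominated by a multiple of (3 / 2) ^ i, via the exponential series at a
    multiple of ln (3 / 2), which leaves the ratio 3 / 4. *)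
Lemma poly_geometric n : exists2 A : R, 0 <= A & forall m, \sum_(i < m) (i + n.+1)%:R ^+ n * 2^-1 ^+ i <= A.
Proof.
have [B B0 hB] : exists2 B : R, 0 <= B & forall i : nat, (i + n.+1)%:R ^+ n <= B * (3 / 2) ^+ i.
  case: n => [|n]; first by exists 1 => // i; rewrite expr0 mul1r exprn_ege1//; lra.
  pose la : R := ln (3 / 2); have la0 : 0 < la by rewrite ln_gt0//; lra.
  have e32 : expR la = 3 / 2 by rewrite lnK// posrE; lra.
  exists (n.+1`!%:R / la ^+ n.+1 * (3 / 2) ^+ n.+2).
    by rewrite mulr_ge0 ?divr_ge0 ?exprn_ge0 ?ler0n ?(ltW la0).
  move=> i; set k := (i + n.+2)%N; set q : R := 3 / 2.
  have -> : n.+1`!%:R / la ^+ n.+1 * q ^+ n.+2 * q ^+ i = n.+1`!%:R / la ^+ n.+1 * q ^+ k.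
    by rewrite -mulrA -exprD [(n.+2 + i)%N]addnC.
  have kl : 0 <= k%:R * la by rewrite mulr_ge0// ltW.
  have := expR_ge1Dxn n kl.
  have -> : expR (k%:R * la) = (3 / 2) ^+ k.
    by rewrite mulrC -e32 -expRM_natr.
  move=> h; have h1 : (k%:R * la) ^+ n.+1 / n.+1`!%:R <= (3 / 2) ^+ k.
    by apply: le_trans h; rewrite lerDr.
  move: h1; rewrite exprMn ler_pdivrMr ?ltr0n ?fact_gt0// -ler_pdivlMr ?exprn_gt0// => h1.
  by apply: (le_trans h1); rewrite le_eqVlt; apply/orP; left; apply/eqP; ring.
exists (B * 4); first by rewrite mulr_ge0.
move=> m; apply: (@le_trans _ _ (\sum_(i < m) B * (3 / 4) ^+ i)).
  apply: ler_sum => i _; rewrite (_ : 3 / 4 = 3 / 2 * 2^-1 :> R); last by field.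
  by rewrite exprMn mulrA ler_wpM2r ?exprn_ge0 ?invr_ge0// hB.
rewrite -mulr_sumr ler_wpM2l//.
have : \sum_(i < m) (3 / 4) ^+ i <= 4 - 4 * (3 / 4) ^+ m :> R.
  elim: m => [|m IH]; first by rewrite big_ord0 expr0; lra.
  by rewrite big_ord_recr/= exprS; move: IH; lra.
by have : 0 <= (3 / 4) ^+ m :> R; [rewrite exprn_ge0//|]; lra.
Qed.

(** Coefficients of size (r / 2) ^ i against poles at distance r give the ratio 1 / 2, and the
    derivatives add only polynomial factors. *)
Lemma laurent_constants (r : R) : 0 < r -> exists C : nat -> R, forall n, 0 <= C n /\
  forall m, \sum_(i < m) 2 ^+ n * (pole_bound r n i * (r / 2) ^+ i) <= C n.
Proof.
move=> r0; have /choice[A hA] : forall n, exists A : R, 0 <= A /\ forall m, \sum_(i < m) (i + n.+1)%:R ^+ n * 2^-1 ^+ i <= A.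
  by move=> n; have [A A0 h] := poly_geometric n; exists A.
have k0 n : 0 <= 2 ^+ n * (Num.max 1 r^-1) ^+ n * r^-1.
  by rewrite !mulr_ge0 ?exprn_ge0 ?invr_ge0 ?le_max ?ler01// ltW.
exists (fun n => 2 ^+ n * (Num.max 1 r^-1) ^+ n * r^-1 * A n) => n; split.
  by rewrite mulr_ge0// (hA n).1.
move=> m; apply: le_trans (ler_wpM2l (k0 n) ((hA n).2 m)); rewrite mulr_sumr; apply: ler_sum => i _.
rewrite le_eqVlt; apply/orP; left; apply/eqP; rewrite /pole_bound exprMn exprS.
have e : r^-1 ^+ i * r ^+ i = 1 by rewrite -exprMn mulVf ?expr1n// gt_eqF.
rewrite -[RHS]mulr1 -e; ring.
Qed.

Section Series.
Variables (E : tvsType R[i]) (hE : hausdorff_space E) (sc : series_complete E).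
Variables (z' : R[i]) (r : R) (r0 : 0 < r).

Definition laurent (x : nat -> E) (z : R[i]^o) : E :=
  xget 0 [set l : E | (fun m => \sum_(i < m) ((z - z')^-1 ^+ i.+1 : R[i]) *: x i) @ \oo --> l].

Variables (C : nat -> R).
Hypothesis hC' : forall n, 0 <= C n /\ forall m, \sum_(i < m) 2 ^+ n * (pole_bound r n i * (r / 2) ^+ i) <= C n.
Variables (D : set E) (bD : bdisk D) (t : R) (t0 : 0 <= t) (x : nat -> E).
Hypothesis hx : forall i, scaled D (t * (r / 2) ^+ i) (x i).

Let e n i : R := 2 ^+ n * (pole_bound r n i * (r / 2) ^+ i) * t.

Let e_ge0 n i : 0 <= e n i.
Proof. by rewrite mulr_ge0// mulr_ge0 ?exprn_ge0// mulr_ge0 ?pole_bound_ge0 ?exprn_ge0 ?divr_ge0// ltW. Qed.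

Let e_sum n m : \sum_(i < m) e n i <= C n * t.
Proof. by rewrite -mulr_suml ler_wpM2r// (hC' n).2. Qed.

Let u i (z : R[i]^o) : E := ((z - z')^-1 ^+ i.+1 : R[i]) *: x i.

Let u_BD n i : BD n (outside z' r) (fun=> e n i * 1) D (u i).
Proof.
case: bD => Dc D0 _ _; have o := @open_outside z' r.
have h1 : BD n (outside z' r) (fun=> t * (r / 2) ^+ i) D (fun=> x i) by apply: BD_cst.
have q0 : 0 <= t * (r / 2) ^+ i by rewrite mulr_ge0 ?exprn_ge0 ?divr_ge0// ltW.
have := BD_mul hE o Dc D0 (fun _ _ => pole_bound_ge0 n i r0) (fun _ _ => q0) (pole_BD z' n i r0) h1.
by apply: BD_eqc => z _; rewrite /e; ring.
Qed.

Lemma laurent_cvg z : outside z' r z ->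
  (fun m => \sum_(i < m) ((z - z')^-1 ^+ i.+1 : R[i]) *: x i) @ \oo --> laurent x z.
Proof.
move=> zr; have Du i : scaled D (e 0 i) (u i z) by have := BD_val (u_BD 0 i) zr; rewrite mulr1.
have [l hl] := sc bD (e_ge0 0) (e_sum 0) Du.
exact: (@xgetPex _ (0 : E) [set l : E | (fun m => \sum_(i < m) ((z - z')^-1 ^+ i.+1 : R[i]) *: x i) @ \oo --> l] (ex_intro _ l hl)).
Qed.

Lemma laurent_BD n : BD n (outside z' r) (fun=> C n * t) D (laurent x).
Proof.
have := @BD_series _ _ hE (outside z' r) D (e n) (C n * t) 1 (fun=> 1) (@open_outside z' r) bD (e_ge0 n) (e_sum n)
  (fun _ _ => ler01) (fun _ _ => lexx _) n u (laurent x) sc (u_BD n).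
by move=> /(_ (fun z zr => laurent_cvg zr)); apply: BD_eqc => z _; rewrite mulr1.
Qed.

(** Both partial derivatives are multiples, by 1 and by i, of the same sum l, so [dbar] gives a
    multiple of (1 + i i) l = 0. *)
Lemma laurent_dbar z : outside z' r z -> dbar (laurent x) z = 0.
Proof.
move=> zr; case: (bD) => Dc D0 _ _.
have zz : z != z' by rewrite -subr_eq0 -normc_gt0; exact: lt_trans zr.
have upd b i : partial (dir b) (u i) z = (- (i.+1%:R * dir b) * (z - z')^-1 ^+ i.+2 : R[i]) *: x i.
  apply: (is_pd_partial hE).
  have := is_pdM (@is_pd_invpow z' b i z zz) (is_pd_cst (dir b) (x i) z).
  by rewrite scaler0 addr0.
have Du i : scaled D (e 1 i) (partial (dir false) (u i) z).
  by have := BD_val (BD_partial false (u_BD 1 i)) zr; rewrite mulr1.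
have [l hl] := sc bD (e_ge0 1) (e_sum 1) Du.
have pd b : is_pd (dir b) (laurent x) z ((dir b : R[i]) *: l).
  apply: (@is_pd_series _ _ hE (outside z' r) D (e 1) (C 1 * t) 1 (fun=> 1) (@open_outside z' r) bD (e_ge0 1) (e_sum 1)
   (fun _ _ => ler01) (fun _ _ => lexx _) u (laurent x) b z _ (u_BD 1) (fun z zr => laurent_cvg zr) zr).
  have -> : (fun n => \sum_(k < n) partial (dir b) (u k) z) =
    (fun n => (dir b : R[i]) *: \sum_(k < n) partial (dir false) (u k) z).
    apply/funext => n; rewrite scaler_sumr; apply: eq_bigr => k _.
    by rewrite !upd scalerA; congr (_ *: _); rewrite /dir; ring.
  exact: (@cvgZc_tvs _ _ _ _ _ _ (dir b) _ hl).
rewrite (dbarE hE pd) scale1r scalerA -expr2 sqr_i scaleN1r subrr scaler0//.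
Qed.

End Series.

End LaurentTails.

(** * Condition (A) *)

Section ConditionA.
Variables (R : realType) (E : tvsType R[i]) (hE : hausdorff_space E).
Implicit Types (D : set E) (B : nat -> set E).

(* Condition (A) for integer exponents and closed disks. *)
Definition disk_splitting D0 := forall D (s : nat), bdisk D -> (0 < s)%N -> exists2 D' : set E, bdisk D' &
  forall r : R, 0 < r -> forall x, D x -> exists y z, [/\ x = y + z, scaled D0 r y & scaled D' (r^-1 ^+ s) z].

Lemma fundamental_mono B m n : fundamental_sequence B -> (m <= n)%N -> B m `<=` B n.
Proof.
move=> [_ mB _] /subnK <-; elim: (n - m)%N => [|k IH]; first by rewrite add0n.
by apply: (subset_trans IH); rewrite addSn; exact: mB.
Qed.

(** An absolutely convex set may be empty; n0 is an index from which on B n contains 0. *)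
Lemma fundamental_closure B : fundamental_sequence B -> exists n0, forall n, (n0 <= n)%N ->
  bdisk (closure (B n)) /\ B n `<=` closure (B n).
Proof.
move=> fB; have [hB mB uB] := fB.
have [n0 h0] : exists n, [set (0 : E)] `<=` B n.
  by apply: uB; apply: csn_bounded => p cp; exists 0 => _ ->; rewrite (seminorm0 cp.1).
exists n0 => n hn; split; last exact: subset_closure.
have [h1 h2] := hB n; apply: bdisk_closure => //.
by exists 0; apply: (fundamental_mono fB hn); apply: h0.
Qed.

Lemma fundamental_in_disks B : fundamental_sequence B -> bounded_in_disks E.
Proof.
move=> fB A bA; have [n0 h0] := fundamental_closure fB; have [_ _ uB] := fB.
have [n hn] := uB A bA.
have [h1 h2] := h0 (maxn n0 n) (leq_maxl _ _); exists (closure (B (maxn n0 n))) => //.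
apply: (subset_trans hn); apply: (subset_trans _ h2); apply: (fundamental_mono fB); exact: leq_maxr.
Qed.

Lemma condition_A_splitting B : fundamental_sequence B -> condition_A B ->
  exists2 D0 : set E, bdisk D0 & disk_splitting D0.
Proof.
move=> fB [n hn]; have [n0 h0] := fundamental_closure fB; have [_ _ uB] := fB.
have [bD0 sD0] := h0 (maxn n0 n) (leq_maxl _ _).
exists (closure (B (maxn n0 n))) => // D s bD s0; case: (bD) => _ _ _ boD.
have [m Dm] := uB D boD.
have s0' : 0 < s%:R :> R by rewrite ltr0n.
have [k [C [mk C0 hC]]] := hn (maxn n m) s%:R (leq_maxl _ _) s0'.
have [bDk sDk] := h0 (maxn n0 k) (leq_maxl _ _).
exists (scaled (closure (B (maxn n0 k))) C); first exact: bdisk_scaled.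
move=> r r0 x /Dm Bx; have /hC := fundamental_mono fB (leq_maxr n m) Bx.
move=> /(_ r r0)[y By [z Bz <-]].
exists (r%:C%C *: y), ((C / r `^ s%:R)%:C%C *: z); split=> //.
  exists y => //; apply: sD0; exact: (fundamental_mono fB (leq_maxr _ _) By).
rewrite scaled_mul; exists z.
  apply: sDk; exact: (fundamental_mono fB (leq_maxr _ _) Bz).
by rewrite powR_mulrn ?(ltW r0)// exprVn mulrC.
Qed.

End ConditionA.

(** * Simultaneous splitting along a chain of weights *)

Section Splitting.
Variables (R : realType) (E : tvsType R[i]) (hE : hausdorff_space E) (sc : series_complete E).
Variables (hB : bounded_in_disks E) (D0 : set E) (bD0 : bdisk D0) (hD0 : disk_splitting D0).
Variables (I : Type) (V : nat -> I -> R) (s : nat -> nat) (C : nat -> R).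
Hypotheses (V_gt0 : forall p i, 0 < V p i) (V_mono : forall p i, V p i <= V p.+1 i).
Hypotheses (s_gt0 : forall p, (0 < s p)%N) (C_gt0 : forall p, 0 < C p).
Hypothesis V_conv : forall p i, V p.+2 i * V p i ^+ s p <= C p * V p.+1 i ^+ (s p).+1.
Variables (D : set E) (bD : bdisk D) (e : R) (e0 : 0 < e).

Let delta p : R := e * mesh R p.+1.

Let delta_gt0 p : 0 < delta p. Proof. by rewrite mulr_gt0// mesh_gt0. Qed.

Let delta_sum m : \sum_(p < m) delta p <= e.
Proof.
rewrite -mulr_sumr ler_piMr ?(ltW e0)//.
have : \sum_(p < m) mesh R p.+1 <= 1 - mesh R m.
  elim: m => [|m IH]; first by rewrite big_ord0 meshE expr0 invr1 subrr.
  by rewrite big_ord_recr/=; move: IH; rewrite (meshS R m); lra.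
have := mesh_gt0 R m; lra.
Qed.

(* Starting from y_0 = b, split y_p = x_p + y_(p+1) by [hD0], with parameter
   r = delta p * V (p+1) / V p; [V_conv] is what makes y_(p+1) of size 1 / V (p+2).
   Then x = sum_p x_p, and y = b - x = y_p - sum_(q >= p) x_q for every p. *)
Lemma split_weights : exists2 Ds : nat -> set E, forall p, bdisk (Ds p) &
  forall i b, scaled D (V 1%N i)^-1 b -> exists x y, [/\ b = x + y,
    scaled D0 (e / V 0%N i) x & forall p, scaled (Ds p) (V p i)^-1 y].
Proof.
have /choice[nxt hnxt] : forall Gp : set E * nat, exists D' : set E, bdisk Gp.1 -> (0 < Gp.2)%N -> bdisk D' /\
  forall r : R, 0 < r -> forall x, Gp.1 x -> exists y z, [/\ x = y + z, scaled D0 r y & scaled D' (r^-1 ^+ Gp.2) z].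
  move=> [A p]; have [h|h] := pselect (bdisk A /\ (0 < p)%N); last by exists A => h1 h2; case: h.
  by have [D' h1 h2] := hD0 h.1 h.2; exists D'.
pose kk p : R := C p * (delta p)^-1 ^+ s p.
have kk0 p : 0 < kk p by rewrite mulr_gt0// exprn_gt0// invr_gt0.
(* The disks are fixed by recursion on p alone, before any index i and vector b. This uniformity
   lets a single disk serve all cells and all Laurent coefficients. *)
pose G := fix G p := if p is q.+1 then scaled (nxt (G q, s q)) (kk q) else D.
have bG p : bdisk (G p).
  elim: p => [//|p IH] /=; apply: bdisk_scaled => //; exact: (hnxt (G p, s p) IH (s_gt0 p)).1.
have stepG i p y : scaled (G p) (V p.+1 i)^-1 y -> exists y', scaled D0 (delta p / V p i) (y - y') /\
    scaled (G p.+1) (V p.+2 i)^-1 y'.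
  move=> [a Ga <-]; have [bn hn] := hnxt (G p, s p) (bG p) (s_gt0 p).
  pose r := delta p * V p.+1 i / V p i.
  have r0 : 0 < r := divr_gt0 (mulr_gt0 (delta_gt0 _) (V_gt0 _ _)) (V_gt0 _ _).
  have [u [z [-> Du Dz]]] := hn r r0 a Ga.
  exists (((V p.+1 i)^-1)%:C%C *: z); split.
    rewrite scalerDr addrK; case: bD0 => Dc DD0 _ _.
    apply: scaledZ Du => //; first exact: ltW.
    rewrite normcR gtr0_norm ?invr_gt0//; rewrite le_eqVlt; apply/orP; left; apply/eqP.
    by rewrite /r; field; rewrite !gt_eqF.
  rewrite /= scaled_mul; case: bn => Dc DD0 _ _.
  have ri : 0 <= r^-1 ^+ s p by rewrite exprn_ge0// invr_ge0 ltW.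
  apply: scaledZ Dz => //.
  rewrite normcR gtr0_norm ?invr_gt0// /= /kk.
  have -> : r^-1 ^+ s p = (delta p)^-1 ^+ s p * (V p i ^+ s p / V p.+1 i ^+ s p).
    rewrite -exprVn -!exprMn; congr (_ ^+ _); rewrite /r; move: (delta p) (delta_gt0 p) => d d0.
    by field; rewrite !gt_eqF.
  have v1 : 0 < V p.+1 i ^+ (s p).+1 by rewrite exprn_gt0.
  have v2 : 0 < (delta p)^-1 ^+ s p by rewrite exprn_gt0// invr_gt0.
  rewrite [leLHS](_ : _ = (delta p)^-1 ^+ s p * (V p i ^+ s p / V p.+1 i ^+ (s p).+1)); last first.
    rewrite exprS [(V p.+1 i * _)^-1]invfM; move: (V p.+1 i ^+ s p)^-1 (V p i ^+ s p) ((delta p)^-1 ^+ s p) => a1 a2 a3.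
    by ring.
  rewrite [leRHS](_ : _ = (delta p)^-1 ^+ s p * (C p / V p.+2 i)); last by move: ((delta p)^-1 ^+ s p) => d; ring.
  rewrite ler_wpM2l ?(ltW v2)// ler_pdivrMr// mulrAC ler_pdivlMr// mulrC.
  exact: V_conv.
(* For the final estimate of y: y_p has size 1 / V (p+1) <= 1 / V p in [G p], and the tail of x from
   p on has size e / V p in [D0], so a disk containing both bounds the difference. *)
have hH p : exists2 H : set E, bdisk H & forall i y z, scaled (G p) (V p.+1 i)^-1 y -> scaled D0 (e / V p i) z ->
    scaled H (V p i)^-1 (y - z).
  have [H bH [GH DH]] := bounded_in_disks_dir hB (bG p) bD0.
  case: (bH) => Hc H0 _ _.
  exists (scaled H (1 + e)); first by apply: bdisk_scaled => //; exact: addr_gt0 ltr01 e0.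
  move=> i y z Gy Dz; rewrite scaled_mul mulrDr mulr1.
  have v0 : 0 <= (V p i)^-1 by rewrite invr_ge0 ltW.
  have v1 : 0 <= (V p.+1 i)^-1 by rewrite invr_ge0 ltW.
  apply: scaledB => //; first by rewrite mulr_ge0// ltW.
    apply: (@scaled_le _ _ H (V p.+1 i)^-1) => //; first by rewrite lef_pV2 ?posrE.
    by case: Gy => a Ga <-; exists a => //; exact: GH.
  by case: Dz => a Da <-; exists a; [exact: DH|rewrite mulrC].
have /choice[Hs hHs] : forall p, exists H : set E, bdisk H /\ forall i y z, scaled (G p) (V p.+1 i)^-1 y -> scaled D0 (e / V p i) z ->
    scaled H (V p i)^-1 (y - z).
  by move=> p; have [H h1 h2] := hH p; exists H.
exists Hs => [p|i b Db]; first exact: (hHs p).1.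
have /choice[st hst] : forall py : nat * E, exists y', scaled (G py.1) (V py.1.+1 i)^-1 py.2 ->
   scaled D0 (delta py.1 / V py.1 i) (py.2 - y') /\ scaled (G py.1.+1) (V py.1.+2 i)^-1 y'.
  move=> [p y]; have [h|h] := pselect (scaled (G p) (V p.+1 i)^-1 y); last by exists 0.
  by have [y' hy'] := stepG i p y h; exists y'.
pose ys := fix ys p := if p is q.+1 then st (q, ys q) else b.
have Gys p : scaled (G p) (V p.+1 i)^-1 (ys p).
  by elim: p => [//|p IH]; exact: (hst (p, ys p) IH).2.
have Dys p : scaled D0 (delta p / V p i) (ys p - ys p.+1) := (hst (p, ys p) (Gys p)).1.
have Vle p q : V p i <= V (p + q)%N i.
  elim: q => [|q IH]; first by rewrite addn0.
  by rewrite addnS; apply: le_trans IH _; exact: V_mono.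
have tel p m : \sum_(q < m) (ys (p + q)%N - ys (p + q).+1) = ys p - ys (p + m)%N.
  elim: m => [|m IH]; first by rewrite big_ord0 addn0 subrr.
  by rewrite big_ord_recr/= IH addnS addrA subrK.
have [_ D00 _ _] := bD0; have [D0c _ _ _] := bD0.
have ce0 p q : 0 <= delta q / V p i by rewrite divr_ge0// ltW.
have ce p m : \sum_(q < m) delta q / V p i <= e / V p i.
  by rewrite -mulr_suml ler_wpM2r// invr_ge0 ltW.
(* The sizes delta (p+q) / V (p+q) are weakened to delta q / V p, so that the tail starting at p
   again sums to at most e / V p. *)
have Dpq p q : scaled D0 (delta q / V p i) (ys (p + q)%N - ys (p + q).+1).
  apply: (scaled_le D0c D00 _ _ (Dys _)); first exact: ce0.
  apply: ler_pM; rewrite ?invr_ge0 ?(ltW (delta_gt0 _)) ?(ltW (V_gt0 _ _))//.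
    rewrite ler_pM2l//; elim: p => [|p IH]; first by rewrite add0n.
    by apply: le_trans IH; rewrite addSn (meshS R (p + q).+1); have := mesh_gt0 R (p + q).+2; lra.
  by rewrite lef_pV2 ?posrE.
have [x hx] := sc bD0 (ce0 0%N) (ce 0%N) (Dpq 0%N).
have ylim p : (fun m => \sum_(q < m) (ys (p + q)%N - ys (p + q).+1)) @ \oo --> ys p - (b - x).
  apply/cvg_csn => f cf r r0; have /cvg_csn/(_ f cf r r0)[N _ h] := hx.
  exists N => // m /= Nm; have := h (p + m)%N (leq_trans Nm (leq_addl _ _)); rewrite /= !tel !add0n /=.
  by congr (f _ < _); lmod E.
exists x, (b - x); split; first by rewrite addrC subrK.
  exact: (scaled_psum_lim0 hE bD0 (ce0 0%N) (Dpq 0%N) (ce 0%N) hx).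
move=> p; rewrite [b - x](_ : _ = ys p - (ys p - (b - x))); last by rewrite opprB addrCA subrr addr0.
apply: (hHs p).2 => //.
exact: (scaled_psum_lim0 hE bD0 (ce0 p) (Dpq p) (ce p) (ylim p)).
Qed.

End Splitting.

(** * Cells, poles and multipliers *)

Section PoleGeometry.
Variable R : realType.
Implicit Types (F G : R -> R) (z : R[i]).

(** The pole lies d / 4 beyond the edge on the vertical line through z0, and s = 1 or -1 selects the
    upper or lower edge. Uniform continuity keeps it at a distance tau from the whole strip,
    uniformly in z0, and for d small against the gap (1 - a) c it is also 8 d away from the inner
    strip. *)
Lemma pole_one_side F (a : R) : profile F -> a < 1 -> exists2 d0 : R, 0 < d0 &
  forall d : R, 0 < d -> d <= d0 -> exists tau a' : R, [/\ 0 < tau, a' < 1 &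
  forall (s : R) z0, s ^+ 2 = 1 -> a' * F (complex.Re z0) <= s * complex.Im z0 ->
    s * complex.Im z0 < F (complex.Re z0) -> exists z' : R[i],
    [/\ normc (z0 - z') <= d / 2,
      forall z, s * complex.Im z < a * F (complex.Re z) -> 8 * d < normc (z - z') &
      forall z, s * complex.Im z < F (complex.Re z) -> tau < normc (z - z')]].
Proof.
move=> /profileP[c [H [c0 FH uF]]] a1.
pose e := (1 - a) * c / 2; have e0 : 0 < e by rewrite divr_gt0// mulr_gt0// subr_gt0.
have [de de0 hde] := uF e e0.
exists (Num.min (de / 9) (e / 9)) => [|d d0]; first by rewrite lt_min (divr_gt0 de0)// (divr_gt0 e0).
rewrite le_min => /andP[dde dee].
have [dk dk0 hdk] := uF (d / 8) ltac:(by rewrite divr_gt0).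
have H0 : 0 < H by have /andP[] := FH 0; lra.
(* This a' puts z0 within d / 4 of the edge, hence within d / 2 of the pole. *)
exists (Num.min (dk / 2) (d / 16)), (1 - d / (4 * H)); split.
- by rewrite lt_min !divr_gt0.
- by rewrite ltrBlDr ltrDl divr_gt0// mulr_gt0.
move=> s z0 s1 h1 h2; set x := complex.Re z0 in h1 h2 *.
exists (x +i* (s * (F x + d / 4)))%C.
have ss y : s * (s * y) = y by rewrite mulrA -expr2 s1 mul1r.
have sn y : `|s * y| = `|y|.
  have : `|s| ^+ 2 = 1 by rewrite -normrX s1 normr1.
  by move=> /eqP; rewrite sqrf_eq1 => /orP[/eqP h|/eqP h]; rewrite normrM h ?mul1r//; have := normr_ge0 s; lra.
have imd z : `|s * complex.Im z - (F x + d / 4)| <= normc (z - (x +i* (s * (F x + d / 4)))%C).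
  apply: le_trans (normc_Im _); rewrite -[leRHS]sn.
  by case: z => p q /=; rewrite mulrBr ss.
have red z : `|complex.Re z - x| <= normc (z - (x +i* (s * (F x + d / 4)))%C).
  by apply: le_trans (normc_Re _); case: z => p q.
have Fx := FH x.
split.
- apply: (le_trans (normc_le_ReIm _)).
  have -> : complex.Re (z0 - (x +i* (s * (F x + d / 4)))%C) = 0.
    by rewrite /x; case: (z0) => p q /=; rewrite subrr.
  rewrite normr0 add0r -sn.
  have -> : s * complex.Im (z0 - (x +i* (s * (F x + d / 4)))%C) = s * complex.Im z0 - (F x + d / 4).
    by case: (z0) => p q /=; rewrite mulrBr ss.
  have dH : d / (4 * H) * F x <= d / 4.
    have -> : d / 4 = d / (4 * H) * H by field; rewrite gt_eqF.
    by rewrite ler_wpM2l ?divr_ge0 ?mulr_ge0 ?(ltW d0) ?(ltW H0)//; case/andP: Fx.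
  by rewrite ler_norml; apply/andP; split; move: h1 h2 dH; rewrite mulrBl mul1r; lra.
- move=> z hz; rewrite ltNge; apply/negP => zd.
  have hr := le_trans (red z) zd; have hi := le_trans (imd z) zd.
  have : `|F (complex.Re z) - F x| < e by apply: hde; apply: le_lt_trans hr _; lra.
  rewrite ltr_norml => /andP[_ f2]; move: hi; rewrite ler_norml => /andP[i1 _].
  have : (1 - a) * c <= (1 - a) * F (complex.Re z).
    by rewrite ler_wpM2l ?subr_ge0 ?(ltW a1)//; have /andP[] := FH (complex.Re z).
  move: hz f2 i1; rewrite /e; move: (s * complex.Im z) => p hz f2 i1 h3.
  have e2 : e = (1 - a) * c / 2 by [].
  move: dee; rewrite e2; lra.
- move=> z hz; rewrite ltNge; apply/negP; rewrite le_min => /andP[zd1 zd2].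
  have hr := le_trans (red z) zd1; have hi := le_trans (imd z) zd2.
  have : `|F (complex.Re z) - F x| < d / 8 by apply: hdk; apply: le_lt_trans hr _; lra.
  rewrite ltr_norml => /andP[_ f2]; move: hi; rewrite ler_norml => /andP[i1 _].
  lra.
Qed.

Lemma pole_geometry F G (a : R) : profile F -> profile G -> a < 1 -> exists d tau a' : R,
  [/\ 0 < d <= 1, 0 < tau, a' < 1 &
  forall z0, strip F G z0 -> ~ sub_strip F G a' z0 -> exists z' : R[i],
    [/\ normc (z0 - z') <= d / 2,
      forall z, sub_strip F G a z -> 8 * d < normc (z - z') &
      forall z, strip F G z -> tau < normc (z - z')]].
Proof.
move=> pF pG a1; have [d1 d10 h1] := pole_one_side pF a1; have [d2 d20 h2] := pole_one_side pG a1.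
pose d := Num.min 1 (Num.min d1 d2).
have d0 : 0 < d by rewrite !lt_min ltr01 d10.
have [t1 [a1' [t10 a1'1 k1]]] := h1 d d0 ltac:(by rewrite !ge_min lexx orbT).
have [t2 [a2' [t20 a2'1 k2]]] := h2 d d0 ltac:(by rewrite !ge_min lexx !orbT).
exists d, (Num.min t1 t2), (Num.max a1' a2'); split.
- by rewrite d0 ge_min lexx.
- by rewrite lt_min t10.
- by rewrite gt_max a1'1.
have Fx := profileP pF; have Gx := profileP pG.
have [c1 [H1 [c10 FH _]]] := Fx; have [c2 [H2 [c20 GH _]]] := Gx.
move=> z0 /andP[hz1 hz2] nz.
have [hp|hp] := leP (a1' * F (complex.Re z0)) (complex.Im z0).
  have [z' [p1 p2 p3]] := k1 1 z0 (expr1n _ _) ltac:(by rewrite mul1r) ltac:(by rewrite mul1r).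
  exists z'; split=> // z /andP[q1 q2]; first by apply: p2; rewrite mul1r.
  by rewrite gt_min p3// mul1r.
have hn : a2' * G (complex.Re z0) <= - complex.Im z0.
  rewrite leNgt; apply/negP => hn; apply: nz; rewrite /sub_strip /strip /=.
  have f0 : 0 <= F (complex.Re z0) by have /andP[] := FH (complex.Re z0); lra.
  have g0 : 0 <= G (complex.Re z0) by have /andP[] := GH (complex.Re z0); lra.
  have m1 : a1' <= Num.max a1' a2' by rewrite le_max lexx.
  have m2 : a2' <= Num.max a1' a2' by rewrite le_max lexx orbT.
  have := ler_wpM2r f0 m1; have := ler_wpM2r g0 m2.
  by move=> *; apply/andP; split; lra.
have [z' [p1 p2 p3]] := k2 (-1) z0 ltac:(by rewrite sqrrN expr1n) ltac:(by rewrite mulN1r) ltac:(rewrite mulN1r; lra).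
exists z'; split=> // z /andP[q1 q2]; first by apply: p2; rewrite mulN1r; lra.
by rewrite gt_min p3 ?orbT// mulN1r; lra.
Qed.

Lemma cell_geometry F G (a : R) : profile F -> profile G -> 0 <= a -> a < 1 -> exists r a' : R,
  [/\ 0 < r, a' < 1 & forall z w, sub_strip F G a z -> (forall b, `|coord b (w - z)| < r) -> sub_strip F G a' w].
Proof.
move=> /profileP[c1 [H1 [c10 FH uF]]] /profileP[c2 [H2 [c20 GH uG]]] a0 a1.
pose c := Num.min c1 c2; have c0 : 0 < c by rewrite lt_min c10.
pose e := (1 - a) * c / 8; have e0 : 0 < e by rewrite divr_gt0// mulr_gt0// subr_gt0.
have eE : (1 - a) * c = 8 * e by rewrite /e; field.
clearbody e; have [d1 d10 k1] := uF e e0; have [d2 d20 k2] := uG e e0.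
pose a' := (1 + a) / 2.
exists (Num.min e (Num.min d1 d2)), a'; split; [by rewrite !lt_min e0 d10|by rewrite /a'; lra|].
move=> z w /andP[z1 z2] hw.
have := hw true; have := hw false; rewrite !lt_min => /and3P[_ r1 r2] /and3P[i1 _ _].
move: r1 r2 i1; rewrite !coordB /coord; set x := complex.Re z; set y := complex.Re w => r1 r2.
rewrite ltr_norml => /andP[i1 i2].
have := k1 _ _ r1; have := k2 _ _ r2; rewrite !ltr_norml => /andP[g1 g2] /andP[f1 f2].
have key (P : R -> R) : c <= P x -> P x - e < P y -> a * P x + e <= a' * P y.
  move=> cP Py; have ap : 0 <= a' by rewrite /a'; lra.
  have := ler_wpM2l ap (ltW Py).
  have := ler_wpM2l (_ : 0 <= 1 - a) cP; rewrite subr_ge0 => /(_ (ltW a1)).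
  have a'1 : a' <= 1 by rewrite /a'; lra.
  have := ler_wpM2r (ltW e0) a'1; rewrite mul1r.
  rewrite eE /a'; lra.
have cF : c <= F x by rewrite ge_min; have /andP[-> _] := FH x.
have cG : c <= G x by rewrite ge_min; have /andP[-> _] := GH x; rewrite orbT.
have := key F cF ltac:(lra); have := key G cG ltac:(lra).
move: z1 z2; rewrite -/x => z1 z2 q1 q2; apply/andP; split; rewrite -/y; lra.
Qed.

Lemma strip_height F G : profile F -> profile G -> exists2 H : R, 1 <= H &
  forall z, strip F G z -> `|complex.Im z| < H.
Proof.
move=> /profileP[c1 [H1 [c10 FH _]]] /profileP[c2 [H2 [c20 GH _]]].
exists (Num.max 1 (Num.max H1 H2)) => [|z /andP[z1 z2]]; first by rewrite le_max lexx.
have /andP[_ f] := FH (complex.Re z); have /andP[_ g] := GH (complex.Re z).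
have m1 : H1 <= Num.max 1 (Num.max H1 H2) by rewrite !le_max lexx orbT.
have m2 : H2 <= Num.max 1 (Num.max H1 H2) by rewrite !le_max lexx !orbT.
by rewrite ltr_norml; apply/andP; split; lra.
Qed.

End PoleGeometry.

Section DbarRules.
Variables (R : realType) (E : tvsType R[i]) (hE : hausdorff_space E).
Implicit Types (f g : R[i]^o -> E) (phi : R[i]^o -> R[i]^o) (z : R[i]).
Let hC := @plane_hausdorff R.

Definition has_pds f z := forall b, is_pd (dir b) f z (partial (dir b) f z).

Lemma BD_has_pds n S c D f z : BD n.+1 S c D f -> S z -> has_pds f z.
Proof. by move=> h Sz b; exact: (BD_pd (b := b) h Sz). Qed.

Lemma has_pdsI f z (l : bool -> E) : (forall b, is_pd (dir b) f z (l b)) -> has_pds f z.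
Proof. by move=> h b; rewrite (is_pd_partial hE (h b)). Qed.

Lemma has_pds_cst (x : E) z : has_pds (fun=> x) z.
Proof. exact: (has_pdsI (fun b => is_pd_cst (dir b) x z)). Qed.

Lemma dbar_cst (x : E) z : dbar (fun=> x) z = 0.
Proof. by rewrite (dbarE hE (fun b => is_pd_cst (dir b) x z)) scaler0 addr0 scaler0. Qed.

Lemma has_pdsD f g z : has_pds f z -> has_pds g z -> has_pds (fun w => f w + g w) z.
Proof. by move=> hf hg; apply: (has_pdsI (fun b => is_pdD (hf b) (hg b))). Qed.

Lemma dbarD f g z : has_pds f z -> has_pds g z -> dbar (fun w => f w + g w) z = dbar f z + dbar g z.
Proof.
move=> hf hg; rewrite (dbarE hE (fun b => is_pdD (hf b) (hg b))) (dbarE hE hf) (dbarE hE hg).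
move: (partial (dir false) f z) (partial (dir true) f z) (partial (dir false) g z) (partial (dir true) g z) => a b c d.
by lmod E.
Qed.

Lemma has_pdsB f g z : has_pds f z -> has_pds g z -> has_pds (fun w => f w - g w) z.
Proof. by move=> hf hg; apply: (has_pdsI (fun b => is_pdB (hf b) (hg b))). Qed.

Lemma dbarB f g z : has_pds f z -> has_pds g z -> dbar (fun w => f w - g w) z = dbar f z - dbar g z.
Proof.
move=> hf hg; rewrite (dbarE hE (fun b => is_pdB (hf b) (hg b))) (dbarE hE hf) (dbarE hE hg).
move: (partial (dir false) f z) (partial (dir true) f z) (partial (dir false) g z) (partial (dir true) g z) => a b c d.
by lmod E.
Qed.

Lemma has_pdsM phi f z : (forall b, is_pd (dir b) phi z (partial (dir b) phi z)) -> has_pds f z ->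
  has_pds (fun w => (phi w : R[i]) *: f w) z.
Proof. by move=> hp hf; apply: (has_pdsI (fun b => is_pdM (hp b) (hf b))). Qed.

Lemma dbarM phi f z : (forall b, is_pd (dir b) phi z (partial (dir b) phi z)) -> has_pds f z ->
  dbar (fun w => (phi w : R[i]) *: f w) z = (dbar phi z : R[i]) *: f z + (phi z : R[i]) *: dbar f z.
Proof.
move=> hp hf; rewrite (dbarE hE (fun b => is_pdM (hp b) (hf b))) (dbarE hE hf).
rewrite (dbarE hC hp : dbar phi z = (2%:R^-1 : R[i]) * (partial (dir false) phi z + 'i%C * partial (dir true) phi z)).
move: (partial (dir false) f z) (partial (dir true) f z) (f z) => a b c.
move: (partial (dir false) phi z : R[i]) (partial (dir true) phi z : R[i]) (phi z : R[i]) => p q r.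
by lmod E.
Qed.

Lemma has_pds_aff f (k : R) (c : R[i]) z : has_pds f (k%:C%C * z + c) ->
  has_pds (fun w : R[i]^o => f (k%:C%C * w + c)) z.
Proof. by move=> h; apply: (has_pdsI (fun b => is_pd_aff (h b))). Qed.

Lemma dbar_aff f (k : R) (c : R[i]) z : has_pds f (k%:C%C * z + c) ->
  dbar (fun w : R[i]^o => f (k%:C%C * w + c)) z = k%:C%C *: dbar f (k%:C%C * z + c).
Proof.
move=> h; rewrite (dbarE hE (fun b => is_pd_aff (h b))) (dbarE hE h).
move: (partial (dir false) f _) (partial (dir true) f _) => a b.
by lmod E.
Qed.

Lemma has_pds_sum n (u : nat -> R[i]^o -> E) z : (forall j, (j < n)%N -> has_pds (u j) z) ->
  has_pds (fun w => \sum_(j < n) u j w) z.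
Proof.
elim: n => [|n IH] h.
  have -> : (fun w => \sum_(j < 0) u j w) = fun=> 0 by apply/funext => w; rewrite big_ord0.
  exact: has_pds_cst.
have -> : (fun w => \sum_(j < n.+1) u j w) = fun w => \sum_(j < n) u j w + u n w.
  by apply/funext => w; rewrite big_ord_recr.
by apply: has_pdsD; [apply: IH => j jn; apply: h; exact: ltnW|exact: h].
Qed.

Lemma dbar_sum n (u : nat -> R[i]^o -> E) z : (forall j, (j < n)%N -> has_pds (u j) z) ->
  dbar (fun w => \sum_(j < n) u j w) z = \sum_(j < n) dbar (u j) z.
Proof.
elim: n => [|n IH] h.
  have -> : (fun w => \sum_(j < 0) u j w) = fun=> 0 by apply/funext => w; rewrite big_ord0.
  by rewrite big_ord0 dbar_cst.
have -> : (fun w => \sum_(j < n.+1) u j w) = fun w => \sum_(j < n) u j w + u n w.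
  by apply/funext => w; rewrite big_ord_recr.
have h' j : (j < n)%N -> has_pds (u j) z by move=> jn; apply: h; exact: ltnW.
by rewrite big_ord_recr/= -IH// dbarD//; [exact: has_pds_sum|exact: h].
Qed.

(** Lets constants be absorbed into the disk, as [KWB] asks for the exact bound [decay]. *)
Lemma BD_scaledD n S c D (r : R) f : BD n S c (scaled D r) f <-> BD n S (fun z => c z * r) D f.
Proof.
elim: n f => [|n IH] f /=; first by split=> -[h _]; split=> // z /h; rewrite scaled_mul.
split=> -[h [h1 h2]]; (split; first by move=> z /h; rewrite scaled_mul); split=> // b.
  exact/IH.
exact/IH.
Qed.

End DbarRules.

(** * A rapidly decaying holomorphic function *)

Section DecayingHolomorphic.
Variables (R : realType) (F G : R -> R) (w : nat -> R -> R).
Hypotheses (pF : profile F) (pG : profile G) (hw : weight_system w).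
Hypotheses (hwalpha : weight_alpha w) (hwN : weight_N w).
Hypothesis hscalar : dbar_surjective (R[i])^o F G w.
Implicit Types (z : R[i]).
Let hC := @plane_hausdorff R.
Let U := @unit_disk R.

Lemma decay_gt0 N (z : R[i]^o) : 0 < decay w N z.
Proof. exact: expR_gt0. Qed.

Lemma decay_le1 N (z : R[i]^o) : decay w N z <= 1.
Proof. by rewrite -expR0 ler_expR oppr_le0 weight_ge0. Qed.

Lemma decay_mono N M (z : R[i]^o) : (N <= M)%N -> decay w M z <= decay w N z.
Proof. by move=> NM; rewrite ler_expR lerN2 weight_le. Qed.

Lemma plane_in_disks : bounded_in_disks R[i]^o.
Proof.
move=> A bA; have [r r0 hr] := plane_bounded bA; have bU := unit_disk_bdisk R.
by exists (scaled U r); [exact: bdisk_scaled|move=> x /hr h; apply/unit_diskP => //; exact: ltW].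
Qed.

(** Where |Re z| < 2 the factor [decay] is bounded below, and where |Re z| > 1 the function
    vanishes; these are two overlapping open sets. *)
Lemma compact_decay (q : R[i]^o -> R[i]^o) n N : SB setT q ->
  (forall z, 1 <= `|coord false z| -> q z = 0) ->
  exists2 C : R, 0 < C & BD n setT (fun z => C * decay w N z) U q.
Proof.
move=> sq q0; have [C C0 hq] := sq n; have [Uc U0 _ _] := unit_disk_bdisk R.
pose m := expR (- w N 2); have m0 : 0 < m := expR_gt0 _.
exists ((C + 1) / m); first by rewrite divr_gt0//; lra.
pose A : set R[i]^o := [set z | `|coord false z| < 2].
pose B : set R[i]^o := [set z | 1 < `|coord false z|].
have -> : @setT R[i]^o = A `|` B.
  apply/seteqP; split=> // z _; have [h|h] := ltP `|coord false z| 2; [left|right] => //.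
  by rewrite /B /=; lra.
have oB : open B := @open_coord_gt R false 1.
have d0 z : 0 <= (C + 1) / m * decay w N z.
  by rewrite mulr_ge0 ?(ltW (decay_gt0 _ _))// divr_ge0 ?(ltW m0)//; lra.
apply: BD_union.
  apply: BD_le hq => // z Az.
  have : m <= decay w N z by rewrite ler_expR lerN2 weight_mono//; exact: ltW.
  move=> mz; have := ler_wpM2l (_ : 0 <= (C + 1) / m) mz.
  by rewrite divfK ?gt_eqF// divr_ge0 ?(ltW m0) ?addr_ge0// => /(_ isT); lra.
by apply: (BD_ext oB _ (BD_cst0 hC n _ oB U0)) => z /= /ltW /q0.
Qed.

Lemma unit_bound n (S : set R[i]^o) (c : R[i]^o -> R) (D : set R[i]^o) (f : R[i]^o -> R[i]^o) :
  bdisk D -> (forall z, S z -> 0 <= c z) -> BD n S c D f -> exists2 r : R, 0 < r & BD n S (fun z => c z * r) U f.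
Proof.
move=> [Dc D0 _ boD] c0 h; have [r r0 hr] := plane_bounded boD; exists r => //.
apply/BD_scaledD; apply: BD_le h => // x /hr xr; apply/unit_diskP => //; exact: ltW.
Qed.

Lemma id_BD n (S : set R[i]^o) (H : R) : open S -> 0 <= H -> (forall z, S z -> `|complex.Im z| <= H) ->
  BD n S (fun z => 1 + H + `|complex.Re z|) U (id : R[i]^o -> R[i]^o).
Proof.
move=> o H0 hS; have [Uc U0 _ _] := unit_disk_bdisk R.
have c0 z : 0 <= 1 + H + `|complex.Re z| by rewrite !addr_ge0.
have val z : S z -> scaled U (1 + H + `|complex.Re z|) z.
  move=> /hS h; apply/unit_diskP => //; apply: (le_trans (normc_le_ReIm z)); lra.
case: n => [|n]; first by split=> // z; exact: val.
apply: (BD_intro hC (f' := fun b _ => dir b)) => // [b z _|b]; first exact: is_pd_id.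
apply: (BD_cst hC) => // z _; apply/unit_diskP => //; rewrite normc_dir.
have := normr_ge0 (complex.Re z); lra.
Qed.

(* P = chi + z f, where chi = 1 - z k is a cutoff and f solves dbar f = dbar k. *)
Lemma holomorphic_bump : exists P : R[i]^o -> R[i]^o, [/\ P 0 = 1,
  forall n N a, a < 1 -> exists2 C : R, 0 < C & BD n (sub_strip F G a) (fun z => C * decay w N z) U P &
  forall z, strip F G z -> dbar P z = 0].
Proof.
have [cF [HF [cF0 FH _]]] := profileP pF; have [cG [HG [cG0 GH _]]] := profileP pG.
have [Uc U0 _ _] := unit_disk_bdisk R.
have [n0 _] : exists n0, mesh R n0 <= 1 by exists 0%N; exact: mesh_le1.
pose k := kern n0 : R[i]^o -> R[i]^o.
have sk : SB setT k := SB_kern R n0.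
have g0 z : 1 <= `|coord false z| -> dbar k z = 0.
  by move=> h; apply: (@dbar_kern_supp _ _ _ false); apply: le_trans h; exact: mesh_le1.
have gK : KWB F G w (dbar k).
  move=> n N a a1; have [C C0 h] := compact_decay n N (SB_dbar sk) g0.
  exists (scaled U C); first by apply: bdisk_scaled => //; exact: unit_disk_bdisk.
  apply/BD_scaledD; apply: BD_le h => // z _; first by rewrite mulrC.
  by rewrite mulr_ge0 ?(ltW C0) ?(ltW (decay_gt0 _ _)).
have [f fK df] := hscalar (KWB_KW hC pF pG (fun N t t0 => weight_ge0 hw N t0) gK).
have fB := KW_KWB hC pF pG plane_in_disks fK.
pose chi (z : R[i]^o) : R[i]^o := cutoff ((2 ^+ n0)%:C%C * z).
have schi : SB setT chi.
  have := SB_aff (2 ^+ n0) 0 (@openT _) (SB_cutoff R); apply: SB_ext => [|z _]; first exact: openT.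
  by rewrite addr0.
have chiE z : chi z = 1 - z * k z.
  rewrite /k /kern /ckernel; have [->|z0] := eqVneq z 0.
    rewrite mul0r subr0 /chi mulr0 /cutoff !bump1 ?mulr1//; rewrite /coord /= normr0; lra.
  have p0 : ((2 ^+ n0)%:C%C : R[i]) != 0 by rewrite -normc_gt0 normcR normr_gt0 expf_neq0.
  transitivity (1 - z * ((2 ^+ n0)%:C%C * ((1 - chi z) / ((2 ^+ n0)%:C%C * z))) : R[i]); last by [].
  by move: (chi z : R[i]) => X; field; rewrite z0 p0.
have chi0 z : 1 <= `|coord false z| -> chi z = 0.
  move=> h; suff h' : 1 <= `|coord false ((2 ^+ n0)%:C%C * z)| by rewrite /chi /cutoff (bump0 h').1 mul0r.
  rewrite coordM normrM ger0_norm ?exprn_ge0//; apply: le_trans h _.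
  by rewrite ler_peMl// exprn_ege1// ler1n.
exists (fun z => chi z + (z : R[i]) *: f z); split.
- by rewrite scale0r addr0 chiE mul0r subr0.
- move=> n N a a1; have [C1 C10 h1] := compact_decay n N schi chi0.
  (* The factor z costs one power of 1 + |Re z|, which a larger weight absorbs. *)
  have [M [C2 [NM C20 hM]]] := weight_poly1 hw hwalpha hwN N.
  have [D bD h2] := fB n M a a1.
  have o := open_sub_strip (a := a) pF pG.
  have [r r0 h3] := unit_bound bD (fun z _ => ltW (decay_gt0 M z)) h2.
  have [H H1 hH] := strip_height pF pG.
  have H0 : 0 <= H by lra.
  have Sim z : sub_strip F G a z -> `|complex.Im z| <= H.
    by move=> Sz; apply/ltW/hH; rewrite -sub_strip1; apply: (sub_strip_mono pF pG (ltW a1)).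
  have c1 z : sub_strip F G a z -> 0 <= 1 + H + `|complex.Re z| by rewrite !addr_ge0.
  have c3 z : sub_strip F G a z -> 0 <= decay w M z * r.
    by rewrite mulr_ge0 ?(ltW r0)// (ltW (decay_gt0 _ _)).
  have h4 := BD_mul hC o Uc U0 c1 c3 (id_BD n o H0 Sim) h3.
  have h1' : BD n (sub_strip F G a) (fun z => C1 * decay w N z) U chi.
    by apply: BD_le h1 => // z _; rewrite mulr_ge0 ?(ltW C10)// (ltW (decay_gt0 _ _)).
  have d1 z : sub_strip F G a z -> 0 <= C1 * decay w N z.
    by rewrite mulr_ge0 ?(ltW C10)// (ltW (decay_gt0 _ _)).
  have d2 z : sub_strip F G a z -> 0 <= 2 ^+ n * ((1 + H + `|complex.Re z|) * (decay w M z * r)).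
    by move=> Sz; rewrite mulr_ge0 ?exprn_ge0//; exact: mulr_ge0 (c1 z Sz) (c3 z Sz).
  have h := BD_add hC o Uc U0 d1 d2 h1' h4.
  exists (C1 + 2 ^+ n * (1 + H) * r * C2).
    by rewrite ltr_wpDr// !mulr_ge0 ?exprn_ge0 ?(ltW r0)//; lra.
  apply: BD_le h => // [z Sz|z Sz]; last by rewrite addr_ge0 ?d1 ?d2.
  rewrite [leRHS]mulrDl lerD2l.
  have := hM `|complex.Re z| (normr_ge0 _); rewrite -/(decay w M z) -/(decay w N z) => hz.
  have e1 : 1 + H + `|complex.Re z| <= (1 + H) * (1 + `|complex.Re z|).
    by have := mulr_ge0 H0 (normr_ge0 (complex.Re z)); lra.
  have k0 : 0 <= 2 ^+ n * (1 + H) * r by rewrite !mulr_ge0 ?exprn_ge0 ?(ltW r0)//; lra.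
  have := ler_wpM2l k0 hz; rewrite [X in _ -> _ <= X](_ : _ = 2 ^+ n * (1 + H) * r * (C2 * decay w N z)); last by ring.
  apply: le_trans; rewrite [leRHS](_ : _ = 2 ^+ n * (((1 + H) * (1 + `|complex.Re z|)) * (decay w M z * r))); last by rewrite /decay; ring.
  by apply: ler_wpM2l; rewrite ?exprn_ge0//; apply: ler_wpM2r => //; exact: c3.
- move=> z Tz.
  have [a /andP[_ a1] Sa] := strip_exhaust pF pG Tz.
  have [D bD h2] := fB 1%N 0%N a a1.
  have pf : has_pds f z := BD_has_pds h2 Sa.
  have [Ck _ hk] := sk 1%N; have pk : has_pds k z := BD_has_pds hk I.
  have pid : has_pds (id : R[i]^o -> R[i]^o) z := has_pdsI hC (fun b => is_pd_id z).
  (* In this form holomorphy is visible: f - k and z are both annihilated by [dbar]. *)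
  have -> : (fun z : R[i]^o => chi z + (z : R[i]) *: f z) = (fun z => 1 + (z : R[i]) *: (f z - k z)).
    apply/funext => y; rewrite chiE.
    transitivity (1 - y * k y + y * f y : R[i]); first by [].
    transitivity (1 + y * (f y - k y) : R[i]); last by [].
    by ring.
  have pfk := has_pdsB hC pf pk.
  rewrite (dbarD hC (@has_pds_cst _ _ hC (1 : R[i]^o) z) (has_pdsM hC pid pfk)) (dbar_cst hC) add0r.
  rewrite (dbarM hC pid pfk) (dbarB hC pf pk) (df z Tz) subrr scaler0 addr0.
  have -> : dbar (id : R[i]^o -> R[i]^o) z = 0.
    rewrite (dbarE hC (fun b => is_pd_id (v := dir b) z)).
    transitivity (2%:R^-1 * (1 + 'i%C * 'i%C) : R[i]); first by [].
    by rewrite -expr2 sqr_i subrr mulr0.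
  by rewrite scale0r.
Qed.

(* The profiles play no role in the conclusion: by condition (alpha) the function of
   [holomorphic_bump] can be dilated, which widens the strip. *)
Lemma holomorphic_multiplier (H : R) : 0 < H -> exists P : R[i]^o -> R[i]^o, [/\
  forall n N, exists2 C : R, 0 < C & BD n [set z : R[i]^o | `|complex.Im z| < H] (fun z => C * decay w N z) U P,
  forall z, `|complex.Im z| < H -> dbar P z = 0 &
  forall z, `|complex.Re z| < 3 -> `|complex.Im z| < H -> 1 / 2 <= normc (P z)].
Proof.
move=> H0; have [P0 [P01 P0B P0d]] := holomorphic_bump.
have [cF [HF [cF0 FH _]]] := profileP pF; have [cG [HG [cG0 GH _]]] := profileP pG.
have [Uc U0 _ _] := unit_disk_bdisk R.
pose c := Num.min cF cG; have c0 : 0 < c by rewrite lt_min cF0.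
have o := open_sub_strip (a := 1 / 2) pF pG.
have small z : `|complex.Im z| < c / 2 -> sub_strip F G (1 / 2) z.
  rewrite ltr_norml => /andP[h1 h2].
  have : c <= F (complex.Re z) by rewrite ge_min; have /andP[-> _] := FH (complex.Re z).
  have : c <= G (complex.Re z) by rewrite ge_min; have /andP[-> _] := GH (complex.Re z); rewrite orbT.
  by move=> *; apply/andP; split; lra.
have S0 : sub_strip F G (1 / 2) 0 by apply: small; rewrite /= normr0; lra.
have [rho rho0 hrho] : exists2 rho : R, 0 < rho & forall z, normc z < rho -> 1 / 2 <= normc (P0 z).
  have [C C0 hP] := P0B 1%N 0%N (1 / 2) ltac:(lra).
  have hP' : BD 1 (sub_strip F G (1 / 2)) (fun=> C) U P0.
    apply: BD_le hP => // z _; first by rewrite ler_piMr ?(ltW C0)// decay_le1.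
    by rewrite mulr_ge0 ?(ltW C0)// (ltW (decay_gt0 _ _)).
  have := BD_cont hC (unit_disk_bdisk R) o S0 (ltW C0) hP'.
  move=> /cvg_csn/(_ _ (normc_csn R) (1 / 2) ltac:(lra))/nbhs_planeP[d d0 hd].
  exists d => // z zd; have := hd z; rewrite subr0 => /(_ zd); rewrite P01 => h.
  have := normc_triangle (P0 z) (1 - P0 z); rewrite addrC subrK normc1.
  by rewrite normc_sub in h; move: h; move: (normc _) (normc _) => *; lra.
(* The second entry maps the slab into the half strip of [P0], the third maps the box |Re z| < 3 of
   the slab into the disc where |P0| >= 1 / 2. *)
pose la := Num.min 1 (Num.min (c / (2 * H)) (rho / (3 + H))).
have la0 : 0 < la by rewrite !lt_min ltr01 !divr_gt0//; lra.
have la1 : la <= 1 by rewrite ge_min lexx.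
have laH : la * H <= c / 2.
  have : la <= c / (2 * H) by rewrite !ge_min lexx orbT.
  rewrite ler_pdivlMr; lra.
have lar : la * (3 + H) <= rho.
  have : la <= rho / (3 + H) by rewrite !ge_min lexx !orbT.
  by rewrite ler_pdivlMr//; lra.
have scal z : `|complex.Im z| < H -> sub_strip F G (1 / 2) (la%:C%C * z + 0).
  move=> h; rewrite addr0; apply: small; rewrite -[complex.Im _]/(coord true _) coordM normrM (gtr0_norm la0).
  by apply: lt_le_trans laH; rewrite ltr_pM2l.
exists (fun z => P0 (la%:C%C * z + 0)); split.
- move=> n N; have [M [C1 [NM hM]]] := weight_dilation hw hwalpha N la^-1.
  have [C C0 hP] := P0B n M (1 / 2) ltac:(lra).
  have d0 z : sub_strip F G (1 / 2) z -> 0 <= C * decay w M z.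
    by rewrite mulr_ge0 ?(ltW C0)// (ltW (decay_gt0 _ _)).
  exists (C * expR C1); first by rewrite mulr_gt0 ?expR_gt0.
  have := BD_aff hC la 0 o Uc U0 d0 hP.
  apply: BD_le => // z hz; last first.
    by rewrite mulr_ge0 ?exprn_ge0 ?le_max ?ler01// d0//; exact: scal.
  have -> : Num.max 1 `|la| = 1 by apply/max_idPl; rewrite gtr0_norm.
  rewrite expr1n mul1r -mulrA ler_pM2l// -expRD ler_expR addr0.
  have -> : complex.Re (la%:C%C * z) = la * complex.Re z by rewrite -[LHS]/(coord false _) coordM.
  rewrite normrM (gtr0_norm la0).
  have t0 : 0 <= la * `|complex.Re z| by rewrite mulr_ge0// ltW.
  have := hM _ t0; rewrite mulrA mulVf ?gt_eqF// mul1r => -[h|]; first lra.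
  by rewrite ltNge normr_ge0.
- move=> z hz; have Sz := scal z hz.
  have [C C0 hP] := P0B 1%N 0%N (1 / 2) ltac:(lra).
  rewrite (dbar_aff hC (BD_has_pds hP Sz)) P0d ?scaler0//.
  by rewrite -sub_strip1; apply: (sub_strip_mono pF pG _ Sz); lra.
- move=> z h1 h2; apply: hrho; rewrite addr0 normcM normcR (gtr0_norm la0).
  apply: lt_le_trans lar; rewrite ltr_pM2l//.
  by apply: (le_lt_trans (normc_le_ReIm z)); lra.
Qed.

End DecayingHolomorphic.

Section DbarSeries.
Variables (R : realType) (E : tvsType R[i]) (hE : hausdorff_space E) (sc : series_complete E).
Variables (S : set R[i]^o) (D : set E) (e : nat -> R) (s M0 : R) (M : R[i]^o -> R).
Hypotheses (oS : open S) (bD : bdisk D) (e0 : forall k, 0 <= e k) (es : forall n, \sum_(k < n) e k <= s).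
Hypotheses (M_ge0 : forall z, S z -> 0 <= M z) (M_le : forall z, S z -> M z <= M0).
Variables (u : nat -> R[i]^o -> E) (f : R[i]^o -> E).
Hypothesis hu : forall k, BD 1 S (fun z => e k * M z) D (u k).
Hypothesis hf : forall z, S z -> (fun n => \sum_(k < n) u k z) @ \oo --> f z.

Lemma dbar_series z : S z -> has_pds f z /\ (fun n => \sum_(k < n) dbar (u k) z) @ \oo --> dbar f z.
Proof.
move=> Sz; have pu k : has_pds (u k) z := BD_has_pds (hu k) Sz.
have eM k : 0 <= e k * M z by rewrite mulr_ge0// M_ge0.
have eMs n : \sum_(k < n) e k * M z <= s * M z by rewrite -mulr_suml ler_wpM2r// M_ge0.
have /choice[l hl] b : exists l : E, (fun n => \sum_(k < n) partial (dir b) (u k) z) @ \oo --> l.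
  exact: (sc bD eM eMs (fun k => BD_val (BD_partial b (hu k)) Sz)).
have pf b : is_pd (dir b) f z (l b).
  exact: (@is_pd_series _ _ hE S D e s M0 M oS bD e0 es M_ge0 M_le u f b z (l b) hu hf Sz (hl b)).
split; first exact: has_pdsI pf.
rewrite (dbarE hE pf).
have -> : (fun n => \sum_(k < n) dbar (u k) z) = (fun n => (2%:R^-1 : R[i]) *:
    (\sum_(k < n) partial (dir false) (u k) z + 'i%C *: \sum_(k < n) partial (dir true) (u k) z)).
  apply/funext => n; rewrite (scaler_sumr 'i%C) -big_split/= scaler_sumr; apply: eq_bigr => k _.
  exact: (dbarE hE (pu k)).
exact: (@cvgZc_tvs _ _ _ _ _ _ 2%:R^-1 _ (@cvgD_tvs _ _ _ _ _ _ _ _ _ (hl false) (@cvgZc_tvs _ _ _ _ _ _ 'i%C _ (hl true)))).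
Qed.

End DbarSeries.

Section CauchyCell.
Variable R : realType.

(** Translating the cell to the origin and absorbing r into the disk reduces this to
    [cauchy_solution], with the same K for cells at any position. *)
Lemma cauchy_cell : exists2 K : R, 0 < K &
  forall (E : tvsType R[i]), hausdorff_space E -> series_complete E ->
  forall (h : R[i]^o -> E) (c : R[i]), (forall z b, 1 < `|coord b (z - c)| -> h z = 0) ->
  (forall n, exists (D : set E) (r : R), [/\ bdisk D, 0 < r & BD n setT (fun=> r) D h]) ->
  exists u : R[i]^o -> E, [/\
    forall n D (r : R), bdisk D -> 0 < r -> BD n.+1 setT (fun=> r) D h -> BD n setT (fun=> K * r) D u,
    forall z, dbar u z = h z &
    forall D (r : R) (z' : R[i]) (d : R), bdisk D -> 0 < r -> BD 1 setT (fun=> r) D h -> 0 < d ->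
      (forall w, h w != 0 -> normc (w - z') <= d) ->
      exists2 b : nat -> E, forall i, scaled D (K * r * d ^+ i) (b i) &
        forall z, 2 * d <= normc (z - z') ->
          (fun m => \sum_(i < m) ((z - z')^-1 ^+ i.+1 : R[i]) *: b i) @ \oo --> u z].
Proof.
have [K K0 hK] := cauchy_solution R; exists K => // E hE sc h c hc hh.
pose g w : E := h (1%:C%C * w + c).
have gE w : g w = h (w + c) by rewrite /g rmorph1 mul1r.
have o := @openT R[i]^o.
have gB n D (r : R) : bdisk D -> 0 < r -> BD n setT (fun=> r) D h -> BD n setT (fun=> 1) (scaled D r) g.
  move=> [Dc D0 _ _] r0 Hh; apply/BD_scaledD.
  have := @BD_aff _ _ hE n setT (fun=> r) D h 1 c o Dc D0 (fun _ _ => ltW r0) Hh.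
  apply: BD_eqc => z _; rewrite normr1; have -> : Num.max 1 1 = 1 :> R by apply/max_idPl.
  by rewrite expr1n.
have sg : supported g by move=> z b zb; rewrite gE (hc _ b)// addrK.
have [|u [u1 u2 u3]] := hK E hE sc g sg.
  by move=> n; have [D [r [bD r0 Hh]]] := hh n; exists (scaled D r); [exact: bdisk_scaled|exact: gB].
have uE z : u (1%:C%C * z + - c) = u (z - c) by rewrite rmorph1 mul1r.
exists (fun z => u (1%:C%C * z + - c)); split.
- move=> n D r bD r0 Hh; have := u1 n _ (bdisk_scaled bD r0) (gB _ _ _ bD r0 Hh).
  move=> /BD_scaledD H1; case: (bD) => Dc D0 _ _.
  have Kr : 0 <= K * r by rewrite mulr_ge0 ?ltW.
  have := @BD_aff _ _ hE n setT (fun=> K * r) D u 1 (- c) o Dc D0 (fun _ _ => Kr) H1.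
  apply: BD_eqc => z _; rewrite normr1; have -> : Num.max 1 1 = 1 :> R by apply/max_idPl.
  by rewrite expr1n mul1r.
- move=> z; have [D [r [bD r0 Hh]]] := hh 2%N.
  have H1 := u1 1%N _ (bdisk_scaled bD r0) (gB _ _ _ bD r0 Hh).
  rewrite (dbar_aff hE (k := 1) (c := - c) (f := u) (z := z) (BD_has_pds H1 I)) u2 gE rmorph1 mul1r scale1r.
  by rewrite subrK.
- move=> D r z' d bD r0 Hh d0 hd.
  have [|b b1 b2] := u3 _ (z' - c) d (bdisk_scaled bD r0) (gB _ _ _ bD r0 Hh) d0.
    move=> w; rewrite gE => /hd; have -> // : w + c - z' = w - (z' - c) by ring.
  exists b => [i|z zz]; first by have := b1 i; rewrite scaled_mul mulrAC.
  have e : z - c - (z' - c) = z - z' by ring.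
  by rewrite uE -e; apply: b2; rewrite e.
Qed.

End CauchyCell.

(** * Summation of the pieces with multipliers *)

Section Assembly.
Variables (R : realType) (E : tvsType R[i]) (hE : hausdorff_space E) (sc : series_complete E).
Variables (w : nat -> R -> R) (hw : weight_system w) (hwalpha : weight_alpha w) (hwN : weight_N w).
Variables (P : R[i]^o -> R[i]^o) (H : R).
Let slab : set R[i]^o := [set z | `|complex.Im z| < H].
Hypothesis P_BD : forall n N, exists2 C : R, 0 < C & BD n slab (fun z => C * decay w N z) (@unit_disk R) P.
Hypothesis P_dbar : forall z, slab z -> dbar P z = 0.
Variables (delta : R) (J : nat).
Hypotheses (delta_gt0 : 0 < delta) (delta_le1 : delta <= 1).
Implicit Types (v : bool -> nat -> nat -> R[i]^o -> E) (z : R[i]) (S D : set E).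
Let hC := @plane_hausdorff R.
Let U := @unit_disk R.

Lemma open_slab : open slab.
Proof.
have -> : slab = (fun z : R[i]^o => complex.Im z) @^-1` [set x : R | `|x| < H] by [].
apply: open_comp; first by move=> x _; exact: Im_continuous.
have -> : [set x : R | `|x| < H] = (fun x : R => `|x|) @^-1` [set x | x < H] by [].
by apply: open_comp; [move=> x _; exact: norm_continuous|exact: open_lt].
Qed.

(** The integer multiples of delta as two sequences, one per half-axis, which [tile] adds in pairs;
    the sum over all columns thus becomes a series over nat. *)
Definition xpos (s : bool) (m : nat) : R := if s then - (m.+1%:R * delta) else m%:R * delta.

Lemma xpos_ge s m : m%:R * delta <= `|xpos s m|.
Proof.
have d0 := ltW delta_gt0; rewrite /xpos; case: s; last by rewrite ger0_norm// mulr_ge0.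
rewrite normrN ger0_norm ?mulr_ge0//; by rewrite ler_wpM2r// ler_nat.
Qed.

Definition mult s m (z : R[i]^o) : R[i]^o := P (1%:C%C * z + (- xpos s m)%:C%C).

Lemma mult_arg s m z : 1%:C%C * z + (- xpos s m)%:C%C = z - (xpos s m)%:C%C.
Proof. by rewrite rmorph1 mul1r rmorphN. Qed.

Lemma slab_mult s m z : slab z -> slab (1%:C%C * z + (- xpos s m)%:C%C).
Proof. by rewrite mult_arg /slab /=; case: z => x y /=; rewrite subr0. Qed.

Lemma mult_pds s m z : slab z -> has_pds (mult s m) z.
Proof.
move=> Sz; have [C C0 h] := P_BD 1 0; apply: (has_pds_aff hC).
exact: (BD_has_pds h (slab_mult s m Sz)).
Qed.

Lemma mult_dbar s m z : slab z -> dbar (mult s m) z = 0.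
Proof.
move=> Sz; have [C C0 h] := P_BD 1 0.
rewrite (dbar_aff hC (k := 1) (c := (- xpos s m)%:C%C) (f := P) (z := z) (BD_has_pds h (slab_mult s m Sz))).
by rewrite P_dbar ?scaler0//; exact: slab_mult.
Qed.

(** The decay of P (z - x) in z - x and that of the coefficient in x combine to decay in z by
    [weight_shift]. Two spare powers of 1 + |x|, from [weight_poly], give the summable factor in
    m. *)
Lemma mult_BD n N : exists M (C : R), 0 < C /\ forall (S : set R[i]^o) (D : set E) s m (f : R[i]^o -> E),
  open S -> S `<=` slab -> bdisk D -> BD n S (fun=> expR (- w M `|xpos s m|)) D f ->
  BD n S (fun z => C * (m.+1%:R ^- 2 * decay w N z)) D (fun z => (mult s m z : R[i]) *: f z).
Proof.
have [M1 [C1 [NM1 h1]]] := weight_shift hw hwalpha N.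
have [M [C2 [M1M C20 h2]]] := weight_poly hw hwalpha hwN 2 M1.
have [C3 C30 h3] := P_BD n M1.
have [Uc U0 _ _] := unit_disk_bdisk R.
exists M, (2 ^+ n * C3 * (C2 + 1) * expR C1 * delta ^- 2); split.
  by rewrite !mulr_gt0 ?exprn_gt0 ?invr_gt0 ?exprn_gt0 ?expR_gt0//; lra.
move=> S D s m f oS SS bD hf; case: (bD) => Dc D0 _ _.
set x := xpos s m in hf *.
have P0 z : slab z -> 0 <= C3 * decay w M1 z by rewrite mulr_ge0 ?(ltW C30)// ltW// expR_gt0.
have hm := BD_aff hC 1 (- x)%:C%C open_slab Uc U0 P0 h3.
have hm' : BD n S (fun z => C3 * decay w M1 (1%:C%C * z + (- x)%:C%C)) U (mult s m).
  have SS' : S `<=` [set z | slab (1%:C%C * z + (- x)%:C%C)] by move=> z /SS; exact: slab_mult.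
  apply: BD_le hm => // z Sz.
    by rewrite normr1; have -> : Num.max 1 1 = 1 :> R by [apply/max_idPl]; rewrite expr1n mul1r.
  by rewrite mulr_ge0 ?exprn_ge0 ?le_max ?ler01// P0//; exact: SS'.
have a0 z : S z -> 0 <= C3 * decay w M1 (1%:C%C * z + (- x)%:C%C).
  by move=> Sz; apply: P0; apply: slab_mult; exact: SS.
have := BD_mul hE oS Dc D0 a0 (fun _ _ => ltW (expR_gt0 _)) hm' hf.
apply: BD_le => // z Sz; last by rewrite mulr_ge0 ?exprn_ge0 ?mulr_ge0 ?a0// ltW// expR_gt0.
rewrite mult_arg.
have -> : decay w M1 (z - x%:C%C) = expR (- w M1 `|complex.Re z - x|).
  by rewrite /decay; case: (z) => p q.
have k1 : expR (- w M1 `|complex.Re z - x|) * expR (- w M1 `|x|) <= expR C1 * decay w N z.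
  rewrite -expRD -expRD ler_expR; have := h1 (complex.Re z - x) x; rewrite subrK; lra.
(* m delta <= |x|, and delta <= 1 accounts for the step from m to m + 1. *)
have xm : delta ^+ 2 * m.+1%:R ^+ 2 <= (1 + `|x|) ^+ 2.
  rewrite -exprMn; apply: lerXn2r; rewrite ?nnegrE ?mulr_ge0 ?addr_ge0 ?(ltW delta_gt0)//.
  have := xpos_ge s m; rewrite -/x -[m.+1%:R]natr1; move: `|x| (m%:R : R) => a b h.
  by have := delta_le1; lra.
have k2 : expR (- w M `|x|) <= C2 * expR (- w M1 `|x|) * (delta ^- 2 * m.+1%:R ^- 2).
  have p0 : 0 < delta ^+ 2 * m.+1%:R ^+ 2 by rewrite mulr_gt0// exprn_gt0.
  rewrite -invfM ler_pdivlMr// mulrC.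
  apply: le_trans (h2 `|x| (normr_ge0 x)); rewrite ler_wpM2r//; exact: ltW (expR_gt0 _).
have k3 : 0 <= 2 ^+ n * C3 * expR (- w M1 `|complex.Re z - x|).
  by rewrite !mulr_ge0 ?exprn_ge0 ?(ltW C30) ?(ltW (expR_gt0 _)).
have := ler_wpM2l k3 k2.
rewrite [X in X <= _ -> _](_ : _ = 2 ^+ n * (C3 * expR (- w M1 `|complex.Re z - x|) * expR (- w M `|x|))); last by ring.
move=> /le_trans; apply.
have dm0 : 0 <= delta ^- 2 * m.+1%:R ^- 2 :> R by rewrite mulr_ge0// invr_ge0 exprn_ge0// ltW.
have k4 : 0 <= 2 ^+ n * C3 * C2 * (delta ^- 2 * m.+1%:R ^- 2).
  apply: mulr_ge0 => //; apply: mulr_ge0 => //; apply: mulr_ge0; [exact: exprn_ge0|exact: ltW].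
have := ler_wpM2l k4 k1.
rewrite [X in X <= _ -> _](_ : _ = 2 ^+ n * C3 * expR (- w M1 `|complex.Re z - x|) * (C2 * expR (- w M1 `|x|) * (delta ^- 2 * m.+1%:R ^- 2))); last first.
  by move: (delta ^- 2) (m.+1%:R ^- 2) => *; ring.
move=> /le_trans; apply.
rewrite [leRHS](_ : _ = 2 ^+ n * C3 * (C2 + 1) * (delta ^- 2 * m.+1%:R ^- 2) * (expR C1 * decay w N z)); last first.
  by move: (delta ^- 2) (m.+1%:R ^- 2) => *; ring.
apply: ler_wpM2r; first by rewrite mulr_ge0// ltW// expR_gt0.
apply: ler_wpM2r => //; apply: ler_wpM2l; last lra.
by rewrite mulr_ge0 ?exprn_ge0 ?(ltW C30).
Qed.

Lemma inv_square_sum n : \sum_(m < n) m.+1%:R ^- 2 <= 2 :> R.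
Proof.
suff h k : \sum_(m < k.+1) m.+1%:R ^- 2 <= 2 - k.+1%:R^-1 :> R.
  case: n => [|n]; first by rewrite big_ord0.
  by apply: (le_trans (h n)); rewrite gerBl invr_ge0.
elim: k => [|k IH]; first by rewrite big_ord_recr big_ord0/= add0r expr1n invr1; lra.
rewrite big_ord_recr/=; apply: (le_trans (lerD IH (lexx _))).
rewrite -[k.+2%:R]natr1; have k0 : 0 < k.+1%:R :> R by rewrite ltr0n.
move: (k.+1%:R) k0 => x x0.
have x1 : 0 < x + 1 by lra.
rewrite -subr_ge0 [leRHS](_ : _ = (x * (x + 1) ^+ 2)^-1); last by field; rewrite !gt_eqF.
by rewrite invr_ge0 mulr_ge0 ?exprn_ge0// ltW.
Qed.

Definition column v s m z : E := (mult s m z : R[i]) *: \sum_(j < J) v s m j z.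

Definition tile v m z : E := column v false m z + column v true m z.

Definition total v z : E := xget 0 [set l : E | (fun n => \sum_(m < n) tile v m z) @ \oo --> l].

Lemma tile_BD n N : exists M (C : R), 0 < C /\ forall (S : set R[i]^o) (D : set E) v,
  open S -> S `<=` slab -> bdisk D ->
  (forall s m j, BD n S (fun=> expR (- w M `|xpos s m|)) D (v s m j)) ->
  forall m, BD n S (fun z => m.+1%:R ^- 2 * (C * decay w N z)) D (tile v m).
Proof.
have [M [C [C0 h]]] := mult_BD n N; exists M, (2 * J.+1%:R * C); split.
  by rewrite !mulr_gt0.
move=> S D v oS SS bD hv m; case: (bD) => Dc D0 _ _.
have hs s : BD n S (fun z => J.+1%:R * C * (m.+1%:R ^- 2 * decay w N z)) D (column v s m).
  have := BD_sum hE oS Dc D0 (K := J) (c := fun j z => expR (- w M `|xpos s m|)) (fun _ _ _ => ltW (expR_gt0 _)) (fun j _ => hv s m j).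
  rewrite (_ : (fun z => \sum_(k < J) _) = (fun=> expR (- w M `|xpos s m|) * J%:R)); last first.
    by apply/funext => z; rewrite big_const_ord iter_addr addr0 mulr_natr.
  move=> h1.
  have h2 : BD n S (fun=> expR (- w M `|xpos s m|)) (scaled D J.+1%:R) (fun z => \sum_(j < J) v s m j z).
    apply/BD_scaledD; apply: BD_le h1 => // z _.
    by rewrite ler_wpM2l ?(ltW (expR_gt0 _))// ler_nat.
  have bD' : bdisk (scaled D J.+1%:R) by exact: bdisk_scaled.
  have /BD_scaledD := h S _ s m _ oS SS bD' h2.
  by apply: BD_eqc => z _; ring.
have q0 z : S z -> 0 <= J.+1%:R * C * (m.+1%:R ^- 2 * decay w N z).
  by rewrite !mulr_ge0 ?(ltW C0) ?invr_ge0 ?exprn_ge0 ?(ltW (expR_gt0 _)).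
have := BD_add hE oS Dc D0 q0 q0 (hs false) (hs true).
by apply: BD_eqc => z _; ring.
Qed.

Let sq_ge0 m : 0 <= m.+1%:R ^- 2 :> R.
Proof. by rewrite invr_ge0 exprn_ge0. Qed.

Lemma decay_bounds N (C : R) z : 0 < C -> 0 <= C * decay w N z /\ C * decay w N z <= C.
Proof.
by move=> C0; rewrite mulr_ge0 ?(ltW C0) ?(ltW (expR_gt0 _))// ler_piMr ?(ltW C0)// decay_le1.
Qed.

(** M and C are found before the pieces v, because [small_solution] must know the weight before it
    splits the coefficients. *)
Lemma total_BD n N : exists M (C : R), 0 < C /\ forall (S : set R[i]^o) (D : set E) v,
  open S -> S `<=` slab -> bdisk D ->
  (forall s m j, BD n S (fun=> expR (- w M `|xpos s m|)) D (v s m j)) ->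
  BD n S (fun z => C * decay w N z) D (total v) /\
  forall z, S z -> (fun n => \sum_(m < n) tile v m z) @ \oo --> total v z.
Proof.
have [M [C [C0 h]]] := tile_BD n N; exists M, (2 * C); split; first by rewrite mulr_gt0.
move=> S D v oS SS bD hv; have ht := h S D v oS SS bD hv.
have db z := decay_bounds N z C0.
have cv z : S z -> (fun n => \sum_(m < n) tile v m z) @ \oo --> total v z.
  move=> Sz; have [d0 _] := db z.
  have e0 m : 0 <= m.+1%:R ^- 2 * (C * decay w N z) by rewrite mulr_ge0.
  have es k : \sum_(m < k) m.+1%:R ^- 2 * (C * decay w N z) <= 2 * (C * decay w N z).
    by rewrite -mulr_suml ler_wpM2r// inv_square_sum.
  have [l hl] := sc bD e0 es (fun m => BD_val (ht m) Sz).
  exact: (@xgetPex _ (0 : E) [set l : E | (fun n => \sum_(m < n) tile v m z) @ \oo --> l] (ex_intro _ l hl)).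
split=> //.
have := @BD_series _ _ hE S D (fun m => m.+1%:R ^- 2) 2 C (fun z => C * decay w N z) oS bD sq_ge0 inv_square_sum
  (fun z _ => (db z).1) (fun z _ => (db z).2) n (tile v) (total v) sc ht cv.
by apply: BD_eqc => z _; rewrite mulrA.
Qed.

Lemma total_dbar : exists M, forall (S : set R[i]^o) (D : set E) v z,
  open S -> S `<=` slab -> bdisk D ->
  (forall s m j, BD 1 S (fun=> expR (- w M `|xpos s m|)) D (v s m j)) -> S z ->
  has_pds (total v) z /\
  (fun n => \sum_(m < n) ((mult false m z : R[i]) *: \sum_(j < J) dbar (v false m j) z +
                          (mult true m z : R[i]) *: \sum_(j < J) dbar (v true m j) z)) @ \oo --> dbar (total v) z.
Proof.
have [M1 [C1 [C10 h1]]] := tile_BD 1 0; have [M2 [C2 [C20 h2]]] := total_BD 1 0.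
exists (maxn M1 M2) => S D v z oS SS bD hv Sz; case: (bD) => Dc D0 _ _.
have hvM M : (M <= maxn M1 M2)%N -> forall s m j, BD 1 S (fun=> expR (- w M `|xpos s m|)) D (v s m j).
  move=> hM s m j; apply: BD_le (hv s m j) => // y _.
  by rewrite ler_expR lerN2 weight_le.
have ht := h1 S D v oS SS bD (hvM _ (leq_maxl _ _)).
have [_ cv] := h2 S D v oS SS bD (hvM _ (leq_maxr _ _)).
have db y := decay_bounds 0 y C10.
have [hp hd] := dbar_series hE sc oS bD sq_ge0 inv_square_sum (fun y _ => (db y).1) (fun y _ => (db y).2) ht cv Sz.
split=> //; suff -> : (fun n => \sum_(m < n) ((mult false m z : R[i]) *: \sum_(j < J) dbar (v false m j) z +
   (mult true m z : R[i]) *: \sum_(j < J) dbar (v true m j) z)) = (fun n => \sum_(m < n) dbar (tile v m) z) by [].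
apply/funext => n; apply: eq_bigr => m _; symmetry.
have pv s j : (j < J)%N -> has_pds (v s m j) z by move=> _; exact: (BD_has_pds (hv s m j) Sz).
have ps s := has_pds_sum hE (pv s).
have pm s := @mult_pds s m z (SS _ Sz).
rewrite (dbarD hE (has_pdsM hE (pm false) (ps false)) (has_pdsM hE (pm true) (ps true))).
rewrite !(dbarM hE (pm _) (ps _)) !(dbar_sum hE (pv _)) !mult_dbar ?scale0r ?add0r//; exact: SS.
Qed.

End Assembly.

(** * Decomposition into cells *)

Section Cells.
Variables (R : realType) (E : tvsType R[i]) (hE : hausdorff_space E) (sc : series_complete E).
Variables (F G : R -> R) (pF : profile F) (pG : profile G).
Variables (w : nat -> R -> R) (hw : weight_system w) (hwalpha : weight_alpha w) (hwN : weight_N w).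
Variables (P : R[i]^o -> R[i]^o) (H : R).
Let slab : set R[i]^o := [set z | `|complex.Im z| < H].
Hypothesis P_BD : forall n N, exists2 C : R, 0 < C & BD n slab (fun z => C * decay w N z) (@unit_disk R) P.
Hypothesis P_dbar : forall z, slab z -> dbar P z = 0.
Hypothesis P_low : forall z, `|complex.Re z| < 3 -> slab z -> 1 / 2 <= normc (P z).
Hypothesis strip_slab : strip F G `<=` slab.
Variables (delta : R) (J0 : nat).
Hypotheses (delta_gt0 : 0 < delta) (delta_le1 : delta <= 1) (HJ : H <= J0%:R * delta).
Variables (g : R[i]^o -> E) (gK : KWB F G w g) (a2 a3 : R).
Hypotheses (a21 : a2 < 1) (a31 : a3 < 1).
Hypothesis hcell : forall z y, sub_strip F G a2 z -> (forall b, `|coord b (y - z)| < 3 * delta) -> sub_strip F G a3 y.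
Implicit Types (v : bool -> nat -> nat -> R[i]^o -> E) (z : R[i]) (S D : set E).
Let hC := @plane_hausdorff R.
Let U := @unit_disk R.
Let xp := xpos delta.
Let mul := mult P delta.
Let J := (J0.*2).+1.

(** A difference of two shifted steps, so that sums over integer translates telescope to 1. *)
Definition hat (x : R) : R := step (x + 1) - step x.

Lemma hat_supp x : hat x != 0 -> `|x| < 1.
Proof.
apply: contraNT; rewrite -leNgt ler_normr /hat => /orP[x1|x1].
  by rewrite !step_ge1 ?subrr//; lra.
by rewrite !step_le0 ?subrr//; lra.
Qed.

Lemma hat_sum n t : \sum_(m < n) hat (t - m%:R) = step (t + 1) - step (t - n%:R + 1).
Proof.
elim: n => [|n IH]; first by rewrite big_ord0 subr0 subrr.
rewrite big_ord_recr/= IH /hat -[n.+1%:R]natr1 (_ : t - (n%:R + 1) + 1 = t - n%:R); last ring.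
by rewrite addrA subrK.
Qed.

Lemma hat_sumV n t : \sum_(m < n) hat (t + m.+1%:R) = step (t + n%:R + 1) - step (t + 1).
Proof.
elim: n => [|n IH]; first by rewrite big_ord0 addr0 subrr.
rewrite big_ord_recr/= IH /hat -[n.+1%:R]natr1 (_ : t + (n%:R + 1) = t + n%:R + 1); last ring.
by rewrite addrC addrA subrK.
Qed.

Definition hat2 (z : R[i]^o) : R[i]^o := (hat (coord false z) * hat (coord true z))%:C%C.

Lemma SB_hat2 : SB setT hat2.
Proof.
have o := @openT R[i]^o.
have hb (b : bool) : SB setT (fun z : R[i]^o => (hat (coord b z))%:C%C : R[i]^o).
  have := SB_sub o (SB_aff 1 (dir b) o (SB_step R b)) (SB_step R b); apply: SB_ext => // z _.
  by rewrite coordD coordM coord_dir eqxx mul1r -rmorphB.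
have := SB_mul o (hb false) (hb true); apply: SB_ext => // z _; by rewrite -rmorphM.
Qed.

Definition ypos (j : nat) : R := (j%:R - J0%:R) * delta.

Definition center (s : bool) (m j : nat) : R[i] := (xp s m +i* ypos j)%C.

Definition eta s m j (z : R[i]^o) : R[i]^o := hat2 ((delta^-1)%:C%C * z + - ((delta^-1)%:C%C * center s m j)).

Lemma eta_coord s m j z b : coord b ((delta^-1)%:C%C * z + - ((delta^-1)%:C%C * center s m j)) =
  delta^-1 * coord b (z - center s m j).
Proof. by rewrite -mulrBr coordM. Qed.

Lemma etaE s m j z : eta s m j z =
  (hat (delta^-1 * (complex.Re z - xp s m)) * hat (delta^-1 * (complex.Im z - ypos j)))%:C%C.
Proof. by rewrite /eta /hat2 !eta_coord !coordB. Qed.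

Lemma eta_supp s m j z : eta s m j z != 0 -> forall b, `|coord b (z - center s m j)| < delta.
Proof.
move=> e0 b; have : hat (delta^-1 * coord b (z - center s m j)) != 0.
  apply: contraNneq e0 => e0; rewrite /eta /hat2 !eta_coord.
  by case: b e0 => ->; rewrite ?mulr0 ?mul0r.
by move=> /hat_supp; rewrite normrM gtr0_norm ?invr_gt0// mulrC ltr_pdivrMr// mul1r.
Qed.

Lemma eta_BD n : exists2 C : R, 0 <= C & forall s m j, BD n setT (fun=> C) U (eta s m j).
Proof.
have [C C0 h] := SB_hat2 n; have [Uc U0 _ _] := unit_disk_bdisk R.
exists (Num.max 1 `|delta^-1| ^+ n * C); first by rewrite mulr_ge0 ?exprn_ge0 ?le_max ?ler01.
by move=> s m j; exact: (BD_aff hC delta^-1 (- ((delta^-1)%:C%C * center s m j)) (@openT _) Uc U0 (fun _ _ => C0) h).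
Qed.

(** The 2 J0 + 1 rows cover the height of the slab, and the columns beyond |Re z| / delta + 1
    contribute 0, so the sum is eventually constant in n. *)
Lemma eta_sum z : slab z -> exists n0, forall n, (n0 <= n)%N ->
  \sum_(m < n) (\sum_(j < J) eta false m j z + \sum_(j < J) eta true m j z : R[i]) = 1.
Proof.
move=> Sz; set x := delta^-1 * complex.Re z; set y := delta^-1 * complex.Im z.
have di0 : 0 < delta^-1 by rewrite invr_gt0.
have ysum : \sum_(j < J) hat (delta^-1 * (complex.Im z - ypos j)) = 1.
  have ey j : delta^-1 * (complex.Im z - ypos j) = (y + J0%:R) - j%:R.
    by rewrite /ypos /y; field; rewrite gt_eqF.
  under eq_bigr => j _ do rewrite ey.
  have : `|y| <= J0%:R.
    rewrite normrM gtr0_norm// mulrC ler_pdivrMr//; apply: le_trans HJ; exact: ltW.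
  rewrite hat_sum ler_norml /J -[_.+1%:R]natr1 -muln2 natrM => /andP[y1 y2].
  by rewrite step_ge1; [rewrite step_le0 ?subr0//|]; lra.
have [n0 hn0] : exists n0 : nat, `|x| + 1 <= n0%:R.
  by exists (Num.truncn (`|x| + 1)).+1; exact: ltW (truncnS_gt _).
exists n0 => n nn; have xn : `|x| + 1 <= n%:R by apply: (le_trans hn0); rewrite ler_nat.
have row s m : \sum_(j < J) eta s m j z = ((hat (delta^-1 * (complex.Re z - xp s m)))%:C%C : R[i]).
  under eq_bigr => j _ do rewrite etaE; rewrite -rmorph_sum -mulr_sumr ysum mulr1//.
under eq_bigr => m _ do rewrite !row -rmorphD.
rewrite -rmorph_sum big_split/=.
have ex1 m : delta^-1 * (complex.Re z - xp false m) = x - m%:R.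
  by rewrite /xp /xpos /x; field; rewrite gt_eqF.
have ex2 m : delta^-1 * (complex.Re z - xp true m) = x + m.+1%:R.
  by rewrite /xp /xpos /x; move: (m.+1%:R : R) => k; field; rewrite gt_eqF.
under eq_bigr => m _ do rewrite ex1.
under [X in _ + X]eq_bigr => m _ do rewrite ex2.
rewrite hat_sum hat_sumV; have : `|x| <= n%:R - 1 by lra.
rewrite ler_norml => /andP[x1 x2].
have -> : step (x - n%:R + 1) = 0 by apply: step_le0; lra.
have -> : step (x + n%:R + 1) = 1 by apply: step_ge1; lra.
by rewrite subr0 addrC subrK.
Qed.

Definition included s m j := exists z, sub_strip F G a2 z /\ forall b, `|coord b (z - center s m j)| < delta.

(* Cells meeting the smaller strip only, so that [g] is bounded there; the division
   by [mul] anticipates the factor in [column]. *)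
Definition cell s m j (z : R[i]^o) : E :=
  if `[< included s m j >] then ((eta s m j z : R[i]) * (mul s m z : R[i])^-1) *: g z else 0.

Lemma included_box s m j z : included s m j -> (forall b, `|coord b (z - center s m j)| < 2 * delta) ->
  sub_strip F G a3 z.
Proof.
move=> [y [Ty hy]] hz; apply: (hcell Ty) => b; have := hy b; have := hz b; rewrite !coordB => h1 h2.
have := ler_normD (coord b z - coord b (center s m j)) (coord b (center s m j) - coord b y).
rewrite addrA subrK [`|coord b (center s m j) - _|]distrC; lra.
Qed.

Lemma cell_supp s m j z : cell s m j z != 0 ->
  [/\ included s m j, forall b, `|coord b (z - center s m j)| < delta & g z != 0].
Proof.
rewrite /cell; case: asboolP => [inc|_]; last by rewrite eqxx.
move=> h; split=> //; last by apply: contraNneq h => ->; rewrite scaler0.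
by apply: eta_supp; apply: contraNneq h => ->; rewrite mul0r scale0r.
Qed.

Lemma sub_strip_slab a z : a < 1 -> sub_strip F G a z -> slab z.
Proof. by move=> a1 Sz; apply: strip_slab; rewrite -sub_strip1; apply: (sub_strip_mono pF pG (ltW a1)). Qed.

Lemma mul_low s m j z : included s m j -> (forall b, `|coord b (z - center s m j)| < 2 * delta) ->
  1 / 2 <= normc (mul s m z).
Proof.
move=> inc hz; rewrite /mul /mult mult_arg; apply: P_low.
  have := hz false; rewrite coordB /coord /center /= => h.
  by case: z h {hz} => p q /= h; rewrite /xp in h *; apply: lt_le_trans h _; have := delta_le1; lra.
by have := sub_strip_slab a31 (included_box inc hz); rewrite /slab /=; case: z {hz} => p q /=; rewrite subr0.
Qed.

(** All [mul s m] are translates of P, and translation carries the boxes of included cells into the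
    fixed set Q, where |P| >= 1 / 2; hence C is uniform in the cell. *)
Lemma inv_mul_BD n : exists2 C : R, 0 <= C & forall s m j, included s m j ->
  BD n [set z : R[i]^o | forall b, `|coord b (z - center s m j)| < 2 * delta] (fun=> C) U (fun z => (mul s m z : R[i])^-1 : R[i]^o).
Proof.
pose Q : set R[i]^o := [set z | `|complex.Re z| < 3] `&` slab.
have [Uc U0 _ _] := unit_disk_bdisk R.
have oQ : open Q.
  apply: openI; last exact: open_slab.
  have -> : [set z : R[i]^o | `|complex.Re z| < 3] = (fun z : R[i]^o => complex.Re z) @^-1` [set x : R | `|x| < 3] by [].
  apply: open_comp; first by move=> x _; exact: Re_continuous.
  have -> : [set x : R | `|x| < 3] = (fun x : R => `|x|) @^-1` [set x | x < 3] by [].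
  by apply: open_comp; [move=> x _; exact: norm_continuous|exact: open_lt].
have sP : SB Q P.
  move=> k; have [C C0 h] := P_BD k 0; exists C; first exact: ltW.
  apply: BD_le h => // [z [] //|z _|z _].
    exact: (decay_bounds hw 0 z C0).2.
  exact: (decay_bounds hw 0 z C0).1.
have [C C0 h] := SB_inv (m := 1 / 2) oQ ltac:(lra) (fun z (Qz : Q z) => P_low Qz.1 Qz.2) sP n.
exists C => // s m j inc.
have := BD_aff hC 1 (- xp s m)%:C%C oQ Uc U0 (fun _ _ => C0) h.
apply: BD_le => // [z hz|z _|z _]; last by rewrite mulr_ge0// exprn_ge0// le_max ler01.
  rewrite /= mult_arg; split.
    have := hz false; rewrite coordB /coord /center /= => h1.
    by case: z h1 {hz} => p q /= h1; rewrite /xp in h1 *; apply: lt_le_trans h1 _; have := delta_le1; lra.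
  by have := sub_strip_slab a31 (included_box inc hz); rewrite /slab /=; case: z {hz} => p q /=; rewrite subr0.
by rewrite normr1; have -> : Num.max 1 1 = 1 :> R by [apply/max_idPl]; rewrite expr1n mul1r.
Qed.

Lemma open_box c (r : R) : open [set z : R[i]^o | forall b, `|coord b (z - c)| < r].
Proof.
have h b : open [set z : R[i]^o | `|coord b (z - c)| < r].
  have -> : [set z : R[i]^o | `|coord b (z - c)| < r] =
    (fun z : R[i]^o => coord b z) @^-1` [set x : R | `|x - coord b c| < r].
    by apply/seteqP; split=> z /=; rewrite coordB.
  apply: open_comp; first by move=> x _; exact: coord_continuous.
  have -> : [set x : R | `|x - coord b c| < r] = ball (coord b c) r.
    by apply/seteqP; split=> x /=; rewrite /ball /= distrC.
  exact: ball_open.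
have -> : [set z : R[i]^o | forall b, `|coord b (z - c)| < r] =
  [set z : R[i]^o | `|coord false (z - c)| < r] `&` [set z : R[i]^o | `|coord true (z - c)| < r].
  by apply/seteqP; split=> [z hz|z [h1 h2] []//]; split; exact: hz.
by apply: openI.
Qed.

Lemma open_far b c (r : R) : open [set z : R[i]^o | r < `|coord b (z - c)|].
Proof.
have -> : [set z : R[i]^o | r < `|coord b (z - c)|] =
  (fun z : R[i]^o => coord b z) @^-1` [set x : R | r < `|x - coord b c|].
  by apply/seteqP; split=> z /=; rewrite coordB.
apply: open_comp; first by move=> x _; exact: coord_continuous.
have -> : [set x : R | r < `|x - coord b c|] = (fun x : R => `|x - coord b c|) @^-1` [set x | r < x] by [].
apply: open_comp; last exact: open_gt.
move=> x _; apply: (@continuous_comp _ _ _ (fun x : R => x - coord b c) (fun x : R => `|x|)); last exact: norm_continuous.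
by apply: cvgB; [exact: cvg_id|exact: cvg_cst].
Qed.

(** On a box of half-side 2 delta all three factors are controlled, and off the box of half-side
    delta the piece is 0. As z stays within 2 of the column, [weight_shift] trades the decay of g in
    z for decay in the column position. *)
Lemma cell_BD n N0 : exists2 D : set E, bdisk D &
  forall s m j, BD n setT (fun=> expR (- w N0 `|xp s m|)) D (cell s m j).
Proof.
have [N [C1 [_ h1]]] := weight_shift hw hwalpha N0.
have [D bD hg] := gK n N a31; case: (bD) => Dc D0 _ _.
have [Ce Ce0 he] := eta_BD n; have [Ci Ci0 hi] := inv_mul_BD n.
have [Uc U0 _ _] := unit_disk_bdisk R.
pose A := 2 ^+ n * (2 ^+ n * (Ce * Ci)) * expR (C1 + w N 2) + 1.
have A0 : 0 < A by rewrite ltr_wpDl// !mulr_ge0 ?exprn_ge0 ?expR_ge0.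
exists (scaled D A); first exact: bdisk_scaled.
move=> s m j; apply/BD_scaledD.
have [inc|ninc] := pselect (included s m j); last first.
  have -> : cell s m j = fun=> 0 by apply/funext => z; rewrite /cell asboolF.
  exact: (BD_cst0 hE n _ (@openT _) D0).
have cE z : cell s m j z = ((eta s m j z : R[i]) * (mul s m z : R[i])^-1) *: g z by rewrite /cell asboolT.
have o := @open_box (center s m j) (2 * delta).
set Bx := [set z : R[i]^o | forall b, _] in o.
have sg : Bx `<=` sub_strip F G a3 by move=> z; exact: included_box.
have B1 : BD n Bx (fun=> expR (- w N0 `|xp s m|) * A) D (cell s m j).
  have e1 : BD n Bx (fun=> Ce) U (eta s m j) by apply: BD_le (he s m j).
  have g1 : BD n Bx (decay w N) D g by apply: BD_le hg => // z _; exact: ltW (expR_gt0 _).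
  have q0 : 0 <= 2 ^+ n * (Ce * Ci) by rewrite !mulr_ge0 ?exprn_ge0.
  have p1 := BD_mul hC o Uc U0 (fun _ _ => Ce0) (fun _ _ => Ci0) e1 (hi s m j inc).
  have p2 := BD_mul hE o Dc D0 (fun _ _ => q0) (fun z _ => ltW (expR_gt0 _)) p1 g1.
  apply: (BD_ext o (fun z _ => esym (cE z))).
  apply: BD_le p2 => // z Bz; last by rewrite !mulr_ge0 ?exprn_ge0 ?expR_ge0.
  have : decay w N z <= expR (C1 + w N 2) * expR (- w N0 `|xp s m|).
    rewrite -expRD ler_expR; have := h1 (complex.Re z) (xp s m - complex.Re z).
    rewrite addrC subrK; have : w N `|xp s m - complex.Re z| <= w N 2.
      apply: weight_mono => //; have := Bz false; rewrite distrC coordB /coord /center /= => h.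
      by apply/ltW/(lt_le_trans h); have := delta_le1; lra.
    lra.
  have k0 : 0 <= 2 ^+ n * (2 ^+ n * (Ce * Ci)) by rewrite mulr_ge0 ?exprn_ge0.
  move=> hd; rewrite mulrA; apply: (le_trans (ler_wpM2l k0 hd)).
  by rewrite [leRHS]mulrC /A mulrDl mul1r -[X in _ <= X + _]mulrA lerDl expR_ge0.
have B2 b : BD n [set z : R[i]^o | delta < `|coord b (z - center s m j)|] (fun=> expR (- w N0 `|xp s m|) * A) D (cell s m j).
  have ob := @open_far b (center s m j) delta.
  apply: (BD_ext ob _ (BD_cst0 hE n _ ob D0)) => z /= zb; apply/esym/eqP; apply: contraTT zb => /cell_supp[_ h _].
  by rewrite -leNgt ltW.
have := BD_union B1 (BD_union (B2 false) (B2 true)).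
suff -> : Bx `|` ([set z : R[i]^o | delta < `|coord false (z - center s m j)|] `|`
   [set z : R[i]^o | delta < `|coord true (z - center s m j)|]) = setT by [].
apply/seteqP; split=> // z _.
have [h|h] := ltP delta `|coord false (z - center s m j)|; first by right; left.
have [h'|h'] := ltP delta `|coord true (z - center s m j)|; first by right; right.
left=> b; have := delta_gt0; case: b; lra.
Qed.

Lemma cells_sum z : sub_strip F G a2 z -> exists n0, forall n, (n0 <= n)%N ->
  \sum_(m < n) ((mul false m z : R[i]) *: \sum_(j < J) cell false m j z +
                (mul true m z : R[i]) *: \sum_(j < J) cell true m j z) = g z.
Proof.
move=> Tz; have [n0 h] := eta_sum (sub_strip_slab a21 Tz); exists n0 => n /h e1.
have term s m j : (mul s m z : R[i]) *: cell s m j z = (eta s m j z : R[i]) *: g z.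
  have [e0|e0] := eqVneq (eta s m j z : R[i]) 0.
    by rewrite /cell e0; case: asboolP => _; rewrite ?mul0r ?scale0r scaler0.
  have hz := eta_supp e0; have inc : included s m j by exists z.
  rewrite /cell asboolT// scalerA; congr (_ *: _).
  have : 1 / 2 <= normc (mul s m z).
    by apply: (@mul_low s m j) => // b; have := hz b; have := delta_gt0; lra.
  move=> hn; have n0' : (mul s m z : R[i]) != 0 by rewrite -normc_gt0; lra.
  by rewrite mulrC -mulrA mulVf// mulr1.
have row s m : (mul s m z : R[i]) *: \sum_(j < J) cell s m j z = (\sum_(j < J) (eta s m j z : R[i])) *: g z.
  by rewrite scaler_sumr scaler_suml; apply: eq_bigr => j _; exact: term.
under eq_bigr => m _ do rewrite !row -scalerDl.
by rewrite -scaler_suml e1 scale1r.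
Qed.

Lemma cells_solution v : (forall n N, exists2 D : set E, bdisk D &
    forall s m j, BD n (strip F G) (fun=> expR (- w N `|xp s m|)) D (v s m j)) ->
  (forall s m j z, strip F G z -> dbar (v s m j) z = cell s m j z) ->
  KWB F G w (total P delta J v) /\ forall z, sub_strip F G a2 z -> dbar (total P delta J v) z = g z.
Proof.
move=> hv dv; have oT : open (strip F G) by rewrite -sub_strip1; exact: open_sub_strip.
split=> [n N a a1|z Tz].
  have [M [C [C0 h]]] := total_BD hE sc hw hwalpha hwN P_BD J delta_gt0 delta_le1 n N.
  have [D bD hD] := hv n M; have [h1 _] := h _ D v oT strip_slab bD hD.
  exists (scaled D C); first exact: bdisk_scaled.
  apply/BD_scaledD; case: (bD) => Dc D0 _ _.
  apply: BD_le h1 => // [y|y _|y _]; last by rewrite mulr_ge0 ?(ltW C0) ?expR_ge0.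
    by rewrite -[strip F G]sub_strip1; apply: (sub_strip_mono pF pG (ltW a1)).
  by rewrite mulrC.
have Sz : strip F G z by rewrite -sub_strip1; apply: (sub_strip_mono pF pG (ltW a21)).
have [M h] := total_dbar hE sc hw hwalpha hwN P_BD P_dbar J delta_gt0 delta_le1.
have [D bD hD] := hv 1%N M; have [_ h1] := h _ D v z oT strip_slab bD hD Sz.
apply: (cvg_unique hE h1); have [n0 hn0] := cells_sum Tz.
apply/cvg_csn => p cp r r0; exists n0 => // n /= nn.
rewrite (_ : \sum_(m < n) _ = g z); first by rewrite subrr (seminorm0 cp.1).
rewrite -(hn0 n nn); apply: eq_bigr => m _.
by congr (_ *: _ + _ *: _); apply: eq_bigr => j _; exact: dv.
Qed.

End Cells.

(** * Small solutions and gluing *)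

Section SmallSolution.
Variables (R : realType) (F G : R -> R) (w : nat -> R -> R).
Hypotheses (pF : profile F) (pG : profile G) (hw : weight_system w).
Hypotheses (hwalpha : weight_alpha w) (hwN : weight_N w) (hwomega : weight_omega w).
Hypothesis hscalar : dbar_surjective (R[i])^o F G w.
Variables (E : tvsType R[i]) (hE : hausdorff_space E) (sc : series_complete E).
Implicit Types (g f : R[i]^o -> E) (z : R[i]) (D : set E).
Let I := (bool * nat * nat)%type.

Lemma open_stripT : open (strip F G).
Proof. by rewrite -sub_strip1; exact: open_sub_strip. Qed.

(** An interface that hides multipliers and partition: X k is the column position, c k the centre
    and h k the piece, and [tot] reassembles any solutions of the local equations. The last clause
    again fixes M and C before v. *)
Lemma cell_problem g (a2 rho : R) : KWB F G w g -> a2 < 1 -> 0 < rho ->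
  exists (X : I -> R) (c : I -> R[i]) (h : I -> R[i]^o -> E) (tot : (I -> R[i]^o -> E) -> R[i]^o -> E),
  [/\ forall n N, exists2 D : set E, bdisk D & forall k, BD n setT (fun=> expR (- w N `|X k|)) D (h k),
      forall k z, h k z != 0 -> [/\ forall b, `|coord b (z - c k)| < rho, strip F G z & g z != 0],
      forall v, (forall n N, exists2 D : set E, bdisk D &
          forall k, BD n (strip F G) (fun=> expR (- w N `|X k|)) D (v k)) ->
        (forall k z, strip F G z -> dbar (v k) z = h k z) ->
        KWB F G w (tot v) /\ forall z, sub_strip F G a2 z -> dbar (tot v) z = g z &
      forall n N, exists M (C : R), 0 < C /\ forall a D v, a < 1 -> bdisk D ->
        (forall k, BD n (sub_strip F G a) (fun=> expR (- w M `|X k|)) D (v k)) ->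
        BD n (sub_strip F G a) (fun z => C * decay w N z) D (tot v)].
Proof.
move=> gK a21 rho0.
have [H H1 hH] := strip_height pF pG; have H0 : 0 < H by lra.
have [P [P_BD P_dbar P_low]] := holomorphic_multiplier pF pG hw hwalpha hwN hscalar H0.
pose a2' := Num.max 0 a2.
have a2'0 : 0 <= a2' by rewrite le_max lexx.
have a2'1 : a2' < 1 by rewrite gt_max ltr01.
have [r [a3 [r0 a31 hr]]] := cell_geometry pF pG a2'0 a2'1.
(* Besides the prescribed size rho, three cell sizes must fit into the margin r between the strips
   for a2' and a3. *)
pose delta := Num.min 1 (Num.min rho (r / 3)).
have d0 : 0 < delta by rewrite !lt_min ltr01 rho0 divr_gt0.
have d1 : delta <= 1 by rewrite ge_min lexx.
have drho : delta <= rho by rewrite !ge_min lexx orbT.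
have dr : 3 * delta <= r.
  have : delta <= r / 3 by rewrite !ge_min lexx !orbT.
  by rewrite ler_pdivlMr// mulrC.
have hcell (z y : R[i]) : sub_strip F G a2' z -> (forall b, `|coord b (y - z)| < 3 * delta) -> sub_strip F G a3 y.
  by move=> Tz hy; apply: (hr z) => // b; apply: lt_le_trans (hy b) dr.
pose J0 := (Num.truncn (H / delta)).+1.
have HJ : H <= J0%:R * delta by rewrite -ler_pdivrMr//; exact: ltW (truncnS_gt _).
pose cf (k : I) := cell F G P delta J0 g a2' k.1.1 k.1.2 k.2.
exists (fun k => xpos delta k.1.1 k.1.2), (fun k => center delta J0 k.1.1 k.1.2 k.2), cf,
  (fun v => total P delta J0.*2.+1 (fun s m j => v (s, m, j))); split.
- move=> n N; have [D bD hD] := cell_BD hE pF pG hw hwalpha P_BD P_low hH J0 d0 d1 gK a31 hcell n N.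
  by exists D => // -[[s m] j]; exact: hD.
- move=> [[s m] j] z /(cell_supp d0)[inc hz gz]; split=> //.
    by move=> b; exact: lt_le_trans (hz b) drho.
  rewrite -sub_strip1; apply: (sub_strip_mono pF pG (ltW a31)).
  by apply: (included_box hcell inc) => b; have := hz b; lra.
- move=> v hv dv.
  have hv' n N : exists2 D : set E, bdisk D &
      forall s m j, BD n (strip F G) (fun=> expR (- w N `|xpos delta s m|)) D (v (s, m, j)).
    by have [D bD hD] := hv n N; exists D => // s m j; exact: (hD (s, m, j)).
  have [KT dT] := @cells_solution _ _ hE sc _ _ pF pG _ hw hwalpha hwN _ _ P_BD P_dbar P_low hH _ _ d0 d1 HJ g a2' a3 a2'1 a31 hcell
     (fun s m j => v (s, m, j)) hv' (fun s m j => dv (s, m, j)).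
  split=> // z Tz; apply: dT; apply: (sub_strip_mono pF pG _ Tz).
  by rewrite le_max lexx orbT.
- move=> n N; have [M [C [C0 h]]] := total_BD hE sc hw hwalpha hwN P_BD J0.*2.+1 d0 d1 n N.
  exists M, C; split=> // a D v a1 bD hv.
  have sl : sub_strip F G a `<=` [set z | `|complex.Im z| < H].
    by move=> z Sz; apply: hH; rewrite -sub_strip1; apply: (sub_strip_mono pF pG (ltW a1)).
  exact: (h (sub_strip F G a) D (fun s m j => v (s, m, j)) (open_sub_strip pF pG) sl bD (fun s m j => hv (s, m, j))).1.
Qed.

Lemma coord_diff_le z y c (r : R) : (forall b, `|coord b (z - c)| < r) -> (forall b, `|coord b (y - c)| < r) ->
  normc (z - y) <= 4 * r.
Proof.
move=> hz hy; rewrite (_ : 4 * r = 2 * (2 * r)); last by ring.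
apply: normc_le_coord => b; have := hz b; have := hy b; rewrite !coordB => h1 h2.
have := ler_normD (coord b z - coord b c) (coord b c - coord b y).
rewrite addrA subrK [`|coord b c - _|]distrC; lra.
Qed.

(** Without smallness the uncorrected Cauchy transforms suffice, since the multipliers provide the
    decay. This leaves a right-hand side vanishing on a smaller strip. *)
Lemma approximate_solution g (a2 : R) : KWB F G w g -> a2 < 1 ->
  exists2 f, KWB F G w f & forall z, sub_strip F G a2 z -> dbar f z = g z.
Proof.
move=> gK a21; have [K K0 hK] := cauchy_cell R.
have [X [c [h [tot [hBD hsupp hsol _]]]]] := cell_problem gK a21 ltr01.
have /choice[u hu] : forall k, exists u : R[i]^o -> E,
   (forall n D (r : R), bdisk D -> 0 < r -> BD n.+1 setT (fun=> r) D (h k) -> BD n setT (fun=> K * r) D u) /\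
   (forall z, dbar u z = h k z).
  move=> k; have [||u [u1 u2 _]] := hK E hE sc (h k) (c k).
  - move=> z b; apply: contraTeq => /hsupp[hz _ _]; by rewrite -leNgt ltW.
  - by move=> n; have [D bD hD] := hBD n 0%N; exists D, (expR (- w 0 `|X k|)); split=> //; exact: expR_gt0.
  by exists u.
have [||KT dT] := hsol u; last by exists (tot u).
- move=> n N; have [D bD hD] := hBD n.+1 N; exists (scaled D K); first exact: bdisk_scaled.
  move=> k; apply/BD_scaledD; have [u1 _] := hu k; case: (bD) => Dc D0 _ _.
  apply: BD_le (u1 n D _ bD (expR_gt0 _) (hD k)) => // z _; first by rewrite mulrC.
  by rewrite mulr_ge0 ?expR_ge0 ?(ltW K0).
- by move=> k z _; exact: (hu k).2.
Qed.

Variables (hB : bounded_in_disks E) (D0 : set E) (bD0 : bdisk D0) (hD0 : disk_splitting D0).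

(** The pieces of g lie close to the edge, so each has a pole just outside the strip. Subtracting
    the y-part of its Laurent expansion leaves on the inner strip the x-part, small in [D0]; a'
    depends only on the geometry, not on g or a2. *)
Lemma small_solution (a : R) N (e : R) : a < 1 -> 0 < e -> exists2 a' : R, a' < 1 &
  forall g, KWB F G w g -> (forall z, sub_strip F G a' z -> g z = 0) ->
  forall a2 : R, a2 < 1 -> exists f, [/\ KWB F G w f, forall z, sub_strip F G a2 z -> dbar f z = g z &
    BD N (sub_strip F G a) (fun z => e * decay w N z) D0 f].
Proof.
move=> a1 e0; have [d [tau [a' [/andP[d0 d1] tau0 a'1 hgeo]]]] := pole_geometry pF pG a1.
exists a' => // g gK gv a2 a21; have [K K0 hK] := cauchy_cell R.
(* Two points of such a cell differ by at most d / 2, so with a pole within d / 2 of one of them the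
   whole support is within d of the pole. *)
have rho0 : 0 < d / 8 by rewrite divr_gt0.
have [X [c [h [tot [hBD hsupp hsol hbound]]]]] := cell_problem gK a21 rho0.
have [M [C [C0 hC]]] := hbound N N.
have [Ns [s [C' [Ns0 Nsm Nsp hconv]]]] := weight_chain hw hwomega M.
have r8 : 0 < 8 * d by rewrite mulr_gt0.
(* [L1] is for the inner strip, at distance 8 d from the poles, and [L2] for the full strip, at
   distance tau. *)
have [L1 hL1] := laurent_constants r8; have [L2 hL2] := laurent_constants tau0.
have [D1 bD1 hD1] := hBD 1%N (Ns 1%N).
have [H H1 hH] := strip_height pF pG.
have pole k : exists z' : R[i], [/\ forall z, h k z != 0 -> normc (z - z') <= d,
    forall z, sub_strip F G a z -> 8 * d < normc (z - z') & forall z, strip F G z -> tau < normc (z - z')].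
  have [[z0 hz0]|nz] := pselect (exists z0, h k z0 != 0).
    have [b0 T0 g0] := hsupp k z0 hz0.
    have [|z' [z1 z2 z3]] := hgeo z0 T0; first by move=> Sz0; move: g0; rewrite gv ?eqxx.
    exists z'; split=> // z /hsupp[b1 _ _].
    have := normc_triangle (z - z0) (z0 - z'); rewrite addrA subrK.
    have := coord_diff_le b1 b0; move: z1; move: (normc _) (normc _) (normc _) => *; lra.
  (* A piece that is identically 0 also needs a pole; a point far above the strip will do. *)
  have im z : strip F G z -> 8 * d + tau < normc (z - (0 +i* (H + 8 * d + tau))%C).
    move=> /hH; rewrite ltr_norml => /andP[_ h2]; apply: lt_le_trans (normc_Im _).
    by case: z h2 => p q /= h2; rewrite ltr_normr; apply/orP; right; lra.
  exists (0 +i* (H + 8 * d + tau))%C; split=> [z hz|z Sz|z Tz]; first by exfalso; apply: nz; exists z.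
    have Tz : strip F G z by rewrite -sub_strip1; apply: (sub_strip_mono pF pG (ltW a1)).
    by have := im z Tz; move: (normc _) => *; lra.
  by have := im z Tz; move: (normc _) => *; lra.
pose Q k (t : (R[i]^o -> E) * R[i] * (nat -> E)) := let u := t.1.1 in let z' := t.1.2 in let b := t.2 in
  [/\ forall n D (r : R), bdisk D -> 0 < r -> BD n.+1 setT (fun=> r) D (h k) -> BD n setT (fun=> K * r) D u,
      forall z, dbar u z = h k z,
      forall i, scaled D1 (K * expR (- w (Ns 1%N) `|X k|) * d ^+ i) (b i),
      forall z, 2 * d <= normc (z - z') ->
          (fun m => \sum_(i < m) ((z - z')^-1 ^+ i.+1 : R[i]) *: b i) @ \oo --> u z &
      (forall z, sub_strip F G a z -> 8 * d < normc (z - z')) /\ forall z, strip F G z -> tau < normc (z - z')].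
have /choice[t ht] : forall k, exists t, Q k t.
  move=> k; have [z' [z1 z2 z3]] := pole k.
  have [||u [u1 u2 u3]] := hK E hE sc (h k) (c k).
  - move=> z b; apply: contraTeq => /hsupp[hz _ _]; rewrite -leNgt ltW//; apply: lt_le_trans (hz b) _; lra.
  - by move=> n; have [D bD hD] := hBD n 0%N; exists D, (expR (- w 0 `|X k|)); split=> //; exact: expR_gt0.
  have [b b1 b2] := u3 D1 _ z' d bD1 (expR_gt0 _) (hD1 k) d0 z1.
  by exists (u, z', b).
(* At p = 1 the bound 1 / V is exp (- w) d ^ i, the size of the given coefficients. At p = 0 it is
   exp (- w) (4 d) ^ i, which suffices at distance 8 d, half of that being 4 d. For large p the
   radius 4 d / 4 ^ p is below tau / 2, so the y-part converges on the whole strip. *)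
pose V p (ki : I * nat) : R := (4 ^+ p / (4 * d)) ^+ ki.2 * expR (w (Ns p) `|X ki.1|).
have q0 p : 0 < 4 ^+ p / (4 * d) by rewrite divr_gt0 ?exprn_gt0// mulr_gt0.
have V_gt0 p ki : 0 < V p ki by rewrite mulr_gt0 ?expR_gt0 ?exprn_gt0.
have V_mono p ki : V p ki <= V p.+1 ki.
  apply: ler_pM; rewrite ?exprn_ge0 ?expR_ge0 ?(ltW (q0 _))//; last first.
    by rewrite ler_expR; apply: (weight_le hw).
  apply: lerXn2r; rewrite ?nnegrE ?(ltW (q0 _))//.
  rewrite ler_wpM2r ?invr_ge0 ?mulr_ge0 ?(ltW d0)// exprS ler_peMl ?exprn_ge0//; lra.
(* The weights contribute [weight_chain]; the radii 1, 4, 16 times q contribute 16 <= 4 ^ (s + 1),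
   which holds because s >= 1. *)
have V_conv p ki : V p.+2 ki * V p ki ^+ s p <= expR (C' p) * V p.+1 ki ^+ (s p).+1.
  have [sp hsp] := hconv p; rewrite /V; set x := `|X ki.1|; set i := ki.2.
  set q := 4 ^+ p / (4 * d).
  have e2 : 4 ^+ p.+2 / (4 * d) = 16 * q by rewrite /q !exprS !mulrA; congr (_ * _ / _); ring.
  have e1 : 4 ^+ p.+1 / (4 * d) = 4 * q by rewrite /q exprS mulrA.
  have qp : 0 < q := q0 p.
  have k1 : 16 * q * q ^+ s p <= (4 * q) ^+ (s p).+1.
    rewrite [leRHS](_ : _ = 4 * 4 ^+ s p * (q * q ^+ s p)); last by rewrite exprS exprMn; ring.
    rewrite -mulrA.
    have h4 : 4 <= 4 ^+ s p :> R by rewrite -[X in X <= _]expr1 ler_weXn2l//; lra.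
    have : 0 <= q * q ^+ s p by rewrite mulr_ge0 ?exprn_ge0// ltW.
    move: (q * q ^+ s p) => y y0; have := ler_wpM2r y0 h4; lra.
  have k2 : expR (w (Ns p.+2) x) * expR (w (Ns p) x) ^+ s p <= expR (C' p) * expR (w (Ns p.+1) x) ^+ (s p).+1.
    rewrite -!expRM_natr -!expRD ler_expR.
    have := hsp x (normr_ge0 _); rewrite -[(s p).+1%:R]natr1; move: ((s p)%:R : R) => y; lra.
  rewrite e1 e2.
  have i0 : 0 <= 16 * q * q ^+ s p := mulr_ge0 (mulr_ge0 (ler0n _ 16) (ltW qp)) (exprn_ge0 _ (ltW qp)).
  have k1' : (16 * q * q ^+ s p) ^+ i <= ((4 * q) ^+ (s p).+1) ^+ i.
    have j0 : 0 <= (4 * q) ^+ (s p).+1 := exprn_ge0 _ (mulr_ge0 (ler0n _ 4) (ltW qp)).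
    by apply: lerXn2r k1; rewrite nnegrE.
  have p1 : 0 <= (16 * q * q ^+ s p) ^+ i by rewrite exprn_ge0.
  have p2 : 0 <= expR (w (Ns p.+2) x) * expR (w (Ns p) x) ^+ s p by rewrite mulr_ge0 ?exprn_ge0 ?expR_ge0.
  have := ler_pM p1 p2 k1' k2; congr (_ <= _).
    rewrite [(16 * q * q ^+ s p) ^+ i]exprMn -[(q ^+ s p) ^+ i]exprM [(s p * i)%N]mulnC [q ^+ (i * s p)]exprM.
    by rewrite [(q ^+ i * _) ^+ s p]exprMn [RHS]mulrACA.
  rewrite -[((4 * q) ^+ _) ^+ i]exprM mulnC exprM mulrCA; congr (_ * _).
  by rewrite [RHS]exprMn.
(* Compensates the constant of the Laurent series on the inner strip and that of the reassembly. *)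
pose e1 := e / (C * (L1 N + 1)).
have L10 : 0 <= L1 N := (hL1 N).1.
have L11 : 0 < L1 N + 1 by rewrite ltr_wpDl.
have e10 : 0 < e1 by rewrite divr_gt0// mulr_gt0.
have [Ds bDs hDs] := split_weights hE sc hB bD0 hD0 V_gt0 V_mono (fun p => (hconv p).1) (fun p => expR_gt0 (C' p))
  V_conv (bdisk_scaled bD1 K0) e10.
have /choice[xy hxy] : forall ki : I * nat, exists xy : E * E, [/\ (t ki.1).2 ki.2 = xy.1 + xy.2,
   scaled D0 (e1 / V 0%N ki) xy.1 & forall p, scaled (Ds p) (V p ki)^-1 xy.2].
  move=> ki; have [_ _ b1 _ _] := ht ki.1.
  have [|x [y [h1 h2 h3]]] := hDs ki ((t ki.1).2 ki.2); last by exists (x, y).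
  have := b1 ki.2; rewrite scaled_mul; congr (scaled D1 _ _).
  rewrite /V expr1 -mulrA mulrC; congr (_ * _); rewrite invfM expRN -exprVn; rewrite mulrC; congr (_ ^+ _ / _).
  by field; rewrite gt_eqF.
pose u k := (t k).1.1; pose z' k := (t k).1.2; pose x k i := (xy (k, i)).1; pose y k i := (xy (k, i)).2.
pose v k z := u k z - laurent (z' k) (y k) z.
have Vinv p k i : (V p (k, i))^-1 = expR (- w (Ns p) `|X k|) * ((4 * d) / 4 ^+ p) ^+ i.
  by rewrite /V /= [LHS]invfM expRN mulrC; congr (_ * _); rewrite -[LHS]exprVn invf_div.
have y_T p k : 4 * d / 4 ^+ p <= tau / 2 -> forall i, scaled (Ds p) (expR (- w (Ns p) `|X k|) * (tau / 2) ^+ i) (y k i).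
  move=> hp i; have [_ _ h3] := hxy (k, i); case: (bDs p) => Dc D00 _ _.
  apply: scaled_le (h3 p) => //; first by rewrite invr_ge0 ltW.
  rewrite Vinv; apply: ler_wpM2l; first exact: expR_ge0.
  have dp : 0 <= 4 * d / 4 ^+ p by rewrite divr_ge0 ?exprn_ge0// mulr_ge0// ltW.
  have t2 : 0 <= tau / 2 := divr_ge0 (ltW tau0) (ler0n _ 2).
  by apply: lerXn2r hp; rewrite nnegrE.
(* One index p serves two purposes: the decay demanded by N' and convergence up to distance tau from
   the poles. *)
have big_p N' : exists2 p, (N' <= p)%N & 4 * d / 4 ^+ p <= tau / 2.
  have [q hq] : exists q : nat, 8 * d / tau <= q%:R by exists (Num.truncn (8 * d / tau)).+1; exact: ltW (truncnS_gt _).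
  exists (maxn N' q); first exact: leq_maxl.
  have hq4 : 8 * d / tau <= 4 ^+ maxn N' q.
    apply: (le_trans hq); rewrite -natrX ler_nat; apply: leq_trans (leq_maxr N' q) _.
    by apply/ltnW/ltn_expl.
  move: hq4; rewrite ler_pdivrMr// => hq4; rewrite ler_pdivrMr ?exprn_gt0//; lra.
have oT := open_stripT.
have T_out k z : strip F G z -> outside (z' k) tau z by have [_ _ _ _ [_ h2]] := ht k; exact: h2.
have Y_BD n p k : 4 * d / 4 ^+ p <= tau / 2 ->
    BD n (strip F G) (fun=> L2 n * expR (- w (Ns p) `|X k|)) (Ds p) (laurent (z' k) (y k)).
  move=> hp; case: (bDs p) => Dc D00 _ _.
  apply: BD_le (laurent_BD hE sc (z' k) tau0 hL2 (bDs p) (expR_ge0 _) (y_T p k hp) n) => //.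
  - exact: T_out.
  - by move=> z _; rewrite mulr_ge0 ?expR_ge0// (hL2 n).1.
(* On the full strip nothing is known about x; u and the series of y are bounded separately. *)
have v_T n N' : exists2 D : set E, bdisk D & forall k, BD n (strip F G) (fun=> expR (- w N' `|X k|)) D (v k).
  have [Da bDa hDa] := hBD n.+1 N'; have [p Np hp] := big_p N'.
  have [D bD [Da1 Dp1]] := bounded_in_disks_dir hB bDa (bDs p).
  case: (bD) => Dc D00 _ _; case: (bDa) => Dac Da0 _ _; case: (bDs p) => Dpc Dp0 _ _.
  have L20 := (hL2 n).1; have A0 : 0 < K + L2 n by lra.
  exists (scaled D (K + L2 n)); first exact: bdisk_scaled.
  move=> k; apply/BD_scaledD; have [u1 _ _ _ _] := ht k.
  have Ku : 0 <= K * expR (- w N' `|X k|) by rewrite mulr_ge0 ?expR_ge0 ?(ltW K0).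
  have Ly : 0 <= L2 n * expR (- w N' `|X k|) by rewrite mulr_ge0 ?expR_ge0.
  have h1 : BD n (strip F G) (fun=> K * expR (- w N' `|X k|)) D (u k).
    by apply: BD_le (u1 n Da _ bDa (expR_gt0 _) (hDa k)).
  have h2 : BD n (strip F G) (fun=> L2 n * expR (- w N' `|X k|)) D (laurent (z' k) (y k)).
    apply: BD_le (Y_BD n p k hp) => // z _.
      rewrite ler_wpM2l// ler_expR lerN2; apply: (weight_le hw) => //; exact: leq_trans Np (Nsp p).
    by rewrite mulr_ge0 ?expR_ge0.
  have h3 := BD_scale hE (-1) oT Dc D00 (fun _ _ => Ly) h2.
  have Ly' z : strip F G z -> 0 <= normc (-1 : R[i]) * (L2 n * expR (- w N' `|X k|)).
    by rewrite mulr_ge0 ?normc_ge0.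
  have := BD_add hE oT Dc D00 (fun _ _ => Ku) Ly' h1 h3.
  have -> : (fun z => u k z + -1 *: laurent (z' k) (y k) z) = v k by apply/funext => z; rewrite scaleN1r.
  by apply: BD_eqc => z _; rewrite normcN normc1 mul1r; ring.
have v_dbar k z : strip F G z -> dbar (v k) z = h k z.
  move=> Tz; have [p _ hp] := big_p 0%N.
  have [Da bDa hDa] := hBD 2%N 0%N; have [u1 u2 _ _ _] := ht k.
  have Bu := u1 1%N Da _ bDa (expR_gt0 _) (hDa k).
  have pu : has_pds (u k) z by exact: (BD_has_pds Bu).
  have pY : has_pds (laurent (z' k) (y k)) z := BD_has_pds (Y_BD 1%N p k hp) Tz.
  rewrite (dbarB hE pu pY) u2 (laurent_dbar hE sc tau0 hL2 (bDs p) (expR_ge0 _) (y_T p k hp) (T_out k z Tz)).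
  by rewrite subr0.
have [KT dT] := hsol v v_T v_dbar; exists (tot v); split=> //.
case: (bD0) => D0c D00 _ _.
have x_a k i : scaled D0 (e1 * expR (- w M `|X k|) * (8 * d / 2) ^+ i) (x k i).
  have [_ h2 _] := hxy (k, i); move: h2; congr (scaled D0 _ _).
  rewrite Vinv Ns0 expr0 divr1 mulrA; congr (_ * _ ^+ _); by field.
have y_a k i : scaled (Ds 0%N) (expR (- w (Ns 0%N) `|X k|) * (8 * d / 2) ^+ i) (y k i).
  have [_ _ h3] := hxy (k, i); have := h3 0%N; congr (scaled _ _ _).
  rewrite Vinv expr0 divr1; congr (_ * _ ^+ _); by field.
(* Here the expansions of u, x and y all converge, and b = x + y leaves v equal to the series of x
   alone. *)
have small k : BD N (sub_strip F G a) (fun=> expR (- w M `|X k|)) (scaled D0 (e / C)) (v k).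
  have out z : sub_strip F G a z -> outside (z' k) (8 * d) z by have [_ _ _ _ [h1 _]] := ht k; exact: h1.
  have t0 : 0 <= e1 * expR (- w M `|X k|) by rewrite mulr_ge0 ?expR_ge0 ?(ltW e10).
  have h1 := laurent_BD hE sc (z' k) r8 hL1 bD0 t0 (x_a k) N.
  apply/BD_scaledD; apply: (BD_ext (open_sub_strip pF pG) (f := laurent (z' k) (x k))).
    move=> z Sz; have oz := out z Sz; have [_ _ _ b2 _] := ht k.
    have cx := laurent_cvg hE sc r8 hL1 bD0 t0 (x_a k) oz.
    have cy := laurent_cvg hE sc r8 hL1 (bDs 0%N) (expR_ge0 _) (y_a k) oz.
    have cu : (fun m => \sum_(i < m) ((z - z' k)^-1 ^+ i.+1 : R[i]) *: (t k).2 i) @ \oo --> u k z.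
      by apply: b2; move: oz; rewrite /outside /=; move: (normc _) => *; lra.
    rewrite /v; apply: (cvg_unique hE cx).
    have -> : (fun m => \sum_(i < m) ((z - z' k)^-1 ^+ i.+1 : R[i]) *: x k i) =
      (fun m => \sum_(i < m) ((z - z' k)^-1 ^+ i.+1 : R[i]) *: (t k).2 i - \sum_(i < m) ((z - z' k)^-1 ^+ i.+1 : R[i]) *: y k i).
      apply/funext => m; rewrite -sumrB; apply: eq_bigr => i _; have [h3 _ _] := hxy (k, nat_of_ord i).
      by rewrite /= in h3; rewrite h3 -/(x k i) -/(y k i) scalerDr addrK.
    exact: (@cvgB_tvs _ _ _ _ _ _ _ _ _ cu cy).
  apply: BD_le h1 => // z _; last by rewrite mulr_ge0.
  have e1E : (L1 N + 1) * e1 = e / C.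
    by rewrite /e1; move: (L1 N) L11 => l l0; field; rewrite !gt_eqF.
  rewrite mulrA mulrC; apply: ler_wpM2l; first exact: expR_ge0.
  by rewrite -e1E; apply: ler_wpM2r; [exact: ltW|rewrite lerDl].
have bDe : bdisk (scaled D0 (e / C)) by apply: bdisk_scaled => //; rewrite divr_gt0.
have /BD_scaledD := hC a _ v a1 bDe small.
by apply: BD_eqc => z _; field; rewrite gt_eqF.
Qed.

End SmallSolution.

(** * Mittag-Leffler gluing *)

Section Gluing.
Variables (R : realType) (F G : R -> R) (w : nat -> R -> R).
Hypotheses (pF : profile F) (pG : profile G) (hw : weight_system w).
Variables (E : tvsType R[i]) (hE : hausdorff_space E) (sc : series_complete E) (hB : bounded_in_disks E).
Implicit Types (g f : R[i]^o -> E) (z : R[i]) (D : set E).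

Lemma KWB_pds f z : KWB F G w f -> strip F G z -> has_pds f z.
Proof.
move=> fK /(strip_exhaust pF pG)[a /andP[_ a1] Sa]; have [D _ h] := fK 1%N 0%N a a1.
exact: (BD_has_pds h Sa).
Qed.

Lemma KWB_add f g : KWB F G w f -> KWB F G w g -> KWB F G w (fun z => f z + g z).
Proof.
move=> hf hg n N a a1; have [D1 b1 h1] := hf n N a a1; have [D2 b2 h2] := hg n N a a1.
have [D bD [s1 s2]] := bounded_in_disks_dir hB b1 b2.
have o := open_sub_strip (a := a) pF pG; case: (bD) => Dc D0 _ _.
case: b1 => c1 z1 _ _; case: b2 => c2 z2 _ _.
have d0 z : sub_strip F G a z -> 0 <= decay w N z by move=> _; exact: ltW (decay_gt0 _ _ _).
have k1 : BD n (sub_strip F G a) (decay w N) D f by apply: BD_le h1.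
have k2 : BD n (sub_strip F G a) (decay w N) D g by apply: BD_le h2.
exists (scaled D 2); first by apply: bdisk_scaled.
apply/BD_scaledD; have := BD_add hE o Dc D0 d0 d0 k1 k2.
by apply: BD_eqc => z _; rewrite mulr_natr mulr2n.
Qed.

Lemma KWB_scale f (k : R[i]) : KWB F G w f -> KWB F G w (fun z => k *: f z).
Proof.
move=> hf n N a a1; have [D bD h] := hf n N a a1; case: (bD) => Dc D0 _ _.
have o := open_sub_strip (a := a) pF pG.
have d0 z : sub_strip F G a z -> 0 <= decay w N z by move=> _; exact: ltW (decay_gt0 _ _ _).
have k1 : 0 < normc k + 1 by rewrite ltr_wpDl ?normc_ge0.
exists (scaled D (normc k + 1)); first exact: bdisk_scaled.
apply/BD_scaledD; apply: BD_le (BD_scale hE k o Dc D0 d0 h) => // z Sz; last by rewrite mulr_ge0 ?normc_ge0 ?d0.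
by rewrite mulrC ler_wpM2l ?d0// lerDl.
Qed.

Lemma KWB_partial f b : KWB F G w f -> KWB F G w (partial (dir b) f).
Proof. by move=> hf n N a a1; have [D bD h] := hf n.+1 N a a1; exists D => //; exact: BD_partial. Qed.

Lemma KWB_sub_dbar g f : KWB F G w g -> KWB F G w f -> KWB F G w (fun z => g z - dbar f z).
Proof.
move=> gK fK.
have h := KWB_scale (- 2%:R^-1) (KWB_add (KWB_partial false fK) (KWB_scale 'i%C (KWB_partial true fK))).
have := KWB_add gK h; congr KWB; apply/funext => z.
by rewrite scaleNr.
Qed.

Lemma KWB_sum (f : nat -> R[i]^o -> E) n : (forall j, KWB F G w (f j)) -> KWB F G w (fun z => \sum_(j < n) f j z).
Proof.
move=> hf; elim: n => [|n IH].
  have := KWB_scale 0 (hf 0%N); congr KWB; apply/funext => z; by rewrite big_ord0 scale0r.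
have := KWB_add IH (hf n); congr KWB; apply/funext => z; by rewrite big_ord_recr.
Qed.

Variables (D0 : set E) (bD0 : bdisk D0) (f : nat -> R[i]^o -> E) (b : nat -> R).
Hypotheses (fK : forall j, KWB F G w (f j)) (b1 : forall a, a < 1 -> exists j0, forall j, (j0 <= j)%N -> a <= b j).
Hypothesis f_small : forall j, BD j (sub_strip F G (b j)) (fun z => mesh R j * decay w j z) D0 (f j).

Definition glue z : E := xget 0 [set l : E | (fun n => \sum_(j < n) f j z) @ \oo --> l].

Lemma mesh_sum n : \sum_(k < n) mesh R k <= 2.
Proof.
suff : \sum_(k < n) mesh R k <= 2 - 2 * mesh R n by have := mesh_gt0 R n; lra.
elim: n => [|n IH]; first by rewrite big_ord0 meshE expr0 invr1 mulr1 subrr.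
by rewrite big_ord_recr/=; move: IH; rewrite (meshS R n); lra.
Qed.

Lemma mesh_le m n : (m <= n)%N -> mesh R n <= mesh R m.
Proof.
move=> /subnK <-; elim: (n - m)%N => [|k IH]; first by rewrite add0n.
by apply: le_trans IH; rewrite addSn (meshS R (k + m)); have := mesh_gt0 R (k + m).+1; lra.
Qed.

(** The smallness of f j is tied to j in order, decay and strip. For fixed n, N and a it is
    therefore available after finitely many terms, all in the one disk [D0]. *)
Lemma tail_BD n N a : a < 1 -> exists j0, (forall j, (j0 <= j)%N -> a <= b j) /\
  forall k, BD n (sub_strip F G a) (fun z => mesh R k * decay w N z) D0 (f (j0 + k)%N).
Proof.
move=> a1; have [j1 h1] := b1 a1; exists (maxn j1 (maxn n N)); split.
  by move=> j /(leq_trans (leq_maxl _ _)); exact: h1.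
move=> k; case: (bD0) => Dc D00 _ _.
have jn : (maxn j1 (maxn n N) <= maxn j1 (maxn n N) + k)%N := leq_addr _ _.
apply: BD_le (f_small _) => //.
- by apply: leq_trans jn; rewrite !leq_max leqnn orbT.
- by apply: (sub_strip_mono pF pG); apply: h1; apply: leq_trans jn; exact: leq_maxl.
- move=> z _; apply: ler_pM; rewrite ?(ltW (mesh_gt0 _ _)) ?(ltW (decay_gt0 _ _ _))//.
    by apply: mesh_le; exact: leq_addl.
  apply: (decay_mono hw); apply: leq_trans jn; by rewrite !leq_max leqnn !orbT.
- by move=> z _; rewrite mulr_ge0 ?(ltW (mesh_gt0 _ _)) ?(ltW (decay_gt0 _ _ _)).
Qed.

Lemma split_psum (x : nat -> E) j0 m : \sum_(k < m) x (j0 + k)%N = \sum_(j < j0 + m) x j - \sum_(j < j0) x j.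
Proof.
elim: m => [|m IH]; first by rewrite big_ord0 addn0 subrr.
by rewrite big_ord_recr/= IH addnS big_ord_recr/= addrAC.
Qed.

Lemma tail_cvg a z j0 : a < 1 -> sub_strip F G a z ->
  (fun m => \sum_(k < m) f (j0 + k)%N z) @ \oo --> glue z - \sum_(j < j0) f j z.
Proof.
move=> a1 Sz; have [j1 [_ h1]] := tail_BD 0 0 a1.
have e0 k : 0 <= mesh R k * decay w 0 z by rewrite mulr_ge0 ?(ltW (mesh_gt0 _ _)) ?(ltW (decay_gt0 _ _ _)).
have es n : \sum_(k < n) mesh R k * decay w 0 z <= 2 * decay w 0 z.
  by rewrite -mulr_suml ler_wpM2r ?mesh_sum// ltW// decay_gt0.
have [l hl] := sc bD0 e0 es (fun k => BD_val (h1 k) Sz).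
have full : (fun n => \sum_(j < n) f j z) @ \oo --> l + \sum_(j < j1) f j z.
  apply/cvg_csn => p cp r r0; have /cvg_csn/(_ p cp r r0)[N _ h] := hl.
  exists (j1 + N)%N => // n /= hn; have j1n : (j1 <= n)%N := leq_trans (leq_addr _ _) hn.
  have := h (n - j1)%N; rewrite /= leq_subRL// => /(_ hn).
  rewrite (split_psum (fun j => f j z)) subnKC//; congr (p _ < _).
  by rewrite opprD addrA [in RHS]addrAC.
have gl : (fun n => \sum_(j < n) f j z) @ \oo --> glue z.
  by rewrite /glue; case: xgetP => [y _ hy|no]; [exact: hy|case: (no _ full)].
apply/cvg_csn => p cp r r0; have /cvg_csn/(_ p cp r r0)[N _ h] := gl.
exists N => // n /= Nn; have := h (j0 + n)%N (leq_trans Nn (leq_addl _ _)).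
rewrite /= (split_psum (fun j => f j z)); congr (p _ < _).
by rewrite opprB addrA subrK.
Qed.

Lemma tail_glue_BD n N a : a < 1 -> exists j0, (forall j, (j0 <= j)%N -> a <= b j) /\
  BD n (sub_strip F G a) (fun z => 2 * decay w N z) D0 (fun z => glue z - \sum_(j < j0) f j z) /\
  forall z, sub_strip F G a z -> (0 < n)%N ->
    has_pds (fun z => glue z - \sum_(j < j0) f j z) z /\
    (fun m => \sum_(k < m) dbar (f (j0 + k)%N) z) @ \oo --> dbar (fun z => glue z - \sum_(j < j0) f j z) z.
Proof.
move=> a1; have [j0 [h0 hj]] := tail_BD n N a1; exists j0; split=> //.
have o := open_sub_strip (a := a) pF pG; case: (bD0) => Dc D00 _ _.
have m0 k : 0 <= mesh R k := ltW (mesh_gt0 R k).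
have d0 z : sub_strip F G a z -> 0 <= decay w N z by move=> _; exact: ltW (decay_gt0 _ _ _).
have d1 z : sub_strip F G a z -> decay w N z <= 1 by move=> _; exact: decay_le1.
have cv z : sub_strip F G a z -> (fun m => \sum_(k < m) f (j0 + k)%N z) @ \oo --> glue z - \sum_(j < j0) f j z.
  by move=> Sz; exact: (@tail_cvg a z j0 a1 Sz).
split.
  exact: (@BD_series _ _ hE _ D0 (mesh R) 2 1 (decay w N) o bD0 m0 mesh_sum d0 d1 n (fun k => f (j0 + k)%N) _ sc hj cv).
move=> z Sz n0; have hj1 k : BD 1 (sub_strip F G a) (fun z => mesh R k * decay w N z) D0 (f (j0 + k)%N).
  exact: BD_lt (hj k).
exact: (dbar_series hE sc o bD0 m0 mesh_sum d0 d1 hj1 cv Sz).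
Qed.

Lemma glue_KWB : KWB F G w glue.
Proof.
move=> n N a a1; have [j0 [_ [hb _]]] := tail_glue_BD n N a1.
have [D1 bD1 h1] := KWB_sum j0 fK n N a1.
have [D bD [s1 s2]] := bounded_in_disks_dir hB bD1 bD0.
have o := open_sub_strip (a := a) pF pG; case: (bD) => Dc D00 _ _.
case: (bD1) => c1 z1 _ _; case: (bD0) => c2 z2 _ _.
have d0 z : sub_strip F G a z -> 0 <= decay w N z by move=> _; exact: ltW (decay_gt0 _ _ _).
have d2 z : sub_strip F G a z -> 0 <= 2 * decay w N z by move=> Sz; rewrite mulr_ge0 ?d0.
have k1 : BD n (sub_strip F G a) (decay w N) D (fun z => \sum_(j < j0) f j z) by apply: BD_le h1.
have k2 : BD n (sub_strip F G a) (fun z => 2 * decay w N z) D (fun z => glue z - \sum_(j < j0) f j z) by apply: BD_le hb.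
exists (scaled D 3); first by apply: bdisk_scaled.
apply/BD_scaledD; apply: (BD_ext o (f := fun z => \sum_(j < j0) f j z + (glue z - \sum_(j < j0) f j z))).
  by move=> z _; rewrite addrC subrK.
apply: BD_eqc (BD_add hE o Dc D00 d0 d2 k1 k2) => z _; ring.
Qed.

(** Near a fixed z the partial sums of the [dbar (f i) z] are eventually equal to g0 z, so the tail
    after j0 contributes 0. *)
Lemma glue_dbar (g0 : R[i]^o -> E) z : strip F G z ->
  (forall j, \sum_(i < j) dbar (f i) z = g0 z \/ ~ sub_strip F G (b j) z) -> dbar glue z = g0 z.
Proof.
move=> Tz hg; have [a /andP[_ a1] Sa] := strip_exhaust pF pG Tz.
have [j0 [hj0 [_ /(_ z Sa isT)[pt dt]]]] := tail_glue_BD 1 0 a1.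
have hs j : (j0 <= j)%N -> \sum_(i < j) dbar (f i) z = g0 z.
  by move=> jj; have [//|[]] := hg j; apply: (sub_strip_mono pF pG _ Sa); exact: hj0.
have pf j : (j < j0)%N -> has_pds (f j) z by move=> _; exact: KWB_pds.
have -> : glue = (fun z => \sum_(j < j0) f j z + (glue z - \sum_(j < j0) f j z)).
  by apply/funext => y; rewrite addrC subrK.
rewrite (dbarD hE (has_pds_sum hE pf) pt) (dbar_sum hE pf) hs//.
suff -> : dbar (fun z => glue z - \sum_(j < j0) f j z) z = 0 by rewrite addr0.
apply: (cvg_unique hE dt); apply/cvg_csn => p cp r r0; exists 0%N => // m _ /=.
by rewrite (split_psum (fun j => dbar (f j) z)) !hs ?leq_addr// subrr subr0 (seminorm0 cp.1).
Qed.

End Gluing.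

Theorem theorem3p9 (R : realType) (F G : R -> R) (w : nat -> R -> R)
  (hF : profile F) (hG : profile G)
  (hw : weight_system w)
  (hwalpha : weight_alpha w) (hwN : weight_N w) (hwomega : weight_omega w)
  (hscalar : dbar_surjective (R[i])^o F G w)
  (E : tvsType R[i]) (hE : hausdorff_space E)
  (hEcomplete : locally_complete E)
  (B : nat -> set E) (hB : fundamental_sequence B) (hA : condition_A B) :
  dbar_surjective E F G w.
Proof.
have sc := locally_complete_series hEcomplete.
have hBd := fundamental_in_disks hB.
have [D0 bD0 hD0] := condition_A_splitting hB hA.
move=> g /(KW_KWB hE hF hG hBd) gK.
pose b j : R := 1 - mesh R j.
have b_lt1 j : b j < 1 by rewrite /b; have := mesh_gt0 R j; lra.
have /choice[a' ha'] : forall j, exists a' : R, a' < 1 /\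
  forall g, KWB F G w g -> (forall z, sub_strip F G a' z -> g z = 0) ->
  forall a2 : R, a2 < 1 -> exists f, [/\ KWB F G w f, forall z, sub_strip F G a2 z -> dbar f z = g z &
    BD j (sub_strip F G (b j)) (fun z => mesh R j * decay w j z) D0 f].
  move=> j; have [a' a'1 h] := small_solution hF hG hw hwalpha hwN hwomega hscalar hE sc hBd bD0 hD0 j (b_lt1 j) (mesh_gt0 R j).
  by exists a'.
(* b j makes the strips exhaust T, and a' j is where the next right-hand side must vanish for
   [small_solution] to apply. *)
pose a j : R := Num.max (b j) (a' j).
have a_lt1 j : a j < 1 by rewrite gt_max b_lt1 (ha' j).1.
have [fi fiK dfi] := approximate_solution hF hG hw hwalpha hwN hscalar hE sc gK (a_lt1 0%N).
pose good j (h : R[i]^o -> E) := KWB F G w h /\ forall z, sub_strip F G (a j) z -> h z = 0.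
have /choice[nxt hnxt] : forall jh : nat * (R[i]^o -> E), exists f, good jh.1 jh.2 ->
   [/\ KWB F G w f, forall z, sub_strip F G (a jh.1.+1) z -> dbar f z = jh.2 z &
    BD jh.1 (sub_strip F G (b jh.1)) (fun z => mesh R jh.1 * decay w jh.1 z) D0 f].
  move=> [j h]; have [[hK h0]|] := pselect (good j h); last by exists (fun=> 0).
  have [|f hf] := (ha' j).2 h hK _ (a j.+1) (a_lt1 _); last by exists f.
  move=> z Sz; apply: h0; apply: (sub_strip_mono hF hG _ Sz); by rewrite le_max lexx orbT.
(* The remainders: [gs j] vanishes on the strip for a j, and the correction chosen for it solves the
   equation up to a (j + 1) while being small on the strip for b j. *)
pose gs := fix gs j := if j is i.+1 then (fun z => gs i z - dbar (nxt (i, gs i)) z) else (fun z => g z - dbar fi z).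
have gs_good j : good j (gs j).
  elim: j => [|j IH] /=.
    split; first exact: KWB_sub_dbar.
    by move=> z Sz; rewrite dfi// subrr.
  have [fK df _] := hnxt (j, gs j) IH; split; first exact: (KWB_sub_dbar hF hG hE hBd IH.1 fK).
  by move=> z Sz; rewrite df// subrr.
pose f j := nxt (j, gs j).
have hf j := hnxt (j, gs j) (gs_good j).
have fK j : KWB F G w (f j) by have [] := hf j.
have f_small j : BD j (sub_strip F G (b j)) (fun z => mesh R j * decay w j z) D0 (f j) by have [] := hf j.
have b1 (c : R) : c < 1 -> exists j0, forall j, (j0 <= j)%N -> c <= b j.
  move=> c1; have [|j0 h] := @mesh_small R (1 - c); first lra.
  by exists j0 => j /h; rewrite /b; lra.
have glK := glue_KWB hF hG hw hE sc hBd bD0 fK b1 f_small.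
have sumK := KWB_add hF hG hE hBd fiK glK.
exists (fun z => fi z + glue f z).
  exact: (KWB_KW hE hF hG (fun N t t0 => weight_ge0 hw N t0) sumK).
move=> z Tz.
have tele j : \sum_(i < j) dbar (f i) z = gs 0%N z - gs j z.
  elim: j => [|j IH]; first by rewrite big_ord0 subrr.
  have -> : gs j.+1 z = gs j z - dbar (f j) z by [].
  by rewrite big_ord_recr IH opprB addrA addrAC.
rewrite (dbarD hE (KWB_pds hF hG fiK Tz) (KWB_pds hF hG glK Tz)).
rewrite (glue_dbar hF hG hw hE sc bD0 fK b1 f_small (g0 := gs 0%N) Tz) /=; first by rewrite addrC subrK.
move=> j; have [Sz|] := pselect (sub_strip F G (b j) z); last by right.
left; rewrite tele (gs_good j).2 ?subr0//.
by apply: (sub_strip_mono hF hG _ Sz); rewrite le_max lexx.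
Qed.
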